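(* Fix a real number $\vartheta$ with $0<\vartheta<1$. Then there is a constant $C=C(\vartheta)>0$ such that for all real $x\ge 27$, \[ \left| S_{\vartheta}(x) - x^{\vartheta} F\big((1-\vartheta)\log x\big)\frac{\alpha_{\vartheta}(x)}{\vartheta}\right| \le C\, x^{\vartheta} F\big((1-\vartheta)\log x\big)\frac{\alpha_{\vartheta}(x)}{\vartheta}\sqrt{\frac{\log\log x}{\log x}} . \] Moreover, as $x\to\infty$, \[ S_{\vartheta}(x)=(1+o(1))\, x^{\vartheta} F\big((1-\vartheta)\log x\big)\frac{1}{\vartheta}\Big(\frac{2}{1-\vartheta}\Big)^{1/2}\big((\log x)\log\log x\big)^{-1/2}. \]
   Context: For a natural number $m$, let $k(m)$ denote the largest square-free divisor of $m$ (the product of the distinct primes dividing $m$). For $\vartheta>0$ and real $x\ge1$, let $S_\vartheta(x)$ be the number of natural numbers $m\le x$ with $k(m)\le m^{\vartheta}$. Let $\psi(m)=\prod_{p\mid m}(p+1)$ (product over primes), and define $F:[0,\infty)\to[0,\infty)$ by \[F(v)=\frac{6}{\pi^2}\sum_{m\ge1}\frac{1}{\psi(m)}\min\Big(1,\frac{e^v}{m}\Big).\] For $0<\vartheta<1$ and $x\ge 2$, $\alpha_\vartheta(x)$ denotes the unique real number $\alpha>0$ satisfying \[\sum_{p}\frac{p^{\alpha}\log p}{(p^{\alpha}-1)\big(1+(p+1)(p^{\alpha}-1)\big)}=(1-\vartheta)\log x,\] the sum being over all primes $p$. *)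

(* Defs.v *)
From Stdlib Require Import Reals ClassicalEpsilon.
From Coquelicot Require Import Coquelicot.
From mathcomp Require Import ssreflect ssrbool ssrnat eqtype seq bigop prime.

Set Implicit Arguments.
Unset Strict Implicit.

Definition rad (m : nat) : nat := (\prod_(p <- primes m) p)%N.

Definition psi (m : nat) : nat := (\prod_(p <- primes m) p.+1)%N.

Open Scope R_scope.

Definition S_count (theta x : R) : nat :=
  (\sum_(1 <= m < (Z.to_nat (Int_part x)).+1)
     (if Rle_dec (INR (rad m)) (Rpower (INR m) theta) then 1 else 0))%N.

Definition S_theta (theta x : R) : R := INR (S_count theta x).

(* F(v) = 6/pi^2 * sum_{m >= 1} 1/psi(m) * min(1, e^v / m); index n stands for m = n+1. *)
Definition F (v : R) : R :=
  6 / PI ^ 2 *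
  Series (fun n : nat => / INR (psi n.+1) * Rmin 1 (exp v / INR n.+1)).

Definition G (a : R) : R :=
  Series (fun n : nat =>
    if prime n then
      let p := INR n in
      Rpower p a * ln p /
        ((Rpower p a - 1) * (1 + (p + 1) * (Rpower p a - 1)))
    else 0).

(* alpha_theta(x): the (unique) alpha > 0 with G alpha = (1 - theta) log x,
   selected by definite description (Hilbert epsilon). *)
Definition alpha (theta x : R) : R :=
  epsilon (inhabits 0) (fun a => 0 < a /\ G a = (1 - theta) * ln x).

(* Main.v *)
Require Import Defs.
From Stdlib Require Import Reals Lra Psatz ZArith ClassicalEpsilon.
From Coquelicot Require Import Coquelicot.
From HB Require Import structures.
From mathcomp Require Import all_boot.
From mathcomp Require Import zify.

Set Implicit Arguments.
Unset Strict Implicit.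
Open Scope R_scope.

(** Put v = (1 - theta) ln x, beta = theta / (1 - theta), let G a = v and L = - ln a.
    Writing n = k j with k = rad n turns S_theta(x) into a sum over j <= x of the number of
    k <= Y_j with k = rad (k j), where Y_j = min (x / j, j ^ beta).  A sieve evaluates the inner
    count as (6 / pi^2) Y_j / psi(j) with an error that is summed by Rankin's trick at the exponent a
    and is smaller than the main term by a power of a.

    Let P(m) = 1 / (psi(m) m^a H(a)), a probability on the positive integers, and X = ln m - v, which
    is centred because G a = v.  Up to the common factor (6 / pi^2) e^(a v) H(a), F(v) is the expectation
    of f(X) with f(u) = e^(a u) min (1, e^-u), and the main term of S_theta(x) is x^theta times the
    expectation of r(X) with r(u) = e^(a u) min (e^(beta u), e^-u).  At scales up to 1 / a the law of X
    is flat: after smoothing by the Fejer kernel its density at u differs from the density at 0 by a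
    relative error O(a L).  Hence the ratio of the two expectations is that of the integrals of r and f,
    namely a / theta, up to a factor 1 + O(a L), and a L is of order sqrt (ln ln x / ln x) because
    G a ~ 1 / (a^2 L).  The smoothing rests on bounds for the characteristic function of X, an
    explicit Euler product.  On the range a/10 <= t <= a^-10 it is at most a^14: if t is not too small, then otherwise
    t ln p would be close to a multiple of 2 pi for all but few primes p, hence also t ln n and
    t ln (n + h) for most integers free of the exceptional primes, contradicting the size of
    ln (1 + h / n). *)

(** The standard deviation of [X] is of order [(a^3 L)^(-1/2)], which exceeds the width [1 / a] of
    the window by the factor [(a L)^(-1/2)] only. Comparing the densities at [u] and 0 through the
    modulus of the characteristic function would lose [sqrt (a L)]. The error [a L] is reached
    because centring makes the imaginary part of the characteristic function cubic in [t]: it is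
    paired with [sin (t u)], and the real part with [1 - cos (t u)], so that both contributions are
    of second order. Primes enter through the bounds of Chebyshev and Mertens, which say nothing on
    sums of [p^(it)]; hence the argument with [n] and [n + h] for large [t]. The exponents leave
    room. With the cut-off [T = a^-10] the smoothing error is about [T^(-1/2) = a^5], while the
    smoothed density at 0 is at least [a^2 / 2000]; the bound [a^14] integrated up to [T] costs
    [a^4]. The sieve loses a factor 2 for each prime divisor of [j], too much for Rankin's trick, so
    it is first interpolated with the trivial bound, the sieve having a weight proportional to
    [a]. *)

#[global] Arguments INR : simpl never.

(** * Finite sums and products of reals *)

HB.instance Definition _ := Monoid.isComLaw.Build R 0 Rplus
  (fun a b c => esym (Rplus_assoc a b c)) Rplus_comm Rplus_0_l.
HB.instance Definition _ := Monoid.isComLaw.Build R 1 Rmult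
  (fun a b c => esym (Rmult_assoc a b c)) Rmult_comm Rmult_1_l.
HB.instance Definition _ := Monoid.isMulLaw.Build R 0 Rmult Rmult_0_l Rmult_0_r.
HB.instance Definition _ := Monoid.isAddLaw.Build R Rmult Rplus
  Rmult_plus_distr_r Rmult_plus_distr_l.

Notation "'\rsum_' ( m <= i < n | P ) F" := (\big[Rplus/0]_(m <= i < n | P%B) F)
  (at level 36, F at level 36, i, m, n at level 50).
Notation "'\rsum_' ( m <= i < n ) F" := (\big[Rplus/0]_(m <= i < n) F)
  (at level 36, F at level 36, i, m, n at level 50).
Notation "'\rsum_' ( i <- r | P ) F" := (\big[Rplus/0]_(i <- r | P%B) F)
  (at level 36, F at level 36, i, r at level 50).
Notation "'\rsum_' ( i <- r ) F" := (\big[Rplus/0]_(i <- r) F)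
  (at level 36, F at level 36, i, r at level 50).
Notation "'\rprod_' ( m <= i < n ) F" := (\big[Rmult/1]_(m <= i < n) F)
  (at level 36, F at level 36, i, m, n at level 50).
Notation "'\rprod_' ( i <- r ) F" := (\big[Rmult/1]_(i <- r) F)
  (at level 36, F at level 36, i, r at level 50).

Section Sums.
Variables (I : eqType).
Implicit Types (r : seq I) (P : pred I) (F E : I -> R).

Lemma rsum_ge0 r P F : (forall i, i \in r -> P i -> 0 <= F i) ->
  0 <= \rsum_(i <- r | P i) F i.
Proof.
move=> h; rewrite big_seq_cond.
apply: (big_ind (fun x => 0 <= x)); [lra | move=> x y; lra | by move=> i /andP [? ?]; apply: h].
Qed.

Lemma rsum_le r P F E : (forall i, i \in r -> P i -> F i <= E i) ->
  \rsum_(i <- r | P i) F i <= \rsum_(i <- r | P i) E i.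
Proof.
move=> h; rewrite big_seq_cond [X in _ <= X]big_seq_cond.
apply: (big_ind2 (fun x y => x <= y)); [lra | move=> x y z t; lra | by move=> i /andP [? ?]; apply: h].
Qed.

Lemma rsum_abs r P F :
  Rabs (\rsum_(i <- r | P i) F i) <= \rsum_(i <- r | P i) Rabs (F i).
Proof.
apply: (big_ind2 (fun x y => Rabs x <= y)); first by rewrite Rabs_R0; lra.
  move=> x y z t h1 h2; apply: Rle_trans (Rabs_triang _ _) _; lra.
by move=> *; lra.
Qed.

Lemma rsumM r P F (c : R) : c * \rsum_(i <- r | P i) F i = \rsum_(i <- r | P i) (c * F i).
Proof. by rewrite big_distrr. Qed.

Lemma rsum_sub r P F E : \rsum_(i <- r | P i) F i - \rsum_(i <- r | P i) E i
  = \rsum_(i <- r | P i) (F i - E i).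
Proof.
have -> : \rsum_(i <- r | P i) F i - \rsum_(i <- r | P i) E i =
  \rsum_(i <- r | P i) F i + -1 * \rsum_(i <- r | P i) E i by ring.
by rewrite rsumM -big_split; apply: eq_bigr => i _ /=; ring.
Qed.

Lemma rsum_const r (c : R) : \rsum_(i <- r) c = INR (size r) * c.
Proof.
elim: r => [|a r IH]; first by rewrite big_nil /= Rmult_0_l.
by rewrite big_cons IH -[size (a :: r)]/((size r).+1) S_INR; ring.
Qed.

Lemma rprod_ge0 r F : (forall i, i \in r -> 0 <= F i) -> 0 <= \rprod_(i <- r) F i.
Proof.
move=> h; rewrite big_seq.
by apply: (big_ind (fun x => 0 <= x)); [lra | move=> x y; nra | ].
Qed.

Lemma rprod_gt0 r F : (forall i, i \in r -> 0 < F i) -> 0 < \rprod_(i <- r) F i.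
Proof.
move=> h; rewrite big_seq.
by apply: (big_ind (fun x => 0 < x)); [lra | move=> x y; nra | ].
Qed.

Lemma rprod_le r F E : (forall i, i \in r -> 0 <= F i <= E i) ->
  \rprod_(i <- r) F i <= \rprod_(i <- r) E i.
Proof.
move=> h.
suff : 0 <= \rprod_(i <- r) F i <= \rprod_(i <- r) E i by lra.
rewrite big_seq [X in _ <= _ <= X]big_seq.
by apply: (big_ind2 (fun x y => 0 <= x <= y)); [lra | move=> x y z t; nra | ].
Qed.

Lemma rprod_exp r F : \rprod_(i <- r) exp (F i) = exp (\rsum_(i <- r) F i).
Proof.
by apply/esym/(big_morph exp) => [x y|]; [rewrite exp_plus | rewrite exp_0].
Qed.

Lemma rprod_le_exp r F E : (forall i, i \in r -> 0 <= F i <= exp (E i)) ->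
  \rprod_(i <- r) F i <= exp (\rsum_(i <- r) E i).
Proof. by move=> h; rewrite -rprod_exp; apply: rprod_le. Qed.

Lemma rprod_mul r F E :
  \rprod_(i <- r) (F i * E i) = (\rprod_(i <- r) F i) * (\rprod_(i <- r) E i).
Proof. by rewrite big_split. Qed.

(** Weierstrass's product inequality. It turns a small sum of deviations into a lower bound for a
    product of local factors. *)
Lemma rprod_ge_1sub r F : (forall i, i \in r -> 0 <= F i <= 1) ->
  1 - \rsum_(i <- r) F i <= \rprod_(i <- r) (1 - F i) <= 1.
Proof.
elim: r => [|a r IH] h; first by rewrite !big_nil; lra.
have h1 : 0 <= F a <= 1 by apply: h; rewrite inE eqxx.
have h2 : forall i, i \in r -> 0 <= F i <= 1 by move=> i hi; apply: h; rewrite inE hi orbT.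
rewrite !big_cons; have := IH h2.
have : 0 <= \rsum_(i <- r) F i by apply: rsum_ge0 => i hi _; case: (h2 i hi).
have : 0 <= \rprod_(i <- r) (1 - F i) by apply: rprod_ge0 => i hi; have := h2 i hi; lra.
nra.
Qed.

End Sums.

Lemma rsum_nat_le (m n : nat) (F E : nat -> R) :
  (forall i, (m <= i < n)%N -> F i <= E i) ->
  \rsum_(m <= i < n) F i <= \rsum_(m <= i < n) E i.
Proof. by move=> h; apply: rsum_le => i; rewrite mem_index_iota => hi _; apply: h. Qed.

Lemma rsum_nat_ge0 (m n : nat) (F : nat -> R) :
  (forall i, (m <= i < n)%N -> 0 <= F i) -> 0 <= \rsum_(m <= i < n) F i.
Proof. by move=> h; apply: rsum_ge0 => i; rewrite mem_index_iota => hi _; apply: h. Qed.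

Lemma rsum_sub_range (m n : nat) (F : nat -> R) (a b : nat) :
  (forall i, 0 <= F i) -> (m <= a)%N -> (b <= n)%N ->
  \rsum_(a <= i < b) F i <= \rsum_(m <= i < n) F i.
Proof.
move=> h ma bn.
case: (leqP a b) => ab; last first.
  by rewrite big_geq; [apply: rsum_nat_ge0 | lia].
rewrite (@big_cat_nat _ _ _ a m n) //=; last by lia.
rewrite (@big_cat_nat _ _ _ b a n) //=.
have := @rsum_nat_ge0 m a F (fun i _ => h i).
have := @rsum_nat_ge0 b n F (fun i _ => h i).
lra.
Qed.

Lemma rsum_telescope (m n : nat) (f : nat -> R) : (m <= n)%N ->
  \rsum_(m <= i < n) (f i.+1 - f i) = f n - f m.
Proof.
elim: n => [|n IH] h; first by (have -> : m = 0%N by lia); rewrite big_geq //; ring.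
case: (ltngtP m n.+1) => hh; [|lia|by rewrite hh big_geq // ; ring].
by rewrite big_nat_recr /= ?IH; [ring | lia | lia].
Qed.

(** * Series as limits of partial sums *)

Lemma sum_n_rsum (a : nat -> R) n : sum_n a n = \rsum_(0 <= i < n.+1) a i.
Proof.
elim: n => [|n IH]; first by rewrite sum_O big_nat1.
by rewrite sum_Sn IH [RHS]big_nat_recr.
Qed.

Lemma is_series_rsum (a : nat -> R) (l : R) :
  is_series a l <-> is_lim_seq (fun N => \rsum_(0 <= i < N) a i) l.
Proof.
rewrite (is_lim_seq_incr_1 (fun N => \rsum_(0 <= i < N) a i)).
split=> h.
  by apply: (is_lim_seq_ext (sum_n a)) => // n; apply: sum_n_rsum.
apply: (is_lim_seq_ext (fun n => \rsum_(0 <= i < n.+1) a i)) h => n.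
by rewrite sum_n_rsum.
Qed.

Lemma Series_rsum (a : nat -> R) : ex_series a ->
  is_lim_seq (fun N => \rsum_(0 <= i < N) a i) (Series a).
Proof. by move=> h; apply/is_series_rsum/Series_correct. Qed.

Lemma is_lim_seq_le_const (u : nat -> R) (l B : R) :
  (exists N, forall n, (N <= n)%N -> u n <= B) -> is_lim_seq u l -> l <= B.
Proof.
move=> [N h] hl.
have : Rbar_le l B.
  apply: (@is_lim_seq_le_loc u (fun _ => B)) => //; last exact: is_lim_seq_const.
  by exists N => n hn; apply: h; lia.
by [].
Qed.

Lemma is_lim_seq_ge_const (u : nat -> R) (l B : R) :
  (exists N, forall n, (N <= n)%N -> B <= u n) -> is_lim_seq u l -> B <= l.
Proof.
move=> [N h] hl.
have : Rbar_le B l.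
  apply: (@is_lim_seq_le_loc (fun _ => B) u) => //; last exact: is_lim_seq_const.
  by exists N => n hn; apply: h; lia.
by [].
Qed.

Lemma pos_series_bounded (a : nat -> R) (B : R) : (forall n, 0 <= a n) ->
  (forall N, \rsum_(0 <= i < N) a i <= B) -> ex_series a /\ Series a <= B.
Proof.
move=> a0 hB.
have : ex_finite_lim_seq (fun N => \rsum_(0 <= i < N) a i).
  apply: (ex_finite_lim_seq_incr _ B) => // n.
  by rewrite big_nat_recr //=; have := a0 n; lra.
case=> l hl; have hs : is_series a l by apply/is_series_rsum.
split; first by exists l.
rewrite (is_series_unique _ _ hs); apply: is_lim_seq_le_const hl.
by exists 0%N.
Qed.

Lemma rsum_le_Series (a : nat -> R) N : (forall n, 0 <= a n) -> ex_series a ->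
  \rsum_(0 <= i < N) a i <= Series a.
Proof.
move=> a0 h; apply: is_lim_seq_ge_const (Series_rsum h).
by exists N => n hn; apply: rsum_sub_range.
Qed.

Lemma Series_ge0 (a : nat -> R) : (forall n, 0 <= a n) -> ex_series a -> 0 <= Series a.
Proof.
by move=> h1 h2; have := rsum_le_Series 0 h1 h2; rewrite big_geq.
Qed.

Lemma series_le (a b : nat -> R) : (forall n, Rabs (a n) <= b n) -> ex_series b ->
  ex_series a /\ Rabs (Series a) <= Series b.
Proof.
move=> h hb.
have ha : ex_series (fun n => Rabs (a n)).
  by apply: (ex_series_le (fun n => Rabs (a n)) b) => // n; rewrite /norm /= /abs /= Rabs_Rabsolu.
split; first exact: ex_series_Rabs.
apply: Rle_trans (Series_Rabs _ ha) _; apply: Series_le => // n; split=> //; exact: Rabs_pos.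
Qed.

Lemma series_tail_small (a : nat -> R) eps : ex_series a -> 0 < eps ->
  exists N, forall n, (N <= n)%N -> Rabs (Series a - \rsum_(0 <= i < n) a i) < eps.
Proof.
move=> h he.
have /is_lim_seq_spec /(_ (mkposreal _ he)) [N hN] := Series_rsum h.
by exists N => n hn; rewrite Rabs_minus_sym; apply: hN; lia.
Qed.

Lemma INR_gt0 n : (0 < n)%N -> 0 < INR n.
Proof. by move=> h; apply: lt_0_INR; lia. Qed.

Lemma leq_INR (m n : nat) : (m <= n)%N -> INR m <= INR n.
Proof. by move=> h; apply: le_INR; lia. Qed.

Lemma ltn_INR (m n : nat) : (m < n)%N -> INR m < INR n.
Proof. by move=> h; apply: lt_INR; lia. Qed.

Lemma INR_ge1 n : (0 < n)%N -> 1 <= INR n.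
Proof. by move=> h; apply: (@leq_INR 1). Qed.

Lemma INR_ge2 n : (1 < n)%N -> 2 <= INR n.
Proof. by move=> h; have -> : 2 = INR 2 by []; apply: leq_INR. Qed.

Lemma INR_leq (m n : nat) : INR m <= INR n -> (m <= n)%N.
Proof. by move=> h; have := INR_le _ _ h; lia. Qed.

Lemma INR_ltn (m n : nat) : INR m < INR n -> (m < n)%N.
Proof. by move=> h; have := INR_lt _ _ h; lia. Qed.

Lemma INR_addn (m n : nat) : INR (m + n)%N = INR m + INR n.
Proof. exact: plus_INR. Qed.

Lemma INR_muln (m n : nat) : INR (m * n)%N = INR m * INR n.
Proof. exact: mult_INR. Qed.

Lemma INR0 : INR 0 = 0. Proof. by []. Qed.
Lemma INR1 : INR 1 = 1. Proof. by []. Qed.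
Lemma INR2 : INR 2 = 2. Proof. by []. Qed.

Lemma le_divr a b c : 0 < c -> a * c <= b -> a <= b / c.
Proof. by move=> h; apply Rle_div_r. Qed.

Lemma divr_le a b c : 0 < c -> a <= b * c -> a / c <= b.
Proof. by move=> h; apply Rle_div_l. Qed.

HB.instance Definition _ := Monoid.isComLaw.Build C (RtoC 1) Cmult
  Cmult_assoc Cmult_comm Cmult_1_l.

Notation "'\cprod_' ( m <= i < n ) F" := (\big[Cmult/RtoC 1]_(m <= i < n) F)
  (at level 36, F at level 36, i, m, n at level 50).

(** * Euler products *)

Definition CSeries (a : nat -> C) : C :=
  (Series (fun n => fst (a n)), Series (fun n => snd (a n))).

Definition Csummable (a : nat -> C) := ex_series (fun n => Cmod (a n)).

Lemma Rabs_fst_Cmod (z : C) : Rabs (fst z) <= Cmod z.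
Proof. by apply: Rle_trans (Rmax_Cmod z); apply: Rmax_l. Qed.

Lemma Rabs_snd_Cmod (z : C) : Rabs (snd z) <= Cmod z.
Proof. by apply: Rle_trans (Rmax_Cmod z); apply: Rmax_r. Qed.

Lemma Csummable_fst a : Csummable a -> ex_series (fun n => fst (a n)).
Proof. by move=> h; apply: (proj1 (series_le _ h)) => n; exact: Rabs_fst_Cmod. Qed.

Lemma Csummable_snd a : Csummable a -> ex_series (fun n => snd (a n)).
Proof. by move=> h; apply: (proj1 (series_le _ h)) => n; exact: Rabs_snd_Cmod. Qed.

Lemma Csummable_le (a b : nat -> C) : (forall n, Cmod (a n) <= Cmod (b n)) ->
  Csummable b -> Csummable a.
Proof.
move=> h hb; apply: (proj1 (series_le _ hb)) => n.
by rewrite Rabs_pos_eq; [|exact: Cmod_ge_0].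
Qed.

Lemma CSeries_ext (a b : nat -> C) : (forall n, a n = b n) -> CSeries a = CSeries b.
Proof. by move=> h; rewrite /CSeries; congr (_, _); apply: Series_ext => n; rewrite h. Qed.

Lemma CSeries_plus (a b : nat -> C) : Csummable a -> Csummable b ->
  CSeries (fun n => (a n + b n)%C) = (CSeries a + CSeries b)%C.
Proof.
move=> ha hb; rewrite /CSeries /Cplus /=; congr (_, _); apply: Series_plus;
  by [apply: Csummable_fst | apply: Csummable_snd].
Qed.

Lemma CSeries_scal (c : C) (a : nat -> C) : Csummable a ->
  CSeries (fun n => (c * a n)%C) = (c * CSeries a)%C.
Proof.
move=> ha; have h1 := Csummable_fst ha; have h2 := Csummable_snd ha.
rewrite /CSeries /Cmult /=; congr (_, _).
  rewrite (Series_ext _ (fun n => c.1 * (a n).1 + - c.2 * (a n).2)); last by move=> n; ring.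
  rewrite Series_plus; [|exact: ex_series_scal|exact: ex_series_scal].
  by rewrite !Series_scal_l; ring.
rewrite Series_plus; [|exact: ex_series_scal|exact: ex_series_scal].
by rewrite !Series_scal_l; ring.
Qed.

Lemma Csummable_scal (c : C) a : Csummable a -> Csummable (fun n => (c * a n)%C).
Proof.
move=> h; apply: (ex_series_ext (fun n => Cmod c * Cmod (a n))).
  by move=> n; rewrite Cmod_mult.
exact: ex_series_scal.
Qed.

Lemma Csummable_plus a b : Csummable a -> Csummable b ->
  Csummable (fun n => (a n + b n)%C).
Proof.
move=> ha hb; have h := ex_series_plus _ _ ha hb.
apply: (proj1 (series_le _ h)) => n.
rewrite Rabs_pos_eq; [exact: Cmod_triangle|exact: Cmod_ge_0].
Qed.

Lemma rsum_multiples (k N : nat) (F : nat -> R) : (0 < k)%N ->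
  \rsum_(0 <= m < k * N) (if (k %| m)%N then F m else 0) = \rsum_(0 <= m < N) F (k * m)%N.
Proof.
move=> k0; elim: N => [|N IH]; first by rewrite muln0 !big_geq.
rewrite mulnS (@big_cat_nat _ _ _ (k * N)) //=; last by lia.
rewrite IH [RHS]big_nat_recr //=; congr (_ + _).
rewrite big_ltn; last by lia.
rewrite dvdn_mulr // big1_seq ?Rplus_0_r // => i.
rewrite mem_index_iota => hi; case: ifP => // /dvdnP [j hj]; exfalso.
by move: hi; rewrite hj [(j * k)%N]mulnC -mulnS !ltn_pmul2l //=; lia.
Qed.

Lemma is_lim_seq_mult_subseq (u : nat -> R) (l : R) (k : nat) : (0 < k)%N ->
  is_lim_seq u l -> is_lim_seq (fun N => u (k * N)%N) l.
Proof.
move=> k0; apply: is_lim_seq_subseq.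
by apply: eventually_subseq => n; apply/ltP; rewrite ltn_pmul2l.
Qed.

(** The partial sums up to [k N] on the left are those up to [N] on the right, so the limits agree
    along a subsequence. *)
Lemma Series_multiples (k : nat) (F : nat -> R) : (0 < k)%N ->
  ex_series (fun n => Rabs (F n)) ->
  ex_series (fun m => if (k %| m)%N then F m else 0) /\
  Series (fun m => if (k %| m)%N then F m else 0) = Series (fun m => F (k * m)%N).
Proof.
move=> k0 h.
have h1 : ex_series (fun m => if (k %| m)%N then F m else 0).
  by apply: (proj1 (series_le _ h)) => n; case: ifP => _; [lra | rewrite Rabs_R0; exact: Rabs_pos].
split=> //.
have := is_lim_seq_mult_subseq k0 (Series_rsum h1).
move/(is_lim_seq_ext _ _ _ (fun N => rsum_multiples N F k0)).
by move/is_series_rsum/is_series_unique.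
Qed.

Lemma CSeries_multiples (k : nat) (a : nat -> C) : (0 < k)%N -> Csummable a ->
  CSeries (fun m => if (k %| m)%N then a m else RtoC 0) = CSeries (fun m => a (k * m)%N).
Proof.
move=> k0 ha.
have h1 : ex_series (fun n => Rabs (fst (a n))).
  by apply: (proj1 (series_le _ ha)) => n; rewrite Rabs_Rabsolu; exact: Rabs_fst_Cmod.
have h2 : ex_series (fun n => Rabs (snd (a n))).
  by apply: (proj1 (series_le _ ha)) => n; rewrite Rabs_Rabsolu; exact: Rabs_snd_Cmod.
have [_ e1] := Series_multiples k0 h1; have [_ e2] := Series_multiples k0 h2.
rewrite /CSeries; congr (_, _); [rewrite -e1|rewrite -e2];
  by apply: Series_ext => n; case: ifP.
Qed.

(** A multiplicative weight that ignores exponents; [b p = 1 / (p + 1)] gives [1 / psi]. *)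
Definition pweight (b : nat -> R) (m : nat) : R := \rprod_(p <- primes m) b p.

(** Removing the primes one at a time through this predicate makes Euler products an induction on
    [k], without expanding integers into prime powers. *)
Definition rough (k m : nat) : bool := all (fun p => (k <= p)%N) (primes m).

Lemma pweight1 b : pweight b 1 = 1.
Proof. by rewrite /pweight big_nil. Qed.

Lemma pweightM b p m : prime p -> (0 < m)%N ->
  pweight b (p * m)%N = if (p %| m)%N then pweight b m else b p * pweight b m.
Proof.
move=> pp m0; have p0 := prime_gt0 pp; rewrite /pweight.
case: ifP => pm.
  suff -> : primes (p * m)%N = primes m by [].
  apply/eq_primes => q; rewrite primesM // primes_prime // inE.
  by case: eqP => [->|//]; rewrite mem_primes pp m0 pm.
have -> : b p * \rprod_(q <- primes m) b q = \rprod_(q <- p :: primes m) b q by rewrite big_cons.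
apply: perm_big.
apply: uniq_perm; rewrite ?primes_uniq //= ?primes_uniq ?andbT.
  by rewrite mem_primes pp m0 pm.
by move=> q; rewrite primesM // primes_prime // !inE.
Qed.

Lemma pweight_ge0 b m : (forall p, 0 <= b p) -> 0 <= pweight b m.
Proof. by move=> h; apply: rprod_ge0. Qed.

Lemma rough0 m : rough 0 m.
Proof. exact/allP. Qed.

Lemma roughS k m : (0 < m)%N ->
  rough k.+1 m = rough k m && ~~ (prime k && (k %| m)%N).
Proof.
move=> m0; apply/idP/idP.
  move/allP=> h; apply/andP; split; first by apply/allP => p /h; lia.
  apply/negP => /andP [pk km].
  by have := h k; rewrite mem_primes pk m0 km => /(_ isT); rewrite ltnn.
case/andP=> /allP h1 h2; apply/allP => p hp; have := h1 p hp.
rewrite leq_eqVlt => /orP [/eqP e|//].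
by move: hp h2; rewrite mem_primes e => /and3P [-> _ ->].
Qed.

Lemma rough_mul k m : prime k -> (0 < m)%N -> rough k (k * m) = rough k m.
Proof.
move=> pk m0; have k0 := prime_gt0 pk; apply/allP/allP => h p hp.
  by apply: h; rewrite primesM // hp orbT.
move: hp; rewrite primesM // => /orP [|]; last exact: h.
by rewrite primes_prime // inE => /eqP ->.
Qed.

(** The least prime factor of [m > 1] is at most [m]. So after [k] steps only the term [m = 1] and a
    tail from [k] on are left. *)
Lemma rough_small k m : (0 < m)%N -> (m < k)%N -> rough k m -> m = 1%N.
Proof.
move=> m0 mk /allP h; case: (ltngtP m 1) => // hm; first by lia.
have : pdiv m \in primes m by rewrite mem_primes pdiv_prime // m0 pdiv_dvd.
by move/h; have := pdiv_leq m0; lia.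
Qed.

Section EulerUpper.
Variables (b e : nat -> R).
Hypothesis b0 : forall p, 0 <= b p.
Hypothesis e0 : forall m, 0 <= e m.
Hypothesis e1 : e 1%N = 1.
Hypothesis eM : forall p m, prime p -> (0 < m)%N -> e (p * m)%N = e p * e m.
Hypothesis elt1 : forall p, prime p -> e p < 1.

(* The local factor [1 + b p (e p + e p ^ 2 + ...)]. *)
Definition efac (n : nat) : R := if prime n then 1 + b n * (e n / (1 - e n)) else 1.

Let ta k m := if (0 < m)%N && rough k m then pweight b m * e m else 0.

Lemma ta_ge0 k m : 0 <= ta k m.
Proof.
rewrite /ta; case: ifP => _; [|lra].
by apply: Rmult_le_pos; [apply: pweight_ge0|].
Qed.

Lemma efac_ge1 n : 1 <= efac n.
Proof.
rewrite /efac; case: ifP => pn; [|lra].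
suff : 0 <= b n * (e n / (1 - e n)) by lra.
apply: Rmult_le_pos => //; apply: Rdiv_le_0_compat => //; have := elt1 pn; lra.
Qed.

(** Split the sum into multiples of [k] and the rest, [D] and [T]. Writing [m = k m'] gives
    [D <= e k (D + b k T)], an inequality because the range of [m'] is shorter, and this is solved
    for [D]. *)
Lemma euler_upper_step N k :
  \rsum_(0 <= m < N) ta k m <= efac k * \rsum_(0 <= m < N) ta k.+1 m.
Proof.
rewrite /efac; case: ifP => pk; last first.
  rewrite Rmult_1_l; apply: rsum_nat_le => m _; rewrite /ta.
  by case m0: (0 < m)%N => //=; [rewrite roughS // pk /= andbT; lra | lra].
have k0 := prime_gt0 pk.
set T := \rsum_(0 <= m < N) ta k.+1 m.
set D := \rsum_(0 <= m < N) (if (k %| m)%N then ta k m else 0).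
have T0 : 0 <= T by apply: rsum_nat_ge0 => m _; apply: ta_ge0.
have -> : \rsum_(0 <= m < N) ta k m = T + D.
  rewrite /T /D -big_split; apply: eq_bigr => m _ /=; rewrite /ta.
  case m0: (0 < m)%N => /=; last by case: ifP => _; rewrite Rplus_0_l.
  rewrite roughS // pk /=; case: (rough k m); case: (k %| m)%N => /=; lra.
have hD : D <= e k * (D + b k * T).
  have -> : e k * (D + b k * T) = \rsum_(0 <= m < N) ta k (k * m)%N.
    rewrite /D /T rsumM -big_split rsumM; apply: eq_bigr => m _ /=; rewrite /ta.
    rewrite muln_gt0 k0 /=; case m0: (0 < m)%N => /=; last by case: ifP; lra.
    rewrite roughS // rough_mul // pk /= pweightM // eM //.
    by case: (rough k m); case: (k %| m)%N => /=; lra.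
  rewrite -rsum_multiples //; apply: rsum_sub_range => //; last by nia.
  by move=> i; case: ifP => _; [apply: ta_ge0|lra].
have h1 := elt1 pk; have h2 := e0 k.
suff : D <= b k * (e k / (1 - e k)) * T by lra.
have : D * (1 - e k) <= b k * e k * T by nra.
move=> h; apply: (Rmult_le_reg_r (1 - e k)); first lra.
by apply: Rle_trans h _; right; field; lra.
Qed.

(** Truncation only discards nonnegative terms, so the bound requires no summability; it is the way
    in which summability is obtained later. *)
Lemma euler_upper N :
  \rsum_(1 <= m < N) (pweight b m * e m) <= \rprod_(0 <= n < N) efac n.
Proof.
have fge0 k : 0 <= \rprod_(0 <= n < k) efac n.
  by apply: rprod_ge0 => i _; have := efac_ge1 i; lra.
case: N => [|[|N]]; [by rewrite [X in X <= _]big_geq //; exact: fge0 .. |].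
have H k : \rsum_(0 <= m < N.+2) ta 0 m <=
    (\rprod_(0 <= n < k) efac n) * \rsum_(0 <= m < N.+2) ta k m.
  elim: k => [|k IH]; first by rewrite [X in X * _]big_geq //; lra.
  apply: Rle_trans IH _; rewrite [X in _ <= X * _]big_nat_recr //= Rmult_assoc.
  by apply: Rmult_le_compat_l; last exact: euler_upper_step.
have := H N.+2.
have -> : \rsum_(0 <= m < N.+2) ta 0 m = \rsum_(1 <= m < N.+2) (pweight b m * e m).
  rewrite big_ltn // /ta /= Rplus_0_l big_seq_cond [RHS]big_seq_cond.
  apply: eq_bigr => m; rewrite mem_index_iota => /andP [/andP [m0 _] _].
  by rewrite m0 rough0.
move=> h; apply: Rle_trans h _.
rewrite -[X in _ <= X]Rmult_1_r; apply: Rmult_le_compat_l => //.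
rewrite big_ltn // big_ltn // [ta _ 0]/ta [ta _ 1]/ta /= pweight1 e1 big1_seq; first by lra.
move=> m; rewrite mem_index_iota => /andP [_ /andP [m1 m2]]; rewrite /ta.
case: ifP => // /andP [m0 hm]; have := rough_small m0 m2 hm; lia.
Qed.

End EulerUpper.

Section EulerProduct.
Variables (b : nat -> R) (e : nat -> C).
Hypothesis e1 : e 1%N = RtoC 1.
Hypothesis eM : forall p m, prime p -> (0 < m)%N -> e (p * m)%N = (e p * e m)%C.
Hypothesis elt1 : forall p, prime p -> Cmod (e p) < 1.

Definition cfac (n : nat) : C :=
  if prime n then (1 + RtoC (b n) * (e n / (1 - e n)))%C else RtoC 1.

Definition cterm k m : C :=
  if (0 < m)%N && rough k m then (RtoC (pweight b m) * e m)%C else RtoC 0.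

Hypothesis hsum : Csummable (cterm 0).

Lemma cterm_le k m : Cmod (cterm k m) <= Cmod (cterm 0 m).
Proof.
rewrite /cterm rough0 andbT; case m0: (0 < m)%N => /=; last by lra.
by case: ifP => _; [lra | rewrite Cmod_0; exact: Cmod_ge_0].
Qed.

Lemma cterm_summable k : Csummable (cterm k).
Proof. by apply: Csummable_le hsum => n; apply: cterm_le. Qed.

Lemma one_sub_neq0 k : prime k -> (1 - e k)%C <> RtoC 0.
Proof.
move=> pk h; have : e k = RtoC 1 by rewrite -[e k]Cplus_0_r -h; ring.
by move=> h1; have := elt1 pk; rewrite h1 Cmod_1; lra.
Qed.

(** The same splitting as in [euler_upper_step], now for the full series, where the relation
    [D = e k (D + b k T)] is exact and [1 - e k] is invertible. *)
Lemma euler_step k : CSeries (cterm k) = (cfac k * CSeries (cterm k.+1))%C.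
Proof.
rewrite /cfac; case: ifP => pk; last first.
  rewrite Cmult_1_l; apply: CSeries_ext => m; rewrite /cterm.
  by case m0: (0 < m)%N => //=; rewrite roughS // pk /= andbT.
have k0 := prime_gt0 pk.
set T := CSeries (cterm k.+1).
set d := fun m => if (k %| m)%N then cterm k m else RtoC 0.
have sd : Csummable d.
  apply: Csummable_le (cterm_summable k) => n; rewrite /d; case: ifP => _; first by lra.
  by rewrite Cmod_0; exact: Cmod_ge_0.
set D := CSeries d.
have -> : CSeries (cterm k) = (T + D)%C.
  rewrite /T /D -CSeries_plus //; last exact: cterm_summable.
  apply: CSeries_ext => m; rewrite /d /cterm.
  case m0: (0 < m)%N => /=; last by case: ifP => _; rewrite Cplus_0_l.
  by rewrite roughS // pk /=; case: (rough k m); case: (k %| m)%N => /=; ring.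
have hD : D = (e k * (D + RtoC (b k) * T))%C.
  rewrite {1}/D CSeries_multiples //; last exact: cterm_summable.
  have s2 := Csummable_scal (RtoC (b k)) (cterm_summable k.+1).
  rewrite /T -(CSeries_scal (RtoC (b k)) (cterm_summable k.+1)) /D.
  rewrite -(CSeries_plus sd s2) -CSeries_scal; last exact: Csummable_plus.
  apply: CSeries_ext => m; rewrite /d /cterm muln_gt0 k0 /=.
  case m0: (0 < m)%N => /=; last by case: ifP => _; ring.
  rewrite roughS // rough_mul // pk /= pweightM // eM //.
  by case: (rough k m); case: (k %| m)%N => /=; rewrite ?RtoC_mult; ring.
have nz := one_sub_neq0 pk.
have -> : D = (RtoC (b k) * (e k / (1 - e k)) * T)%C.
  have h : (D * (1 - e k) = RtoC (b k) * e k * T)%C.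
    by rewrite Cmult_comm [in LHS]/Cminus Cmult_plus_distr_r {1}hD; ring.
  have -> : D = (D * (1 - e k) / (1 - e k))%C by field.
  by rewrite h; field.
ring.
Qed.

Lemma euler_partial k : CSeries (cterm 0) = ((\cprod_(0 <= n < k) cfac n) * CSeries (cterm k))%C.
Proof.
elim: k => [|k IH]; first by rewrite big_geq // Cmult_1_l.
by rewrite big_nat_recr //= IH euler_step; ring.
Qed.

(** The factor 2 comes from bounding the real and imaginary parts separately. *)
Lemma CSeries_Cmod_le (a : nat -> C) (g : nat -> R) : (forall n, Cmod (a n) <= g n) ->
  ex_series g -> Cmod (CSeries a) <= 2 * Series g.
Proof.
move=> h hg.
have h1 : forall n, Rabs (fst (a n)) <= g n by move=> n; apply: Rle_trans (Rabs_fst_Cmod _) _.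
have h2 : forall n, Rabs (snd (a n)) <= g n by move=> n; apply: Rle_trans (Rabs_snd_Cmod _) _.
have [_ i1] := series_le h1 hg; have [_ i2] := series_le h2 hg.
have : Cmod (CSeries a) <= Rabs (fst (CSeries a)) + Rabs (snd (CSeries a)).
  rewrite /Cmod; set u := fst _; set w := snd _.
  have hu := Rabs_pos u; have hw := Rabs_pos w.
  rewrite -(sqrt_Rsqr (Rabs u + Rabs w)); last lra.
  apply: sqrt_le_1_alt; rewrite -(pow2_abs u) -(pow2_abs w) /Rsqr; nra.
rewrite /CSeries /=; lra.
Qed.

(** By [rough_small] the sieved series differs from its term at 1 by a series dominated by the tail
    from [k] of an absolutely convergent one. *)
Lemma cterm_lim : forall eps, 0 < eps -> exists K, forall k, (K <= k)%N ->
  Cmod (CSeries (cterm k) - 1)%C < eps.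
Proof.
move=> eps he.
have he4 : 0 < eps / 4 by lra.
have [N hN] := series_tail_small hsum he4.
exists (N + 2)%N => k hk.
set g := fun n => if (n < k)%N then 0 else Cmod (cterm 0 n).
have gle : forall n, Rabs (g n) <= Cmod (cterm 0 n).
  move=> n; rewrite /g; case: ifP => _; rewrite ?Rabs_R0; first exact: Cmod_ge_0.
  by rewrite Rabs_pos_eq; [lra | exact: Cmod_ge_0].
have [sg _] := series_le gle hsum.
have Sg : Series g = Series (fun n => Cmod (cterm 0 n)) - \rsum_(0 <= i < k) Cmod (cterm 0 i).
  have s1 : is_series (fun n => Cmod (cterm 0 n) - g n) (\rsum_(0 <= i < k) Cmod (cterm 0 i)).
    apply/is_series_rsum; apply: (is_lim_seq_ext_loc (fun _ => \rsum_(0 <= i < k) Cmod (cterm 0 i))); last exact: is_lim_seq_const.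
    exists k => n hn; rewrite (@big_cat_nat _ _ _ k 0 n) //=; last by lia.
    rewrite [X in _ + X]big1_seq; last first.
      move=> i; rewrite mem_index_iota /g => /andP [_ /andP [h _]].
      by rewrite ltnNge h /=; ring.
    rewrite Rplus_0_r big_seq [RHS]big_seq; apply: eq_bigr => i.
    by rewrite mem_index_iota /g => /andP [_ h]; rewrite h; ring.
  have := is_series_unique _ _ s1; rewrite Series_minus //; lra.
have -> : (CSeries (cterm k) - 1)%C = CSeries (fun m => if (m == 1)%N then RtoC 0 else cterm k m).
  set d := fun m => if (m == 1)%N then RtoC 0 else cterm k m.
  have sd : Csummable d.
    apply: Csummable_le (cterm_summable k) => n; rewrite /d; case: ifP => _; last by lra.
    by rewrite Cmod_0; exact: Cmod_ge_0.
  set o := fun m : nat => if (m == 1)%N then RtoC 1 else RtoC 0.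
  have iso : forall l : bool, is_series (fun m : nat => if (m == 1)%N then (if l then 1 else 0) else 0) (if l then 1 else 0).
    move=> l; apply/is_series_rsum; apply: (is_lim_seq_ext_loc (fun _ => if l then 1 else 0)); last exact: is_lim_seq_const.
    exists 2%N => n hn; rewrite big_ltn; last by lia.
    rewrite big_ltn /=; last by lia.
    rewrite big1_seq; first by case: l; lra.
    by move=> i; rewrite mem_index_iota => /= hi; case: eqP => // ee; lia.
  have so : Csummable o.
    exists 1; apply: is_series_ext (iso true) => n.
    by rewrite /o; case: ifP => _; rewrite ?Cmod_1 ?Cmod_0.
  have -> : CSeries (cterm k) = CSeries (fun m => (d m + o m)%C).
    apply: CSeries_ext => m; rewrite /d /o; case: eqP => [->|_]; last by ring.
    by rewrite /cterm /= pweight1 e1; ring.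
  rewrite CSeries_plus //.
  have -> : CSeries o = RtoC 1.
    rewrite /CSeries /RtoC; congr (_, _).
      by rewrite -[RHS](is_series_unique _ _ (iso true)); apply: Series_ext => n; rewrite /o; case: ifP.
    by rewrite -[RHS](is_series_unique _ _ (iso false)); apply: Series_ext => n; rewrite /o; case: ifP.
  by rewrite /Cminus; ring.
apply: Rle_lt_trans (@CSeries_Cmod_le _ g _ sg) _.
  move=> n; rewrite /g; case: eqP => [_|n1].
    by rewrite Cmod_0; case: ifP => _; [lra | exact: Cmod_ge_0].
  case: ifP => nk; last exact: cterm_le.
  rewrite /cterm; case: ifP; last by rewrite Cmod_0; lra.
  by case/andP=> n0 /(rough_small n0 nk).
rewrite Sg; have := hN k ltac:(lia); move/Rabs_def2; lra.
Qed.

(** The partial product [P] satisfies [S0 = P s] with [s] close to 1. Since [s] has modulus at least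
    1/2, [P] is bounded by twice the modulus of [S0], whence the difference [P (s - 1)] is small. *)
Lemma euler_product : forall eps, 0 < eps -> exists K, forall k, (K <= k)%N ->
  Cmod (CSeries (cterm 0) - \cprod_(0 <= n < k) cfac n)%C <= eps.
Proof.
move=> eps he; set S0 := CSeries (cterm 0).
have S0p := Cmod_ge_0 S0.
set d := Rmin (1/2) (eps / (2 * Cmod S0 + 1)).
have hd : 0 < d by apply: Rmin_glb_lt; [lra | apply: Rdiv_lt_0_compat; lra].
have [K hK] := cterm_lim hd; exists K => k hk.
have := hK k hk; set s := CSeries (cterm k) => hs.
set P := \cprod_(0 <= n < k) cfac n.
have eS : S0 = (P * s)%C by apply: euler_partial.
have -> : (S0 - P)%C = (P * (s - 1))%C by rewrite eS; ring.
rewrite Cmod_mult.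
have hs1 : 1 / 2 <= Cmod s.
  have h1 : RtoC 1 = (s + - (s - 1))%C by ring.
  have : Cmod (RtoC 1) <= Cmod s + Cmod (- (s - 1))%C by rewrite {1}h1; exact: Cmod_triangle.
  rewrite Cmod_1 Cmod_opp; have : d <= 1/2 by apply: Rmin_l.
  lra.
have : Cmod S0 = Cmod P * Cmod s by rewrite eS Cmod_mult.
have := Cmod_ge_0 P; have := Cmod_ge_0 (s - 1)%C => h3 h4 h5.
have hP : Cmod P <= 2 * Cmod S0 by nra.
have hd2 : d * (2 * Cmod S0 + 1) <= eps.
  have : d <= eps / (2 * Cmod S0 + 1) by apply: Rmin_r.
  move=> h; have h0 : 0 < 2 * Cmod S0 + 1 by lra.
  apply: Rle_trans (Rmult_le_compat_r _ _ _ (Rlt_le _ _ h0) h) _.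
  by right; field; lra.
nra.
Qed.

End EulerProduct.

(** * Elementary inequalities for the logarithm *)

Lemma ln_le_sub1 x : 0 < x -> ln x <= x - 1.
Proof.
by move=> h; have := exp_ineq1_le (ln x); rewrite exp_ln //; lra.
Qed.

Lemma ln_ge_1sub x : 0 < x -> 1 - / x <= ln x.
Proof.
move=> h; have := ln_le_sub1 (Rinv_0_lt_compat _ h); rewrite ln_Rinv //; lra.
Qed.

Lemma ln_le x y : 0 < x -> x <= y -> ln x <= ln y.
Proof. by move=> h [h1|->]; [left; apply: ln_increasing | lra]. Qed.

Lemma ln_ge0 x : 1 <= x -> 0 <= ln x.
Proof. by move=> h; rewrite -ln_1; apply: ln_le; lra. Qed.

Lemma ln_gt0 x : 1 < x -> 0 < ln x.
Proof. by move=> h; rewrite -ln_1; apply: ln_increasing; lra. Qed.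

Lemma INR_prime_ge2 p : prime p -> 2 <= INR p.
Proof. by move=> /prime_gt1; exact: INR_ge2. Qed.

Lemma ln_prime_gt0 p : prime p -> 0 < ln (INR p).
Proof. by move=> /INR_prime_ge2 h; apply: ln_gt0; lra. Qed.

Lemma lnINR_ge0 n : 0 <= ln (INR n).
Proof.
case: n => [|n]; last by apply: ln_ge0; apply: INR_ge1.
(* At the index 0 the logarithm takes its default value 0. *)
by rewrite [INR 0]/= /ln; case: (Rlt_dec 0 0) => h; [exfalso; lra | lra].
Qed.

Lemma ln2_bounds : 1/2 < ln 2 < 1.
Proof.
split; first by have := ln_lt_2; lra.
have : ln 2 < ln (exp 1) by apply: ln_increasing; [lra | have := exp_ineq1 1; lra].
by rewrite ln_exp.
Qed.

Lemma ln_le_2sqrt x : 0 < x -> ln x <= 2 * sqrt x.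
Proof.
move=> h; have hs := sqrt_lt_R0 _ h.
have e : ln x = ln (sqrt x) + ln (sqrt x) by rewrite -ln_mult // sqrt_sqrt; lra.
by have := ln_le_sub1 hs; lra.
Qed.

(** Induction by removing the least prime factor. The free bound [N] lets several such sums share
    one index range. *)
Lemma ln_INR_logn m N : (0 < m)%N -> (m < N)%N ->
  ln (INR m) = \rsum_(0 <= p < N | prime p) (INR (logn p m) * ln (INR p)).
Proof.
elim/ltn_ind: m => m IH m0 mN.
case: (ltngtP m 1) => hm; [lia| |].
  set q := pdiv m; have pq : prime q by apply: pdiv_prime.
  have q0 := prime_gt0 pq; have q1 := prime_gt1 pq.
  have hq : (m = q * (m %/ q))%N by rewrite mulnC divnK // pdiv_dvd.
  set k := (m %/ q)%N in hq.
  have k0 : (0 < k)%N by rewrite lt0n; apply/eqP => k0; move: hq m0; rewrite k0 muln0; lia.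
  have km : (k < m)%N by apply: ltn_Pdiv.
  have qm : (q <= m)%N by apply: pdiv_leq.
  rewrite [in LHS]hq INR_muln ln_mult; [|exact: INR_gt0|exact: INR_gt0].
  rewrite (IH k km k0); last by lia.
  have -> : ln (INR q) = \rsum_(0 <= p < N | prime p) (INR (p == q) * ln (INR p)).
    rewrite big_mkcond (bigD1_seq q) /= ?iota_uniq //; last by rewrite mem_index_iota; lia.
    rewrite pq eqxx big1; first by rewrite Rmult_1_l Rplus_0_r.
    by move=> p /negbTE ->; case: ifP => _ //; rewrite (_ : INR false = 0) // Rmult_0_l.
  rewrite -big_split; apply: eq_bigr => p pp /=.
  by rewrite [in RHS]hq lognM // (@logn_prime p q) // INR_addn Rmult_plus_distr_r.
rewrite hm big1 ?INR1 ?ln_1 // => p pp.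
by rewrite logn1 INR0 Rmult_0_l.
Qed.

(** * Chebyshev and Mertens estimates *)

Definition chebyshev_theta n := \rsum_(0 <= p < n.+1 | prime p) ln (INR p).

Lemma bin_le_pow n m : ('C(n, m) <= 2 ^ n)%N.
Proof.
elim: n m => [|n IH] [|m] //; first by rewrite bin0 expn_gt0.
by rewrite binS expnS mul2n -addnn leq_add.
Qed.

Lemma prime_ndvd_fact p n : prime p -> (n < p)%N -> ~~ (p %| n`!)%N.
Proof.
move=> pp; elim: n => [|n IH] h; first by rewrite dvdn1; have := prime_gt1 pp; lia.
by rewrite factS Euclid_dvdM // negb_or gtnNdvd //=; apply: IH; lia.
Qed.

Lemma INR_expn (a n : nat) : INR (a ^ n)%N = INR a ^ n.
Proof. by elim: n => [|n IH] //; rewrite expnS INR_muln IH. Qed.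

(** Chebyshev's argument: every prime in [(n, 2n]] divides the central binomial coefficient, which
    is at most [2 ^ (2 n)]. *)
Lemma theta_double n : (0 < n)%N ->
  chebyshev_theta (2 * n) <= chebyshev_theta n + INR (2 * n) * ln 2.
Proof.
move=> n0.
set c := 'C(2 * n, n).
have c0 : (0 < c)%N by rewrite bin_gt0; lia.
have hc : ln (INR c) <= INR (2 * n) * ln 2.
  rewrite -ln_pow; last lra.
  apply: ln_le; first exact: INR_gt0.
  by have := leq_INR (bin_le_pow (2 * n) n); rewrite INR_expn.
apply: Rle_trans (Rplus_le_compat_l _ _ _ hc).
set N := (maxn c.+1 (2 * n).+1).
rewrite (@ln_INR_logn c N) //; last by rewrite /N; lia.
have -> : \rsum_(0 <= p < N | prime p) (INR (logn p c) * ln (INR p)) =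
  \rsum_(0 <= p < N) (if prime p then INR (logn p c) * ln (INR p) else 0) by rewrite big_mkcond.
have hpos i : 0 <= (if prime i then INR (logn i c) * ln (INR i) else 0).
  by case: ifP => _; [apply: Rmult_le_pos; [exact: pos_INR | exact: lnINR_ge0] | lra].
have h2 := @rsum_sub_range 0 N (fun p => if prime p then INR (logn p c) * ln (INR p) else 0)
  n.+1 (2 * n).+1 hpos isT ltac:(rewrite /N; lia).
apply: Rle_trans (Rplus_le_compat_l _ _ _ h2).
rewrite /chebyshev_theta !(big_mkcond (fun p => prime p)) /=.
rewrite (@big_cat_nat _ _ _ n.+1 0 (2 * n).+1) //=; last by lia.
apply: Rplus_le_compat_l; apply: rsum_nat_le => p /andP [p1 p2].
case: ifP => pp; [|lra].
have hp : (p %| c)%N.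
  have hf := bin_fact (m := n) (n := 2 * n) ltac:(lia).
  have p1' : (p %| (2 * n)`!)%N by apply: dvdn_fact; have := prime_gt0 pp; lia.
  have pn : ~~ (p %| n`!)%N by apply: prime_ndvd_fact.
  move: p1'; rewrite -hf Euclid_dvdM // Euclid_dvdM // .
  by rewrite (_ : 2 * n - n = n)%N ?(negbTE pn) ?orbF //; lia.
have : (1 <= logn p c)%N by rewrite logn_gt0 mem_primes pp c0 hp.
move/leq_INR; rewrite -[INR 1]/1; have := ln_prime_gt0 pp; nra.
Qed.

(** Strong induction by halving. An odd argument is first increased by 1, which the constant 4
    absorbs because [ln 2 < 1]. *)
Lemma theta_le n : chebyshev_theta n <= 4 * INR n.
Proof.
have [_ l2] := ln2_bounds.
elim/ltn_ind: n => n IH.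
case: n IH => [|[|n]] IH.
- by rewrite /chebyshev_theta big_mkcond big_nat1 INR0 /=; lra.
- rewrite /chebyshev_theta big_mkcond big_ltn // big_nat1 INR1 /=; lra.
case: (boolP (odd n)) => hn.
  set m := (n.+3)./2; have hm : (n.+3 = 2 * m)%N by rewrite /m; lia.
  have m0 : (0 < m)%N by lia.
  have h1 : chebyshev_theta n.+2 <= chebyshev_theta (2 * m).
    rewrite /chebyshev_theta !(big_mkcond (fun p => prime p)) /= -hm.
    apply: rsum_sub_range => // i; case: ifP => _; [exact: lnINR_ge0 | lra].
  have := theta_double m0; have := IH m ltac:(lia).
  have h3 : INR n.+2 = 2 * INR m - 1.
    have h : INR n.+3 = INR (2 * m)%N by rewrite hm.
    by rewrite S_INR INR_muln -[INR 2]/2 in h; lra.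
  have h4 : 2 <= INR m by apply: INR_ge2; lia.
  rewrite INR_muln -[INR 2]/2 h3; nra.
set m := (n.+2)./2; have hm : (n.+2 = 2 * m)%N by rewrite /m; lia.
have m0 : (0 < m)%N by lia.
have := theta_double m0; have := IH m ltac:(lia).
rewrite hm INR_muln; have h4 : 1 <= INR m by apply: INR_ge1.
have -> : INR 2 = 2 by [].
nra.
Qed.

Definition mertens_sum n := \rsum_(0 <= p < n.+1 | prime p) (ln (INR p) / INR p).

Lemma ln_fact_le n : (0 < n)%N -> ln (INR n`!) <= INR n * ln (INR n).
Proof.
elim: n => [//|[|n] IH] _; first by rewrite INR1 ln_1; lra.
rewrite factS INR_muln ln_mult; [|exact: INR_gt0|apply: INR_gt0; exact: fact_gt0].
have h := IH isT; have : ln (INR n.+1) <= ln (INR n.+2).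
  by apply: ln_le; [exact: INR_gt0 | apply: leq_INR].
have := pos_INR n.+1; rewrite (S_INR n.+1); nra.
Qed.

Lemma ln_succ_sub n : (0 < n)%N -> 0 <= ln (INR n.+1) - ln (INR n) <= / INR n.
Proof.
move=> n0; have h := INR_gt0 n0; have h1 := INR_gt0 (ltn0Sn n).
split; first by have := ln_le h (leq_INR (leqnSn n)); lra.
have -> : ln (INR n.+1) - ln (INR n) = ln (INR n.+1 / INR n) by rewrite ln_div.
apply: Rle_trans (ln_le_sub1 _) _; first exact: Rdiv_lt_0_compat.
by rewrite S_INR; right; field; lra.
Qed.

Lemma ln_fact_ge n : (0 < n)%N -> INR n * ln (INR n) - INR n <= ln (INR n`!).
Proof.
elim: n => [//|[|n] IH] _; first by rewrite INR1 ln_1; lra.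
rewrite factS INR_muln ln_mult; [|exact: INR_gt0|apply: INR_gt0; exact: fact_gt0].
have h := IH isT; have [_ h2] := @ln_succ_sub n.+1 isT; have h0 := INR_gt0 (ltn0Sn n).
have : INR n.+1 * (ln (INR n.+2) - ln (INR n.+1)) <= 1.
  by apply: Rle_trans (Rmult_le_compat_l _ _ _ (Rlt_le _ _ h0) h2) _; right; field; lra.
rewrite (S_INR n.+1); nra.
Qed.

Lemma ln_fact_primes n : ln (INR n`!) =
  \rsum_(0 <= p < n.+1 | prime p) (INR (logn p n`!) * ln (INR p)).
Proof.
have f0 := fact_gt0 n.
rewrite (@ln_INR_logn n`! (maxn n`! n).+1) //; last by lia.
rewrite big_mkcond [RHS]big_mkcond (@big_cat_nat _ _ _ n.+1 0) //=; last by lia.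
rewrite [X in _ + X]big1_seq ?Rplus_0_r // => p; rewrite mem_index_iota => /andP [_ /andP [h1 h2]].
case: ifP => // pp; have h := prime_ndvd_fact pp h1.
by rewrite lognE (negbTE h) !andbF /= Rmult_0_l.
Qed.

Lemma INR_divn_le (n d : nat) : (0 < d)%N -> INR (n %/ d) <= INR n / INR d.
Proof.
move=> d0; have h := INR_gt0 d0; apply/Rle_div_r => //.
by rewrite -INR_muln; apply: leq_INR; apply: leq_trunc_div.
Qed.

Lemma INR_divn_ge (n d : nat) : (0 < d)%N -> INR n / INR d - 1 <= INR (n %/ d).
Proof.
move=> d0; have h := INR_gt0 d0.
have : INR n <= INR ((n %/ d).+1 * d)%N by apply: leq_INR; apply: ltnW; apply: ltn_ceil.
rewrite INR_muln S_INR => h1.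
suff : INR n / INR d <= INR (n %/ d) + 1 by lra.
by apply/Rle_div_l.
Qed.

Lemma logn_fact_le p n : prime p -> INR (logn p n`!) <= INR n / (INR p - 1).
Proof.
move=> pp; have h2 := INR_prime_ge2 pp; rewrite logn_fact //.
(* Legendre's formula, with the exact remainder of the geometric series kept so that the induction
   closes. *)
have H m : INR (\sum_(1 <= k < m.+1) n %/ p ^ k)%N <= INR n / (INR p - 1) * (1 - / INR p ^ m).
  elim: m => [|m IH]; first by rewrite big_geq // INR0 /=; right; field; lra.
  rewrite big_nat_recr //= INR_addn.
  have pm : 0 < INR p ^ m by apply: pow_lt; lra.
  have := @INR_divn_le n (p ^ m.+1) ltac:(by rewrite expn_gt0 prime_gt0); rewrite INR_expn /= => h.
  apply: Rle_trans (Rplus_le_compat _ _ _ _ IH h) _.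
  by right; field; lra.
apply: Rle_trans (H n) _.
rewrite -[X in _ <= X]Rmult_1_r; apply: Rmult_le_compat_l.
  by apply: Rdiv_le_0_compat; [exact: pos_INR | lra].
suff : 0 < / INR p ^ n by lra.
by apply: Rinv_0_lt_compat; apply: pow_lt; lra.
Qed.

Lemma logn_fact_ge p n : prime p -> (0 < n)%N -> INR n / INR p - 1 <= INR (logn p n`!).
Proof.
move=> pp n0; apply: Rle_trans (INR_divn_ge n (prime_gt0 pp)) _.
apply: leq_INR; rewrite logn_fact // big_ltn // expn1; exact: leq_addr.
Qed.

(** Compares [ln n! <= n ln n] with the first term of Legendre's formula; the integer parts cost
    [chebyshev_theta n <= 4 n]. *)
Lemma mertens_upper n : (0 < n)%N -> mertens_sum n <= ln (INR n) + 4.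
Proof.
move=> n0; have h0 := INR_gt0 n0.
have : INR n * mertens_sum n - chebyshev_theta n <= INR n * ln (INR n).
  apply: Rle_trans (ln_fact_le n0); rewrite ln_fact_primes /mertens_sum /chebyshev_theta.
  rewrite rsumM rsum_sub; apply: rsum_le => p _ pp.
  have := logn_fact_ge pp n0; have := ln_prime_gt0 pp; rewrite /Rdiv; nra.
have := theta_le n; nra.
Qed.

(** By [ln k <= 2 sqrt k] the summand is of order [k^(-3/2)], and it is dominated by the differences
    of [- 8 / sqrt (k - 1)]. *)
Lemma sum_inv_32_le N : \rsum_(2 <= k < N) (ln (INR k) / (INR k * (INR k - 1))) <= 8.
Proof.
case: (leqP N 2) => hN; first by rewrite big_geq //; lra.
apply: (@Rle_trans _ (\rsum_(2 <= k < N) (- 8 / sqrt (INR k.+1 - 1) - - 8 / sqrt (INR k - 1)))).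
  apply: rsum_nat_le => k /andP [k2 _].
  have hk : 2 <= INR k by exact: INR_ge2.
  rewrite S_INR; have -> : INR k + 1 - 1 = INR k by ring.
  set x := INR k in hk *.
  have s1 : 0 < sqrt x by apply: sqrt_lt_R0; lra.
  have s2 : 0 < sqrt (x - 1) by apply: sqrt_lt_R0; lra.
  have q1 := sqrt_sqrt x ltac:(lra); have q2 := sqrt_sqrt (x - 1) ltac:(lra).
  have hl := @ln_le_2sqrt x ltac:(lra).
  set u := sqrt x in s1 q1 hl *; set w := sqrt (x - 1) in s2 q2 *.
  have wu : w <= u by nra.
  have e1 : x * (x - 1) = (u * w) * (u * w) by rewrite -q2; nra.
  have -> : - 8 / u - - 8 / w = 8 * (u - w) * (u * w) / ((u * w) * (u * w)) by field; lra.
  rewrite e1; apply: Rmult_le_compat_r; first by left; apply: Rinv_0_lt_compat; nra.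
  have d1 : (u - w) * (u + w) = 1 by nra.
  have d2 : 1 <= 2 * u * (u - w) by nra.
  apply: Rle_trans hl _.
  have : u <= 2 * w by nra.
  nra.
rewrite (rsum_telescope (fun k => - 8 / sqrt (INR k - 1))); last by lia.
have -> : INR 2 - 1 = 1 by rewrite INR2; ring.
rewrite sqrt_1.
have : 0 < / sqrt (INR N - 1).
  apply: Rinv_0_lt_compat; apply: sqrt_lt_R0; have := @INR_ge2 N ltac:(lia); lra.
rewrite /Rdiv; lra.
Qed.

(** Here 9 is 1 from Stirling's lower bound plus 8 from the higher prime powers, which turn [1 / p]
    into [1 / (p - 1)]. *)
Lemma mertens_lower n : (0 < n)%N -> ln (INR n) - 9 <= mertens_sum n.
Proof.
move=> n0; have h0 := INR_gt0 n0.
have H : INR n * ln (INR n) - INR n <= INR n * (mertens_sum n + 8).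
  apply: Rle_trans (ln_fact_ge n0) _; rewrite ln_fact_primes.
  apply: (@Rle_trans _ (INR n * (mertens_sum n + \rsum_(2 <= k < n.+1) (ln (INR k) / (INR k * (INR k - 1)))))); last first.
    by apply: Rmult_le_compat_l; [lra | have := sum_inv_32_le n.+1; lra].
  apply: (@Rle_trans _ (INR n * (mertens_sum n + \rsum_(0 <= k < n.+1 | prime k) (ln (INR k) / (INR k * (INR k - 1)))))).
    rewrite /mertens_sum -big_split rsumM; apply: rsum_le => p _ pp /=.
    have := logn_fact_le n pp; have lp := ln_prime_gt0 pp; have p2 := INR_prime_ge2 pp => h.
    apply: Rle_trans (Rmult_le_compat_r _ _ _ (Rlt_le _ _ lp) h) _.
    by right; field; lra.
  apply: Rmult_le_compat_l; first lra.
  apply: Rplus_le_compat_l; rewrite big_mkcond.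
  case: n n0 h0 => [//|n] _ _; rewrite big_ltn // big_ltn //= !Rplus_0_l.
  apply: rsum_nat_le => k /andP [k2 _]; case: ifP => _; first lra.
  have hk := INR_ge2 k2; apply: Rdiv_le_0_compat; first exact: lnINR_ge0.
  nra.
nra.
Qed.

(** Summation by parts against a nonnegative decreasing weight. *)
Lemma abel_bound (E f : nat -> R) (B : R) (m w : nat) : (m <= w)%N ->
  (forall n, (m <= n)%N -> Rabs (E n) <= B) ->
  (forall n, (m <= n)%N -> 0 <= f n.+1 <= f n) ->
  Rabs (\rsum_(m <= i < w) ((E i.+1 - E i) * f i.+1)) <= 2 * B * f m.
Proof.
move=> mw hE hf.
have B0 : 0 <= B by apply: Rle_trans (Rabs_pos (E m)) (hE m (leqnn m)).
(* The boundary terms are kept inside the absolute value, since only this form is preserved by the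
   induction. *)
have H : f w <= f m /\ Rabs (\rsum_(m <= i < w) ((E i.+1 - E i) * f i.+1) - E w * f w + E m * f m)
   <= B * (f m - f w).
  elim: w mw => [|w IH] mw.
    have -> : m = 0%N by lia.
    by rewrite big_geq //; split; [lra|]; rewrite (_ : _ + _ = 0) ?Rabs_R0; nra.
  case: (ltngtP m w.+1) => h; [|lia|]; last first.
    by rewrite -h big_geq //; split; [lra|]; rewrite (_ : _ + _ = 0) ?Rabs_R0; nra.
  have [i1 i2] := IH ltac:(lia); have [f0 f1] := hf w ltac:(lia).
  split; first lra.
  rewrite big_nat_recr //=.
  set S := \rsum_(m <= i < w) _ in i2 *.
  have -> : S + (E w.+1 - E w) * f w.+1 - E w.+1 * f w.+1 + E m * f m
     = (S - E w * f w + E m * f m) + E w * (f w - f w.+1) by ring.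
  apply: Rle_trans (Rabs_triang _ _) _; rewrite Rabs_mult (Rabs_pos_eq (f w - _)); last lra.
  have := hE w ltac:(lia); nra.
case: H => h1 h2.
have fw : 0 <= f w.
  case: (ltngtP m w) => h; [|lia|]; last by rewrite -h; have := hf m (leqnn m); lra.
  by case: w mw h h1 h2 => [|w] //= _ h _ _; have := hf w ltac:(lia); lra.
set S := \rsum_(m <= i < w) _ in h2 *.
have -> : S = (S - E w * f w + E m * f m) + E w * f w + - E m * f m by ring.
apply: Rle_trans (Rabs_triang _ _) _.
have a1 := Rabs_triang (S - E w * f w + E m * f m) (E w * f w).
have a2 : Rabs (E w * f w) <= B * f w.
  by rewrite Rabs_mult (Rabs_pos_eq (f w)) //; apply: Rmult_le_compat_r => //; apply: hE.
have a3 : Rabs (- E m * f m) <= B * f m.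
  rewrite Rabs_mult Rabs_Ropp (Rabs_pos_eq (f m)); last lra.
  by apply: Rmult_le_compat_r; [lra | apply: hE].
lra.
Qed.

Lemma sum_inv_sq_le y w : (1 < y)%N -> \rsum_(y <= i < w) (/ INR i * / INR i) <= 1.
Proof.
move=> hy; case: (leqP w y) => hw; first by rewrite big_geq //; lra.
apply: (@Rle_trans _ (\rsum_(y <= i < w) (- / (INR i.+1 - 1) - - / (INR i - 1)))).
  apply: rsum_nat_le => i /andP [hi _]; have h : 2 <= INR i by apply: INR_ge2; lia.
  rewrite S_INR; set x := INR i in h *.
  have -> : - / (x + 1 - 1) - - / (x - 1) = / x * / (x - 1) by field; lra.
  apply: Rmult_le_compat_l; first by left; apply: Rinv_0_lt_compat; lra.
  by apply: Rinv_le_contravar; lra.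
rewrite (rsum_telescope (fun k => - / (INR k - 1))); last by lia.
have h1 : 2 <= INR y by apply: INR_ge2.
have h2 : 2 <= INR w by apply: INR_ge2; lia.
have : 0 < / (INR w - 1) by apply: Rinv_0_lt_compat; lra.
have : / (INR y - 1) <= / 1 by apply: Rinv_le_contravar; lra.
rewrite Rinv_1; lra.
Qed.

(** Partial summation of Mertens' estimate against [1 / ln^2]. The constant is 2 times 9 for the
    Mertens error, plus 2 for the sum [r] of second-order terms by which [dl / ln^2] differs from
    the increments of [- 1 / ln]. *)
Lemma prime_sum_inv_log y w : (1 < y)%N -> (y <= w)%N ->
  Rabs (\rsum_(y.+1 <= p < w.+1 | prime p) / (INR p * ln (INR p))
        - (/ ln (INR y) - / ln (INR w))) <= 20 / (ln (INR y)) ^ 2.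
Proof.
move=> hy yw.
have lnp : forall i, (y <= i)%N -> 0 < ln (INR i) /\ ln (INR y) <= ln (INR i) /\ 1 / 2 < ln (INR i).
  move=> i hi; have h2 : 2 <= INR i by apply: INR_ge2; lia.
  split; first by apply: ln_gt0; lra.
  split; first by apply: ln_le; [apply: INR_gt0; lia | exact: leq_INR].
  have := @ln_le 2 (INR i) ltac:(lra) h2; have := ln2_bounds; lra.
pose f n := / (ln (INR n)) ^ 2.
pose E n := mertens_sum n - ln (INR n).
have hE n : (y <= n)%N -> Rabs (E n) <= 9.
  move=> hn; apply: Rabs_le; rewrite /E.
  have := @mertens_upper n ltac:(lia); have := @mertens_lower n ltac:(lia); lra.
have hf n : (y <= n)%N -> 0 <= f n.+1 <= f n.
  move=> hn; have [h1 _] := lnp n hn; have [h2 _] := lnp n.+1 ltac:(lia).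
  have h3 : ln (INR n) <= ln (INR n.+1) by apply: ln_le; [apply: INR_gt0; lia | exact: leq_INR].
  rewrite /f; split; first by left; apply: Rinv_0_lt_compat; apply: pow_lt.
  apply: Rinv_le_contravar; first by apply: pow_lt.
  by apply: pow_incr; lra.
have hA := @abel_bound E f 9 y w yw hE hf.
have [ly [_ ly2]] := lnp y (leqnn y).
pose dl i := ln (INR i.+1) - ln (INR i).
pose r i := dl i * dl i * (/ ln (INR i) * f i.+1).
have key : \rsum_(y.+1 <= p < w.+1 | prime p) / (INR p * ln (INR p))
        - (/ ln (INR y) - / ln (INR w)) =
   \rsum_(y <= i < w) ((E i.+1 - E i) * f i.+1) - \rsum_(y <= i < w) r i.
  have -> : / ln (INR y) - / ln (INR w) = - / ln (INR w) - - / ln (INR y) by ring.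
  rewrite -(rsum_telescope (fun k => - / ln (INR k)) yw).
  rewrite big_mkcond big_add1 /= !rsum_sub big_seq [RHS]big_seq; apply: eq_bigr => i.
  rewrite mem_index_iota => /andP [hi _].
  have [h1 _] := lnp i hi; have [h2 _] := lnp i.+1 ltac:(lia).
  have -> : E i.+1 - E i = (if prime i.+1 then ln (INR i.+1) / INR i.+1 else 0) - dl i.
    rewrite /E /dl /mertens_sum (big_mkcond (fun p => prime p)) [in X in _ - (X - _)]big_mkcond /=.
    rewrite [X in X - _ - _]big_nat_recr //=; ring.
  rewrite /r /f /dl; have h0 : 0 < INR i.+1 by apply: INR_gt0.
  set a := ln (INR i.+1) in h2 *; set b := ln (INR i) in h1 *.
  by case: ifP => _; field; lra.
have rpos : 0 <= \rsum_(y <= i < w) r i <= 2 * f y.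
  split.
    apply: rsum_nat_ge0 => i /andP [hi _]; have [h1 _] := lnp i hi; have [h2 _] := hf i hi.
    have := Rinv_0_lt_compat _ h1; rewrite /r => h3.
    apply: Rmult_le_pos; first exact: Rle_0_sqr.
    by apply: Rmult_le_pos; lra.
  apply: (@Rle_trans _ (2 * f y * \rsum_(y <= i < w) (/ INR i * / INR i))); last first.
    have := sum_inv_sq_le w hy; have := hf y (leqnn y); nra.
  rewrite rsumM; apply: rsum_nat_le => i /andP [hi _].
  have [h1 [h1' h1'']] := lnp i hi; have [h2 h2'] := hf i hi.
  have [h3 h4] := @ln_succ_sub i ltac:(lia).
  have h5 : / ln (INR i) <= 2.
    have -> : 2 = / (1 / 2) by field.
    by apply: Rinv_le_contravar; lra.
  have h6 : f i.+1 <= f y.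
    rewrite /f; apply: Rinv_le_contravar; first exact: pow_lt.
    by apply: pow_incr; have [_ [h _]] := lnp i.+1 ltac:(lia); lra.
  have h7 := Rinv_0_lt_compat _ h1.
  rewrite /r (Rmult_comm (2 * f y)).
  apply: Rmult_le_compat.
  - exact: Rle_0_sqr.
  - by apply: Rmult_le_pos; lra.
  - by apply: Rmult_le_compat.
  - by apply: Rmult_le_compat; lra.
rewrite key.
have -> : 20 / ln (INR y) ^ 2 = 20 * f y by [].
have := Rabs_triang (\rsum_(y <= i < w) ((E i.+1 - E i) * f i.+1)) (- \rsum_(y <= i < w) r i).
rewrite Rabs_Ropp (Rabs_pos_eq (\rsum_(y <= i < w) r i)); last lra.
rewrite /Rminus in hA *; lra.
Qed.

Lemma prime_sum_inv_log_le y w : (1 < y)%N ->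
  \rsum_(y.+1 <= p < w | prime p) / (INR p * ln (INR p)) <= 41 / ln (INR y).
Proof.
move=> hy.
have h2 : 2 <= INR y by apply: INR_ge2.
have hl : 1 / 2 < ln (INR y).
  by have := @ln_le 2 (INR y) ltac:(lra) h2; have := ln2_bounds; lra.
case: (leqP w y.+1) => hw.
  by rewrite big_geq //; apply: Rdiv_le_0_compat; lra.
case: w hw => [//|w] hw.
have := @prime_sum_inv_log y w hy ltac:(lia).
move/Rabs_le_between => [_ h].
have : 0 < / ln (INR w).
  apply: Rinv_0_lt_compat; apply: ln_gt0; have := @INR_ge2 w ltac:(lia); lra.
have : 20 / ln (INR y) ^ 2 <= 40 / ln (INR y).
  have -> : 40 / ln (INR y) = 20 * (2 * ln (INR y)) / ln (INR y) ^ 2 by field; lra.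
  apply: Rmult_le_compat_r; last lra.
  by left; apply: Rinv_0_lt_compat; apply: pow_lt; lra.
rewrite /Rdiv; lra.
Qed.

Lemma ln_le_4sqrt4 x : 0 < x -> ln x <= 4 * sqrt (sqrt x).
Proof.
move=> h; have hs := sqrt_lt_R0 _ h.
have e : ln x = ln (sqrt x) + ln (sqrt x) by rewrite -ln_mult // sqrt_sqrt; lra.
have := ln_le_2sqrt hs; lra.
Qed.

(** A prime above [sqrt n] has [2 ln p / ln n >= 1], one below has [2 sqrt n ln p / p >= 1]; so the
    count is at most the sum of both weights, which Chebyshev and Mertens bound. *)
Lemma prime_count_le n : (1 < n)%N ->
  \rsum_(0 <= p < n.+1 | prime p) 1 <= 300 * (INR n / ln (INR n)).
Proof.
move=> hn; have h2 := INR_ge2 hn; set x := INR n in h2 *.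
have lx : 1 / 2 < ln x.
  by have := @ln_le 2 x ltac:(lra) h2; have := ln2_bounds; lra.
have sx : 0 < sqrt x by apply: sqrt_lt_R0; lra.
have ssx : sqrt x * sqrt x = x by apply: sqrt_sqrt; lra.
have s4 : 0 < sqrt (sqrt x) by apply: sqrt_lt_R0.
have ss4 : sqrt (sqrt x) * sqrt (sqrt x) = sqrt x by apply: sqrt_sqrt; lra.
apply: (@Rle_trans _ (2 / ln x * chebyshev_theta n + 2 * sqrt x * mertens_sum n)).
  rewrite /chebyshev_theta /mertens_sum !rsumM -big_split.
  apply: rsum_le => p _ pp /=.
  have p2 := INR_prime_ge2 pp; have lp := ln_prime_gt0 pp.
  have lp2 : 1 / 2 < ln (INR p).
    by have := @ln_le 2 (INR p) ltac:(lra) p2; have := ln2_bounds; lra.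
  have t1 : 0 < 2 / ln x * ln (INR p).
    by apply: Rmult_lt_0_compat => //; apply: Rdiv_lt_0_compat; lra.
  have t2 : 0 < 2 * sqrt x * (ln (INR p) / INR p).
    apply: Rmult_lt_0_compat; first lra.
    by apply: Rdiv_lt_0_compat; lra.
  case: (Rle_lt_dec (INR p) (sqrt x)) => hp.
    suff : 1 <= 2 * sqrt x * (ln (INR p) / INR p) by lra.
    have -> : 2 * sqrt x * (ln (INR p) / INR p) = (sqrt x / INR p) * (2 * ln (INR p)) by field; lra.
    have : 1 <= sqrt x / INR p by apply: le_divr; lra.
    nra.
  suff : 1 <= 2 / ln x * ln (INR p) by lra.
  have : ln (sqrt x) <= ln (INR p) by apply: ln_le; lra.
  have e : ln x = ln (sqrt x) + ln (sqrt x) by rewrite -ln_mult // ssx.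
  move=> h; have -> : 2 / ln x * ln (INR p) = (2 * ln (INR p)) / ln x by field; lra.
  by apply: le_divr; lra.
have hth := theta_le n; have hm := @mertens_upper n ltac:(lia).
rewrite -/x in hth hm.
have h1 : 2 / ln x * chebyshev_theta n <= 8 * (x / ln x).
  have -> : 8 * (x / ln x) = 2 / ln x * (4 * x) by field; lra.
  by apply: Rmult_le_compat_l => //; apply: Rdiv_le_0_compat; lra.
have h3 := @ln_le_4sqrt4 x ltac:(lra).
have h4 : 2 * sqrt x * mertens_sum n <= 288 * (x / ln x).
  apply: (@Rle_trans _ (2 * sqrt x * (9 * ln x))); first by apply: Rmult_le_compat_l; lra.
  have -> : 288 * (x / ln x) = 288 * x / ln x by field; lra.
  apply: le_divr; first lra.
  have hh : ln x * ln x <= 16 * sqrt x by rewrite -ss4; nra.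
  have := Rmult_le_compat_l (18 * sqrt x) _ _ ltac:(lra) hh.
  have -> : 18 * sqrt x * (16 * sqrt x) = 288 * (sqrt x * sqrt x) by ring.
  rewrite ssx; lra.
have : 0 < x / ln x by apply: Rdiv_lt_0_compat; lra.
lra.
Qed.

(** * Integer parts and exponential inequalities *)

Definition nfloor (x : R) : nat := Z.to_nat (Int_part x).

Lemma nfloor_bounds x : 0 <= x -> INR (nfloor x) <= x < INR (nfloor x) + 1.
Proof.
move=> h; have [h1 h2] := base_Int_part x; rewrite /nfloor.
have h3 : (0 <= Int_part x)%Z.
  have : IZR (-1) < IZR (Int_part x) by lra.
  by move/lt_IZR; lia.
rewrite INR_IZR_INZ Z2Nat.id //; lra.
Qed.

Lemma leq_nfloor n x : 0 <= x -> INR n <= x -> (n <= nfloor x)%N.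
Proof.
move=> h0 h; have [_ h2] := nfloor_bounds h0.
have : INR n < INR (nfloor x).+1 by rewrite S_INR; lra.
by move/INR_ltn; lia.
Qed.

Lemma exp_ge1p x : 1 + x <= exp x.
Proof. exact: exp_ineq1_le. Qed.

Lemma exp_gt1 x : 0 < x -> 1 < exp x.
Proof. by move=> h; have := exp_ge1p x; lra. Qed.

Lemma exp_le x y : x <= y -> exp x <= exp y.
Proof. by move=> [h|->]; [left; exact: exp_increasing | lra]. Qed.

Lemma exp_le1 x : x <= 0 -> exp x <= 1.
Proof. by move=> h; rewrite -exp_0; exact: exp_le. Qed.

(** After division by [exp (x / 2)] this is [sinh y >= y] at [y = x / 2]. Keeping the factor
    [exp (x / 2)] provides the decay of [qp] in large primes. *)
Lemma exp_sub1_ge_half x : 0 <= x -> x * exp (x / 2) <= exp x - 1.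
Proof.
move=> h.
have e0 : x * exp (x / 2) = exp (x / 2) * x by ring.
have e1 : exp x = exp (x / 2) * exp (x / 2) by rewrite -exp_plus; congr exp; field.
have e2 : exp (x / 2) * exp (- (x / 2)) = 1 by rewrite -exp_plus -exp_0; congr exp; field.
pose f y := exp y - exp (- y) - 2 * y.
have hf : forall y, 0 <= y -> 0 <= f y.
  move=> y [hy|<-]; last by rewrite /f Ropp_0 exp_0; lra.
  have [c [hc1 hc2]] : exists c, f y - f 0 = (exp c + exp (- c) - 2) * (y - 0) /\ 0 <= c <= y.
    have := MVT_gen f 0 y (fun c => exp c + exp (- c) - 2).
    rewrite Rmin_left ?Rmax_right; [|lra|lra].
    case.
    - move=> c _; rewrite /f; auto_derive => //; ring.
    - move=> c _; rewrite /f; apply continuity_pt_filterlim.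
      by apply: (@ex_derive_continuous _ _ (fun y => exp y - exp (- y) - 2 * y)); auto_derive.
    - by move=> c [h1 h2]; exists c.
  have f0 : f 0 = 0 by rewrite /f Ropp_0 exp_0; ring.
  have : 2 <= exp c + exp (- c) by have := exp_ge1p c; have := exp_ge1p (- c); lra.
  nra.
have := hf (x / 2) ltac:(lra); rewrite /f => h2.
have := exp_pos (x / 2); nra.
Qed.

Lemma exp_sub1_le2 x : 0 <= x <= 1 / 2 -> exp x - 1 <= 2 * x.
Proof.
move=> h.
have : exp x * exp (- x) = 1 by rewrite -exp_plus Rplus_opp_r exp_0.
have := exp_ge1p (- x); have := exp_pos x; nra.
Qed.

Lemma inv_1sub_exp_le x : 0 < x -> / (1 - exp (- x)) <= 1 + / x.
Proof.
move=> h.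
have e : exp x * exp (- x) = 1 by rewrite -exp_plus Rplus_opp_r exp_0.
have h1 := exp_ge1p x; have h2 := exp_pos (- x).
have h3 : exp (- x) < 1 by nra.
have h4 : 0 < / x by apply: Rinv_0_lt_compat.
apply: (Rmult_le_reg_r (1 - exp (- x))); first lra.
rewrite Rinv_l; last lra.
suff : x <= (1 + x) * (1 - exp (- x)).
  move=> h5; have -> : (1 + / x) * (1 - exp (- x)) = ((1 + x) * (1 - exp (- x))) / x by field; lra.
  by apply: le_divr; lra.
nra.
Qed.

(** * The saddle point equation *)

(* Under the law [P(m) ~ 1 / (psi m * m ^ a)] the exponents of the primes in [m] are independent:
   [p] divides [m] with probability [qp a p], and then its exponent is geometric
   of ratio [rho a p] and mean [lam a p].  So [mu a p] is the mean of [(logn p m) * ln p]. *)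
Definition qp (a : R) (n : nat) := / (1 + (INR n + 1) * (Rpower (INR n) a - 1)).
Definition rho (a : R) (n : nat) := Rpower (INR n) (- a).
Definition lam (a : R) (n : nat) := / (1 - rho a n).
Definition mu (a : R) (n : nat) := qp a n * lam a n * ln (INR n).

Section PerPrime.
Variables (a : R) (n : nat).
Hypothesis a0 : 0 < a.
Hypothesis pn : prime n.
Let p := INR n.
Let x := a * ln p.

Lemma alnp_gt0 : 0 < a * ln (INR n).
Proof. by apply: Rmult_lt_0_compat => //; exact: ln_prime_gt0. Qed.

Lemma Rpower_alnp : Rpower (INR n) a = exp (a * ln (INR n)).
Proof. by []. Qed.

Lemma rho_alnp : rho a n = exp (- (a * ln (INR n))).
Proof. by rewrite /rho /Rpower; congr exp; ring. Qed.

Lemma rho_mul : Rpower (INR n) a * rho a n = 1.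
Proof. by rewrite rho_alnp Rpower_alnp -exp_plus Rplus_opp_r exp_0. Qed.

Lemma rho_bounds : 0 < rho a n < 1.
Proof.
rewrite rho_alnp; split; first exact: exp_pos.
rewrite -exp_0; apply: exp_increasing; have := alnp_gt0; lra.
Qed.

Lemma lam_ge1 : 1 <= lam a n.
Proof.
have := rho_bounds => h; rewrite /lam -{1}Rinv_1; apply: Rinv_le_contravar; lra.
Qed.

Lemma lam_ln_le : lam a n * ln (INR n) <= ln (INR n) + / a.
Proof.
have lp := ln_prime_gt0 pn; rewrite /lam rho_alnp.
have := inv_1sub_exp_le alnp_gt0 => h.
apply: Rle_trans (Rmult_le_compat_r _ _ _ (Rlt_le _ _ lp) h) _.
by right; field; lra.
Qed.

Lemma pow_sub1_gt0 : 0 < Rpower (INR n) a - 1.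
Proof. by have := exp_gt1 alnp_gt0; rewrite Rpower_alnp; lra. Qed.

Lemma qp_bounds : 0 < qp a n < 1.
Proof.
have h1 := pow_sub1_gt0; have h2 := INR_prime_ge2 pn.
have h : 0 < (INR n + 1) * (Rpower (INR n) a - 1) by apply: Rmult_lt_0_compat; lra.
rewrite /qp; split; first by apply: Rinv_0_lt_compat; lra.
by rewrite -Rinv_1; apply: Rinv_lt_contravar; lra.
Qed.

(* [x e^{x/2} <= e^x - 1] with [x = a ln p]. *)
Lemma qp_le : qp a n <= / (a * (INR n * ln (INR n))) * exp (- (a * ln (INR n) / 2)).
Proof.
have h2 := INR_prime_ge2 pn; have lp := ln_prime_gt0 pn; have xp := alnp_gt0.
have h := exp_sub1_ge_half (Rlt_le _ _ xp).
have e2 := exp_pos (a * ln (INR n) / 2).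
rewrite /qp exp_Ropp -Rinv_mult; apply: Rinv_le_contravar.
  by apply: Rmult_lt_0_compat => //; nra.
rewrite Rpower_alnp.
have : INR n * (a * ln (INR n) * exp (a * ln (INR n) / 2)) <= INR n * (exp (a * ln (INR n)) - 1).
  by apply: Rmult_le_compat_l; lra.
have := exp_gt1 xp; nra.
Qed.

Lemma qp_le_simple : qp a n <= / (a * (INR n * ln (INR n))).
Proof.
have h := qp_le; have h2 := INR_prime_ge2 pn; have lp := ln_prime_gt0 pn; have xp := alnp_gt0.
have : exp (- (a * ln (INR n) / 2)) <= 1 by apply: exp_le1; lra.
have : 0 < / (a * (INR n * ln (INR n))) by apply: Rinv_0_lt_compat; nra.
nra.
Qed.

Lemma mu_eq : mu a n = Rpower (INR n) a * ln (INR n) /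
   ((Rpower (INR n) a - 1) * (1 + (INR n + 1) * (Rpower (INR n) a - 1))).
Proof.
have h1 := pow_sub1_gt0; have h2 := INR_prime_ge2 pn; have h3 := rho_mul.
rewrite /mu /qp /lam; set u := Rpower (INR n) a in h1 h3 *.
have -> : rho a n = / u by apply: (Rmult_eq_reg_l u); [rewrite h3 Rinv_r; lra | lra].
have h : 0 < (INR n + 1) * (u - 1) by nra.
by field; lra.
Qed.

Lemma mu_gt0 : 0 < mu a n.
Proof.
have [h _] := qp_bounds; have h1 := lam_ge1; have := ln_prime_gt0 pn.
by rewrite /mu => h3; apply: Rmult_lt_0_compat => //; apply: Rmult_lt_0_compat; lra.
Qed.

(** The efficient bound for primes below about [1 / a], where [qp] is close to 1. *)
Lemma mu_le_small : mu a n <= ln (INR n) + / a.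
Proof.
have [h h'] := qp_bounds; have h1 := lam_ge1; have lp := ln_prime_gt0 pn.
have := lam_ln_le; rewrite /mu Rmult_assoc.
have : 0 < lam a n * ln (INR n) by nra.
nra.
Qed.

(** With [y = a ln p] it reduces to [y^2 e^y <= (e^y - 1)^2]. *)
Lemma mu_le : mu a n <= / (a * a) * / (INR n * ln (INR n)).
Proof.
rewrite mu_eq Rpower_alnp.
have h2 := INR_prime_ge2 pn; have lp := ln_prime_gt0 pn; have xp := alnp_gt0.
have h := exp_sub1_ge_half (Rlt_le _ _ xp).
set y := a * ln (INR n) in xp h *.
have e1 : exp y = exp (y / 2) * exp (y / 2) by rewrite -exp_plus; congr exp; field.
have ep := exp_pos (y / 2); have eg := exp_gt1 xp.
have h5 : exp y * (y * y) <= (exp y - 1) * (exp y - 1).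
  have : (y * exp (y / 2)) * (y * exp (y / 2)) <= (exp y - 1) * (exp y - 1).
    by apply: Rmult_le_compat => //; nra.
  by move=> h6; rewrite {1}e1; lra.
have h6 : 0 < (exp y - 1) * (1 + (INR n + 1) * (exp y - 1)).
  by apply: Rmult_lt_0_compat; [lra | nra].
apply: divr_le => //.
have -> : / (a * a) * / (INR n * ln (INR n)) = ln (INR n) / (INR n * (y * y)) by rewrite /y; field; lra.
have h7 : INR n * (exp y * (y * y)) <= (exp y - 1) * (1 + (INR n + 1) * (exp y - 1)).
  have : INR n * (exp y * (y * y)) <= INR n * ((exp y - 1) * (exp y - 1)).
    by apply: Rmult_le_compat_l; lra.
  nra.
have h8 : 0 < INR n * (y * y) by apply: Rmult_lt_0_compat; nra.
apply: (Rmult_le_reg_r (INR n * (y * y))) => //.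
have -> : ln (INR n) / (INR n * (y * y)) * ((exp y - 1) * (1 + (INR n + 1) * (exp y - 1))) * (INR n * (y * y))
  = ln (INR n) * ((exp y - 1) * (1 + (INR n + 1) * (exp y - 1))) by field; split; lra.
nra.
Qed.

(** Converse of [mu_le] for large primes: [e^y - 1 <= y e^y], and each of the two summands 1 in the
    denominator costs a factor [1 + 1 / A]. It is used with [A = L]. *)
Lemma mu_ge (A : R) : 0 < A -> A * 1 <= INR n * (a * ln (INR n)) -> A <= INR n ->
  exp (- (a * ln (INR n))) / ((1 + / A) * (1 + / A)) * (/ (a * a) * / (INR n * ln (INR n))) <= mu a n.
Proof.
move=> A0 hA1 hA2.
rewrite mu_eq Rpower_alnp.
have h2 := INR_prime_ge2 pn; have lp := ln_prime_gt0 pn; have xp := alnp_gt0.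
have -> : / (a * a) * / (INR n * ln (INR n)) =
  ln (INR n) / (INR n * ((a * ln (INR n)) * (a * ln (INR n)))) by field; lra.
set y := a * ln (INR n) in xp hA1 *.
have ey := exp_gt1 xp.
have e1 : exp y * exp (- y) = 1 by rewrite -exp_plus Rplus_opp_r exp_0.
have e2 := exp_pos (- y).
have h3 : exp y - 1 <= y * exp y by have := exp_ge1p (- y); nra.
have iA : A * / A = 1 by rewrite Rinv_r; lra.
have iA0 : 0 < / A by apply: Rinv_0_lt_compat.
set c := 1 + / A.
have c1 : 1 < c by rewrite /c; lra.
have g1 : INR n + 1 <= INR n * c by rewrite /c; nra.
have g0 : y <= exp y - 1 by have := exp_ge1p y; lra.
have g2 : 1 <= INR n * (exp y - 1) * / A.
  have : A * 1 * / A <= INR n * (exp y - 1) * / A.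
    apply: Rmult_le_compat_r; first lra.
    by apply: Rle_trans hA1 _; apply: Rmult_le_compat_l; lra.
  by rewrite Rmult_1_r iA.
have g3 : 1 + (INR n + 1) * (exp y - 1) <= INR n * (exp y - 1) * (c * c).
  have : (INR n + 1) * (exp y - 1) <= INR n * c * (exp y - 1) by apply: Rmult_le_compat_r; lra.
  have : 0 < INR n * (exp y - 1) by apply: Rmult_lt_0_compat; lra.
  set w := INR n * (exp y - 1) in g2 *.
  have -> : INR n * c * (exp y - 1) = w * c by rewrite /w; ring.
  have -> : w * (c * c) = w * c + w * / A * c by rewrite /c; ring.
  move=> h8 h9; have : 1 <= w * / A * c by nra.
  lra.
have D : 0 < (exp y - 1) * (1 + (INR n + 1) * (exp y - 1)).
  by apply: Rmult_lt_0_compat; [lra | nra].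
have g4 : (exp y - 1) * (1 + (INR n + 1) * (exp y - 1)) <= INR n * (c * c) * ((y * exp y) * (y * exp y)).
  apply: (@Rle_trans _ ((exp y - 1) * (INR n * (exp y - 1) * (c * c)))).
    by apply: Rmult_le_compat_l; lra.
  have -> : (exp y - 1) * (INR n * (exp y - 1) * (c * c)) = INR n * (c * c) * ((exp y - 1) * (exp y - 1)) by ring.
  apply: Rmult_le_compat_l; first by nra.
  by apply: Rmult_le_compat; lra.
apply: le_divr => //.
apply: Rle_trans (Rmult_le_compat_l _ _ _ _ g4) _.
  apply: Rmult_le_pos.
    apply: Rdiv_le_0_compat; first lra.
    by nra.
  apply: Rdiv_le_0_compat; first lra.
  by apply: Rmult_lt_0_compat; nra.
right.
have -> : exp (- y) = / exp y by rewrite exp_Ropp.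
by field; rewrite /c in c1 *; repeat split; lra.
Qed.

End PerPrime.

Definition gterm (a : R) (n : nat) := if prime n then mu a n else 0.

Lemma G_gterm a : 0 < a -> G a = Series (gterm a).
Proof.
move=> a0; apply: Series_ext => n; rewrite /gterm; case: ifP => pn //.
by rewrite mu_eq.
Qed.

(** The common majorant of all local quantities; Mertens' estimate makes it summable. *)
Definition plog (n : nat) := if prime n then / (INR n * ln (INR n)) else 0.

Lemma plog_ge0 n : 0 <= plog n.
Proof.
rewrite /plog; case: ifP => pn; last lra.
have := INR_prime_ge2 pn; have := ln_prime_gt0 pn => h1 h2.
by left; apply: Rinv_0_lt_compat; nra.
Qed.

(** The prime 2 contributes at most 1, the others at most [41 / ln 2 <= 82]. *)
Lemma plog_sum_le N : \rsum_(0 <= n < N) plog n <= 83.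
Proof.
apply: (@Rle_trans _ (\rsum_(0 <= n < N + 3) plog n)).
  by apply: rsum_sub_range => //; [exact: plog_ge0 | lia].
rewrite big_ltn; last by lia.
rewrite big_ltn; last by lia.
rewrite big_ltn; last by lia.
rewrite /plog /= INR2.
have := @prime_sum_inv_log_le 2 (N + 3) isT; rewrite INR2 big_mkcond /=.
have h := ln2_bounds => h1.
have h2 : 41 / ln 2 <= 82 by apply: divr_le; lra.
have h3 : / (2 * ln 2) <= 1 by rewrite -Rinv_1; apply: Rinv_le_contravar; lra.
lra.
Qed.

Lemma ex_series_plog : ex_series plog.
Proof. exact: (proj1 (pos_series_bounded plog_ge0 plog_sum_le)). Qed.

Lemma gterm_ge0 a n : 0 < a -> 0 <= gterm a n.
Proof. by move=> a0; rewrite /gterm; case: ifP => pn; [left; exact: mu_gt0 | lra]. Qed.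

Lemma gterm_le a n : 0 < a -> gterm a n <= / (a * a) * plog n.
Proof.
move=> a0; rewrite /gterm /plog; case: ifP => pn; [exact: mu_le | lra].
Qed.

Lemma ex_series_gterm a : 0 < a -> ex_series (gterm a).
Proof.
move=> a0; have h := ex_series_scal_l (/ (a * a)) plog ex_series_plog.
apply: (proj1 (series_le _ h)) => n.
by rewrite Rabs_pos_eq; [exact: gterm_le | exact: gterm_ge0].
Qed.

Lemma G_le a : 0 < a -> G a <= 83 / (a * a).
Proof.
move=> a0; rewrite G_gterm //.
apply: is_lim_seq_le_const (Series_rsum (ex_series_gterm a0)); exists 0%N => N _.
apply: (@Rle_trans _ (\rsum_(0 <= i < N) (/ (a * a) * plog i))).
  by apply: rsum_nat_le => i _; exact: gterm_le.
rewrite -rsumM /Rdiv Rmult_comm; apply: Rmult_le_compat_r; last exact: plog_sum_le.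
by left; apply: Rinv_0_lt_compat; nra.
Qed.

Lemma continuous_rsum (f : nat -> R -> R) (x : R) N : (forall n, continuous (f n) x) ->
  continuous (fun y => \rsum_(0 <= n < N) f n y) x.
Proof.
move=> h; elim: N => [|N IH].
  apply: (continuous_ext (fun _ => 0)) => [y|]; first by rewrite big_geq.
  exact: continuous_const.
apply: (continuous_ext (fun y => \rsum_(0 <= n < N) f n y + f N y)).
  by move=> y; rewrite big_nat_recr.
exact: (continuous_plus (fun y => \rsum_(0 <= n < N) f n y)).
Qed.

(** Weierstrass's M-test, with domination required only near the point. *)
Lemma continuous_Series (f : nat -> R -> R) (M : nat -> R) (x : R) :
  (forall n, continuous (f n) x) ->
  locally x (fun y => forall n, Rabs (f n y) <= M n) -> ex_series M ->
  continuous (fun y => Series (fun n => f n y)) x.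
Proof.
move=> hc [d hd] hM; apply/filterlim_locally => eps.
have e4 : 0 < eps / 4 by have := cond_pos eps; lra.
have [N hN] := series_tail_small hM e4.
have hx := hd x (ball_center x d).
have M0 n : 0 <= M n by apply: Rle_trans (Rabs_pos _) (hx n).
have tail y : ball x d y -> Rabs (Series (fun n => f n y) - \rsum_(0 <= n < N) f n y) <= eps / 4.
  move=> hy; have hfy := hd y hy.
  have [sf _] := series_le hfy hM.
  pose g n := if (n < N)%N then 0 else f n y.
  pose m n := if (n < N)%N then 0 else M n.
  have fin (u : nat -> R) : ex_series u -> is_series (fun n => if (n < N)%N then 0 else u n) (Series u - \rsum_(0 <= n < N) u n).
    move=> su; apply/is_series_rsum.
    apply: (is_lim_seq_ext_loc (fun k => \rsum_(0 <= n < k) u n - \rsum_(0 <= n < N) u n)).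
      exists N => k hk; rewrite (@big_cat_nat _ _ _ N 0 k) //=; last by lia.
      rewrite [in RHS](@big_cat_nat _ _ _ N 0 k) //=; last by lia.
      rewrite [X in _ = X + _]big1_seq; last first.
        by move=> i; rewrite mem_index_iota => /andP [_ /andP [_ ->]].
      have -> : \rsum_(N <= i < k) (if (i < N)%N then 0 else u i) = \rsum_(N <= i < k) u i.
        apply: eq_big_seq => i; rewrite mem_index_iota => /andP [h _].
        by rewrite ltnNge h.
      lra.
    apply: is_lim_seq_minus'; [exact: Series_rsum | exact: is_lim_seq_const].
  rewrite -(is_series_unique _ _ (fin _ sf)).
  have sm := fin _ hM.
  have le n : Rabs (if (n < N)%N then 0 else f n y) <= (if (n < N)%N then 0 else M n).
    by case: ifP => _; [rewrite Rabs_R0; lra | exact: hfy].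
  have [_ h] := series_le le (ex_intro _ _ sm).
  apply: Rle_trans h _; rewrite (is_series_unique _ _ sm).
  by have := hN N (leqnn N); move/Rabs_def2; lra.
have /filterlim_locally /(_ (mkposreal _ e4)) hfin := @continuous_rsum f x N hc.
have hball : locally x (fun y => ball x d y) by exists d.
generalize (filter_and _ _ hfin hball); apply: filter_imp => y [h1 h2].
have t1 := tail x (ball_center x d); have t2 := tail y h2.
rewrite /ball /= /AbsRing_ball /= /abs /minus /plus /opp /= in h1 *.
move: t1 t2 h1 => /Rabs_le_between t1 /Rabs_le_between t2 /Rabs_def2 h1.
apply: Rabs_def1; lra.
Qed.

Lemma continuous_gterm n a : 0 < a -> continuous (fun y => gterm y n) a.
Proof.
move=> a0; rewrite /gterm; case: (boolP (prime n)) => pn; last exact: continuous_const.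
have h2 := INR_prime_ge2 pn.
have h1 := pow_sub1_gt0 a0 pn; have lp := ln_prime_gt0 pn.
apply: (@ex_derive_continuous _ _ (fun y => mu y n)).
rewrite /mu /qp /lam /rho /Rpower.
have [r0 r1] := rho_bounds a0 pn; rewrite /rho /Rpower in r0 r1.
rewrite /Rpower in h1.
by auto_derive; repeat split => //; nra.
Qed.

(** Near [a] the parameter stays above [a / 2], where [gterm_le] supplies one summable majorant. *)
Lemma continuous_G a : 0 < a -> continuous G a.
Proof.
move=> a0.
apply: (continuous_ext_loc G (fun y => Series (gterm y))).
  have ha2 : 0 < a / 2 by lra.
  exists (mkposreal _ ha2) => y; rewrite /ball /= /AbsRing_ball /= /abs /minus /plus /opp /=.
  by move/Rabs_def2 => h; rewrite G_gterm //; lra.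
apply: (@continuous_Series (fun n y => gterm y n) (fun n => / (a / 2 * (a / 2)) * plog n)).
- by move=> n; exact: continuous_gterm.
- have ha2 : 0 < a / 2 by lra.
  exists (mkposreal _ ha2) => y; rewrite /ball /= /AbsRing_ball /= /abs /minus /plus /opp /=.
  move/Rabs_def2 => h n; have y0 : 0 < y by lra.
  rewrite Rabs_pos_eq; last exact: gterm_ge0.
  apply: Rle_trans (gterm_le n y0) _; apply: Rmult_le_compat_r; first exact: plog_ge0.
  by apply: Rinv_le_contravar; nra.
- exact: ex_series_scal_l ex_series_plog.
Qed.

Lemma exp_ge_pow6 L : 0 <= L -> (L / 6) ^ 6 <= exp L.
Proof.
move=> h; have -> : exp L = exp (L / 6) ^ 6.
  by rewrite /= Rmult_1_r -!exp_plus; congr exp; field.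
apply: pow_incr; have := exp_ge1p (L / 6); lra.
Qed.

Lemma exp_nfloor_ln Y : 2 <= Y ->
  ln Y - 1 <= ln (INR (nfloor Y)) <= ln Y /\ (1 < nfloor Y)%N.
Proof.
move=> hY; have [h1 h2] := @nfloor_bounds Y ltac:(lra).
have h3 : (2 <= nfloor Y)%N by apply: leq_nfloor; rewrite ?INR2; lra.
have h4 : 2 <= INR (nfloor Y) by apply: INR_ge2.
split=> //; split; last by apply: ln_le; lra.
have : ln (Y / 2) <= ln (INR (nfloor Y)) by apply: ln_le; lra.
rewrite ln_div; [|lra|lra]; have := ln2_bounds; lra.
Qed.

Lemma rsum_plog y w : \rsum_(y <= n < w) plog n =
  \rsum_(y <= p < w | prime p) / (INR p * ln (INR p)).
Proof. by rewrite [RHS]big_mkcond. Qed.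

(** * Asymptotics of [G] near 0 *)

Section Asymp.
Variable a : R.
Hypothesis a0 : 0 < a.
Let L := - ln a.
Hypothesis hL : 100 <= L.
Let s := sqrt L.

Lemma asym_s : 10 <= s /\ s * s = L /\ ln L <= 2 * s.
Proof.
have ss : s * s = L by apply: sqrt_sqrt; lra.
have s0 : 0 <= s by apply: sqrt_pos.
split; first by nra.
by split=> //; apply: ln_le_2sqrt; lra.
Qed.

Lemma a_expL : a = exp (- L).
Proof. by rewrite /L Ropp_involutive exp_ln. Qed.

Lemma inv_a_expL : / a = exp L.
Proof. by rewrite {1}a_expL exp_Ropp Rinv_inv. Qed.

Lemma aL3_le : a * L ^ 3 <= 1.
Proof.
have h := @exp_ge_pow6 L ltac:(lra).
have e : a * exp L = 1 by rewrite -inv_a_expL Rinv_r; lra.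
have : L ^ 3 <= exp L.
  apply: Rle_trans h.
  have -> : (L / 6) ^ 6 = L ^ 3 * (L ^ 3 / 46656) by field.
  rewrite -{1}[L ^ 3]Rmult_1_r; apply: Rmult_le_compat_l; first by apply: pow_le; lra.
  have : 100 ^ 3 <= L ^ 3 by apply: pow_incr; lra.
  lra.
nra.
Qed.

(** Split at [Y = 1 / (a L)]. Below, [mu_le_small] and the prime count give [O (1 / (a L)^2)].
    Above, [mu_le] and [prime_sum_inv_log] give [1 / (a^2 ln Y)] with [ln Y = L - ln L]; the error
    [1 / s] comes from [ln L <= 2 sqrt L]. *)
Lemma G_upper : G a <= (1 + 690 / s) / (a * a * L).
Proof.
have [s10 [ss ls]] := asym_s; have aL3 := aL3_le.
set Y := / (a * L).
have aL : 0 < a * L by nra.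
have lnY : ln Y = L - ln L.
  by rewrite /Y ln_Rinv // ln_mult //; [rewrite /L; ring | lra].
have Y2 : 2 <= Y.
  rewrite /Y -[2]Rinv_inv; apply: Rinv_le_contravar => //; nra.
have [[ly1 ly2] hy] := exp_nfloor_ln Y2.
have [fy1 fy2] := @nfloor_bounds Y ltac:(lra).
set y := nfloor Y in ly1 ly2 hy fy1 fy2.
rewrite lnY in ly1 ly2.
have ly3 : L - 2 * s - 1 <= ln (INR y) by lra.
have ly4 : L / 2 <= ln (INR y) by nra.
have P1 : \rsum_(0 <= n < y.+1) gterm a n <= 4 / (a * L) + 600 / (a * a * (L * L)).
  apply: (@Rle_trans _ (chebyshev_theta y + / a * \rsum_(0 <= n < y.+1 | prime n) 1)).
    rewrite /chebyshev_theta rsumM -big_split /gterm -big_mkcond.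
    by apply: rsum_le => p _ pp /=; have := mu_le_small a0 pp; lra.
  have t1 := theta_le y; have t2 := prime_count_le hy.
  have t3 : 4 * INR y <= 4 / (a * L) by rewrite /Rdiv -/Y; lra.
  have t4 : 300 * (INR y / ln (INR y)) <= 600 / (a * (L * L)).
    have -> : 600 / (a * (L * L)) = 300 * (Y * / (L / 2)) by rewrite /Y; field; lra.
    apply: Rmult_le_compat_l; first lra.
    apply: Rmult_le_compat; [exact: pos_INR | by left; apply: Rinv_0_lt_compat; lra | lra |].
    by apply: Rinv_le_contravar; lra.
  have t5 : / a * \rsum_(0 <= n < y.+1 | prime n) 1 <= / a * (600 / (a * (L * L))).
    by apply: Rmult_le_compat_l; [left; exact: Rinv_0_lt_compat | lra].
  have -> : 600 / (a * a * (L * L)) = / a * (600 / (a * (L * L))) by field; lra.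
  lra.
have P2 N : (y.+1 <= N)%N -> \rsum_(y.+1 <= n < N) gterm a n
    <= / (a * a) * (/ (L - 2 * s - 1) + 80 / (L * L)).
  case: N => [|w] // hw.
  apply: (@Rle_trans _ (/ (a * a) * \rsum_(y.+1 <= n < w.+1) plog n)).
    by rewrite rsumM; apply: rsum_nat_le => i _; exact: gterm_le.
  apply: Rmult_le_compat_l; first by left; apply: Rinv_0_lt_compat; nra.
  have := @prime_sum_inv_log y w hy ltac:(lia).
  rewrite -rsum_plog => /Rabs_le_between [_ h].
  have h1 : / ln (INR y) <= / (L - 2 * s - 1) by apply: Rinv_le_contravar; nra.
  have h2 : 0 < / ln (INR w).
    apply: Rinv_0_lt_compat; apply: ln_gt0; have := @INR_ge2 w ltac:(lia); lra.
  have h3 : 20 / ln (INR y) ^ 2 <= 80 / (L * L).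
    have -> : 80 / (L * L) = 20 * / ((L / 2) ^ 2) by field; lra.
    apply: Rmult_le_compat_l; first lra.
    apply: Rinv_le_contravar; first by apply: pow_lt; lra.
    by apply: pow_incr; lra.
  lra.
rewrite G_gterm //.
apply: is_lim_seq_le_const (Series_rsum (ex_series_gterm a0)); exists y.+1 => N hN.
rewrite (@big_cat_nat _ _ _ y.+1 0 N) //=.
apply: Rle_trans (Rplus_le_compat _ _ _ _ P1 (P2 N hN)) _.
apply: le_divr; first by nra.
have -> : (4 / (a * L) + 600 / (a * a * (L * L)) + / (a * a) * (/ (L - 2 * s - 1) + 80 / (L * L))) * (a * a * L)
  = 4 * a + 680 / L + (1 + (2 * s + 1) / (L - 2 * s - 1)).
  by field; repeat split; nra.
have b1 : (2 * s + 1) / (L - 2 * s - 1) <= 5 / s.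
  apply: divr_le; first by nra.
  have -> : 5 / s * (L - 2 * s - 1) = 5 * s - 10 - 5 / s by rewrite -ss; field; lra.
  have : 5 / s <= 1 by apply: divr_le; lra.
  lra.
have b2 : 680 / L <= 680 / s.
  by apply: Rmult_le_compat_l; [lra | apply: Rinv_le_contravar; nra].
have b3 : 4 * a <= 4 / s.
  apply: Rmult_le_compat_l; first lra.
  rewrite -[a]Rinv_inv inv_a_expL; apply: Rinv_le_contravar; first lra.
  by have := exp_ge1p L; nra.
have : 690 / s = 680 / s + 5 / s + 4 / s + 1 / s by field; lra.
have : 0 < 1 / s by apply: Rdiv_lt_0_compat; lra.
lra.
Qed.

(** Only primes between [L / a] and [exp (L^2)] are kept: there [p a >= L] and [a ln p <= 1 / L], so
    [mu_ge] loses a factor [1 - O (1 / L)], and the discarded tail of [1 / (p ln p)] is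
    [O (1 / L^2)]. *)
Lemma G_lower : (1 - 27 / s) / (a * a * L) <= G a.
Proof.
have [s10 [ss ls]] := asym_s; have aL3 := aL3_le.
have a1 : a < 1 by have : 1 <= L ^ 3; [by apply: pow_R1_Rle; lra | nra].
have lL : 0 <= ln L by apply: ln_ge0; lra.
set Y := L / a.
have Y2 : 2 <= Y by apply: le_divr; nra.
have lnY : ln Y = L + ln L by rewrite /Y ln_div; [rewrite /L; ring | lra | lra].
have [[ly1 ly2] hy] := exp_nfloor_ln Y2.
have [fy1 fy2] := @nfloor_bounds Y ltac:(lra).
set y := nfloor Y in ly1 ly2 hy fy1 fy2.
rewrite lnY in ly1 ly2.
have lL1 : 1 <= ln L.
  rewrite -[1](ln_exp 1); apply: ln_le; [exact: exp_pos | have := exp_le_3; lra].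
set W := exp (L * L).
have W2 : 2 <= W by have := exp_ge1p (L * L); rewrite -/W; nra.
have [[lw1 lw2] hw] := exp_nfloor_ln W2.
have [fw1 fw2] := @nfloor_bounds W ltac:(lra).
set w := nfloor W in lw1 lw2 hw fw1 fw2.
rewrite ln_exp in lw1 lw2.
have yw : (y <= w)%N.
  apply: INR_leq; apply: Rlt_le; apply: ln_lt_inv; [apply: INR_gt0; lia | apply: INR_gt0; lia|].
  by nra.
set c := (1 - / L) * (1 - 2 * / L).
have iL : 0 < / L <= / 100 by split; [apply: Rinv_0_lt_compat; lra | apply: Rinv_le_contravar; lra].
have iLL : L * / L = 1 by rewrite Rinv_r; lra.
have c0 : 0 <= c by rewrite /c; nra.
have hp n : (y < n <= w)%N -> prime n -> c * (/ (a * a) * / (INR n * ln (INR n))) <= mu a n.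
  move=> /andP [h1 h2] pn.
  have p2 := INR_prime_ge2 pn; have lp := ln_prime_gt0 pn.
  have pY : Y <= INR n by have := leq_INR h1; rewrite S_INR; lra.
  have pa : L <= INR n * a.
    have : Y * a <= INR n * a by apply: Rmult_le_compat_r; lra.
    by rewrite /Y; have -> : L / a * a = L by field; lra.
  have lnp1 : 1 <= ln (INR n).
    have : ln Y <= ln (INR n) by apply: ln_le; lra.
    lra.
  have lnp2 : ln (INR n) <= L * L.
    have : ln (INR n) <= ln (INR w) by apply: ln_le; [lra | apply: leq_INR].
    lra.
  have := @mu_ge a n a0 pn L ltac:(lra) ltac:(nra) ltac:(nra).
  move=> h; apply: Rle_trans h; apply: Rmult_le_compat_r.
    left; apply: Rmult_lt_0_compat; apply: Rinv_0_lt_compat; nra.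
  have e1 : 1 - / L <= exp (- (a * ln (INR n))).
    have := exp_ge1p (- (a * ln (INR n))).
    have : a * ln (INR n) <= a * (L * L) by apply: Rmult_le_compat_l; lra.
    have : a * (L * L) <= / L.
      apply: (Rmult_le_reg_r L); first lra.
      by rewrite Rinv_l; [rewrite /= in aL3; lra | lra].
    lra.
  have e2 : 1 - 2 * / L <= / ((1 + / L) * (1 + / L)).
    apply: (Rmult_le_reg_r ((1 + / L) * (1 + / L))); first by nra.
    by rewrite Rinv_l; nra.
  by apply: Rmult_le_compat; lra.
rewrite G_gterm //.
apply: is_lim_seq_ge_const (Series_rsum (ex_series_gterm a0)); exists w.+1 => N hN.
apply: (@Rle_trans _ (\rsum_(y.+1 <= n < w.+1) gterm a n)); last first.
  by apply: rsum_sub_range => // i; exact: gterm_ge0.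
apply: (@Rle_trans _ (c * / (a * a) * \rsum_(y.+1 <= n < w.+1) plog n)); last first.
  rewrite rsumM; apply: rsum_nat_le => i /andP [h1 h2].
  rewrite /plog /gterm; case: ifP => pi; last lra.
  by rewrite Rmult_assoc; apply: hp => //; lia.
have := prime_sum_inv_log hy yw.
rewrite -rsum_plog => /Rabs_le_between [h _].
set S := \rsum_(y.+1 <= n < w.+1) plog n in h *.
have ly0 : L <= ln (INR y) <= L + 2 * s by lra.
have h1 : / (L + 2 * s) <= / ln (INR y) by apply: Rinv_le_contravar; lra.
have h2 : / ln (INR w) <= 2 * / (L * L).
  have -> : 2 * / (L * L) = / (L * L / 2) by field; lra.
  by apply: Rinv_le_contravar; nra.
have h3 : 20 / ln (INR y) ^ 2 <= 20 * / (L * L).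
  apply: Rmult_le_compat_l; first lra.
  by apply: Rinv_le_contravar; nra.
have hS : / (L + 2 * s) - 22 * / (L * L) <= S by lra.
apply: divr_le; first by nra.
have -> : c * / (a * a) * S * (a * a * L) = c * (L * S) by field; lra.
have g1 : 1 - 2 / s - 22 * / L <= L * S.
  have : L * (/ (L + 2 * s) - 22 * / (L * L)) <= L * S by apply: Rmult_le_compat_l; lra.
  have -> : L * (/ (L + 2 * s) - 22 * / (L * L)) = 1 - 2 * s / (L + 2 * s) - 22 * / L by field; nra.
  have : 2 * s / (L + 2 * s) <= 2 / s.
    apply: divr_le; first nra.
    have -> : 2 / s * (L + 2 * s) = 2 * s + 4 by rewrite -ss; field; lra.
    lra.
  lra.
have is1 : / L <= / s by apply: Rinv_le_contravar; nra.
have is0 : 0 < / s <= / 10 by split; [apply: Rinv_0_lt_compat; lra | apply: Rinv_le_contravar; lra].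
have g2 : 1 - 3 * / L <= c by rewrite /c; nra.
case: (Rle_lt_dec (1 - 27 / s) 0) => hs.
  apply: Rle_trans hs _; apply: Rmult_le_pos => //; apply: Rmult_le_pos; first lra.
  rewrite /S; apply: rsum_nat_ge0 => i _; exact: plog_ge0.
have : (1 - 3 * / L) * (1 - 2 / s - 22 * / L) <= c * (L * S).
  by rewrite /Rdiv in hs g1 *; apply: Rmult_le_compat; lra.
rewrite /Rdiv; nra.
Qed.

End Asymp.

Lemma G_exists v : 0 < v -> exists a, 0 < a /\ G a = v.
Proof.
move=> v0.
have [a1 [a10 h1]] : exists a1, 0 < a1 /\ v <= G a1.
  (* Then [sqrt L >= 100] keeps the factor in [G_lower] away from 0, and [exp L] exceeds [10 v]. *)
  pose L := 10000 + 10 * v.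
  exists (exp (- L)); split; first exact: exp_pos.
  have eL : - ln (exp (- L)) = L by rewrite ln_exp; ring.
  have := @G_lower (exp (- L)) (exp_pos _) ltac:(rewrite eL /L; lra).
  rewrite eL => h; apply: Rle_trans h.
  have s100 : 100 <= sqrt L.
    have -> : 100 = sqrt (100 * 100) by rewrite sqrt_square; lra.
    by apply: sqrt_le_1_alt; rewrite /L; lra.
  have : 27 / sqrt L <= 27 / 100.
    by apply: Rmult_le_compat_l; [lra | apply: Rinv_le_contravar; lra].
  have e0 := exp_pos (- L); have L0 : 0 < L by rewrite /L; lra.
  have e1 : exp (- L) * exp L = 1 by rewrite -exp_plus Rplus_opp_l exp_0.
  have e2 : exp (- L) * (1 + L) <= 1 by have := exp_ge1p L; nra.
  move=> h; apply: le_divr; first by apply: Rmult_lt_0_compat => //; apply: Rmult_lt_0_compat.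
  have e3 : exp (- L) * (10 * v) <= 1.
    by apply: Rle_trans e2; apply: Rmult_le_compat_l; [lra | rewrite /L; lra].
  have e4 : exp (- L) * L <= 1 by nra.
  have -> : v * (exp (- L) * exp (- L) * L) = (exp (- L) * v) * (exp (- L) * L) by ring.
  have : 0 <= exp (- L) * v by nra.
  nra.
have [a2 [a20 h2]] : exists a2, 0 < a2 /\ G a2 <= v.
  exists (83 / v + 1); have t : 0 < 83 / v by apply: Rdiv_lt_0_compat; lra.
  split; first lra.
  apply: Rle_trans (@G_le (83 / v + 1) ltac:(lra)) _.
  apply: divr_le; first nra.
  have -> : v * ((83 / v + 1) * (83 / v + 1)) = 83 * (83 / v) + 166 + v by field; lra.
  lra.
(* The intermediate value theorem in the variable [ln a], which keeps the solution positive. *)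
have [z [_ hz]] : {x : R | Rmin (ln a1) (ln a2) <= x <= Rmax (ln a1) (ln a2) /\ (fun y => G (exp y)) x = v}.
  apply: IVT_gen.
    move=> y; apply continuity_pt_filterlim.
    apply: (continuous_comp exp G); last exact: continuous_G (exp_pos _).
    by apply: ex_derive_continuous; auto_derive.
  rewrite !exp_ln //; split; [apply: Rle_trans (Rmin_r _ _) h2 | apply: Rle_trans h1 (Rmax_l _ _)].
by exists (exp z); split; [exact: exp_pos |].
Qed.

(** * Trigonometric inequalities *)

Lemma sin_le_x x : 0 <= x -> sin x <= x.
Proof. by move=> [h|<-]; [left; exact: sin_lt_x | rewrite sin_0; lra]. Qed.

Lemma Rabs_sin_le x : Rabs (sin x) <= Rabs x.
Proof.
have H y : 0 <= y -> Rabs (sin y) <= y.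
  move=> hy; apply: Rabs_le; split; last exact: sin_le_x.
  case: (Rle_lt_dec y PI) => h; first by have := sin_ge_0 y hy h; lra.
  by have := SIN_bound y; have := PI2_1; lra.
case: (Rle_lt_dec 0 x) => h; first by rewrite (Rabs_pos_eq x) //; exact: H.
rewrite (Rabs_left x) // -(Rabs_Ropp (sin x)) -sin_neg; apply: H; lra.
Qed.

Lemma one_sub_cos x : 1 - cos x = 2 * (sin (x / 2) * sin (x / 2)).
Proof.
have -> : cos x = cos (2 * (x / 2)) by congr cos; field.
by rewrite cos_2a_sin; ring.
Qed.

Lemma one_sub_cos_le x : 0 <= 1 - cos x <= x * x / 2.
Proof.
split; first by have := COS_bound x; lra.
rewrite one_sub_cos; have h := Rabs_sin_le (x / 2).
have e1 : sin (x / 2) * sin (x / 2) = Rabs (sin (x / 2)) * Rabs (sin (x / 2)).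
  by rewrite -Rabs_mult Rabs_pos_eq //; exact: Rle_0_sqr.
have e2 : x / 2 * (x / 2) = Rabs (x / 2) * Rabs (x / 2).
  by rewrite -Rabs_mult Rabs_pos_eq //; exact: Rle_0_sqr.
have := Rabs_pos (sin (x / 2)); rewrite e1; nra.
Qed.

Lemma sin_ge_cubic x : 0 <= x -> x - x ^ 3 / 6 <= sin x.
Proof.
move=> [hx|<-]; last by rewrite sin_0 /=; lra.
pose f y := sin y - y + y * y * y / 6.
have [c [hc1 hc2]] : exists c, f x - f 0 = (cos c - 1 + c * c / 2) * (x - 0) /\ 0 <= c <= x.
  have := MVT_gen f 0 x (fun c => cos c - 1 + c * c / 2).
  rewrite Rmin_left ?Rmax_right; [|lra|lra].
  case.
  - move=> c _; rewrite /f; auto_derive => //; field.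
  - move=> c _; rewrite /f; apply continuity_pt_filterlim.
    by apply: (@ex_derive_continuous _ _ (fun y => sin y - y + y * y * y / 6)); auto_derive.
  - by move=> c [h1 h2]; exists c.
have f0 : f 0 = 0 by rewrite /f sin_0; lra.
have := one_sub_cos_le c => h.
have : 0 <= (cos c - 1 + c * c / 2) * (x - 0) by apply: Rmult_le_pos; lra.
rewrite -hc1 f0 /f /=; lra.
Qed.

Lemma one_sub_cos_ge x : 0 <= x <= 1 -> x * x / 4 <= 1 - cos x.
Proof.
move=> h; rewrite one_sub_cos.
have := @sin_ge_cubic (x / 2) ltac:(lra); set z := x / 2 => h1.
have -> : x * x / 4 = z * z by rewrite /z; field.
have hz : 0 <= z <= 1 / 2 by rewrite /z; lra.
have : 3 / 4 * z <= sin z by apply: Rle_trans h1; rewrite /=; nra.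
nra.
Qed.

(** * The characteristic function *)

Definition cis (x : R) : C := (cos x, sin x).

Lemma Cmod_cis x : Cmod (cis x) = 1.
Proof.
rewrite /Cmod /cis [fst _]/= [snd _]/=.
have -> : cos x ^ 2 + sin x ^ 2 = 1 by have := sin2_cos2 x; rewrite /Rsqr; lra.
exact: sqrt_1.
Qed.

Lemma cis_add x y : cis (x + y) = (cis x * cis y)%C.
Proof. by rewrite /cis /Cmult /= cos_plus sin_plus; congr (_, _); ring. Qed.

Lemma cis0 : cis 0 = RtoC 1.
Proof. by rewrite /cis cos_0 sin_0. Qed.

Section PrimeFactor.
Variables (a t : R) (n : nat).
Hypothesis a0 : 0 < a.
Hypothesis t0 : 0 <= t.
Hypothesis pn : prime n.
Let x := t * ln (INR n).
Let c := cos x.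
Let q := qp a n.
Let r := rho a n.
Let l := lam a n.

(* [phip] is the characteristic function of [(logn p m) * ln p] at [t]: with [z = exp (i x)]
   it equals [1 - q + q (1 - r) z / (1 - r z)], and [pden = |1 - r z| ^ 2]. *)
Definition pden := (1 - r) * (1 - r) + 2 * r * (1 - c).
Definition gre := (1 - r) * (c - r) / pden.
Definition gim := (1 - r) * sin x / pden.
Definition phip : C := (1 - q + q * gre, q * gim).

Lemma pden_gt0 : 0 < pden.
Proof.
have [r0 r1] := rho_bounds a0 pn; rewrite /pden -/r in r0 r1 *.
have := one_sub_cos_le x; rewrite -/c; nra.
Qed.

(** Identifies the probabilistic local factor with the normalised Euler factor; the link is
    [(1 - q) / (p + 1) = q (1 - r) / r]. *)
Lemma phip_cfac :
  phip = (RtoC (1 - q) * (1 + RtoC (/ (INR n + 1)) *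
    ((RtoC r * cis x) / (1 - RtoC r * cis x))))%C.
Proof.
have [r0 r1] := rho_bounds a0 pn; have hp := pden_gt0.
have h2 := INR_prime_ge2 pn; have hu := pow_sub1_gt0 a0 pn.
have hur := rho_mul a n.
have [q0 q1] := qp_bounds a0 pn.
have nz : (1 - RtoC r * cis x)%C <> RtoC 0.
  move=> h; have : Cmod (RtoC r * cis x)%C = 1.
    have -> : (RtoC r * cis x = RtoC 1)%C by rewrite -[LHS]Cplus_0_r -h; ring.
    by rewrite Cmod_1.
  by rewrite Cmod_mult Cmod_cis Cmod_R Rabs_pos_eq; rewrite /r; lra.
have e1 : (1 - q) / (INR n + 1) = q * (1 - r) / r.
  rewrite /q /qp; set u := Rpower (INR n) a in hu hur *.
  have -> : r = / u by rewrite /r; apply: (Rmult_eq_reg_l u); [rewrite hur Rinv_r; lra | lra].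
  by field; repeat split; nra.
pose z0 : C := (r * (c - r) / pden, r * sin x / pden).
have e2 : (RtoC r * cis x / (1 - RtoC r * cis x) = z0)%C.
  suff h : (z0 * (1 - RtoC r * cis x) = RtoC r * cis x)%C.
    by transitivity (z0 * (1 - RtoC r * cis x) / (1 - RtoC r * cis x))%C; [rewrite h | field].
  have sc := sin2_cos2 x; rewrite /Rsqr -/c in sc.
  have ep : pden = 1 - 2 * r * c + r * r by rewrite /pden; ring.
  have ss : sin x * sin x = 1 - c * c by lra.
  rewrite /z0 /Cmult /Cminus /Cplus /Copp /RtoC /cis /= -/c; congr (_, _).
    have -> : r * (c - r) / pden * (1 + - (r * c - 0 * sin x)) - r * sin x / pden * (0 + - (r * sin x + 0 * c))
      = r * ((c - r) * (1 - r * c) + r * (sin x * sin x)) / pden by field; lra.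
    by rewrite ss ep; field; rewrite -ep; lra.
  have -> : r * (c - r) / pden * (0 + - (r * sin x + 0 * c)) + r * sin x / pden * (1 + - (r * c - 0 * sin x))
      = r * sin x * (1 - 2 * r * c + r * r) / pden by field; lra.
  by rewrite -ep; field; lra.
rewrite e2 /phip /gre /gim.
pose z1 : C := (1 - q + (1 - q) / (INR n + 1) * (r * (c - r) / pden), (1 - q) / (INR n + 1) * (r * sin x / pden)).
have -> : (RtoC (1 - q) * (1 + RtoC (/ (INR n + 1)) * z0) = z1)%C.
  by rewrite /z0 /z1 /Cmult /Cplus /RtoC /=; congr (_, _); field; repeat split; lra.
by rewrite /z1 e1; congr (_, _); field; rewrite /r; lra.
Qed.

Lemma phip_mod2 : (Cmod phip) ^ 2 = 1 - 2 * q * (1 - c) * (1 + r - q) / pden.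
Proof.
have hp := pden_gt0.
rewrite Cmod2_alt /phip /Re /Im /= /gre /gim.
have ep : pden = 1 - 2 * r * c + r * r by rewrite /pden; ring.
have sc := sin2_cos2 x; rewrite /Rsqr -/c in sc.
have ss : sin x * sin x = 1 - c * c by lra.
have -> : (1 - q + q * ((1 - r) * (c - r) / pden)) * ((1 - q + q * ((1 - r) * (c - r) / pden)) * 1) +
 q * ((1 - r) * sin x / pden) * (q * ((1 - r) * sin x / pden) * 1) =
 ((1 - q) * (1 - q) * pden + 2 * (1 - q) * q * ((1 - r) * (c - r))
   + q * q * (1 - r) * (1 - r) * ((c - r) * (c - r) + sin x * sin x) / pden) / pden by field; lra.
rewrite ss.
have -> : (c - r) * (c - r) + (1 - c * c) = pden by rewrite ep; ring.
have -> : q * q * (1 - r) * (1 - r) * pden / pden = q * q * (1 - r) * (1 - r) by field; lra.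
have -> : (1 - q) * (1 - q) * pden + 2 * (1 - q) * q * ((1 - r) * (c - r)) + q * q * (1 - r) * (1 - r)
  = pden - 2 * q * (1 - c) * (1 + r - q) by rewrite ep; ring.
by field; lra.
Qed.

(** A lower bound for 1 minus the squared modulus in [phip_mod2], obtained from [1 + r - q >= r].
    Sums of it over primes measure the decay of the characteristic function. *)
Definition egain := 2 * q * (1 - c) * r / pden.

Lemma egain_bounds : 0 <= egain <= 1.
Proof.
have hp := pden_gt0; have [q0 q1] := qp_bounds a0 pn; have [r0 r1] := rho_bounds a0 pn.
have hc := one_sub_cos_le x; rewrite -/c -/q -/r in hc q0 q1 r0 r1.
rewrite /egain; split.
  by apply: Rdiv_le_0_compat => //; apply: Rmult_le_pos; nra.
apply: divr_le => //; rewrite /pden.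
have : 0 <= 2 * r * (1 - c) by nra.
nra.
Qed.

Lemma Cmod_phip_le : Cmod phip <= exp (- egain / 2).
Proof.
have hp := pden_gt0; have [q0 q1] := qp_bounds a0 pn; have [r0 r1] := rho_bounds a0 pn.
have hc := one_sub_cos_le x; rewrite -/c -/q -/r in hc q0 q1 r0 r1.
have h := phip_mod2.
have h2 : (Cmod phip) ^ 2 <= 1 - egain.
  rewrite h /egain.
  suff : 2 * q * (1 - c) * r / pden <= 2 * q * (1 - c) * (1 + r - q) / pden by lra.
  apply: Rmult_le_compat_r; first by left; apply: Rinv_0_lt_compat.
  by apply: Rmult_le_compat_l; [nra | lra].
have h3 := exp_ge1p (- egain).
have e : exp (- egain) = exp (- egain / 2) * exp (- egain / 2) by rewrite -exp_plus; congr exp; field.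
have := exp_pos (- egain / 2); have := Cmod_ge_0 phip; nra.
Qed.

Let X := l * x.
Let th := q * X.

(** Rotation by the mean phase [th = t * mu a n], which cancels the term linear in [t]. *)
Definition aphp : C := (phip * cis (- th))%C.

Lemma x_ge0 : 0 <= x.
Proof. by apply: Rmult_le_pos => //; exact: Rlt_le (ln_prime_gt0 pn). Qed.

Lemma X_ge : 0 <= x <= X.
Proof.
have hx := x_ge0; have hl := lam_ge1 a0 pn; rewrite -/l in hl.
by rewrite /X; nra.
Qed.

Lemma gre_bounds : 0 <= 1 - gre <= X * X.
Proof.
have hp := pden_gt0; have [r0 r1] := rho_bounds a0 pn.
have hc := one_sub_cos_le x; rewrite -/c -/r in hc r0 r1.
have e : 1 - gre = (1 - c) * (1 + r) / pden.
  by rewrite /gre; apply: (Rmult_eq_reg_r pden); [rewrite /pden; field; rewrite -/pden; lra | lra].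
rewrite e; split; first by apply: Rdiv_le_0_compat => //; nra.
apply: divr_le => //.
have l1 : l * (1 - r) = 1 by rewrite /l /lam -/r Rinv_l; lra.
have -> : X * X * pden = x * x * ((l * (1 - r)) * (l * (1 - r)) + 2 * r * (1 - c) * l * l) by rewrite /X /pden; ring.
rewrite l1.
have : 0 <= 2 * r * (1 - c) * l * l.
  have -> : 2 * r * (1 - c) * l * l = 2 * r * (1 - c) * (l * l) by ring.
  by apply: Rmult_le_pos; [nra | exact: Rle_0_sqr].
have := Rle_0_sqr x; rewrite /Rsqr; nra.
Qed.

(** One has [gim = l sin x / (1 + y)] with [0 <= y <= X^2]. The constant is 1/6 from the sine plus 1
    from the denominator. *)
Lemma gim_bounds : Rabs gim <= X /\ Rabs (gim - X) <= 7 / 6 * X ^ 3.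
Proof.
have hp := pden_gt0; have [r0 r1] := rho_bounds a0 pn.
have hc := one_sub_cos_le x; rewrite -/c -/r in hc r0 r1.
have l1 : l * (1 - r) = 1 by rewrite /l /lam -/r Rinv_l; lra.
have hl := lam_ge1 a0 pn; rewrite -/l in hl.
have [x0 xX] := X_ge.
pose y := 2 * r * (1 - c) * (l * l).
have y0 : 0 <= y by apply: Rmult_le_pos; [nra | exact: Rle_0_sqr].
have yX : y <= X * X.
  have -> : X * X = x * x * (l * l) by rewrite /X; ring.
  by apply: Rmult_le_compat_r; [exact: Rle_0_sqr | nra].
have e : gim = l * sin x / (1 + y).
  have -> : 1 + y = pden * (l * l).
    have -> : pden * (l * l) = (l * (1 - r)) * (l * (1 - r)) + 2 * r * (1 - c) * (l * l) by rewrite /pden; ring.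
    by rewrite l1 /y; ring.
  rewrite /gim -[1 - r]Rmult_1_l; have -> : 1 * (1 - r) = / l by rewrite /l /lam -/r Rinv_inv; ring.
  by field; lra.
have s1 := Rabs_sin_le x; rewrite (Rabs_pos_eq x) // in s1.
have s2 := sin_ge_cubic x0; have s3 := sin_le_x x0.
have iy : 0 < / (1 + y) <= 1.
  by split; [apply: Rinv_0_lt_compat; lra | rewrite -Rinv_1; apply: Rinv_le_contravar; lra].
split.
  rewrite e /Rdiv Rabs_mult Rabs_mult (Rabs_pos_eq l) ?(Rabs_pos_eq (/ (1 + y))); [|lra|lra].
  have : l * Rabs (sin x) <= X by rewrite /X; apply: Rmult_le_compat_l; lra.
  have := Rabs_pos (sin x); nra.
have -> : gim - X = - (l * (x - sin x) + l * sin x * (y * / (1 + y))).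
  by rewrite e /X; field; lra.
rewrite Rabs_Ropp; apply: Rle_trans (Rabs_triang _ _) _.
have b1 : Rabs (l * (x - sin x)) <= X ^ 3 / 6.
  rewrite Rabs_pos_eq; last by nra.
  apply: (@Rle_trans _ (l * (x ^ 3 / 6))); first by apply: Rmult_le_compat_l; lra.
  have -> : X ^ 3 / 6 = l * l * l * (x ^ 3 / 6) by rewrite /X; field.
  apply: Rmult_le_compat_r; last by nra.
  by have := pow_le x 3 x0; lra.
have b2 : Rabs (l * sin x * (y * / (1 + y))) <= X ^ 3.
  rewrite Rabs_mult.
  have -> : X ^ 3 = X * (X * X) by ring.
  apply: Rmult_le_compat; try exact: Rabs_pos.
    rewrite Rabs_mult (Rabs_pos_eq l); last lra.
    by rewrite /X; apply: Rmult_le_compat_l; lra.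
  rewrite Rabs_pos_eq; last by apply: Rmult_le_pos; lra.
  by nra.
lra.
Qed.

Lemma th_bounds : 0 <= th <= X /\ th * th <= q * (X * X) /\ th ^ 3 <= q * X ^ 3.
Proof.
have [q0 q1] := qp_bounds a0 pn; have [x0 xX] := X_ge; rewrite -/q in q0 q1.
have X0 : 0 <= X by lra.
have h1 : 0 <= th <= X by rewrite /th; nra.
split=> //; split.
  by rewrite /th; have := Rle_0_sqr X; rewrite /Rsqr; nra.
have -> : th ^ 3 = q * q * q * X ^ 3 by rewrite /th; ring.
have := pow_le X 3 X0 => h; apply: Rmult_le_compat_r => //; nra.
Qed.

(** The linear parts of [q * gim] and of [sin th] cancel. The factor [q] must survive in every
    remainder, since only it makes the bound summable over primes. *)
Lemma aphp_im : Rabs (snd aphp) <= 3 * q * X ^ 3.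
Proof.
have [q0 q1] := qp_bounds a0 pn; rewrite -/q in q0 q1.
have [x0 xX] := X_ge; have [g1 g2] := gre_bounds; have [m1 m2] := gim_bounds.
have [[th0 thX] [th2 th3]] := th_bounds.
have X0 : 0 <= X by lra.
have X3 := pow_le X 3 X0.
have s2 := sin_ge_cubic th0; have s3 := sin_le_x th0.
have hc := one_sub_cos_le th.
rewrite /aphp /phip /cis /Cmult /= cos_neg sin_neg.
have -> : (1 - q + q * gre) * - sin th + q * gim * cos th =
  (th - sin th) + (q * ((gim - X) - gim * (1 - cos th)) + q * (1 - gre) * sin th).
  by rewrite /th; ring.
apply: Rle_trans (Rabs_triang _ _) _.
have b1 : Rabs (th - sin th) <= q * X ^ 3 / 6 by rewrite Rabs_pos_eq; lra.
have b2 : Rabs (q * ((gim - X) - gim * (1 - cos th))) <= q * (7 / 6 * X ^ 3 + X ^ 3 / 2).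
  rewrite Rabs_mult (Rabs_pos_eq q); last lra.
  apply: Rmult_le_compat_l; first lra.
  apply: Rle_trans (Rabs_triang _ _) _; rewrite Rabs_Ropp.
  apply: Rplus_le_compat => //.
  rewrite Rabs_mult (Rabs_pos_eq (1 - cos th)); last lra.
  have -> : X ^ 3 / 2 = X * (X * X / 2) by rewrite /=; field.
  apply: Rmult_le_compat => //; [exact: Rabs_pos | lra | nra].
have b3 : Rabs (q * (1 - gre) * sin th) <= q * X ^ 3.
  rewrite !Rabs_mult (Rabs_pos_eq q) ?(Rabs_pos_eq (1 - gre)); [|lra|lra].
  have s1 := Rabs_sin_le th; rewrite (Rabs_pos_eq th) // in s1.
  have -> : q * X ^ 3 = q * (X * X) * X by ring.
  apply: Rmult_le_compat; [by apply: Rmult_le_pos; lra | exact: Rabs_pos | by apply: Rmult_le_compat_l; lra | lra].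
have := Rabs_triang (q * ((gim - X) - gim * (1 - cos th))) (q * (1 - gre) * sin th).
nra.
Qed.

Lemma aphp_re : 1 - 3 * q * (X * X) <= fst aphp.
Proof.
have [q0 q1] := qp_bounds a0 pn; rewrite -/q in q0 q1.
have [x0 xX] := X_ge; have [g1 g2] := gre_bounds; have [m1 m2] := gim_bounds.
have [[th0 thX] [th2 th3]] := th_bounds.
have hc := one_sub_cos_le th; have cb := COS_bound th.
rewrite /aphp /phip /cis /Cmult /= cos_neg sin_neg.
have -> : (1 - q + q * gre) * cos th - q * gim * - sin th =
  cos th - q * (1 - gre) * cos th + q * gim * sin th by ring.
have b1 : q * (1 - gre) * cos th <= q * (X * X).
  have : q * (1 - gre) <= q * (X * X) by apply: Rmult_le_compat_l; lra.
  have : 0 <= q * (1 - gre) by apply: Rmult_le_pos; lra.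
  nra.
have b2 : - (q * (X * X)) <= q * gim * sin th.
  have : Rabs (q * gim * sin th) <= q * (X * X).
    rewrite Rabs_mult (Rabs_mult q) (Rabs_pos_eq q); last lra.
    have s1 := Rabs_sin_le th; rewrite (Rabs_pos_eq th) // in s1.
    rewrite Rmult_assoc; apply: Rmult_le_compat_l; first lra.
    by apply: Rmult_le_compat; [exact: Rabs_pos | exact: Rabs_pos | lra | lra].
  by move/Rabs_le_between; lra.
lra.
Qed.

Lemma Cmod_aphp : Cmod aphp = Cmod phip.
Proof. by rewrite /aphp Cmod_mult Cmod_cis Rmult_1_r. Qed.

(** For small primes [1 - q] and [1 - r] are both tiny, so one factor can save a power of [a], far
    beyond what [egain <= 1] allows. The case [c = 1] would divide by 0. *)
Lemma Cmod_phip_small : Cmod phip <= (1 - q) + (1 - r) / sqrt (2 * r * (1 - c)) \/ c = 1.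
Proof.
have hp := pden_gt0; have [q0 q1] := qp_bounds a0 pn; have [r0 r1] := rho_bounds a0 pn.
have hc := one_sub_cos_le x; rewrite -/c -/q -/r in hc q0 q1 r0 r1.
case: (Req_dec c 1) => c1; [by right | left].
have z0 : 0 < 2 * r * (1 - c) by apply: Rmult_lt_0_compat; lra.
have -> : phip = (RtoC (1 - q) + RtoC q * (gre, gim))%C.
  by rewrite /phip /Cplus /Cmult /RtoC /=; congr (_, _); ring.
apply: Rle_trans (Cmod_triangle _ _) _.
rewrite Cmod_mult !Cmod_R !Rabs_pos_eq; [|lra|lra]; apply: Rplus_le_compat_l.
apply: (@Rle_trans _ (Cmod (gre, gim))).
  by have := Cmod_ge_0 (gre, gim); nra.
have ep : pden = 1 - 2 * r * c + r * r by rewrite /pden; ring.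
have sc := sin2_cos2 x; rewrite /Rsqr -/c in sc.
have -> : Cmod (gre, gim) = (1 - r) / sqrt pden.
  rewrite /Cmod /= /gre /gim.
  have -> : (1 - r) * (c - r) / pden * ((1 - r) * (c - r) / pden * 1) +
     (1 - r) * sin x / pden * ((1 - r) * sin x / pden * 1) = (1 - r) * (1 - r) / pden.
    have -> : (1 - r) * (c - r) / pden * ((1 - r) * (c - r) / pden * 1) +
     (1 - r) * sin x / pden * ((1 - r) * sin x / pden * 1) =
     (1 - r) * (1 - r) * ((sin x * sin x + c * c) - 2 * r * c + r * r) / pden / pden by field; lra.
    by rewrite sc -ep; field; lra.
  by rewrite sqrt_div_alt // sqrt_square; lra.
apply: Rmult_le_compat_l; first lra.
apply: Rinv_le_contravar; first exact: sqrt_lt_R0.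
apply: sqrt_le_1_alt; rewrite /pden; nra.
Qed.

End PrimeFactor.

(** * Limits of complex sequences *)

Definition Clim (z : nat -> C) (l : C) :=
  forall eps, 0 < eps -> exists K, forall k, (K <= k)%N -> Cmod (z k - l)%C <= eps.

Lemma Clim_ext z z' l : (forall k, z k = z' k) -> Clim z l -> Clim z' l.
Proof. by move=> h hz eps /hz [K hK]; exists K => k /hK; rewrite h. Qed.

Lemma Clim_mult z z' l l' : Clim z l -> Clim z' l' ->
  Clim (fun k => (z k * z' k)%C) (l * l')%C.
Proof.
move=> hz hz' eps he.
have c1 := Cmod_ge_0 l; have c2 := Cmod_ge_0 l'.
set d := Rmin 1 (eps / (Cmod l + Cmod l' + 1)).
have hd : 0 < d by apply: Rmin_glb_lt; [lra | apply: Rdiv_lt_0_compat; lra].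
have d1 : d <= 1 by apply: Rmin_l.
have d2 : d * (Cmod l + Cmod l' + 1) <= eps.
  have h : d <= eps / (Cmod l + Cmod l' + 1) by apply: Rmin_r.
  apply: Rle_trans (Rmult_le_compat_r _ _ _ _ h) _; first lra.
  by right; field; lra.
have [K hK] := hz d hd; have [K' hK'] := hz' d hd.
exists (maxn K K') => k; rewrite geq_max => /andP [/hK h1 /hK' h2].
have -> : (z k * z' k - l * l' = (z k - l) * (z' k - l') + ((z k - l) * l' + l * (z' k - l')))%C by ring.
apply: Rle_trans (Cmod_triangle _ _) _.
have := Cmod_triangle ((z k - l) * l')%C (l * (z' k - l'))%C.
rewrite !Cmod_mult.
have := Cmod_ge_0 (z k - l)%C; have := Cmod_ge_0 (z' k - l')%C; nra.
Qed.

Lemma Clim_RtoC (u : nat -> R) (l : R) : is_lim_seq u l -> Clim (fun k => RtoC (u k)) (RtoC l).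
Proof.
move=> /is_lim_seq_spec h eps he; have [K hK] := h (mkposreal _ he).
exists K => k hk; rewrite -RtoC_minus Cmod_R; left; apply: hK; lia.
Qed.

Lemma Clim_fst z l : Clim z l -> is_lim_seq (fun k => fst (z k)) (fst l).
Proof.
move=> h; apply/is_lim_seq_spec => eps.
have e2 : 0 < eps / 2 by have := cond_pos eps; lra.
have [K hK] := h _ e2; exists K => k hk.
have : (K <= k)%N by lia.
move/hK; have := Rabs_fst_Cmod (z k - l)%C.
rewrite [fst _]/= -/(Rminus _ _); have := cond_pos eps; lra.
Qed.

Lemma Clim_snd z l : Clim z l -> is_lim_seq (fun k => snd (z k)) (snd l).
Proof.
move=> h; apply/is_lim_seq_spec => eps.
have e2 : 0 < eps / 2 by have := cond_pos eps; lra.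
have [K hK] := h _ e2; exists K => k hk.
have : (K <= k)%N by lia.
move/hK; have := Rabs_snd_Cmod (z k - l)%C.
rewrite [snd _]/= -/(Rminus _ _); have := cond_pos eps; lra.
Qed.

Lemma Clim_Cmod_le z l B : Clim z l -> (exists K, forall k, (K <= k)%N -> Cmod (z k) <= B) -> Cmod l <= B.
Proof.
move=> h [K hK]; apply: Rnot_lt_le => hB.
have e : 0 < (Cmod l - B) / 2 by lra.
have [K' hK'] := h _ e.
have h1 := hK (maxn K K') (leq_maxl _ _); have h2 := hK' (maxn K K') (leq_maxr _ _).
set w := z _ in h1 h2.
have := Cmod_triangle w (- (w - l))%C; rewrite Cmod_opp.
have -> : (w + - (w - l) = l)%C by ring.
lra.
Qed.

Lemma Rabs_cos_sub x y : Rabs (cos x - cos y) <= Rabs (x - y).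
Proof.
have -> : cos x - cos y = - 2 * (sin ((x + y) / 2) * sin ((x - y) / 2)).
  have -> : cos x = cos ((x + y) / 2 + (x - y) / 2) by congr cos; field.
  have -> : cos y = cos ((x + y) / 2 - (x - y) / 2) by congr cos; field.
  by rewrite cos_plus cos_minus; ring.
rewrite !Rabs_mult; have -> : Rabs (- 2) = 2 by rewrite Rabs_left; lra.
have h := Rabs_sin_le ((x - y) / 2); have h2 := SIN_bound ((x + y) / 2).
have h3 : Rabs (sin ((x + y) / 2)) <= 1 by apply: Rabs_le; lra.
have e : Rabs ((x - y) / 2) = Rabs (x - y) / 2.
  by rewrite /Rdiv Rabs_mult (Rabs_pos_eq (/ 2)); lra.
have := Rabs_pos (sin ((x - y) / 2)); have := Rabs_pos (sin ((x + y) / 2)); nra.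
Qed.

Lemma Rabs_sin_sub x y : Rabs (sin x - sin y) <= Rabs (x - y).
Proof.
have := Rabs_cos_sub (PI / 2 - x) (PI / 2 - y); rewrite !cos_shift.
have -> : PI / 2 - x - (PI / 2 - y) = - (x - y) by ring.
by rewrite Rabs_Ropp.
Qed.

Lemma Clim_cis (u : nat -> R) (l : R) : is_lim_seq u l -> Clim (fun k => cis (u k)) (cis l).
Proof.
move=> /is_lim_seq_spec h eps he.
have e2 : 0 < eps / 2 by lra.
have [K hK] := h (mkposreal _ e2).
exists K => k hk; have : (K <= k)%coq_nat by lia.
move/hK => /= h1.
have -> : (cis (u k) - cis l)%C = (RtoC (cos (u k) - cos l) + Ci * RtoC (sin (u k) - sin l))%C.
  by rewrite /cis /Cminus /Cplus /Copp /Cmult /Ci /RtoC /=; congr (_, _); ring.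
apply: Rle_trans (Cmod_triangle _ _) _; rewrite Cmod_mult !Cmod_R.
have -> : Cmod Ci = 1 by rewrite /Cmod /Ci [fst _]/= [snd _]/= -[RHS]sqrt_1; congr sqrt; ring.
have := Rabs_cos_sub (u k) l; have := Rabs_sin_sub (u k) l; lra.
Qed.

(** * The Dirichlet series of [1 / psi], the law [P] and its characteristic function *)

Definition hb (p : nat) : R := / (INR p + 1).
Definition hterm (a : R) (m : nat) : R :=
  if (0 < m)%N then pweight hb m * Rpower (INR m) (- a) else 0.
Definition Hs (a : R) : R := Series (hterm a).

Lemma hb_gt0 p : 0 < hb p.
Proof. by apply: Rinv_0_lt_compat; have := pos_INR p; lra. Qed.

Lemma INR_prod (s : seq nat) (f : nat -> nat) :
  INR (\prod_(p <- s) f p)%N = \rprod_(p <- s) INR (f p).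
Proof. by apply: (big_morph INR) => //; exact: mult_INR. Qed.

Lemma rprod_inv (s : seq nat) (f : nat -> R) : (forall p, 0 < f p) ->
  \rprod_(p <- s) / f p = / \rprod_(p <- s) f p.
Proof.
move=> h; elim: s => [|x s IH]; first by rewrite !big_nil Rinv_1.
by rewrite !big_cons IH Rinv_mult.
Qed.

Lemma pweight_psi m : pweight hb m = / INR (psi m).
Proof.
rewrite /psi INR_prod /pweight -rprod_inv; last by move=> p; apply: INR_gt0.
by apply: eq_bigr => p _; rewrite /hb S_INR.
Qed.

Lemma Rpower_INR_mul (x : R) (p m : nat) : (0 < p)%N -> (0 < m)%N ->
  Rpower (INR (p * m)) x = Rpower (INR p) x * Rpower (INR m) x.
Proof.
by move=> h1 h2; rewrite INR_muln /Rpower ln_mult ?Rmult_plus_distr_l ?exp_plus //; apply: INR_gt0.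
Qed.

Lemma Rpower_1l x : Rpower 1 x = 1.
Proof. by rewrite /Rpower ln_1 Rmult_0_r exp_0. Qed.

Section HDef.
Variable a : R.
Hypothesis a0 : 0 < a.

Lemma hterm_ge0 m : 0 <= hterm a m.
Proof.
rewrite /hterm; case: ifP => _; last lra.
apply: Rmult_le_pos; last by left; exact: exp_pos.
by apply: pweight_ge0 => p; have := hb_gt0 p; lra.
Qed.

Lemma efac_hb n : prime n -> 1 + hb n * (rho a n / (1 - rho a n)) = / (1 - qp a n).
Proof.
move=> pn; have [r0 r1] := rho_bounds a0 pn; have h2 := INR_prime_ge2 pn.
have hu := pow_sub1_gt0 a0 pn; have hur := rho_mul a n.
rewrite /hb /qp; set u := Rpower (INR n) a in hu hur *.
have -> : rho a n = / u by apply: (Rmult_eq_reg_l u); [rewrite hur Rinv_r; lra | lra].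
by field; repeat split; nra.
Qed.

Lemma efac_hb_le n : prime n -> hb n * (rho a n / (1 - rho a n)) <= / a * plog n.
Proof.
move=> pn; have h2 := INR_prime_ge2 pn; have lp := ln_prime_gt0 pn.
have hu := pow_sub1_gt0 a0 pn; have hur := rho_mul a n; have xp := alnp_gt0 a0 pn.
have hu2 : a * ln (INR n) <= Rpower (INR n) a - 1.
  by rewrite Rpower_alnp; have := exp_ge1p (a * ln (INR n)); lra.
rewrite /hb /plog pn; set u := Rpower (INR n) a in hu hur hu2 *.
have -> : rho a n = / u by apply: (Rmult_eq_reg_l u); [rewrite hur Rinv_r; lra | lra].
have -> : / (INR n + 1) * (/ u / (1 - / u)) = / ((INR n + 1) * (u - 1)) by field; repeat split; lra.
rewrite -Rinv_mult; apply: Rinv_le_contravar; first by nra.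
nra.
Qed.

(** [euler_upper] with each local factor at most [exp (plog n / a)]; this proves the convergence of
    [Hs]. *)
Lemma hsum_bound N : \rsum_(0 <= m < N) hterm a m <= exp (/ a * 83).
Proof.
case: N => [|N]; first by rewrite big_geq //; left; exact: exp_pos.
rewrite big_ltn // /hterm /= Rplus_0_l.
have -> : \rsum_(1 <= m < N.+1) (if (0 < m)%N then pweight hb m * Rpower (INR m) (- a) else 0) =
  \rsum_(1 <= m < N.+1) (pweight hb m * Rpower (INR m) (- a)).
  by apply: eq_big_seq => m; rewrite mem_index_iota => /andP [-> _].
apply: Rle_trans (@euler_upper hb (fun m => Rpower (INR m) (- a)) _ _ _ _ _ N.+1) _.
- by move=> p; have := hb_gt0 p; lra.
- by move=> m; left; exact: exp_pos.
- by rewrite INR1 Rpower_1l.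
- by move=> p m pp m0; apply: Rpower_INR_mul => //; exact: prime_gt0.
- by move=> p pp; have := rho_bounds a0 pp; rewrite /rho; lra.
apply: (@Rle_trans _ (exp (\rsum_(0 <= n < N.+1) (/ a * plog n)))).
  apply: rprod_le_exp => n _; rewrite /efac; case: ifP => pn; last first.
    by rewrite /plog pn Rmult_0_r exp_0; lra.
  have h := efac_hb_le pn; rewrite /rho in h.
  have [r0 r1] := rho_bounds a0 pn; rewrite /rho in r0 r1.
  have hbp := hb_gt0 n.
  split; first by (have : 0 < Rpower (INR n) (- a) / (1 - Rpower (INR n) (- a)) by apply: Rdiv_lt_0_compat; lra); nra.
  by have := exp_ge1p (/ a * plog n); lra.
apply: exp_le; rewrite -rsumM; apply: Rmult_le_compat_l; last exact: plog_sum_le.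
by left; exact: Rinv_0_lt_compat.
Qed.

Lemma ex_series_hterm : ex_series (hterm a).
Proof. exact: (proj1 (pos_series_bounded hterm_ge0 hsum_bound)). Qed.

Lemma Hs_ge1 : 1 <= Hs a.
Proof.
have := rsum_le_Series 2 hterm_ge0 ex_series_hterm.
rewrite big_ltn // big_nat1 /hterm /= pweight1 INR1 Rpower_1l /Hs /hterm; lra.
Qed.

Definition ce (t : R) (m : nat) : C := (RtoC (Rpower (INR m) (- a)) * cis (t * ln (INR m)))%C.

Lemma ce_mul t p m : prime p -> (0 < m)%N -> ce t (p * m) = (ce t p * ce t m)%C.
Proof.
move=> pp m0; have p0 := prime_gt0 pp; rewrite /ce Rpower_INR_mul // INR_muln.
rewrite ln_mult; [|exact: INR_gt0|exact: INR_gt0].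
by rewrite Rmult_plus_distr_l cis_add RtoC_mult; ring.
Qed.

Lemma cterm_hb t m : cterm hb (ce t) 0 m = (RtoC (hterm a m) * cis (t * ln (INR m)))%C.
Proof.
rewrite /cterm rough0 andbT /hterm; case: ifP => _; last by ring.
by rewrite /ce RtoC_mult; ring.
Qed.

Lemma cterm_hb_summable t : Csummable (cterm hb (ce t) 0).
Proof.
apply: (ex_series_ext (hterm a)) ex_series_hterm => m.
by rewrite cterm_hb Cmod_mult Cmod_cis Cmod_R Rabs_pos_eq ?Rmult_1_r //; exact: hterm_ge0.
Qed.

Lemma euler_hb t : Clim (fun k => \cprod_(0 <= n < k) cfac hb (ce t) n) (CSeries (cterm hb (ce t) 0)).
Proof.
move=> eps he.
have := @euler_product hb (ce t) _ (ce_mul t) _ (cterm_hb_summable t) eps he.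
case.
- by rewrite /ce INR1 Rpower_1l ln_1 Rmult_0_r cis0; ring.
- move=> p pp; rewrite /ce Cmod_mult Cmod_cis Cmod_R Rmult_1_r.
  by have := rho_bounds a0 pp; rewrite /rho => h; rewrite Rabs_pos_eq; lra.
move=> K hK; exists K => k /hK h.
by rewrite -Cmod_opp; have -> : (- (\cprod_(0 <= n < k) cfac hb (ce t) n - CSeries (cterm hb (ce t) 0)) =
  CSeries (cterm hb (ce t) 0) - \cprod_(0 <= n < k) cfac hb (ce t) n)%C by ring.
Qed.

Definition hfac n := if prime n then / (1 - qp a n) else 1.

Lemma hfac_ge1 n : 1 <= hfac n.
Proof.
rewrite /hfac; case: ifP => pn; last lra.
have [q0 q1] := qp_bounds a0 pn; rewrite -{1}Rinv_1; apply: Rinv_le_contravar; lra.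
Qed.

Lemma euler_Hs : is_lim_seq (fun k => \rprod_(0 <= n < k) hfac n) (Hs a).
Proof.
have h := Clim_fst (euler_hb 0).
have -> : Hs a = fst (CSeries (cterm hb (ce 0) 0)).
  rewrite /CSeries /=; apply: Series_ext => m; rewrite cterm_hb Rmult_0_l cis0 /=; ring.
apply: is_lim_seq_ext h => k.
have -> : \cprod_(0 <= n < k) cfac hb (ce 0) n = RtoC (\rprod_(0 <= n < k) hfac n).
  elim: k => [|k IH]; first by rewrite !big_geq.
  rewrite !big_nat_recr //= IH RtoC_mult; congr (_ * _)%C.
  rewrite /cfac /hfac; case: ifP => // pk.
  rewrite -(efac_hb pk) /ce Rmult_0_l cis0 Cmult_1_r -/(rho a k).
  have [r0 r1] := rho_bounds a0 pk.
  by rewrite RtoC_plus RtoC_mult RtoC_div ?RtoC_minus //; lra.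
by [].
Qed.

Definition Pm (m : nat) : R := hterm a m / Hs a.

Lemma Pm_ge0 m : 0 <= Pm m.
Proof. by apply: Rdiv_le_0_compat; [exact: hterm_ge0 | have := Hs_ge1; lra]. Qed.

Lemma Pm_series : is_series Pm 1.
Proof.
have -> : 1 = / Hs a * Hs a by have := Hs_ge1 => h; field; lra.
apply: (is_series_ext (fun m => / Hs a * hterm a m)) => [m|].
  by rewrite /Pm /Rdiv Rmult_comm.
exact: is_series_scal_l (Series_correct _ ex_series_hterm).
Qed.

Lemma ex_series_Pm : ex_series Pm.
Proof. by exists 1; exact: Pm_series. Qed.

Definition Xm (m : nat) : R := ln (INR m) - G a.

Definition charf (t : R) : C := CSeries (fun m => (RtoC (Pm m) * cis (t * Xm m))%C).

Definition aph (t : R) (n : nat) : C := if prime n then aphp a t n else RtoC 1.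

(** Because [G a] is the sum of the means [mu a p], the centring phase can be distributed over the
    primes. The partial products of [1 / Hs], of the phase and of the Euler product combine into
    centred local factors. *)
Lemma charf_lim t : Clim (fun k => \cprod_(0 <= n < k) aph t n) (charf t).
Proof.
have hH := Hs_ge1.
have e : charf t = (RtoC (/ Hs a) * cis (- (t * G a)) * CSeries (cterm hb (ce t) 0))%C.
  rewrite -CSeries_scal; last exact: cterm_hb_summable.
  apply: CSeries_ext => m; rewrite cterm_hb /Pm /Rdiv RtoC_mult /Xm.
  have -> : t * (ln (INR m) - G a) = - (t * G a) + t * ln (INR m) by ring.
  by rewrite cis_add; ring.
rewrite e.
have l1 : Clim (fun k => RtoC (/ \rprod_(0 <= n < k) hfac n)) (RtoC (/ Hs a)).
  apply: Clim_RtoC.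
  have := @is_lim_seq_inv _ _ euler_Hs; apply; case; lra.
have l2 : Clim (fun k => cis (- (t * \rsum_(0 <= n < k) gterm a n))) (cis (- (t * G a))).
  apply: Clim_cis; rewrite G_gterm //.
  have h := is_lim_seq_scal_l _ (- t) _ (Series_rsum (ex_series_gterm a0)).
  have -> : - (t * Series (gterm a)) = - t * Series (gterm a) by ring.
  by apply: is_lim_seq_ext h => k /=; ring.
apply: Clim_ext (Clim_mult (Clim_mult l1 l2) (euler_hb t)) => k.
elim: k => [|k IH].
  by rewrite !big_geq // Rinv_1 Rmult_0_r Ropp_0 cis0; ring.
rewrite ![in RHS]big_nat_recr //= -IH.
rewrite ![in LHS]big_nat_recr //= Rinv_mult.
set A := \rprod_(0 <= n < k) _; set B := \rsum_(0 <= n < k) _; set D := \cprod_(0 <= n < k) _.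
have -> : - (t * (B + gterm a k)) = - (t * B) + - (t * gterm a k) by ring.
rewrite cis_add RtoC_mult /aph /hfac /gterm /cfac; case: ifP => pk; last first.
  by rewrite Rinv_1 Rmult_0_r Ropp_0 cis0; ring.
rewrite /aphp (phip_cfac t a0 pk) Rinv_inv -/(rho a k) /hb.
have -> : - (qp a k * (lam a k * (t * ln (INR k)))) = - (t * mu a k) by rewrite /mu; ring.
by rewrite /ce -/(rho a k); ring.
Qed.

Definition eg (t : R) (n : nat) : R := if prime n then egain a t n else 0.

Lemma eg_bounds t n : 0 <= eg t n <= 1.
Proof. by rewrite /eg; case: ifP => pn; [exact: egain_bounds | lra]. Qed.

Lemma Cmod_aph_le t n : Cmod (aph t n) <= exp (- eg t n / 2).
Proof.
rewrite /aph /eg; case: ifP => pn.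
  by rewrite Cmod_aphp; exact: Cmod_phip_le.
by rewrite Cmod_1 Ropp_0 /Rdiv Rmult_0_l exp_0; lra.
Qed.

Lemma Cmod_prod_aph_le t k : Cmod (\cprod_(0 <= n < k) aph t n) <=
  exp (- (\rsum_(0 <= n < k) eg t n) / 2).
Proof.
elim: k => [|k IH].
  by rewrite !big_geq // Cmod_1 Ropp_0 /Rdiv Rmult_0_l exp_0; lra.
rewrite !big_nat_recr //= Cmod_mult.
have -> : - (\rsum_(0 <= n < k) eg t n + eg t k) / 2 =
  - (\rsum_(0 <= n < k) eg t n) / 2 + - eg t k / 2 by field.
rewrite exp_plus; apply: Rmult_le_compat => //; try exact: Cmod_ge_0.
exact: Cmod_aph_le.
Qed.

Lemma charf_Cmod_le t g :
  (exists K, forall k, (K <= k)%N -> g <= \rsum_(0 <= n < k) eg t n) ->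
  Cmod (charf t) <= exp (- g / 2).
Proof.
move=> [K hK]; apply: Clim_Cmod_le (charf_lim t) _; exists K => k /hK h.
by apply: Rle_trans (Cmod_prod_aph_le t k) _; apply: exp_le; lra.
Qed.

Lemma Rabs_fst_aph_le t n : Rabs (fst (aph t n)) <= exp (- eg t n / 2).
Proof. by apply: Rle_trans (Rabs_fst_Cmod _) (Cmod_aph_le t n). Qed.

(** Replaces the factors by their real parts one at a time. Each replacement leaves one factor out
    of the exponential decay, which costs at most [exp (1 / 2)] as [eg <= 1]. *)
Lemma prod_real_part t k :
  Cmod (\cprod_(0 <= n < k) aph t n - RtoC (\rprod_(0 <= n < k) fst (aph t n)))%C <=
  exp (1 / 2) * (\rsum_(0 <= n < k) Rabs (snd (aph t n))) * exp (- (\rsum_(0 <= n < k) eg t n) / 2).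
Proof.
elim: k => [|k IH].
  rewrite !big_geq // /Cminus Cplus_opp_r Cmod_0 Rmult_0_r Rmult_0_l; lra.
rewrite !big_nat_recr //=.
set A := \cprod_(0 <= n < k) _ in IH *; set B := \rprod_(0 <= n < k) _ in IH *.
set S := \rsum_(0 <= n < k) _ in IH *; set g := \rsum_(0 <= n < k) _ in IH *.
have [e0 e1] := eg_bounds t k.
have hz := Cmod_aph_le t k.
set z := aph t k in hz *.
have -> : (A * z - RtoC (B * fst z) = (A - RtoC B) * z + RtoC B * (z - RtoC (fst z)))%C.
  by rewrite RtoC_mult; ring.
apply: Rle_trans (Cmod_triangle _ _) _; rewrite !Cmod_mult.
have -> : Cmod (z - RtoC (fst z))%C = Rabs (snd z).
  rewrite /Cmod /Cminus /Cplus /Copp /RtoC [fst _]/= [snd _]/=.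
  have -> : (fst z + - fst z) ^ 2 + (snd z + - 0) ^ 2 = Rsqr (snd z) by rewrite /Rsqr; ring.
  exact: sqrt_Rsqr_abs.
have hB : Cmod (RtoC B) <= exp (- g / 2).
  rewrite Cmod_R /B /g; elim: k {IH A B S g e0 e1 hz z} => [|k IH].
    by rewrite !big_geq // Rabs_R1 Ropp_0 /Rdiv Rmult_0_l exp_0; lra.
  rewrite !big_nat_recr //= Rabs_mult.
  have -> : - (\rsum_(0 <= n < k) eg t n + eg t k) / 2 =
    - (\rsum_(0 <= n < k) eg t n) / 2 + - eg t k / 2 by field.
  rewrite exp_plus; apply: Rmult_le_compat => //; try exact: Rabs_pos.
  exact: Rabs_fst_aph_le.
have -> : - (g + eg t k) / 2 = - g / 2 + - eg t k / 2 by field.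
rewrite exp_plus.
have S0 : 0 <= S by apply: rsum_nat_ge0 => i _; exact: Rabs_pos.
have x1 := exp_pos (- g / 2); have x2 := exp_pos (- eg t k / 2).
have x3 : 1 <= exp (1 / 2) * exp (- eg t k / 2).
  by rewrite -exp_plus; have := exp_ge1p (1 / 2 + - eg t k / 2); lra.
have b1 : Cmod (A - RtoC B)%C * Cmod z <= exp (1 / 2) * S * exp (- g / 2) * exp (- eg t k / 2).
  by apply: Rmult_le_compat => //; exact: Cmod_ge_0.
have b2 : Cmod (RtoC B) * Rabs (snd z) <= exp (- g / 2) * Rabs (snd z) * (exp (1 / 2) * exp (- eg t k / 2)).
  apply: (@Rle_trans _ (exp (- g / 2) * Rabs (snd z))).
    by apply: Rmult_le_compat_r => //; exact: Rabs_pos.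
  have : 0 <= exp (- g / 2) * Rabs (snd z) by apply: Rmult_le_pos; [lra | exact: Rabs_pos].
  nra.
lra.
Qed.

(** A bound on the imaginary part that is small and decaying at the same time; neither follows from
    the modulus alone. *)
Lemma charf_central t g I Rr :
  (exists K, forall k, (K <= k)%N -> g <= \rsum_(0 <= n < k) eg t n) ->
  (forall k, \rsum_(0 <= n < k) Rabs (snd (aph t n)) <= I) ->
  (forall k, Rr <= \rprod_(0 <= n < k) fst (aph t n)) ->
  Rabs (snd (charf t)) <= exp (1 / 2) * I * exp (- g / 2) /\
  Rr - exp (1 / 2) * I * exp (- g / 2) <= fst (charf t).
Proof.
move=> [K hK] hI hR.
have I0 : 0 <= I by have := hI 0%N; rewrite big_geq.
have H k : (K <= k)%N -> Cmod (\cprod_(0 <= n < k) aph t n - RtoC (\rprod_(0 <= n < k) fst (aph t n)))%C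
   <= exp (1 / 2) * I * exp (- g / 2).
  move=> /hK h; apply: Rle_trans (prod_real_part t k) _.
  have := exp_pos (1 / 2) => x.
  apply: Rmult_le_compat.
  - by apply: Rmult_le_pos; [lra | apply: rsum_nat_ge0 => i _; exact: Rabs_pos].
  - by left; exact: exp_pos.
  - by apply: Rmult_le_compat_l; [lra | exact: hI].
  - by apply: exp_le; lra.
split.
  apply: Rabs_le; split.
    apply: is_lim_seq_ge_const (Clim_snd (charf_lim t)); exists K => k /H h.
    have := Rle_trans _ _ _ (Rabs_snd_Cmod _) h; rewrite [snd _]/= Ropp_0 Rplus_0_r.
    by move/Rabs_le_between; lra.
  apply: is_lim_seq_le_const (Clim_snd (charf_lim t)); exists K => k /H h.
  have := Rle_trans _ _ _ (Rabs_snd_Cmod _) h; rewrite [snd _]/= Ropp_0 Rplus_0_r.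
  by move/Rabs_le_between; lra.
apply: is_lim_seq_ge_const (Clim_fst (charf_lim t)); exists K => k /H h.
have := Rle_trans _ _ _ (Rabs_fst_Cmod _) h; rewrite [fst _]/=.
by move/Rabs_le_between; have := hR k; lra.
Qed.

End HDef.

(** * The sieve and the sum over square-free kernels *)

Definition dfree (D : seq nat) (l : nat) : bool := all (fun d => ~~ (d %| l)%N) D.

Definition scnt (D : seq nat) (M : nat) : R :=
  \rsum_(1 <= l < M.+1) (if dfree D l then 1 else 0).

Fixpoint pcoprime (D : seq nat) : bool :=
  if D is d :: D' then (1 < d)%N && all (coprime d) D' && pcoprime D' else true.

Lemma rsum_multiples_le (k M : nat) (F : nat -> R) : (0 < k)%N ->
  \rsum_(1 <= l < M.+1) (if (k %| l)%N then F l else 0) = \rsum_(1 <= l < (M %/ k).+1) F (k * l)%N.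
Proof.
move=> k0.
have h1 : (M.+1 <= k * (M %/ k).+1)%N by rewrite mulnC ltn_ceil.
have := rsum_multiples (M %/ k).+1 F k0.
rewrite (@big_cat_nat _ _ _ M.+1 0 _) //= [X in _ + X]big1_seq; last first.
  move=> i; rewrite mem_index_iota => /andP [_ /andP [i1 i2]].
  case: ifP => // /dvdnP [j hj]; move: i1 i2; rewrite hj mulnC ltn_pmul2l // => i1 i2.
  have : (M < k * (M %/ k))%N by apply: leq_trans i1 _; rewrite leq_mul2l; apply/orP; right; lia.
  by have := leq_trunc_div M k; rewrite mulnC; lia.
rewrite Rplus_0_r big_ltn // [in RHS]big_ltn // dvdn0 muln0.
lra.
Qed.

(** Legendre's recursion: among the multiples [d l], divisibility by the other moduli depends on [l]
    only, by coprimality. *)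
Lemma scnt_cons d D M : (1 < d)%N -> all (coprime d) D ->
  scnt (d :: D) M = scnt D M - scnt D (M %/ d).
Proof.
move=> d1 hc; rewrite /scnt.
have -> : \rsum_(1 <= l < (M %/ d).+1) (if dfree D l then 1 else 0) =
  \rsum_(1 <= l < M.+1) (if (d %| l)%N then (if dfree D l then 1 else 0) else 0).
  rewrite rsum_multiples_le; last by lia.
  apply: eq_bigr => l _; have -> // : dfree D (d * l) = dfree D l.
  apply: eq_in_all => e he; rewrite Gauss_dvdr // coprime_sym.
  by move/allP: hc => /(_ e he).
rewrite rsum_sub; apply: eq_bigr => l _ /=.
by case: (d %| l)%N; case: (dfree D l) => /=; lra.
Qed.

Lemma nfloor_div Z d : 0 <= Z -> (0 < d)%N -> nfloor (Z / INR d) = (nfloor Z %/ d)%N.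
Proof.
move=> Z0 d0; have hd := INR_gt0 d0.
have Zd : 0 <= Z / INR d by apply: Rdiv_le_0_compat.
have [h1 h2] := nfloor_bounds Z0; have [h3 h4] := nfloor_bounds Zd.
apply/eqP; rewrite eqn_leq; apply/andP; split.
  rewrite leq_divRL //; apply: leq_nfloor => //; rewrite INR_muln.
  have : Z / INR d * INR d = Z by field; lra.
  nra.
apply: leq_nfloor => //; apply: le_divr => //; apply: Rle_trans h1.
by rewrite -INR_muln; apply: leq_INR; exact: leq_trunc_div.
Qed.

(** The power [Z^(3/4)], used as remainder of the sieve. It dominates the fractional part for every
    [Z >= 0], and at the moduli [p^2] its inverse is [p^(-3/2)], summable over primes. *)
Definition pow34 (Z : R) := sqrt Z * sqrt (sqrt Z).

Lemma pow34_ge0 Z : 0 <= pow34 Z.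
Proof. by apply: Rmult_le_pos; exact: sqrt_pos. Qed.

Lemma pow34_div Z d : 0 <= Z -> 0 < d -> pow34 (Z / d) = pow34 Z / pow34 d.
Proof.
move=> h h'; have s := sqrt_lt_R0 _ h'; have s' := sqrt_lt_R0 _ s.
by rewrite /pow34 sqrt_div_alt // sqrt_div_alt //; field; lra.
Qed.

Lemma pow34_ge1 d : 1 <= d -> 1 <= pow34 d.
Proof.
move=> h; have h1 : 1 <= sqrt d by rewrite -sqrt_1; apply: sqrt_le_1_alt.
have h2 : 1 <= sqrt (sqrt d) by rewrite -{1}sqrt_1; apply: sqrt_le_1_alt.
rewrite /pow34; nra.
Qed.

Lemma nfloor_err Z : 0 <= Z -> Rabs (INR (nfloor Z) - Z) <= pow34 Z.
Proof.
move=> h; have [h1 h2] := nfloor_bounds h.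
have s0 := sqrt_pos Z; have ss := sqrt_sqrt Z h.
have s0' := sqrt_pos (sqrt Z); have ss' := sqrt_sqrt (sqrt Z) s0.
case: (Rle_lt_dec 1 Z) => hZ.
  by have := pow34_ge1 hZ; rewrite Rabs_left1; lra.
rewrite Rabs_left1; last lra.
have : Z <= pow34 Z.
  rewrite /pow34; have : sqrt Z <= 1 by nra.
  move=> h3; have h4 : sqrt (sqrt Z) <= 1 by nra.
  rewrite -{1}ss; apply: Rmult_le_compat_l => //; nra.
have := pos_INR (nfloor Z); lra.
Qed.

(** Dividing [Z] by [d] divides the remainder by [d^(3/4)], so each modulus multiplies the error by
    [1 + d^(-3/4)] instead of 2. The bound then stays finite for moduli [p^2] with arbitrarily many
    primes. *)
Lemma sieve_bound D Z : pcoprime D -> 0 <= Z ->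
  Rabs (scnt D (nfloor Z) - Z * \rprod_(d <- D) (1 - / INR d)) <=
  pow34 Z * \rprod_(d <- D) (1 + / pow34 (INR d)).
Proof.
elim: D Z => [|d D IH] Z /=.
  move=> _ h; rewrite !big_nil !Rmult_1_r /scnt.
  have -> : \rsum_(1 <= l < (nfloor Z).+1) (if dfree [::] l then 1 else 0) = INR (nfloor Z).
    by rewrite /= rsum_const size_iota subn1 /= Rmult_1_r.
  exact: nfloor_err.
move=> /andP [/andP [d1 hc] hD] Z0; rewrite scnt_cons // !big_cons.
have hd : 2 <= INR d by apply: INR_ge2.
have Zd : 0 <= Z / INR d by apply: Rdiv_le_0_compat; lra.
rewrite -nfloor_div //; last by lia.
have i1 := IH Z hD Z0; have i2 := IH _ hD Zd.
rewrite pow34_div // in i2; last lra.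
set A := \rprod_(j <- D) _ in i1 i2 *; set B := \rprod_(j <- D) _ in i1 i2 *.
have pd := @pow34_ge1 (INR d) ltac:(lra).
have -> : scnt D (nfloor Z) - scnt D (nfloor (Z / INR d)) - Z * ((1 - / INR d) * A) =
  (scnt D (nfloor Z) - Z * A) + - (scnt D (nfloor (Z / INR d)) - Z / INR d * A) by field; lra.
apply: Rle_trans (Rabs_triang _ _) _; rewrite Rabs_Ropp.
have -> : pow34 Z * ((1 + / pow34 (INR d)) * B) = pow34 Z * B + pow34 Z / pow34 (INR d) * B by field; lra.
lra.
Qed.

(** * The sum of the inverse squares and the product over primes *)

Lemma x_cos_le_sin x : 0 <= x <= PI / 2 -> x * cos x <= sin x.
Proof.
move=> [[hx|<-] h2]; last by rewrite sin_0; lra.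
pose f y := sin y - y * cos y.
have [c [hc1 hc2]] : exists c, f x - f 0 = (c * sin c) * (x - 0) /\ 0 <= c <= x.
  have := MVT_gen f 0 x (fun c => c * sin c).
  rewrite Rmin_left ?Rmax_right; [|lra|lra].
  case.
  - move=> c _; rewrite /f; auto_derive => //; ring.
  - move=> c _; rewrite /f; apply continuity_pt_filterlim.
    by apply: (@ex_derive_continuous _ _ (fun y => sin y - y * cos y)); auto_derive.
  - by move=> c [h3 h4]; exists c.
have f0 : f 0 = 0 by rewrite /f sin_0; lra.
have sc : 0 <= sin c by apply: sin_ge_0; have := PI_RGT_0; lra.
have : 0 <= (c * sin c) * (x - 0) by apply: Rmult_le_pos; [apply: Rmult_le_pos|]; lra.
rewrite -hc1 f0 /f; lra.
Qed.

(** From [x cos x <= sin x <= x]; the left side is the squared cotangent. *)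
Lemma inv_sq_sin_bounds x : 0 < x < PI / 2 ->
  / (sin x) ^ 2 - 1 <= / x ^ 2 <= / (sin x) ^ 2.
Proof.
move=> [x0 x1].
have s0 : 0 < sin x by apply: sin_gt_0; have := PI_RGT_0; lra.
have c0 : 0 < cos x by apply: cos_gt_0; lra.
have s1 := sin_le_x (Rlt_le _ _ x0).
have s2 := @x_cos_le_sin x ltac:(lra).
have x2 : 0 < x ^ 2 by apply: pow_lt.
have sc := sin2_cos2 x; rewrite /Rsqr in sc.
have ss : 0 < (sin x) ^ 2 by apply: pow_lt.
split; last by apply: Rinv_le_contravar => //; apply: pow_incr; lra.
have -> : / sin x ^ 2 - 1 = (cos x) ^ 2 / sin x ^ 2.
  have -> : cos x ^ 2 = 1 - sin x ^ 2 by rewrite -sc; ring.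
  by field; lra.
apply: divr_le => //.
have -> : / x ^ 2 * sin x ^ 2 = sin x ^ 2 / x ^ 2 by rewrite /Rdiv Rmult_comm.
apply: le_divr => //.
rewrite -Rpow_mult_distr Rmult_comm; apply: pow_incr; nra.
Qed.

(* Hofbauer's proof of [1 + 1/4 + 1/9 + ... = PI ^ 2 / 6]: the sum of [1 / sin ^ 2] over the angles below is explicit. *)
Definition bang (n k : nat) := INR (2 * k + 1) * PI / 2 ^ (n + 2).

Lemma bang_range n k : (k < 2 ^ n)%N -> 0 < bang n k < PI / 2.
Proof.
move=> hk; have pp := PI_RGT_0; rewrite /bang.
have p2 : 0 < 2 ^ (n + 2) by apply: pow_lt; lra.
have h0 : 0 < INR (2 * k + 1) by apply: INR_gt0; lia.
split; first by apply: Rdiv_lt_0_compat => //; apply: Rmult_lt_0_compat.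
apply Rlt_div_l => //.
have -> : PI / 2 * 2 ^ (n + 2) = 2 ^ (n + 1) * PI.
  by rewrite !pow_add; field.
apply: Rmult_lt_compat_r => //.
have -> : 2 ^ (n + 1) = INR (2 ^ (n + 1)) by rewrite INR_expn INR2.
by apply: ltn_INR; rewrite expnD expn1; lia.
Qed.

Lemma inv_sin_sq_double x : 0 < x < PI / 2 ->
  / (sin x) ^ 2 = / 4 * (/ (sin (x / 2)) ^ 2 + / (sin ((PI - x) / 2)) ^ 2).
Proof.
move=> [x0 x1]; have pp := PI_RGT_0.
have -> : sin ((PI - x) / 2) = cos (x / 2) by rewrite -cos_shift; congr cos; field.
have -> : sin x = 2 * sin (x / 2) * cos (x / 2) by rewrite -sin_2a; congr sin; field.
have s0 : 0 < sin (x / 2) by apply: sin_gt_0; lra.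
have c0 : 0 < cos (x / 2) by apply: cos_gt_0; lra.
have sc := sin2_cos2 (x / 2); rewrite /Rsqr in sc.
have -> : / 4 * (/ sin (x / 2) ^ 2 + / cos (x / 2) ^ 2) =
  (sin (x / 2) * sin (x / 2) + cos (x / 2) * cos (x / 2)) / (4 * (sin (x / 2) ^ 2 * cos (x / 2) ^ 2)) by field; lra.
by rewrite sc; field; lra.
Qed.

Lemma bang_sum n : \rsum_(0 <= k < (2 ^ n)%N) / (sin (bang n k)) ^ 2 = 2 * 4 ^ n.
Proof.
elim: n => [|n IH].
  rewrite big_nat1 /bang -[INR _]/(INR 1) INR1.
  have -> : 1 * PI / 2 ^ (0 + 2) = PI / 4 by rewrite /=; field.
  rewrite sin_PI4 /=; have := sqrt_sqrt 2 ltac:(lra) => s.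
  have s0 : 0 < sqrt 2 by apply: sqrt_lt_R0; lra.
  have -> : 1 / sqrt 2 * (1 / sqrt 2 * 1) = / (sqrt 2 * sqrt 2) by field; lra.
  by rewrite s; field.
have e2 : (2 ^ n.+1 = 2 ^ n + 2 ^ n)%N by rewrite expnS; lia.
rewrite e2 (@big_cat_nat _ _ _ (2 ^ n)%N) //=; last by lia.
have -> : \rsum_(2 ^ n <= k < 2 ^ n + 2 ^ n) / (sin (bang n.+1 k)) ^ 2 =
  \rsum_(0 <= k < (2 ^ n)%N) / (sin ((PI - bang n k) / 2)) ^ 2.
  (* Read backwards, the upper half of the angles consists of [(PI - bang n k) / 2]. *)
  rewrite -{1}[(2 ^ n)%N]add0n big_addn addnK big_nat_rev /= add0n.
  apply: eq_big_seq => k; rewrite mem_index_iota => /andP [_ hk].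
  congr (/ (sin _) ^ 2); rewrite /bang.
  have -> : INR (2 * (2 ^ n - k.+1 + 2 ^ n) + 1) = 2 ^ (n + 2) - INR (2 * k + 1).
    have -> : 2 ^ (n + 2) = INR (2 ^ (n + 2)) by rewrite INR_expn INR2.
    rewrite -minus_INR; last by rewrite expnD; lia.
    by congr INR; rewrite expnD; lia.
  have -> : 2 ^ (n.+1 + 2) = 2 * 2 ^ (n + 2) by [].
  by field; apply: pow_nonzero; lra.
rewrite -big_split /=.
have -> : \rsum_(0 <= k < (2 ^ n)%N) (/ sin (bang n.+1 k) ^ 2 + / sin ((PI - bang n k) / 2) ^ 2) =
   \rsum_(0 <= k < (2 ^ n)%N) (4 * / sin (bang n k) ^ 2).
  apply: eq_big_seq => k; rewrite mem_index_iota => /andP [_ hk].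
  rewrite (inv_sin_sq_double (bang_range hk)).
  have -> : bang n k / 2 = bang n.+1 k.
    rewrite /bang; have -> : 2 ^ (n.+1 + 2) = 2 * 2 ^ (n + 2) by [].
    by field; apply: pow_nonzero; lra.
  lra.
by rewrite -rsumM IH /=; ring.
Qed.

Definition zterm (m : nat) : R := if (0 < m)%N then / (INR m) ^ 2 else 0.

(** Each of the [2 ^ n] terms changes by at most 1 when [1 / x^2] is replaced by [1 / sin^2 x],
    while the total is of order [4 ^ n]. *)
Lemma odd_sum_bounds n :
  PI ^ 2 / 16 * (2 - / 2 ^ n) <= \rsum_(0 <= k < (2 ^ n)%N) / (INR (2 * k + 1)) ^ 2 <= PI ^ 2 / 8.
Proof.
have pp := PI_RGT_0.
have p2 : 0 < 2 ^ n by apply: pow_lt; lra.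
have p4 : 0 < 4 ^ n by apply: pow_lt; lra.
have e4 : 4 ^ n = 2 ^ n * 2 ^ n by rewrite -Rpow_mult_distr; congr (_ ^ _); ring.
have P2 : 0 < PI ^ 2 by apply: pow_lt.
set S := \rsum_(0 <= k < (2 ^ n)%N) / (INR (2 * k + 1)) ^ 2.
have eS : \rsum_(0 <= k < (2 ^ n)%N) / (bang n k) ^ 2 = 16 * 4 ^ n / PI ^ 2 * S.
  rewrite /S rsumM; apply: eq_bigr => k _; rewrite /bang.
  have h0 : 0 < INR (2 * k + 1) by apply: INR_gt0; lia.
  by rewrite pow_add e4; field; lra.
have h1 : \rsum_(0 <= k < (2 ^ n)%N) / (bang n k) ^ 2 <= 2 * 4 ^ n.
  rewrite -bang_sum; apply: rsum_nat_le => k /andP [_ hk].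
  by have := inv_sq_sin_bounds (bang_range hk); lra.
have h2 : 2 * 4 ^ n - 2 ^ n <= \rsum_(0 <= k < (2 ^ n)%N) / (bang n k) ^ 2.
  have -> : 2 ^ n = \rsum_(0 <= k < (2 ^ n)%N) 1.
    by rewrite rsum_const size_iota subn0 INR_expn INR2; ring.
  rewrite -bang_sum rsum_sub; apply: rsum_nat_le => k /andP [_ hk].
  by have := inv_sq_sin_bounds (bang_range hk); lra.
rewrite eS in h1 h2.
have q : 0 < 16 * 4 ^ n / PI ^ 2 by apply: Rdiv_lt_0_compat; lra.
split; apply: (Rmult_le_reg_l (16 * 4 ^ n / PI ^ 2)) => //.
  apply: Rle_trans h2; rewrite e4; right; field; lra.
apply: Rle_trans h1 _; right; field; lra.
Qed.

Lemma zterm_ge0 m : 0 <= zterm m.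
Proof. by rewrite /zterm; case: ifP => h; [left; apply: Rinv_0_lt_compat; apply: pow_lt; exact: INR_gt0 | lra]. Qed.

Lemma ex_series_zterm : ex_series zterm.
Proof.
apply: (proj1 (@pos_series_bounded zterm 2 zterm_ge0 _)) => N.
apply: (@Rle_trans _ (\rsum_(0 <= m < N + 2) zterm m)).
  by apply: rsum_sub_range; [exact: zterm_ge0 | lia | lia].
rewrite big_ltn; last by lia.
rewrite big_ltn; last by lia.
have -> : \rsum_(2 <= i < N + 2) zterm i = \rsum_(2 <= i < N + 2) (/ INR i * / INR i).
  apply: eq_big_seq => i; rewrite mem_index_iota => hi; rewrite /zterm.
  have -> : (0 < i)%N by lia.
  by rewrite /= Rmult_1_r Rinv_mult.
have := @sum_inv_sq_le 2 (N + 2) isT; rewrite /zterm /= INR1; lra.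
Qed.

Lemma is_lim_pow2_odd : is_lim_seq (fun n => \rsum_(0 <= k < (2 ^ n)%N) / (INR (2 * k + 1)) ^ 2) (PI ^ 2 / 8).
Proof.
apply: (@is_lim_seq_le_le (fun n => PI ^ 2 / 16 * (2 - / 2 ^ n)) _ (fun _ => PI ^ 2 / 8)).
- exact: odd_sum_bounds.
- have h : is_lim_seq (fun n => / 2 ^ n) 0.
    apply: (is_lim_seq_ext (fun n => (/ 2) ^ n)); first by move=> n; rewrite pow_inv.
    by apply: is_lim_seq_geom; rewrite Rabs_pos_eq; lra.
  have -> : PI ^ 2 / 8 = PI ^ 2 / 16 * (2 - 0) by field.
  by apply: is_lim_seq_mult'; [exact: is_lim_seq_const | apply: is_lim_seq_minus' => //; exact: is_lim_seq_const].
- exact: is_lim_seq_const.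
Qed.

(** The even terms make up a quarter of the sum, and the odd ones add up to [PI^2 / 8]. *)
Lemma basel : Series zterm = PI ^ 2 / 6.
Proof.
have hz := ex_series_zterm.
have hzr : ex_series (fun n => Rabs (zterm n)).
  by apply: (ex_series_ext zterm) => // n; rewrite Rabs_pos_eq //; exact: zterm_ge0.
have [s1 e1] := @Series_multiples 2 zterm isT hzr.
have e2 : Series (fun m => zterm (2 * m)) = / 4 * Series zterm.
  rewrite -Series_scal_l; apply: Series_ext => m; rewrite /zterm muln_gt0 /=.
  case: ifP => h; last by rewrite Rmult_0_r.
  by rewrite INR_muln INR2; have := INR_gt0 h => h0; field; lra.
pose o m := if (2 %| m)%N then 0 else zterm m.
have so : ex_series o.
  apply: (proj1 (series_le _ hz)) => m; rewrite /o; case: ifP => _; first by rewrite Rabs_R0; exact: zterm_ge0.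
  by rewrite Rabs_pos_eq; [lra | exact: zterm_ge0].
have e3 : Series zterm = Series (fun m => if (2 %| m)%N then zterm m else 0) + Series o.
  rewrite -Series_plus //; apply: Series_ext => m; rewrite /o; case: ifP => _; lra.
have e4 : Series o = PI ^ 2 / 8.
  have l1 : is_lim_seq (fun n => \rsum_(0 <= m < 2 * 2 ^ n) o m) (Series o).
    apply: (is_lim_seq_subseq (fun N => \rsum_(0 <= m < N) o m) (Series o) (fun n => (2 * 2 ^ n)%N)); last exact: Series_rsum.
    by apply: eventually_subseq => n; apply/ltP; rewrite expnS; have := expn_gt0 2 n; lia.
  have l2 := is_lim_pow2_odd.
  have l3 : is_lim_seq (fun n => \rsum_(0 <= m < 2 * 2 ^ n) o m) (PI ^ 2 / 8).
    apply: is_lim_seq_ext l2 => n; move: (2 ^ n)%N => N.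
    elim: N => [|N IH]; first by rewrite muln0 !big_geq.
    have -> : (2 * N.+1 = (2 * N).+2)%N by lia.
    rewrite [RHS]big_nat_recr //= [in RHS]big_nat_recr //= -IH big_nat_recr //=.
    rewrite /o dvdn_mulr //= /zterm.
    have -> : (2 %| (2 * N).+1)%N = false by rewrite dvdn2 /= oddM.
    by rewrite /= addn1; lra.
  by have := is_lim_seq_unique _ _ l1; rewrite (is_lim_seq_unique _ _ l3) => -[].
lra.
Qed.

Section EulerReal.
Variables (b e : nat -> R).
Hypothesis e0 : forall m, 0 <= e m.
Hypothesis e1 : e 1%N = 1.
Hypothesis eM : forall p m, prime p -> (0 < m)%N -> e (p * m)%N = e p * e m.
Hypothesis elt1 : forall p, prime p -> e p < 1.
Let tm m := if (0 < m)%N then pweight b m * e m else 0.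
Hypothesis hs : ex_series (fun m => Rabs (tm m)).

Lemma euler_product_real : is_lim_seq (fun k => \rprod_(0 <= n < k) efac b e n) (Series tm).
Proof.
pose ec m := RtoC (e m).
have ct m : cterm b ec 0 m = RtoC (tm m).
  by rewrite /cterm rough0 andbT /tm /ec; case: ifP => _ //; rewrite RtoC_mult.
have sm : Csummable (cterm b ec 0).
  by apply: ex_series_ext hs => m; rewrite ct Cmod_R.
have h : Clim (fun k => \cprod_(0 <= n < k) cfac b ec n) (CSeries (cterm b ec 0)).
  move=> eps he.
  have [|p m pp m0|p pp|K hK] := @euler_product b ec _ _ _ sm eps he.
  - by rewrite /ec e1.
  - by rewrite /ec eM // RtoC_mult.
  - by rewrite /ec Cmod_R Rabs_pos_eq //; exact: elt1.
  exists K => k /hK h; rewrite -Cmod_opp.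
  by have -> : (- (\cprod_(0 <= n < k) cfac b ec n - CSeries (cterm b ec 0)) =
    CSeries (cterm b ec 0) - \cprod_(0 <= n < k) cfac b ec n)%C by ring.
have := Clim_fst h.
have -> : fst (CSeries (cterm b ec 0)) = Series tm.
  by rewrite /CSeries /=; apply: Series_ext => m; rewrite ct.
apply: is_lim_seq_ext => k.
have -> // : \cprod_(0 <= n < k) cfac b ec n = RtoC (\rprod_(0 <= n < k) efac b e n).
elim: k => [|k IH]; first by rewrite !big_geq.
rewrite !big_nat_recr //= IH RtoC_mult; congr (_ * _)%C.
rewrite /cfac /efac /ec; case: ifP => // pk; have := elt1 pk => h1.
by rewrite RtoC_plus RtoC_mult RtoC_div ?RtoC_minus //; lra.
Qed.

End EulerReal.

(** The inverse of the Euler product of [zeta 2]; the constant [6 / PI^2] of [F] originates here. *)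
Lemma prime_sq_product : is_lim_seq
  (fun k => \rprod_(0 <= n < k) (if prime n then 1 - / (INR n) ^ 2 else 1)) (6 / PI ^ 2).
Proof.
have pp := PI_RGT_0; have P2 : 0 < PI ^ 2 by apply: pow_lt.
have w1 m : pweight (fun=> 1) m = 1 by rewrite /pweight big1.
have h : is_lim_seq (fun k => \rprod_(0 <= n < k) efac (fun=> 1) (fun m => / INR m ^ 2) n)
   (Series (fun m => if (0 < m)%N then pweight (fun=> 1) m * / INR m ^ 2 else 0)).
  apply: euler_product_real.
  - case=> [|m]; first by rewrite INR0 /= Rmult_0_l Rinv_0; lra.
    by left; apply: Rinv_0_lt_compat; apply: pow_lt; exact: INR_gt0.
  - by rewrite INR1 pow1 Rinv_1.
  - move=> p m hp m0; rewrite INR_muln Rpow_mult_distr Rinv_mult //.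
  - move=> p hp; have := INR_prime_ge2 hp => h2; rewrite -Rinv_1; apply: Rinv_lt_contravar; nra.
  apply: (ex_series_ext zterm) ex_series_zterm => m.
  by rewrite w1 Rmult_1_l -/(zterm m) Rabs_pos_eq //; exact: zterm_ge0.
have e : Series (fun m => if (0 < m)%N then pweight (fun=> 1) m * / INR m ^ 2 else 0) = PI ^ 2 / 6.
  by rewrite -basel; apply: Series_ext => m; rewrite w1 Rmult_1_l.
rewrite e in h.
have -> : 6 / PI ^ 2 = / (PI ^ 2 / 6) by field; lra.
have hi := @is_lim_seq_inv _ _ h ltac:(case; lra).
apply: is_lim_seq_ext hi => k /=.
rewrite -rprod_inv.
  apply: eq_bigr => n _; rewrite /efac; case: ifP => pn; last by rewrite Rinv_1.
  have := INR_prime_ge2 pn => h2; have : 0 < INR n ^ 2 by apply: pow_lt; lra.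
  by move=> h3; field; repeat split; nra.
move=> n; rewrite /efac; case: ifP => pn; last lra.
have := INR_prime_ge2 pn => h2.
have i0 : 0 < / INR n ^ 2 < 1.
  split; first by apply: Rinv_0_lt_compat; apply: pow_lt; lra.
  by rewrite -Rinv_1; apply: Rinv_lt_contravar; nra.
have : 0 < / INR n ^ 2 / (1 - / INR n ^ 2) by apply: Rdiv_lt_0_compat; lra.
rewrite -[INR n * (INR n * 1)]/(INR n ^ 2); lra.
Qed.

(** * Square-free kernels and the inner counts *)

Lemma prod_primes_gt0 s : all prime s -> (0 < \prod_(q <- s) q)%N.
Proof.
elim: s => [|q s IH] /=; first by rewrite big_nil.
by move=> /andP [pq ps]; rewrite big_cons muln_gt0 prime_gt0 // IH.
Qed.

Lemma rad_gt0 n : (0 < rad n)%N.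
Proof. by apply: prod_primes_gt0; apply/allP => q; rewrite mem_primes => /andP []. Qed.

Lemma logn_prod_primes p s : all prime s -> logn p (\prod_(q <- s) q)%N = count_mem p s.
Proof.
elim: s => [|q s IH] /=; first by rewrite big_nil logn1.
move=> /andP [pq ps]; rewrite big_cons lognM ?prod_primes_gt0 //; last exact: prime_gt0.
by rewrite IH // logn_prime // eq_sym.
Qed.

Lemma logn_rad p n : logn p (rad n) = (p \in primes n).
Proof.
rewrite /rad logn_prod_primes; first by rewrite count_uniq_mem // primes_uniq.
by apply/allP => q; rewrite mem_primes => /andP [].
Qed.

Lemma mem_primes_rad p n : (p \in primes (rad n)) = (p \in primes n).
Proof. by rewrite -[LHS]logn_gt0 logn_rad lt0b. Qed.

Lemma dvdn_from_logn m n : (0 < m)%N -> (0 < n)%N ->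
  (forall p, (logn p m <= logn p n)%N) -> (m %| n)%N.
Proof.
move=> m0 n0 h; apply/dvdn_partP => // p.
by rewrite -[p \in _]/(p \in primes m) mem_primes => /andP [pp _]; rewrite p_part pfactor_dvdn.
Qed.

Lemma rad_dvdM k j : (0 < k)%N -> (0 < j)%N -> (rad j %| rad (k * j))%N.
Proof.
move=> k0 j0; apply: dvdn_from_logn; rewrite ?rad_gt0 // => p.
by rewrite !logn_rad primesM //; case: (p \in primes j); rewrite ?orbT.
Qed.

Lemma rad_dvd n : (0 < n)%N -> (rad n %| n)%N.
Proof.
move=> n0; apply: dvdn_from_logn; rewrite ?rad_gt0 // => p.
by rewrite logn_rad -logn_gt0; case: (logn p n).
Qed.

(** The sieving moduli: [rad j * l] is the kernel of [rad j * l * j] exactly when [l] is prime to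
    [j] and square-free, that is, when no [p] dividing [j] and no [p^2] with [p] prime to [j]
    divides [l]. *)
Definition dj (j p : nat) : nat := (p ^ (if (p %| j)%N then 1 else 2))%N.
Definition DN (j N : nat) : seq nat := [seq dj j p | p <- [seq p <- index_iota 0 N.+1 | prime p]].

Lemma rad_mul_eq j l N : (0 < j)%N -> (0 < l)%N -> (j <= N)%N -> (l <= N)%N ->
  (rad j * l == rad (rad j * l * j))%N = dfree (DN j N) l.
Proof.
move=> j0 l0 jN lN; have r0 := rad_gt0 j.
have rl0 : (0 < rad j * l)%N by rewrite muln_gt0 r0.
apply/eqP/allP => [E d /mapP [p]|H].
  rewrite mem_filter => /andP [pp _] ->; rewrite /dj pfactor_dvdn // -ltnNge.
  have := congr1 (logn p) E; rewrite lognM // !logn_rad !mem_primes pp j0 /=.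
  by case: (p %| j)%N => /=; case: (_ && _); lia.
apply: eqn_from_log; rewrite ?rad_gt0 // => p.
rewrite lognM // !logn_rad !primesM // mem_primes_rad.
have Hp : prime p -> (p <= N)%N -> ((if (p %| j)%N then 1 else 2) > logn p l)%N.
  move=> pp pN; rewrite ltnNge -pfactor_dvdn //; apply: (H (dj j p)).
  by apply: map_f; rewrite mem_filter pp mem_index_iota.
case pj: (p \in primes j) => /=.
  move: pj; rewrite mem_primes => /and3P [pp _ dv].
  have := Hp pp (leq_trans (dvdn_leq j0 dv) jN); rewrite dv; lia.
rewrite orbF add0n -[p \in primes l]logn_gt0.
case: posnP => // hl.
move: hl pj; rewrite logn_gt0 !mem_primes => /and3P [pp _ dv].
rewrite pp j0 /= => nj; have := Hp pp (leq_trans (dvdn_leq l0 dv) lN).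
have : (0 < logn p l)%N by rewrite logn_gt0 mem_primes pp l0 dv.
by rewrite nj; lia.
Qed.

Definition Qc (j M : nat) : R := \rsum_(1 <= k < M.+1) (if (k == rad (k * j))%N then 1 else 0).

(** A counted [k] is a multiple of [rad j], so the sieve runs over [l = k / rad j]. Moduli from
    primes up to [N] suffice for [j] and [l] up to [N]. *)
Lemma Qc_scnt j M N : (0 < j)%N -> (j <= N)%N -> (M <= N)%N ->
  Qc j M = scnt (DN j N) (M %/ rad j).
Proof.
move=> j0 jN MN; have r0 := rad_gt0 j.
rewrite /scnt.
have -> : \rsum_(1 <= l < (M %/ rad j).+1) (if dfree (DN j N) l then 1 else 0) =
  \rsum_(1 <= l < (M %/ rad j).+1) (if (rad j * l == rad (rad j * l * j))%N then 1 else 0).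
  apply: eq_big_seq => l; rewrite mem_index_iota => /andP [l0 lM].
  rewrite (@rad_mul_eq j l N) //; have := leq_div M (rad j); lia.
rewrite -(rsum_multiples_le M (fun k => if (k == rad (k * j))%N then 1 else 0) r0).
apply: eq_big_seq => k; rewrite mem_index_iota => /andP [k0 _].
case: ifP => // /eqP E; case: ifP => //.
by rewrite E rad_dvdM.
Qed.

Lemma pcoprime_DN j N : pcoprime (DN j N).
Proof.
rewrite /DN; have : uniq [seq p <- index_iota 0 N.+1 | prime p] by rewrite filter_uniq // iota_uniq.
have : all prime [seq p <- index_iota 0 N.+1 | prime p] by apply: filter_all.
elim: [seq _ <- _ | _] => [//|p s IH] /= /andP [pp aps] /andP [ps us].
rewrite IH // andbT; apply/andP; split.
  by rewrite /dj; case: ifP => _; have := prime_gt1 pp; rewrite ?expn1 //; nia.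
apply/allP => d /mapP [q qs ->]; apply: coprimeXl; apply: coprimeXr.
have pq : prime q by move/allP: aps; apply.
rewrite prime_coprime // dvdn_prime2 //; apply/eqP => e.
by move: ps; rewrite e qs.
Qed.

Lemma rprod_DN j N (f : nat -> R) :
  \rprod_(d <- DN j N) f d = \rprod_(0 <= p < N.+1) (if prime p then f (dj j p) else 1).
Proof. by rewrite /DN big_map big_filter big_mkcond. Qed.

Lemma rprod_primes (j N : nat) (f : nat -> R) : (0 < j)%N -> (j <= N)%N ->
  \rprod_(p <- primes j) f p = \rprod_(0 <= p < N.+1) (if prime p && (p %| j)%N then f p else 1).
Proof.
move=> j0 jN; rewrite -(big_mkcond (fun p => prime p && (p %| j)%N)) -[RHS]big_filter.
apply: perm_big.
apply: uniq_perm; rewrite ?primes_uniq ?filter_uniq ?iota_uniq // => p.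
rewrite mem_filter mem_primes j0 /= mem_index_iota /=.
case pp: (prime p) => //=; case dv: (p %| j)%N => //=.
by have := dvdn_leq j0 dv; lia.
Qed.

(** For [p] dividing [j], [1 - 1/p = (1 - 1/p^2) * p / (p + 1)]; the extra factors collect to
    [rad j / psi j]. *)
Lemma DN_main_prod j N : (0 < j)%N -> (j <= N)%N ->
  \rprod_(d <- DN j N) (1 - / INR d) =
  (\rprod_(0 <= n < N.+1) (if prime n then 1 - / INR n ^ 2 else 1)) * (INR (rad j) / INR (psi j)).
Proof.
move=> j0 jN; rewrite rprod_DN /rad /psi !INR_prod /Rdiv -rprod_inv; last by move=> p; exact: INR_gt0.
rewrite -rprod_mul (rprod_primes (fun p => INR p * / INR p.+1) j0 jN) -rprod_mul.
apply: eq_bigr => p _; case pp: (prime p) => /=; last by lra.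
have h2 := INR_prime_ge2 pp.
rewrite /dj; case: (p %| j)%N => /=; rewrite INR_expn; last by rewrite /=; lra.
by rewrite S_INR /=; field; lra.
Qed.

Lemma sum_inv_32 N : \rsum_(2 <= n < N) / (INR n * sqrt (INR n)) <= 2.
Proof.
case: (leqP N 2) => hN; first by rewrite big_geq //; lra.
apply: (@Rle_trans _ (\rsum_(2 <= n < N) (- (2 / sqrt (INR n.+1 - 1)) - - (2 / sqrt (INR n - 1))))).
  apply: rsum_nat_le => n /andP [hn _]; have h2 : 2 <= INR n by apply: INR_ge2.
  have -> : INR n.+1 - 1 = INR n by rewrite S_INR; ring.
  have s0 : 0 < sqrt (INR n - 1) by apply: sqrt_lt_R0; lra.
  have t0 : 0 < sqrt (INR n) by apply: sqrt_lt_R0; lra.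
  have ss := sqrt_sqrt (INR n - 1) ltac:(lra); have tt := sqrt_sqrt (INR n) ltac:(lra).
  set s := sqrt (INR n - 1) in s0 ss *; set t := sqrt (INR n) in t0 tt *.
  have st : s <= t by apply: sqrt_le_1_alt; lra.
  rewrite -{1}tt.
  have e : (t - s) * (t + s) = 1 by lra.
  have -> : - (2 / t) - - (2 / s) = 2 * ((t - s) * (t + s)) / (s * t * (t + s)) by field; lra.
  rewrite e Rmult_1_r.
  have p1 : 0 < s * t * (t + s) by apply: Rmult_lt_0_compat; nra.
  have p2 : 0 < t * t * t by nra.
  have p3 : s * t <= t * t by apply: Rmult_le_compat_r; lra.
  have p4 : s * t * (t + s) <= t * t * (2 * t) by apply: Rmult_le_compat; nra.
  apply: le_divr => //; rewrite Rmult_comm; apply: divr_le => //; lra.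
rewrite rsum_telescope; last lia.
have -> : INR 2 - 1 = 1 by rewrite INR2; lra.
rewrite sqrt_1; have : 0 < 2 / sqrt (INR N - 1).
  apply: Rdiv_lt_0_compat; first lra.
  by apply: sqrt_lt_R0; have := ltn_INR hN; rewrite INR2; lra.
lra.
Qed.

(** A prime divisor of [j] costs at most a factor 2. The other primes contribute at most [exp] of
    the sum of [n^(-3/2)], hence [exp 2 <= 9]. *)
Lemma DN_err_prod j N : (0 < j)%N -> (j <= N)%N ->
  \rprod_(d <- DN j N) (1 + / pow34 (INR d)) <= 9 * \rprod_(p <- primes j) 2.
Proof.
move=> j0 jN; rewrite rprod_DN (rprod_primes (fun=> 2) j0 jN).
set E := fun n => if prime n then / (INR n * sqrt (INR n)) else 0.
apply: (@Rle_trans _ (\rprod_(0 <= p < N.+1) (exp (E p) * (if prime p && (p %| j)%N then 2 else 1)))).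
  apply: rprod_le => p _; rewrite /E; case pp: (prime p) => /=; last by rewrite exp_0; lra.
  have h2 := INR_prime_ge2 pp.
  have s0 : 0 < sqrt (INR p) by apply: sqrt_lt_R0; lra.
  have i0 : 0 < / (INR p * sqrt (INR p)) by apply: Rinv_0_lt_compat; nra.
  rewrite /dj; case: (p %| j)%N; rewrite ?expn1.
    have h1 := @pow34_ge1 (INR p) ltac:(lra).
    have : / pow34 (INR p) <= 1 by rewrite -Rinv_1; apply: Rinv_le_contravar; lra.
    have : 0 < / pow34 (INR p) by apply: Rinv_0_lt_compat; lra.
    have := exp_ge1p (/ (INR p * sqrt (INR p))); nra.
  rewrite INR_expn /pow34 /= Rmult_1_r sqrt_square; last lra.
  have := exp_ge1p (/ (INR p * sqrt (INR p))); lra.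
rewrite rprod_mul rprod_exp; apply: Rmult_le_compat_r.
  by apply: rprod_ge0 => p _; case: ifP; lra.
apply: (@Rle_trans _ (exp 2)); last first.
  have -> : 2 = 1 + 1 by lra.
  rewrite exp_plus; have := exp_le_3; have := exp_pos 1; nra.
apply: exp_le; apply: Rle_trans (sum_inv_32 N.+1).
have E0 n : 0 <= E n.
  rewrite /E; case: ifP => pn; last lra.
  have h2 := INR_prime_ge2 pn; have s0 : 0 < sqrt (INR n) by apply: sqrt_lt_R0; lra.
  by left; apply: Rinv_0_lt_compat; nra.
apply: (@Rle_trans _ (\rsum_(2 <= n < N.+1) E n)); last first.
  apply: rsum_nat_le => n /andP [hn _]; rewrite /E; case: ifP => _; first lra.
  have h2 : 2 <= INR n by apply: INR_ge2.
  have s0 : 0 < sqrt (INR n) by apply: sqrt_lt_R0; lra.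
  by left; apply: Rinv_0_lt_compat; nra.
case: N {jN} => [|N]; first by rewrite big_nat1 big_geq // /E /=; lra.
rewrite [X in X <= _]big_ltn // [X in _ + X <= _]big_ltn // {1 2}/E /=; lra.
Qed.

Lemma six_PI2 : 0 < 6 / PI ^ 2 <= 1.
Proof.
have pp := PI_RGT_0; have P2 : 0 < PI ^ 2 by apply: pow_lt.
split; first by apply: Rdiv_lt_0_compat; lra.
apply: divr_le => //; have := PI2_3_2 => h; rewrite /=; nra.
Qed.

(** The count does not change when the moduli run over more primes, so [N] can go to infinity and
    the product becomes [6 / PI^2]. *)
Lemma Qc_bound j Y : (0 < j)%N -> 0 <= Y ->
  Rabs (Qc j (nfloor Y) - 6 / PI ^ 2 * (Y / INR (psi j))) <=
  9 * (\rprod_(p <- primes j) 2) * pow34 (Y / INR (rad j)).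
Proof.
move=> j0 Y0; have r0 := INR_gt0 (rad_gt0 j).
set Z := Y / INR (rad j).
have Z0 : 0 <= Z by apply: Rdiv_le_0_compat.
have psi0 : 0 < INR (psi j).
  by rewrite /psi INR_prod; apply: rprod_gt0 => p _; exact: INR_gt0.
have h N : (maxn j (nfloor Y) <= N)%N ->
  Rabs (Qc j (nfloor Y) - Z * ((\rprod_(0 <= n < N.+1) (if prime n then 1 - / INR n ^ 2 else 1)) * (INR (rad j) / INR (psi j))))
   <= 9 * (\rprod_(p <- primes j) 2) * pow34 Z.
  rewrite geq_max => /andP [jN YN].
  rewrite (Qc_scnt j0 jN YN) -nfloor_div //; last exact: rad_gt0.
  rewrite -DN_main_prod //; apply: Rle_trans (sieve_bound (pcoprime_DN j N) Z0) _.
  by rewrite Rmult_comm; apply: Rmult_le_compat_r; [exact: pow34_ge0 | exact: DN_err_prod].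
have hl : is_lim_seq (fun N => Qc j (nfloor Y) - Z * ((\rprod_(0 <= n < N.+1) (if prime n then 1 - / INR n ^ 2 else 1)) * (INR (rad j) / INR (psi j))))
   (Qc j (nfloor Y) - Z * (6 / PI ^ 2 * (INR (rad j) / INR (psi j)))).
  have h1 := proj1 (is_lim_seq_incr_1 _ _) prime_sq_product.
  apply: is_lim_seq_minus'; first exact: is_lim_seq_const.
  apply: is_lim_seq_mult'; first exact: is_lim_seq_const.
  by apply: is_lim_seq_mult' => //; exact: is_lim_seq_const.
have -> : Qc j (nfloor Y) - 6 / PI ^ 2 * (Y / INR (psi j)) =
  Qc j (nfloor Y) - Z * (6 / PI ^ 2 * (INR (rad j) / INR (psi j))).
  by rewrite /Z; have := PI_RGT_0 => pp; field; lra.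
apply: is_lim_seq_le_const (is_lim_seq_abs _ _ hl).
by exists (maxn j (nfloor Y)) => N /h.
Qed.

Lemma rad_le_psi j : INR (rad j) <= INR (psi j).
Proof.
rewrite /rad /psi !INR_prod; apply: rprod_le => p _; have := pos_INR p; rewrite S_INR; lra.
Qed.

(** Both the count and its expected value lie between 0 and [Y / rad j]. *)
Lemma Qc_trivial j Y : (0 < j)%N -> 0 <= Y ->
  Rabs (Qc j (nfloor Y) - 6 / PI ^ 2 * (Y / INR (psi j))) <= Y / INR (rad j).
Proof.
move=> j0 Y0; have r0 := INR_gt0 (rad_gt0 j); have rp := rad_le_psi j.
have Z0 : 0 <= Y / INR (rad j) by apply: Rdiv_le_0_compat.
have h1 : 0 <= Qc j (nfloor Y) by apply: rsum_nat_ge0 => k _; case: ifP; lra.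
have h2 : Qc j (nfloor Y) <= Y / INR (rad j).
  rewrite (@Qc_scnt j _ (maxn j (nfloor Y))) ?leq_maxl ?leq_maxr //.
  rewrite -nfloor_div ?rad_gt0 //.
  apply: (@Rle_trans _ (INR (nfloor (Y / INR (rad j))))); last by have := nfloor_bounds Z0; lra.
  rewrite /scnt.
  have -> : INR (nfloor (Y / INR (rad j))) = \rsum_(1 <= l < (nfloor (Y / INR (rad j))).+1) 1.
    by rewrite rsum_const size_iota subn1 /= Rmult_1_r.
  by apply: rsum_nat_le => l _; case: ifP; lra.
have h3 : 0 <= Y / INR (psi j) <= Y / INR (rad j).
  split; first by apply: Rdiv_le_0_compat; lra.
  by apply: Rmult_le_compat_l => //; apply: Rinv_le_contravar.
have [p0 p1] := six_PI2.
have h4 : 0 <= 6 / PI ^ 2 * (Y / INR (psi j)) <= Y / INR (rad j) by split; nra.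
by apply: Rabs_le; lra.
Qed.

(** Geometric mean of [Qc_trivial] with weight [1 - 4 eps] and [Qc_bound] with weight [4 eps]. The
    exponent becomes [1 - 4 eps + 3 eps], and [2^(4 eps) = 16^eps] remains per prime divisor of
    [j]. *)
Lemma Qc_interp j Y eps : (0 < j)%N -> 0 < Y -> 0 < eps <= 1 / 4 ->
  Rabs (Qc j (nfloor Y) - 6 / PI ^ 2 * (Y / INR (psi j))) <=
  9 * (Rpower (Y / INR (rad j)) (1 - eps) * \rprod_(p <- primes j) Rpower 16 eps).
Proof.
move=> j0 Y0 he; have r0 := INR_gt0 (rad_gt0 j).
have Z0 : 0 < Y / INR (rad j) by apply: Rdiv_lt_0_compat.
have := Qc_trivial j0 (Rlt_le _ _ Y0); have := Qc_bound j0 (Rlt_le _ _ Y0).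
move: (Rabs _) (Y / INR (rad j)) Z0 => q Z Z0 h2 h1.
have ew : \rprod_(p <- primes j) Rpower 16 eps = exp (INR (size (primes j)) * (4 * eps * ln 2)).
  have -> : Rpower 16 eps = exp (4 * eps * ln 2).
    rewrite /Rpower; have -> : 16 = 2 ^ 4 by rewrite /=; lra.
    by rewrite ln_pow; [rewrite [INR 4]INR_IZR_INZ /=; congr exp; ring | lra].
  by rewrite rprod_exp rsum_const.
have e2 : \rprod_(p <- primes j) 2 = exp (INR (size (primes j)) * ln 2).
  have -> : 2 = exp (ln 2) by rewrite exp_ln; lra.
  by rewrite rprod_exp rsum_const ln_exp.
rewrite ew; rewrite e2 in h2; set w := INR _ in h2 *.
have e34 : pow34 Z = exp (3 / 4 * ln Z).
  have hs u : 0 < u -> sqrt u = exp (ln u / 2).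
    move=> u0; rewrite -Rpower_sqrt // /Rpower; congr exp; lra.
  rewrite /pow34 (hs Z) // (hs (exp _)); last exact: exp_pos.
  by rewrite ln_exp -exp_plus; congr exp; field.
rewrite e34 in h2.
case: (Rle_lt_dec q 0) => hq.
  apply: Rle_trans hq _; apply: Rmult_le_pos; first lra.
  by left; apply: Rmult_lt_0_compat; exact: exp_pos.
have l1 : ln q <= ln Z by apply: ln_le.
have l9 : 0 <= ln 9 by apply: ln_ge0; lra.
have l2 : ln q <= ln 9 + w * ln 2 + 3 / 4 * ln Z.
  apply: Rle_trans (ln_le hq h2) _.
  rewrite ln_mult; [|apply: Rmult_lt_0_compat; [lra | exact: exp_pos]|exact: exp_pos].
  by rewrite ln_mult ?ln_exp; [lra | lra | exact: exp_pos].
rewrite -{1}(exp_ln q) // -[9](exp_ln 9); last lra.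
rewrite /Rpower -!exp_plus; apply: exp_le; nra.
Qed.

(** * Reduction of [S_theta] to the inner counts *)

Lemma rsum_cond_le (A B : nat) (f : nat -> R) :
  \rsum_(1 <= k < A.+1) (if (k <= B)%N then f k else 0) = \rsum_(1 <= k < (minn A B).+1) f k.
Proof.
rewrite -big_mkcond /= [RHS](@big_nat_widen _ _ _ _ _ A.+1); last by rewrite ltnS geq_minl.
rewrite big_nat_cond [RHS]big_nat_cond; apply: eq_bigl => k.
by case: (leqP 1 k) => //=; case: (ltnP k A.+1) => //= h; rewrite ltnS leq_min; have -> : (k <= A)%N by lia.
Qed.

Lemma nfloor_min a b : 0 <= a -> 0 <= b -> nfloor (Rmin a b) = minn (nfloor a) (nfloor b).
Proof.
move=> a0 b0; have [ha _] := nfloor_bounds a0; have [hb _] := nfloor_bounds b0.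
case: (Rle_lt_dec a b) => h.
  rewrite Rmin_left //; apply/esym/minn_idPl; apply: leq_nfloor => //; lra.
rewrite Rmin_right; last lra.
by apply/esym/minn_idPr; apply: leq_nfloor => //; lra.
Qed.

Definition Yj (beta x : R) (j : nat) : R := Rmin (x / INR j) (Rpower (INR j) beta).

Lemma S_theta_Qc theta x : 0 < theta -> theta < 1 -> 1 <= x ->
  S_theta theta x = \rsum_(1 <= j < (nfloor x).+1) Qc j (nfloor (Yj (theta / (1 - theta)) x j)).
Proof.
move=> t0 t1 x1.
set g := fun n => if Rle_dec (INR (rad n)) (Rpower (INR n) theta) then 1 else 0.
have -> : S_theta theta x = \rsum_(1 <= n < (nfloor x).+1) g n.
  rewrite /S_theta /S_count (big_morph INR INR_addn INR0) -/(nfloor x).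
  by apply: eq_bigr => n _; rewrite /g; case: Rle_dec => /= _; rewrite ?INR1 ?INR0.
set X := nfloor x.
(* Inserts a sum over [j] in which only [j = n / rad n] contributes, so that the order of summation
   can be exchanged. *)
have -> : \rsum_(1 <= n < X.+1) g n =
  \rsum_(1 <= n < X.+1) \rsum_(1 <= j < X.+1) (if (n == rad n * j)%N then g n else 0).
  apply: eq_big_seq => n; rewrite mem_index_iota => /andP [n0 nX].
  have rdv := rad_dvd n0.
  have e : (n = rad n * (n %/ rad n))%N by rewrite mulnC divnK.
  rewrite (bigD1_seq (n %/ rad n)%N) ?iota_uniq //=; last first.
    by rewrite mem_index_iota divn_gt0 ?rad_gt0 // dvdn_leq //= ltnS; have := leq_div n (rad n); lia.
  rewrite -e eqxx big1_seq ?Rplus_0_r // => j /andP [/eqP hj _].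
  case: eqP => // h; case: hj; apply/eqP.
  by rewrite -(eqn_pmul2l (rad_gt0 n)) -e -h.
rewrite exchange_big /=; apply: eq_big_seq => j; rewrite mem_index_iota => /andP [j0 _].
have rj := INR_gt0 j0; set B := nfloor (Rpower (INR j) (theta / (1 - theta))).
have pB : 0 <= Rpower (INR j) (theta / (1 - theta)) by left; exact: exp_pos.
have -> : nfloor (Yj (theta / (1 - theta)) x j) = minn (X %/ j) B.
  rewrite /Yj nfloor_min //; last by apply: Rdiv_le_0_compat; lra.
  by rewrite nfloor_div //; lra.
rewrite /Qc -rsum_cond_le.
have -> : \rsum_(1 <= n < X.+1) (if (n == rad n * j)%N then g n else 0) =
  \rsum_(1 <= n < X.+1) (if (j %| n)%N then (if (n == rad n * j)%N then g n else 0) else 0).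
  apply: eq_bigr => n _; case: eqP => [h|_]; last by case: ifP.
  by rewrite {2}h dvdn_mull.
rewrite (rsum_multiples_le X (fun n => if (n == rad n * j)%N then g n else 0) j0).
apply: eq_big_seq => k; rewrite mem_index_iota => /andP [k0 _].
rewrite mulnC eqn_pmul2r //; case: eqP => [h|_]; last by case: ifP.
rewrite /g -h; have rk := INR_gt0 k0.
(* In logarithms both sides read [(1 - theta) ln k <= theta ln j]. *)
have hiff : INR k <= Rpower (INR (k * j)) theta <-> INR k <= Rpower (INR j) (theta / (1 - theta)).
  rewrite Rpower_INR_mul // /Rpower -{1 3}(exp_ln (INR k)) // -exp_plus.
  have e : (1 - theta) * (theta / (1 - theta) * ln (INR j)) = theta * ln (INR j) by field; lra.
  have t2 : 0 < 1 - theta by lra.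
  split=> H; apply: exp_le.
    case: (Rle_lt_dec (ln (INR k)) (theta / (1 - theta) * ln (INR j))) => // hlt.
    have := Rmult_lt_compat_l _ _ _ t2 hlt; rewrite e.
    have : ln (INR k) <= theta * ln (INR k) + theta * ln (INR j).
      by apply: Rnot_lt_le => /exp_increasing; lra.
    lra.
  have H2 : ln (INR k) <= theta / (1 - theta) * ln (INR j).
    by apply: Rnot_lt_le => /exp_increasing; lra.
  have := Rmult_le_compat_l _ _ _ (Rlt_le _ _ t2) H2; rewrite e; lra.
case: Rle_dec => hk /=.
  by rewrite leq_nfloor //; apply/hiff.
case: ifP => // /leq_INR hB; case: hk; apply/hiff.
by apply: Rle_trans hB _; case: (nfloor_bounds pB).
Qed.

Lemma cube_le_exp x : 0 <= x -> (1 + x) ^ 3 <= 216 * exp (x / 2).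
Proof.
move=> h; have -> : exp (x / 2) = exp (x / 6) ^ 3.
  by rewrite /= Rmult_1_r -!exp_plus; congr exp; field.
have -> : 216 * exp (x / 6) ^ 3 = (6 * exp (x / 6)) ^ 3 by ring.
apply: pow_incr; have := exp_ge1p (x / 6); lra.
Qed.

Lemma sq_le_exp x : 0 <= x -> (1 + x) ^ 2 <= 16 * exp (x / 2).
Proof.
move=> h; have -> : exp (x / 2) = exp (x / 4) ^ 2.
  by rewrite /= Rmult_1_r -!exp_plus; congr exp; field.
have -> : 16 * exp (x / 4) ^ 2 = (4 * exp (x / 4)) ^ 2 by ring.
apply: pow_incr; have := exp_ge1p (x / 4); lra.
Qed.

(** * Bounds for the characteristic function *)

(** Bounds the third moment at a prime, since [lam a p * ln p <= ln p + 1 / a]. *)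
Definition mom3 (a : R) (n : nat) := if prime n then qp a n * (ln (INR n) + / a) ^ 3 else 0.

Section Moments.
Variable a : R.
Hypothesis a0 : 0 < a.
Let L := - ln a.
Hypothesis hL : 1000 <= L.

Lemma mom3_ge0 n : 0 <= mom3 a n.
Proof.
rewrite /mom3; case: ifP => pn; last lra.
have [q0 _] := qp_bounds a0 pn; have := ln_prime_gt0 pn; have := Rinv_0_lt_compat _ a0 => h1 h2.
by apply: Rmult_le_pos; [lra | apply: pow_le; lra].
Qed.

Lemma inv_a_ge2 : 2 <= / a.
Proof. by rewrite (inv_a_expL a0) -/L; have := exp_ge1p L; lra. Qed.

Lemma ln_inv_a : ln (/ a) = L.
Proof. by rewrite ln_Rinv. Qed.

Lemma aL_le1 : a * L <= 1 / 100.
Proof.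
have h := @aL3_le a a0 ltac:(rewrite -/L; lra); rewrite -/L in h.
have : 100 * (a * L) <= a * L ^ 3.
  have -> : a * L ^ 3 = L ^ 2 * (a * L) by ring.
  by apply: Rmult_le_compat_r; nra.
lra.
Qed.

(** Up to [1 / a] each term is at most [8 / a^3] and the prime count gives the factor [1 / (a L)].
    Beyond, the decay [exp (- a ln p / 2)] of [qp] absorbs [(1 + a ln p)^3] and leaves a multiple of
    [plog / a^4]. *)
Lemma mom3_sum k : \rsum_(0 <= n < k) mom3 a n <= 23000 / (a ^ 4 * L).
Proof.
have ia2 := inv_a_ge2; have [[ly1 ly2] hy] := exp_nfloor_ln ia2.
have [fy1 fy2] := @nfloor_bounds (/ a) ltac:(lra).
rewrite ln_inv_a in ly1 ly2; set y := nfloor (/ a) in ly1 ly2 hy fy1 fy2.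
have aL := aL_le1.
have ly3 : L / 2 <= ln (INR y) by lra.
have P1 : \rsum_(0 <= n < y.+1) mom3 a n <= 4800 / (a ^ 4 * L).
  apply: (@Rle_trans _ (8 / a ^ 3 * \rsum_(0 <= n < y.+1 | prime n) 1)).
    rewrite rsumM /mom3 -big_mkcond; apply: rsum_le => p; rewrite mem_index_iota => /andP [_ hp] pp.
    have [q0 q1] := qp_bounds a0 pp; have lp := ln_prime_gt0 pp.
    have h1 : ln (INR p) <= L.
      have : ln (INR p) <= ln (INR y) by apply: ln_le; [apply: INR_gt0; exact: prime_gt0 | apply: leq_INR; lia].
      lra.
    have h2 : L <= / a by rewrite (inv_a_expL a0) -/L; have := exp_ge1p L; lra.
    have h3 : (ln (INR p) + / a) ^ 3 <= (2 * / a) ^ 3 by apply: pow_incr; lra.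
    have -> : 8 / a ^ 3 * 1 = (2 * / a) ^ 3 by field; lra.
    have h4 : 0 <= (ln (INR p) + / a) ^ 3 by apply: pow_le; lra.
    nra.
  have t2 := prime_count_le hy.
  have t4 : 300 * (INR y / ln (INR y)) <= 600 / (a * L).
    have -> : 600 / (a * L) = 300 * (/ a * / (L / 2)) by field; lra.
    apply: Rmult_le_compat_l; first lra.
    apply: Rmult_le_compat; [exact: pos_INR | by left; apply: Rinv_0_lt_compat; lra | lra |].
    by apply: Rinv_le_contravar; lra.
  have -> : 4800 / (a ^ 4 * L) = 8 / a ^ 3 * (600 / (a * L)) by field; lra.
  apply: Rmult_le_compat_l; last lra.
  by apply: Rdiv_le_0_compat; [lra | exact: pow_lt].
have P2 N : \rsum_(y.+1 <= n < N) mom3 a n <= 17712 / (a ^ 4 * L).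
  apply: (@Rle_trans _ (216 / a ^ 4 * \rsum_(y.+1 <= n < N) plog n)).
    rewrite rsumM; apply: rsum_nat_le => n _; rewrite /mom3 /plog; case: ifP => pn; last lra.
    have [q0 q1] := qp_bounds a0 pn; have lp := ln_prime_gt0 pn; have p2 := INR_prime_ge2 pn.
    have xp := alnp_gt0 a0 pn.
    have h1 := cube_le_exp (Rlt_le _ _ xp); have h2 := qp_le a0 pn.
    set x := a * ln (INR n) in xp h1 h2.
    have -> : (ln (INR n) + / a) ^ 3 = (1 + x) ^ 3 / a ^ 3 by rewrite /x; field; lra.
    have e : exp (- (x / 2)) * exp (x / 2) = 1 by rewrite -exp_plus Rplus_opp_l exp_0.
    apply: (@Rle_trans _ (/ (a * (INR n * ln (INR n))) * exp (- (x / 2)) * (216 * exp (x / 2) / a ^ 3))).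
      apply: Rmult_le_compat => //; first lra.
        by apply: Rdiv_le_0_compat; [apply: pow_le; lra | exact: pow_lt].
      by apply: Rmult_le_compat_r => //; left; apply: Rinv_0_lt_compat; exact: pow_lt.
    have -> : / (a * (INR n * ln (INR n))) * exp (- (x / 2)) * (216 * exp (x / 2) / a ^ 3) =
      216 * (exp (- (x / 2)) * exp (x / 2)) / a ^ 4 * / (INR n * ln (INR n)) by field; lra.
    by rewrite e Rmult_1_r; lra.
  have := @prime_sum_inv_log_le y N hy; rewrite -rsum_plog => h.
  have h2 : 41 / ln (INR y) <= 82 / L.
    have -> : 82 / L = 41 * / (L / 2) by field; lra.
    by apply: Rmult_le_compat_l; [lra | apply: Rinv_le_contravar; lra].
  have -> : 17712 / (a ^ 4 * L) = 216 / a ^ 4 * (82 / L) by field; lra.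
  apply: Rmult_le_compat_l; last lra.
  by apply: Rdiv_le_0_compat; [lra | exact: pow_lt].
have tot : 4800 / (a ^ 4 * L) + 17712 / (a ^ 4 * L) <= 23000 / (a ^ 4 * L).
  have : 0 < / (a ^ 4 * L) by apply: Rinv_0_lt_compat; apply: Rmult_lt_0_compat; [exact: pow_lt | lra].
  rewrite /Rdiv; lra.
apply: (@Rle_trans _ (\rsum_(0 <= n < y.+1 + k) mom3 a n)).
  by apply: rsum_sub_range => //; [exact: mom3_ge0 | lia].
rewrite (@big_cat_nat _ _ _ y.+1 0 (y.+1 + k)) //=; last by lia.
exact: Rle_trans (Rplus_le_compat _ _ _ _ P1 (P2 _)) tot.
Qed.

(** The first bound makes second moments summable through [mom3_sum]; the second keeps every single
    deviation below 1 in [re_prod]. *)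
Lemma mom2_le n : prime n -> qp a n * (ln (INR n) + / a) ^ 2 <= a * mom3 a n /\
  qp a n * (ln (INR n) + / a) ^ 2 <= 16 / a ^ 2.
Proof.
move=> pn; rewrite /mom3 pn.
have [q0 q1] := qp_bounds a0 pn; have lp := ln_prime_gt0 pn; have p2 := INR_prime_ge2 pn.
have ia := Rinv_0_lt_compat _ a0; have xp := alnp_gt0 a0 pn.
have iaa : a * / a = 1 by rewrite Rinv_r; lra.
split.
  have -> : a * (qp a n * (ln (INR n) + / a) ^ 3) =
    qp a n * (ln (INR n) + / a) ^ 2 * (a * ln (INR n) + a * / a) by ring.
  rewrite iaa.
  have : 0 <= qp a n * (ln (INR n) + / a) ^ 2 by apply: Rmult_le_pos; [lra | apply: pow_le; lra].
  nra.
have h1 := sq_le_exp (Rlt_le _ _ xp); have h2 := qp_le a0 pn.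
set x := a * ln (INR n) in xp h1 h2.
have -> : (ln (INR n) + / a) ^ 2 = (1 + x) ^ 2 / a ^ 2 by rewrite /x; field; lra.
have -> : qp a n * ((1 + x) ^ 2 / a ^ 2) = qp a n * (1 + x) ^ 2 / a ^ 2 by field; lra.
apply: Rmult_le_compat_r; first by left; apply: Rinv_0_lt_compat; exact: pow_lt.
have sq0 : 0 <= (1 + x) ^ 2 by apply: pow_le; lra.
case: (Rle_lt_dec x 1) => hx; first by nra.
have e : exp (- (x / 2)) * exp (x / 2) = 1 by rewrite -exp_plus Rplus_opp_l exp_0.
have hq : qp a n <= exp (- (x / 2)).
  apply: Rle_trans h2 _.
  have : / (a * (INR n * ln (INR n))) <= 1.
    have -> : a * (INR n * ln (INR n)) = INR n * x by rewrite /x; ring.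
    by rewrite -Rinv_1; apply: Rinv_le_contravar; nra.
  have := exp_pos (- (x / 2)); nra.
have := exp_pos (- (x / 2)) => ep.
apply: (@Rle_trans _ (exp (- (x / 2)) * (16 * exp (x / 2)))).
  by apply: Rmult_le_compat; lra.
have -> : exp (- (x / 2)) * (16 * exp (x / 2)) = 16 * (exp (- (x / 2)) * exp (x / 2)) by ring.
by rewrite e; lra.
Qed.

Lemma im_sum t k : 0 <= t -> \rsum_(0 <= n < k) Rabs (snd (aph a t n)) <= 69000 * t ^ 3 / (a ^ 4 * L).
Proof.
move=> t0.
apply: (@Rle_trans _ (3 * t ^ 3 * \rsum_(0 <= n < k) mom3 a n)).
  rewrite rsumM; apply: rsum_nat_le => n _; rewrite /aph /mom3; case: ifP => pn; last first.
    by rewrite /= Rabs_R0; lra.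
  apply: Rle_trans (aphp_im a0 t0 pn) _.
  have [q0 q1] := qp_bounds a0 pn; have hl := lam_ln_le a0 pn; have l1 := lam_ge1 a0 pn.
  have lp := ln_prime_gt0 pn.
  have -> : 3 * qp a n * (lam a n * (t * ln (INR n))) ^ 3 =
    3 * t ^ 3 * (qp a n * (lam a n * ln (INR n)) ^ 3) by ring.
  apply: Rmult_le_compat_l; first by have := pow_le t 3 t0; lra.
  apply: Rmult_le_compat_l; first lra.
  apply: pow_incr; nra.
have -> : 69000 * t ^ 3 / (a ^ 4 * L) = 3 * t ^ 3 * (23000 / (a ^ 4 * L)) by field; lra.
apply: Rmult_le_compat_l; last exact: mom3_sum.
by have := pow_le t 3 t0; lra.
Qed.

(** The restriction [t <= a / 10] makes each deviation at most 48/100, so that all real parts are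
    positive and the product inequality applies. *)
Lemma re_prod t k : 0 <= t <= a / 10 ->
  0 <= \rprod_(0 <= n < k) fst (aph a t n) /\
  1 - 69000 * t ^ 2 / (a ^ 3 * L) <= \rprod_(0 <= n < k) fst (aph a t n).
Proof.
move=> [t0 t1].
pose w n := if prime n then 3 * t ^ 2 * (qp a n * (ln (INR n) + / a) ^ 2) else 0.
have hw n : 0 <= w n <= 1 /\ 1 - w n <= fst (aph a t n) /\ w n <= 3 * t ^ 2 * a * mom3 a n.
  rewrite /w /aph; case: (boolP (prime n)) => pn; last first.
    by rewrite /mom3 (negbTE pn) /=; lra.
  have [q0 q1] := qp_bounds a0 pn; have hl := lam_ln_le a0 pn; have l1 := lam_ge1 a0 pn.
  have lp := ln_prime_gt0 pn; have [m1 m2] := mom2_le pn.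
  have ia := Rinv_0_lt_compat _ a0.
  have t20 := pow_le t 2 t0.
  have z0 : 0 <= qp a n * (ln (INR n) + / a) ^ 2 by apply: Rmult_le_pos; [lra | apply: pow_le; lra].
  split; first split.
  - by apply: Rmult_le_pos; lra.
  - have : t ^ 2 <= (a / 10) ^ 2 by apply: pow_incr; lra.
    move=> h; apply: (@Rle_trans _ (3 * (a / 10) ^ 2 * (16 / a ^ 2))).
      by apply: Rmult_le_compat; lra.
    have -> : 3 * (a / 10) ^ 2 * (16 / a ^ 2) = 48 / 100 by field; lra.
    lra.
  split.
    apply: Rle_trans (aphp_re a0 t0 pn).
    suff : 3 * qp a n * (lam a n * (t * ln (INR n)) * (lam a n * (t * ln (INR n)))) <=
      3 * t ^ 2 * (qp a n * (ln (INR n) + / a) ^ 2) by lra.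
    have -> : 3 * qp a n * (lam a n * (t * ln (INR n)) * (lam a n * (t * ln (INR n)))) =
      3 * t ^ 2 * (qp a n * (lam a n * ln (INR n)) ^ 2) by ring.
    apply: Rmult_le_compat_l; first lra.
    apply: Rmult_le_compat_l; first lra.
    by apply: pow_incr; nra.
  have -> : 3 * t ^ 2 * a * mom3 a n = 3 * t ^ 2 * (a * mom3 a n) by ring.
  by apply: Rmult_le_compat_l; lra.
have hp : \rprod_(0 <= n < k) (1 - w n) <= \rprod_(0 <= n < k) fst (aph a t n).
  by apply: rprod_le => n _; have := hw n; lra.
have hp0 : 0 <= \rprod_(0 <= n < k) (1 - w n) by apply: rprod_ge0 => n _; have := hw n; lra.
have [hp1 _] := @rprod_ge_1sub _ (index_iota 0 k) w (fun n _ => proj1 (hw n)).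
split; first lra.
apply: Rle_trans hp; apply: Rle_trans hp1.
suff hs : \rsum_(0 <= n < k) w n <= 69000 * t ^ 2 / (a ^ 3 * L).
  by apply: Rplus_le_compat_l; apply: Ropp_le_contravar.
apply: (@Rle_trans _ (3 * t ^ 2 * a * \rsum_(0 <= n < k) mom3 a n)).
  by rewrite rsumM; apply: rsum_nat_le => n _; have := hw n; lra.
have -> : 69000 * t ^ 2 / (a ^ 3 * L) = 3 * t ^ 2 * a * (23000 / (a ^ 4 * L)) by field; lra.
apply: Rmult_le_compat_l; last exact: mom3_sum.
by have := pow_le t 2 t0; nra.
Qed.

(** Only primes between [1 / a] and [1 / a^2] are used. There [L <= ln p <= 2 L], so [a ln p] is
    small, [t ln p <= 1], and [1 / (p ln p)] sums to at least [1 / (4 L)]. *)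
Lemma eg_sum_lower t : 0 <= t -> 2 * t * L <= 1 ->
  exists K, forall k, (K <= k)%N -> t ^ 2 / (64 * a * (a ^ 2 + t ^ 2) * L) <= \rsum_(0 <= n < k) eg a t n.
Proof.
move=> t0 tL.
have ia2 := inv_a_ge2; have [[ly1 ly2] hy] := exp_nfloor_ln ia2.
have [fy1 fy2] := @nfloor_bounds (/ a) ltac:(lra).
rewrite ln_inv_a in ly1 ly2; set y := nfloor (/ a) in ly1 ly2 hy fy1 fy2.
have W2 : 2 <= / a * / a by nra.
have lnW : ln (/ a * / a) = 2 * L by rewrite ln_mult ?ln_inv_a; [ring | lra | lra].
have [[lw1 lw2] hwn] := exp_nfloor_ln W2.
have [fw1 fw2] := @nfloor_bounds (/ a * / a) ltac:(lra).
rewrite lnW in lw1 lw2; set w := nfloor (/ a * / a) in lw1 lw2 hwn fw1 fw2.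
have aL := aL_le1.
have yw : (y <= w)%N.
  apply: INR_leq; apply: Rlt_le; apply: ln_lt_inv; [apply: INR_gt0; lia | apply: INR_gt0; lia|].
  by lra.
have at0 : 0 < a ^ 2 + t ^ 2 by have := pow_lt a 2 a0; have := pow_le t 2 t0; lra.
set c := t ^ 2 / (16 * a * (a ^ 2 + t ^ 2)).
have c0 : 0 <= c by apply: Rdiv_le_0_compat; [exact: pow_le | apply: Rmult_lt_0_compat; lra].
have hp n : (y < n <= w)%N -> prime n -> c * / (INR n * ln (INR n)) <= egain a t n.
  move=> /andP [h1 h2] pn.
  have p2 := INR_prime_ge2 pn; have lp := ln_prime_gt0 pn; have xp := alnp_gt0 a0 pn.
  have pY : / a <= INR n by have := leq_INR h1; rewrite S_INR; lra.
  have pa : 1 <= INR n * a.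
    have : / a * a <= INR n * a by apply: Rmult_le_compat_r; lra.
    by rewrite Rinv_l; lra.
  have lnp1 : L <= ln (INR n).
    have : ln (/ a) <= ln (INR n) by apply: ln_le; lra.
    by rewrite ln_inv_a.
  have lnp2 : ln (INR n) <= 2 * L.
    have : ln (INR n) <= ln (INR w) by apply: ln_le; [lra | apply: leq_INR].
    lra.
  have x1 : a * ln (INR n) <= 1 / 2 by nra.
  have [r0 r1] := rho_bounds a0 pn.
  have r2 : 1 - a * ln (INR n) <= rho a n by rewrite rho_alnp; have := exp_ge1p (- (a * ln (INR n))); lra.
  have [q0 q1] := qp_bounds a0 pn.
  have q2 : / (4 * (a * (INR n * ln (INR n)))) <= qp a n.
    have u2 := @exp_sub1_le2 (a * ln (INR n)) ltac:(lra); rewrite -Rpower_alnp in u2.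
    have u1 := pow_sub1_gt0 a0 pn.
    apply: Rinv_le_contravar; first by nra.
    have : (INR n + 1) * (Rpower (INR n) a - 1) <= (INR n + 1) * (2 * (a * ln (INR n))).
      by apply: Rmult_le_compat_l; lra.
    have : 1 <= a * (INR n * ln (INR n)).
      have -> : a * (INR n * ln (INR n)) = INR n * a * ln (INR n) by ring.
      by nra.
    nra.
  have hx0 : 0 <= t * ln (INR n) <= 1 by split; [apply: Rmult_le_pos; lra | nra].
  have c1 := one_sub_cos_ge hx0; have [c2 c3] := one_sub_cos_le (t * ln (INR n)).
  have hd := pden_gt0 t a0 pn.
  have hd2 : pden a t n <= (a ^ 2 + t ^ 2) * ln (INR n) ^ 2.
    rewrite /pden.
    have : (1 - rho a n) * (1 - rho a n) <= (a * ln (INR n)) * (a * ln (INR n)) by apply: Rmult_le_compat; lra.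
    have : 2 * rho a n * (1 - cos (t * ln (INR n))) <= 2 * 1 * (t * ln (INR n) * (t * ln (INR n)) / 2).
      by apply: Rmult_le_compat; lra.
    rewrite /=; lra.
  rewrite /egain; apply: le_divr => //.
  apply: (@Rle_trans _ (c * / (INR n * ln (INR n)) * ((a ^ 2 + t ^ 2) * ln (INR n) ^ 2))).
    apply: Rmult_le_compat_l => //; apply: Rmult_le_pos => //.
    by left; apply: Rinv_0_lt_compat; nra.
  have -> : c * / (INR n * ln (INR n)) * ((a ^ 2 + t ^ 2) * ln (INR n) ^ 2) =
    2 * / (4 * (a * (INR n * ln (INR n)))) * (t * ln (INR n) * (t * ln (INR n)) / 4) * (1 / 2).
    by rewrite /c; field; lra.
  have i0 : 0 < / (4 * (a * (INR n * ln (INR n)))) by apply: Rinv_0_lt_compat; nra.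
  have s0 : 0 <= t * ln (INR n) * (t * ln (INR n)) / 4.
    by have := Rle_0_sqr (t * ln (INR n)); rewrite /Rsqr; lra.
  apply: Rmult_le_compat; [by apply: Rmult_le_pos; lra | lra | | lra].
  by apply: Rmult_le_compat; lra.
exists w.+1 => k hk.
apply: (@Rle_trans _ (\rsum_(y.+1 <= n < w.+1) eg a t n)); last first.
  by apply: rsum_sub_range => // i; have := eg_bounds a0 t i; lra.
apply: (@Rle_trans _ (c * \rsum_(y.+1 <= n < w.+1) plog n)); last first.
  rewrite rsumM; apply: rsum_nat_le => i /andP [h1 h2].
  by rewrite /plog /eg; case: ifP => pi; [apply: hp => //; lia | lra].
have := prime_sum_inv_log hy yw.
rewrite -rsum_plog => /Rabs_le_between [h _].
set S := \rsum_(y.+1 <= n < w.+1) plog n in h *.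
have -> : t ^ 2 / (64 * a * (a ^ 2 + t ^ 2) * L) = c * (/ L / 4) by rewrite /c; field; lra.
apply: Rmult_le_compat_l => //.
have h1 : / L <= / ln (INR y) by apply: Rinv_le_contravar; lra.
have h2 : / ln (INR w) <= / (2 * L - 1) by apply: Rinv_le_contravar; lra.
have h3 : 20 / ln (INR y) ^ 2 <= 20 * / (L - 1) ^ 2.
  apply: Rmult_le_compat_l; first lra.
  apply: Rinv_le_contravar; first by apply: pow_lt; lra.
  by apply: pow_incr; lra.
have h4 : / (2 * L - 1) <= 6 / 10 * / L.
  have -> : 6 / 10 * / L = / (10 / 6 * L) by field; lra.
  by apply: Rinv_le_contravar; lra.
have h5 : 20 * / (L - 1) ^ 2 <= 1 / 10 * / L.
  have -> : 1 / 10 * / L = 20 * / (200 * L) by field; lra.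
  apply: Rmult_le_compat_l; first lra.
  by apply: Rinv_le_contravar; rewrite /=; nra.
have iL0 : 0 < / L by apply: Rinv_0_lt_compat; lra.
move: h h1 h2 h3 h4 h5; set A1 := 20 / _; set A2 := / ln (INR y); set A3 := / ln (INR w).
by move=> *; lra.
Qed.

End Moments.

(** * The range of large frequencies *)

Lemma exp_dominates (C e : R) (k : nat) : 0 < e ->
  exists L0, 0 < L0 /\ forall L, L0 <= L -> C * L ^ k <= exp (e * L).
Proof.
move=> e0; have k0 := INR_gt0 (ltn0Sn k).
set f := (e / INR k.+1) ^ k.+1.
have f0 : 0 < f by apply: pow_lt; apply: Rdiv_lt_0_compat.
exists (Rabs C / f + 1); split; first by have := Rdiv_le_0_compat _ _ (Rabs_pos C) f0; lra.
move=> L hL.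
have L0 : 0 < L by have := Rdiv_le_0_compat _ _ (Rabs_pos C) f0; lra.
have -> : exp (e * L) = exp (e * L / INR k.+1) ^ k.+1.
  have H m x : exp x ^ m = exp (INR m * x).
    elim: m => [|m IH]; first by rewrite INR0 Rmult_0_l exp_0.
    by rewrite S_INR -tech_pow_Rmult IH -exp_plus; congr exp; ring.
  by rewrite H; congr exp; field; lra.
apply: (@Rle_trans _ ((e * L / INR k.+1) ^ k.+1)); last first.
  apply: pow_incr; split; last by have := exp_ge1p (e * L / INR k.+1); lra.
  by left; apply: Rdiv_lt_0_compat; [apply: Rmult_lt_0_compat|].
have -> : (e * L / INR k.+1) ^ k.+1 = f * L * L ^ k.
  have -> : e * L / INR k.+1 = e / INR k.+1 * L by field; lra.
  by rewrite Rpow_mult_distr -/f -(tech_pow_Rmult L k); ring.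
apply: Rmult_le_compat_r; first by apply: pow_le; lra.
apply: Rle_trans (Rle_abs C) _.
have : f * (Rabs C / f) <= f * L by apply: Rmult_le_compat_l; lra.
have -> : f * (Rabs C / f) = Rabs C by field; lra.
by [].
Qed.

(* Half of [|1 - exp (i t ln n)|], a seminorm in [ln n]: subadditive under multiplication of integers. *)
Definition dph (t : R) (n : nat) := Rabs (sin (t * ln (INR n) / 2)).

Lemma Rabs_sin_add x y : Rabs (sin (x + y)) <= Rabs (sin x) + Rabs (sin y).
Proof.
rewrite sin_plus; apply: Rle_trans (Rabs_triang _ _) _; rewrite !Rabs_mult.
have h1 : Rabs (cos y) <= 1 by apply: Rabs_le; exact: COS_bound.
have h2 : Rabs (cos x) <= 1 by apply: Rabs_le; exact: COS_bound.
have := Rabs_pos (sin x); have := Rabs_pos (sin y); nra.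
Qed.

Lemma dph_ge0 t n : 0 <= dph t n.
Proof. exact: Rabs_pos. Qed.

Lemma dph_le1 t n : dph t n <= 1.
Proof. by apply: Rabs_le; exact: SIN_bound. Qed.

Lemma dph_mul t m n : (0 < m)%N -> (0 < n)%N -> dph t (m * n) <= dph t m + dph t n.
Proof.
move=> m0 n0; rewrite /dph INR_muln ln_mult; [|exact: INR_gt0|exact: INR_gt0].
have -> : t * (ln (INR m) + ln (INR n)) / 2 = t * ln (INR m) / 2 + t * ln (INR n) / 2 by field.
exact: Rabs_sin_add.
Qed.

Lemma dph1 t : dph t 1 = 0.
Proof. by rewrite /dph INR1 ln_1 Rmult_0_r /Rdiv Rmult_0_l sin_0 Rabs_R0. Qed.

Lemma dph_factor t m N : (0 < m)%N -> (m < N)%N ->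
  dph t m <= \rsum_(0 <= p < N | prime p) (INR (logn p m) * dph t p).
Proof.
elim/ltn_ind: m => m IH m0 mN.
case: (ltngtP m 1) => hm; [lia| |].
  set q := pdiv m; have pq : prime q by apply: pdiv_prime.
  have q0 := prime_gt0 pq; have q1 := prime_gt1 pq.
  have hq : (m = q * (m %/ q))%N by rewrite mulnC divnK // pdiv_dvd.
  set k := (m %/ q)%N in hq.
  have k0 : (0 < k)%N by rewrite lt0n; apply/eqP => k0; move: hq m0; rewrite k0 muln0; lia.
  have km : (k < m)%N by apply: ltn_Pdiv.
  have qm : (q <= m)%N by apply: pdiv_leq.
  rewrite [in X in X <= _]hq; apply: Rle_trans (dph_mul t q0 k0) _.
  apply: Rle_trans (Rplus_le_compat_l _ _ _ (IH k km k0 ltac:(lia))) _.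
  have -> : dph t q = \rsum_(0 <= p < N | prime p) (INR (p == q) * dph t p).
    rewrite big_mkcond (bigD1_seq q) /= ?iota_uniq //; last by rewrite mem_index_iota; lia.
    rewrite pq eqxx big1; first by rewrite Rmult_1_l Rplus_0_r.
    by move=> p /negbTE ->; case: ifP => _ //; rewrite (_ : INR false = 0) // Rmult_0_l.
  rewrite -big_split; right; apply: eq_bigr => p pp /=.
  by rewrite [in RHS]hq lognM // (@logn_prime p q) // INR_addn Rmult_plus_distr_r.
rewrite hm dph1; apply: rsum_ge0 => p _ _.
by apply: Rmult_le_pos; [exact: pos_INR | exact: dph_ge0].
Qed.

Lemma sum_logn_fact p M : prime p -> \rsum_(1 <= m < M.+1) INR (logn p m) = INR (logn p M`!).
Proof.
move=> pp; elim: M => [|M IH]; first by rewrite big_geq // logn1.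
by rewrite big_nat_recr //= IH factS lognM ?fact_gt0 // INR_addn Rplus_comm.
Qed.

(** Subadditivity along the prime factorisation; summed over [m], the exponents of [p] become the
    exponent of [p] in [M!], at most [M / (p - 1)]. *)
Lemma dph_sum_upper t (B : seq nat) M : all prime B ->
  \rsum_(1 <= m < M.+1) (if dfree B m then dph t m else 0) <=
  INR M * \rsum_(0 <= p < M.+1) (if prime p && (p \notin B) then dph t p / (INR p - 1) else 0).
Proof.
move=> hB.
apply: (@Rle_trans _ (\rsum_(1 <= m < M.+1) \rsum_(0 <= p < M.+1)
    (if prime p && (p \notin B) then INR (logn p m) * dph t p else 0))).
  apply: rsum_nat_le => m /andP [m0 mM].
  have z p : 0 <= (if prime p && (p \notin B) then INR (logn p m) * dph t p else 0).
    by case: ifP => _; [apply: Rmult_le_pos; [exact: pos_INR | exact: dph_ge0] | lra].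
  case: ifP => hf; last by apply: rsum_nat_ge0.
  apply: Rle_trans (dph_factor t m0 mM) _.
  rewrite big_mkcond; apply: rsum_nat_le => p _.
  case: (boolP (prime p)) => pp /=; last lra.
  case: (boolP (p \in B)) => pB /=; last lra.
  move/allP: hf => /(_ p pB) h; rewrite lognE (negbTE h) !andbF INR0; lra.
rewrite exchange_big /= rsumM; apply: rsum_nat_le => p _.
case: (boolP (prime p)) => pp /=; last by rewrite big1 //; lra.
case: (boolP (p \in B)) => pB /=; first by rewrite big1 //; lra.
have -> : \rsum_(1 <= i < M.+1) (INR (logn p i) * dph t p) = dph t p * INR (logn p M`!).
  rewrite -(sum_logn_fact M pp) rsumM; apply: eq_bigr => i _; ring.
have := Rmult_le_compat_l _ _ _ (dph_ge0 t p) (logn_fact_le M pp).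
by rewrite /Rdiv; lra.
Qed.

Lemma count_le_real (y : R) N : 0 <= y ->
  \rsum_(1 <= n < N.+1) (if Rle_dec (INR n) y then 1 else 0) <= y.
Proof.
move=> y0.
have H : \rsum_(1 <= n < N.+1) (if Rle_dec (INR n) y then 1 else 0) <= INR N /\
  \rsum_(1 <= n < N.+1) (if Rle_dec (INR n) y then 1 else 0) <= y.
  elim: N => [|N [IH1 IH2]]; first by rewrite big_geq // INR0; lra.
  rewrite big_nat_recr //=; case: (Rle_dec (INR N.+1) y) => h /=; rewrite ?S_INR in h *; lra.
by case: H.
Qed.

(** Since [g] is a multiple of every element of [B], [n] and [n + g] are free of [B] together. Their
    phases differ by [t ln (1 + g / n)], which for [delta N < n <= N] lies between
    [delta / 4 * min (1, t)] and 1; so the two values of [dph] cannot both be small. *)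
Lemma phase_lower (B : seq nat) (t delta : R) (N g : nat) :
  0 < t -> 0 < delta < 1 -> (g <= N)%N -> (0 < N)%N -> (forall b, b \in B -> (b %| g)%N) ->
  INR g * Rmax 1 t <= delta * INR N <= 2 * (INR g * Rmax 1 t) ->
  (scnt B N - delta * INR N) * (delta / 16 * Rmin 1 t) <=
  2 * \rsum_(1 <= m < (2 * N).+1) (if dfree B m then dph t m else 0).
Proof.
move=> t0 [dl0 dl1] gN N0 hB [hg1 hg2].
set S := \rsum_(1 <= m < (2 * N).+1) _.
have Npos := INR_gt0 N0.
have m0 : 0 < Rmin 1 t by apply: Rmin_glb_lt; lra.
have M1 : 1 <= Rmax 1 t by apply: Rmax_l.
have Mt : t <= Rmax 1 t by apply: Rmax_r.
have Mm : t = Rmax 1 t * Rmin 1 t.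
  case: (Rle_lt_dec 1 t) => h; first by rewrite Rmax_right ?Rmin_left; lra.
  by rewrite Rmax_left ?Rmin_right; lra.
set M := Rmax 1 t in hg1 hg2 M1 Mt Mm; set mn := Rmin 1 t in m0 Mm *.
have g0 : 0 <= INR g := pos_INR g.
pose ind n := if dfree B n then (if Rle_dec (INR n) (delta * INR N) then 0 else 1) else 0.
have hfree n : dfree B (n + g) = dfree B n.
  by apply: eq_in_all => b /hB hb; rewrite dvdn_addl.
have step n : (1 <= n < N.+1)%N ->
   ind n * (delta / 16 * mn) <= (if dfree B n then dph t n else 0) + (if dfree B (n + g) then dph t (n + g) else 0).
  move=> /andP [n0 nN]; rewrite hfree /ind; case: ifP => hf; last by lra.
  have := dph_ge0 t n; have := dph_ge0 t (n + g).
  case: Rle_dec => hn d1 d2 /=; first by lra.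
  have np := INR_gt0 n0.
  have nd : delta * INR N < INR n by lra.
  have nN' : INR n <= INR N by apply: leq_INR; lia.
  set s := INR g / INR n.
  have s0 : 0 <= s by apply: Rdiv_le_0_compat.
  have sM : s * M <= 1.
    have -> : s * M = INR g * M / INR n by rewrite /s; field; lra.
    by apply: divr_le; lra.
  have s1 : s <= 1 by nra.
  (* The phase gap; being at most 1, it cannot wrap around a multiple of [2 PI]. *)
  set psi := t * ln (INR (n + g)) - t * ln (INR n).
  have epsi : psi = t * ln (1 + s).
    have -> : 1 + s = INR (n + g) / INR n by rewrite /s INR_addn; field; lra.
    rewrite ln_div //; [rewrite /psi; ring | rewrite INR_addn; lra].
  have l1 : ln (1 + s) <= s by have := @ln_le_sub1 (1 + s) ltac:(lra); lra.
  have l2 : s / 2 <= ln (1 + s).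
    apply: Rle_trans (@ln_ge_1sub (1 + s) ltac:(lra)).
    have -> : 1 - / (1 + s) = s / (1 + s) by field; lra.
    apply: Rmult_le_compat_l => //; apply: Rinv_le_contravar; lra.
  have p1 : psi <= 1 by rewrite epsi; nra.
  have p2 : delta / 4 * mn <= psi.
    have h3 : delta / 2 <= s * M.
      have -> : s * M = INR g * M / INR n by rewrite /s; field; lra.
      apply: le_divr => //; nra.
    rewrite epsi; apply: (@Rle_trans _ (t * (s / 2))); last by apply: Rmult_le_compat_l; lra.
    by rewrite Mm; nra.
  have p0 : 0 <= psi by have : 0 < delta / 4 * mn; [apply: Rmult_lt_0_compat; lra | lra].
  have hs : psi / 4 <= sin (psi / 2).
    have := @sin_ge_cubic (psi / 2) ltac:(lra); set w := psi / 2.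
    have hw : 0 <= w <= 1 / 2 by rewrite /w; lra.
    have -> : psi / 4 = w / 2 by rewrite /w; field.
    by move=> h; apply: Rle_trans h; rewrite /=; nra.
  have htri : Rabs (sin (psi / 2)) <= dph t (n + g) + dph t n.
    have -> : psi / 2 = t * ln (INR (n + g)) / 2 + - (t * ln (INR n) / 2) by rewrite /psi; field.
    by apply: Rle_trans (Rabs_sin_add _ _) _; rewrite sin_neg Rabs_Ropp /dph; lra.
  rewrite Rabs_pos_eq in htri; last lra.
  lra.
have sumstep : (\rsum_(1 <= n < N.+1) ind n) * (delta / 16 * mn) <= 2 * S.
  rewrite Rmult_comm rsumM.
  apply: (@Rle_trans _ (\rsum_(1 <= n < N.+1) ((if dfree B n then dph t n else 0) + (if dfree B (n + g) then dph t (n + g) else 0)))).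
    by apply: rsum_nat_le => n /step; lra.
  rewrite big_split /=.
  have pos i : 0 <= (if dfree B i then dph t i else 0).
    by case: ifP => _; [exact: dph_ge0 | lra].
  have h1 : \rsum_(1 <= n < N.+1) (if dfree B n then dph t n else 0) <= S.
    by apply: rsum_sub_range => //; lia.
  have h2 : \rsum_(1 <= n < N.+1) (if dfree B (n + g) then dph t (n + g) else 0) <= S.
    have -> : \rsum_(1 <= n < N.+1) (if dfree B (n + g) then dph t (n + g) else 0) =
      \rsum_(1 + g <= n < N.+1 + g) (if dfree B n then dph t n else 0).
      by rewrite big_addn addnK.
    by apply: rsum_sub_range => //; lia.
  lra.
apply: Rle_trans sumstep; apply: Rmult_le_compat_r.
  by apply: Rmult_le_pos; lra.
have := @count_le_real (delta * INR N) N ltac:(nra).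
set T := \rsum_(1 <= n < N.+1) _ => hT.
suff : scnt B N - T <= \rsum_(1 <= n < N.+1) ind n by lra.
rewrite /scnt /T rsum_sub; apply: rsum_nat_le => n _; rewrite /ind.
by case: (dfree B n); case: (Rle_dec _ _) => _ /=; lra.
Qed.

#[global] Arguments pow : simpl never.

Lemma pcoprime_primes s : uniq s -> all prime s -> pcoprime s.
Proof.
elim: s => [//|p s IH] /= /andP [ps us] /andP [pp aps].
rewrite prime_gt1 // IH // andbT /=; apply/allP => q qs.
rewrite prime_coprime //; apply/negP => pq.
have pq' : prime q by move/allP: aps; apply.
move: pq; rewrite dvdn_prime2 // => /eqP e.
by move: ps; rewrite e qs.
Qed.

Lemma rprod_le_pow (s : seq nat) (f : nat -> R) c : (forall i, i \in s -> 0 <= f i <= c) ->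
  \rprod_(i <- s) f i <= c ^ size s.
Proof.
elim: s => [|x s IH] h; first by rewrite big_nil /= pow_O; lra.
rewrite big_cons -[size (x :: s)]/((size s).+1) -tech_pow_Rmult; have [h1 h2] := h x (mem_head _ _).
have hs : forall i, i \in s -> 0 <= f i <= c by move=> i hi; apply: h; rewrite inE hi orbT.
have := IH hs; have : 0 <= \rprod_(i <- s) f i by apply: rprod_ge0 => i /hs; lra.
nra.
Qed.

Lemma rprod_ge_pow (s : seq nat) (f : nat -> R) c : 0 <= c -> (forall i, i \in s -> c <= f i) ->
  c ^ size s <= \rprod_(i <- s) f i.
Proof.
move=> c0; elim: s => [|x s IH] h; first by rewrite big_nil /= pow_O; lra.
rewrite big_cons -[size (x :: s)]/((size s).+1) -tech_pow_Rmult; have h1 := h x (mem_head _ _).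
have hs : forall i, i \in s -> c <= f i by move=> i hi; apply: h; rewrite inE hi orbT.
have := IH hs; have := pow_le c (size s) c0; nra.
Qed.

Lemma exp_nat_mul m x : exp x ^ m = exp (INR m * x).
Proof.
elim: m => [|m IH]; first by rewrite INR0 Rmult_0_l exp_0.
by rewrite S_INR -tech_pow_Rmult IH -exp_plus; congr exp; ring.
Qed.

Lemma pow2_le_exp (m : nat) x : INR m <= x -> 2 ^ m <= exp x.
Proof.
move=> h; apply: Rle_trans (exp_le h).
have -> : exp (INR m) = exp 1 ^ m by rewrite exp_nat_mul Rmult_1_r.
apply: pow_incr; have := exp_ge1p 1; lra.
Qed.

Lemma Cmod_prod_aph_le_gen a t (g : nat -> R) k : (forall n, Cmod (aph a t n) <= exp (- g n / 2)) ->
  Cmod (\cprod_(0 <= n < k) aph a t n) <= exp (- (\rsum_(0 <= n < k) g n) / 2).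
Proof.
move=> hg; elim: k => [|k IH].
  by rewrite !big_geq // Cmod_1 Ropp_0 /Rdiv Rmult_0_l exp_0; lra.
rewrite !big_nat_recr //= Cmod_mult.
have -> : - (\rsum_(0 <= n < k) g n + g k) / 2 =
  - (\rsum_(0 <= n < k) g n) / 2 + - g k / 2 by field.
rewrite exp_plus; apply: Rmult_le_compat => //; try exact: Cmod_ge_0.
Qed.

Lemma one_sub_cos_dph t n : 1 - cos (t * ln (INR n)) = 2 * (dph t n * dph t n).
Proof.
rewrite one_sub_cos /dph -Rabs_mult Rabs_pos_eq //; exact: Rle_0_sqr.
Qed.

Section Minor.
Variables (a t : R).
Hypothesis a0 : 0 < a.
Let L := - ln a.
Hypothesis hL : 1000 <= L.
Hypothesis hE : 200 * L ^ 4 <= exp (L / 4).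
Hypothesis t1 : / (2 * L) <= t.
Hypothesis t2 : t <= exp (10 * L).

Lemma minor_aL4 : a * L ^ 4 <= / 200.
Proof.
have e : a * exp L = 1 by rewrite -(inv_a_expL a0) Rinv_r; lra.
have : exp (L / 4) <= exp L by apply: exp_le; lra.
have := pow_lt L 4 ltac:(lra); nra.
Qed.

Lemma minor_t0 : 0 < t.
Proof. by have : 0 < / (2 * L); [apply: Rinv_0_lt_compat; lra | lra]. Qed.

(** A single prime below [a^(-1/2)] with a phase off the multiples of [2 PI] saves [a^(1/4)]: in
    [Cmod_phip_small] the first term is at most [2 L a^(1/2)] and the second at most [a L^4]. *)
Lemma bad_small n : prime n -> INR n <= exp (L / 2) -> / L ^ 3 <= dph t n ->
  Cmod (aph a t n) <= exp (- (L / 2) / 2).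
Proof.
move=> pn hn hd; rewrite /aph pn Cmod_aphp.
have p2 := INR_prime_ge2 pn; have lp := ln_prime_gt0 pn.
have L3 : 0 < L ^ 3 by apply: pow_lt; lra.
have iL3 : 0 < / L ^ 3 by apply: Rinv_0_lt_compat.
have lnL : ln (INR n) <= L / 2 by rewrite -(ln_exp (L / 2)); apply: ln_le; lra.
have aL4 := minor_aL4; have [d1 d0] := (dph_le1 t n, dph_ge0 t n).
have L13 : 1 <= L ^ 3 by apply: pow_R1_Rle; lra.
have aL : a * L <= 1 / 200.
  apply: Rle_trans (_ : a * L ^ 4 <= _); last lra.
  have -> : a * L ^ 4 = a * L * L ^ 3 by ring.
  have : 0 < a * L by nra.
  nra.
have x1 : a * ln (INR n) <= a * L / 2 by nra.
have [q0 q1] := qp_bounds a0 pn; have [r0 r1] := rho_bounds a0 pn.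
have r2 : 1 - a * ln (INR n) <= rho a n by rewrite rho_alnp; have := exp_ge1p (- (a * ln (INR n))); lra.
have r3 : 1 / 2 <= rho a n by lra.
have e1 : exp (L / 2) = exp (L / 4) * exp (L / 4) by rewrite -exp_plus; congr exp; field.
have e2 : a * (exp (L / 2) * exp (L / 2)) = 1.
  rewrite -exp_plus; have -> : L / 2 + L / 2 = L by field.
  by rewrite -(inv_a_expL a0) Rinv_r; lra.
have e3 : exp (- (L / 2) / 2) * exp (L / 4) = 1 by rewrite -exp_plus -exp_0; congr exp; field.
have hq : 1 - qp a n <= 2 * L * (a * exp (L / 2)).
  have u2 := @exp_sub1_le2 (a * ln (INR n)) ltac:(have := alnp_gt0 a0 pn; lra); rewrite -Rpower_alnp in u2.
  have u1 := pow_sub1_gt0 a0 pn.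
  have -> : 1 - qp a n = (INR n + 1) * (Rpower (INR n) a - 1) * qp a n.
    by rewrite /qp; field; nra.
  have w0 : 0 < (INR n + 1) * (Rpower (INR n) a - 1) by apply: Rmult_lt_0_compat; lra.
  apply: (@Rle_trans _ ((INR n + 1) * (Rpower (INR n) a - 1))).
    by rewrite -[X in _ <= X]Rmult_1_r; apply: Rmult_le_compat_l; lra.
  apply: (@Rle_trans _ ((2 * exp (L / 2)) * (a * L))); last by lra.
  by apply: Rmult_le_compat; lra.
have hs : / L ^ 3 <= sqrt (2 * rho a n * (1 - cos (t * ln (INR n)))).
  rewrite one_sub_cos_dph -(sqrt_square (/ L ^ 3)); last lra.
  apply: sqrt_le_1_alt.
  have : / L ^ 3 * / L ^ 3 <= dph t n * dph t n by apply: Rmult_le_compat; lra.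
  have : 0 <= dph t n * dph t n by nra.
  nra.
case: (Cmod_phip_small t a0 pn) => h; last first.
  have := one_sub_cos_dph t n; rewrite h; nra.
apply: Rle_trans h _.
have h2 : (1 - rho a n) / sqrt (2 * rho a n * (1 - cos (t * ln (INR n)))) <= a * L ^ 4.
  apply: divr_le; first lra.
  apply: (@Rle_trans _ (a * L ^ 4 * / L ^ 3)).
    have -> : a * L ^ 4 * / L ^ 3 = a * L by field; lra.
    by nra.
  by apply: Rmult_le_compat_l => //; have := pow_lt L 4 ltac:(lra); nra.
apply: Rle_trans (Rplus_le_compat _ _ _ _ hq h2) _.
have ep := exp_pos (L / 4); have hE' := hE; set E := exp (L / 4) in hE' ep e1 e3 *.
have E1 : 200 * L <= E.
  apply: Rle_trans hE'; have -> : L ^ 4 = L * L ^ 3 by ring.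
  nra.
have -> : exp (- (L / 2) / 2) = / E by rewrite -[LHS]Rmult_1_r -(Rinv_r E) -?Rmult_assoc ?e3 ?Rmult_1_l //; lra.
have ea : a = / (E * E * (E * E)).
  by rewrite -e1; apply: (Rmult_eq_reg_r (exp (L / 2) * exp (L / 2))); [rewrite e2 Rinv_l //|]; have := exp_pos (L / 2); nra.
have E1' : 1 <= E by lra.
have -> : 2 * L * (a * exp (L / 2)) + a * L ^ 4 = / E * (2 * L / E + L ^ 4 / (E * E * E)).
  by rewrite e1 ea; field; lra.
rewrite -[X in _ <= X]Rmult_1_r; apply: Rmult_le_compat_l; first by left; apply: Rinv_0_lt_compat.
have f1 : 2 * L / E <= 1 / 2 by apply: divr_le; lra.
have f2 : L ^ 4 / (E * E * E) <= 1 / 2.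
  apply: divr_le; first by nra.
  have : E <= E * E * E by nra.
  have := pow_lt L 4 ltac:(lra); lra.
lra.
Qed.

(** Here [1 - rho] is below [dph], so [egain >= qp / 2]; and [qp], roughly [1 / (1 + a p ln p)], is
    at least [exp (L / 2) / (4 (p - 1))] because [ln p <= 41 L]. *)
Lemma bad_large n (N2 : R) : prime n -> exp (L / 2) < INR n -> INR n <= N2 -> ln N2 <= 41 * L ->
  / L ^ 3 <= dph t n -> exp (L / 2) / 8 * / (INR n - 1) <= eg a t n.
Proof.
move=> pn hn hN lN hd; rewrite /eg pn.
have p2 := INR_prime_ge2 pn; have lp := ln_prime_gt0 pn.
have L3 : 0 < L ^ 3 by apply: pow_lt; lra.
have iL3 : 0 < / L ^ 3 by apply: Rinv_0_lt_compat.
have lnL : ln (INR n) <= 41 * L by apply: Rle_trans (ln_le _ hN) lN; lra.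
have aL4 := minor_aL4; have [d1 d0] := (dph_le1 t n, dph_ge0 t n).
have L13 : 1000 <= L ^ 3.
  have -> : L ^ 3 = L * (L * L) by ring.
  nra.
have aLp : 0 < a * L by nra.
have aL : a * L * L ^ 3 <= / 200 by have -> : a * L * L ^ 3 = a * L ^ 4 by [ring]; lra.
have x1 : a * ln (INR n) <= 41 * (a * L) by nra.
have x2 : 41 * (a * L) <= 1 / 2 by nra.
have xp := alnp_gt0 a0 pn.
have [q0 q1] := qp_bounds a0 pn; have [r0 r1] := rho_bounds a0 pn.
have r2 : 1 - a * ln (INR n) <= rho a n by rewrite rho_alnp; have := exp_ge1p (- (a * ln (INR n))); lra.
have r3 : 1 / 2 <= rho a n by lra.
set E := exp (L / 2) in hn *.
have EE : a * (E * E) = 1.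
  rewrite /E -exp_plus; have -> : L / 2 + L / 2 = L by field.
  by rewrite -(inv_a_expL a0) Rinv_r; lra.
have Ep : 0 < E by exact: exp_pos.
have hL2 : 200 * L <= E.
  apply: Rle_trans (_ : exp (L / 4) <= _); last by apply: exp_le; lra.
  apply: Rle_trans hE; have -> : L ^ 4 = L * L ^ 3 by ring.
  nra.
have hq : E / 4 * / (INR n - 1) <= qp a n.
  have u2 := @exp_sub1_le2 (a * ln (INR n)) ltac:(lra); rewrite -Rpower_alnp in u2.
  have u1 := pow_sub1_gt0 a0 pn.
  have u3 : (INR n + 1) * (Rpower (INR n) a - 1) <= (INR n + 1) * (82 * (a * L)) by apply: Rmult_le_compat_l; lra.
  have den : 0 < 1 + (INR n + 1) * (82 * (a * L)) by nra.
  apply: (@Rle_trans _ (/ (1 + (INR n + 1) * (82 * (a * L))))); last first.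
    by apply: Rinv_le_contravar; [have : 0 < (INR n + 1) * (Rpower (INR n) a - 1) by [nra]; lra | lra].
  apply: (Rmult_le_reg_r (1 + (INR n + 1) * (82 * (a * L)))) => //.
  rewrite Rinv_l; last lra.
  have -> : E / 4 * / (INR n - 1) * (1 + (INR n + 1) * (82 * (a * L))) =
    (E * (1 + (INR n + 1) * (82 * (a * L))) / 4) / (INR n - 1) by field; lra.
  apply: divr_le; first lra.
  have w1 : E * (a * L) <= / 200.
    have -> : E * (a * L) = (a * (E * E)) * (L / E) by field; lra.
    rewrite EE Rmult_1_l; apply: divr_le; lra.
  have w2 : E * (1 + (INR n + 1) * (82 * (a * L))) = E + (INR n + 1) * 82 * (E * (a * L)) by ring.
  rewrite w2; nra.
apply: (@Rle_trans _ (qp a n / 2)); first by lra.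
rewrite /egain one_sub_cos_dph; apply: le_divr; first exact: pden_gt0.
rewrite /pden one_sub_cos_dph.
set d := dph t n in hd d0 d1 *.
have k1 : (1 - rho a n) * (1 - rho a n) <= 2 * (d * d).
  have : 1 - rho a n <= d.
    apply: Rle_trans hd; apply: (Rmult_le_reg_r (L ^ 3)) => //; rewrite Rinv_l; last lra.
    nra.
  by nra.
have dd : 0 <= d * d by exact: Rle_0_sqr.
have k2 : (1 - rho a n) * (1 - rho a n) <= 2 * rho a n * (2 * (d * d)).
  by apply: Rle_trans k1 _; have := Rmult_le_compat_r (d * d) _ _ dd r3; lra.
have := Rmult_le_compat_l (qp a n / 2) _ _ ltac:(lra) k2; lra.
Qed.

Definition bad_primes (z : nat) : seq nat :=
  [seq p <- iota 0 z.+1 | prime p && is_left (Rle_dec (/ L ^ 3) (dph t p))].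

(** 56 primes saving [exp (- L / 4)] each. *)
Lemma minor_many z : INR z <= exp (L / 2) -> (56 <= size (bad_primes z))%N ->
  Cmod (charf a t) <= exp (- (14 * L)).
Proof.
move=> hz h56.
pose g n := if n \in bad_primes z then L / 2 else 0.
have hg n : Cmod (aph a t n) <= exp (- g n / 2).
  rewrite /g; case: ifP => h; last first.
    apply: Rle_trans (Cmod_aph_le a0 t n) _; apply: exp_le.
    by have := eg_bounds a0 t n; lra.
  move: h; rewrite mem_filter mem_iota => /andP [/andP [pn hd] hn].
  apply: bad_small => //.
    by apply: Rle_trans hz; apply: leq_INR; lia.
  by move: hd; case: Rle_dec.
apply: Clim_Cmod_le (charf_lim a0 t) _; exists z.+1 => k hk.
apply: Rle_trans (Cmod_prod_aph_le_gen k hg) _; apply: exp_le.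
suff : 28 * L <= \rsum_(0 <= n < k) g n by lra.
apply: (@Rle_trans _ (\rsum_(0 <= n < z.+1) g n)); last first.
  by apply: rsum_sub_range => // i; rewrite /g; case: ifP => _; lra.
apply: (@Rle_trans _ (\rsum_(n <- bad_primes z) (L / 2))).
  rewrite rsum_const; have := leq_INR h56.
  have -> : INR 56 = 56 by rewrite INR_IZR_INZ.
  by move=> h; apply: Rle_trans (Rmult_le_compat_r (L / 2) _ _ ltac:(lra) h); lra.
right; rewrite /bad_primes big_filter big_mkcond /index_iota subn0; apply: eq_big_seq => n hn.
by rewrite /g /bad_primes mem_filter hn andbT.
Qed.

Let cc := / 2 ^ 122.
Hypothesis hL4 : 336 * 2 ^ 122 <= L.
Hypothesis hL5 : 448 * 2 ^ 122 * L ^ 2 <= exp (L / 2).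

(** With few small bad primes, [phase_lower] and [dph_sum_upper] give [cc / L] as a lower bound for
    the sum of [dph t p / (p - 1)] over the other primes up to [2 N]. Primes with [dph < 1 / L^3]
    account for [O (1 / L^2)], so large bad primes carry the rest, and each of them gains by
    [bad_large]. *)
Lemma minor_few z : INR z <= exp (L / 2) < INR z + 1 -> (size (bad_primes z) < 56)%N ->
  Cmod (charf a t) <= exp (- (14 * L)).
Proof.
move=> [hz1 hz2] h56.
set B := bad_primes z in h56.
have pB : all prime B by apply/allP => p; rewrite mem_filter => /andP [/andP [] ].
have uB : uniq B by apply: filter_uniq; exact: iota_uniq.
have Bz p : p \in B -> INR p <= exp (L / 2).
  by rewrite mem_filter mem_iota => /andP [_ h]; apply: Rle_trans hz1; apply: leq_INR; lia.
have eL0 : 1 <= exp (L / 2) by have := exp_ge1p (L / 2); lra.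
set Q := (\prod_(p <- B) p)%N.
have Q0 : (0 < Q)%N by rewrite /Q big_seq; apply: prodn_cond_gt0 => p hp; apply: prime_gt0; move/allP: pB; apply.
have QB b : b \in B -> (b %| Q)%N.
  by move=> hb; rewrite /Q (big_rem b) //=; exact: dvdn_mulr.
have hQ : INR Q <= exp (28 * L).
  rewrite /Q INR_prod; apply: Rle_trans (@rprod_le_pow B INR (exp (L / 2)) _) _.
    by move=> i hi; split; [exact: pos_INR | exact: Bz].
  rewrite exp_nat_mul; apply: exp_le.
  have := leq_INR (ltnW h56); have -> : INR 56 = 56 by rewrite INR_IZR_INZ.
  by move=> h; have := Rmult_le_compat_r (L / 2) _ _ ltac:(lra) h; lra.
(* Room above the product of the bad primes, at most [exp (28 L)], times
   [max (1, t) <= exp (10 L)]. *)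
set Nr := exp (40 * L).
have Nr0 : 2 ^ 800 <= Nr by apply: pow2_le_exp; rewrite INR_IZR_INZ /=; lra.
have p2 m : 1 <= 2 ^ m by apply: pow_R1_Rle; lra.
have [fN1 fN2] := @nfloor_bounds Nr ltac:(have := p2 800%N; lra).
set N := nfloor Nr in fN1 fN2.
have Nr2 : 2 <= Nr by apply: Rle_trans Nr0; have := p2 799%N; rewrite -(tech_pow_Rmult 2 799); lra.
have Nhalf : Nr / 2 <= INR N by lra.
have N0 : (0 < N)%N by apply: INR_ltn; rewrite INR0; lra.
(* A quarter of the proportion [2^-56] of integers free of [B] obtained in [hs], so that discarding
   [n <= delta N] is affordable. *)
set delta := / 2 ^ 58.
have d58 := p2 58%N.
have dl : 0 < delta < 1.
  split; first by apply: Rinv_0_lt_compat; lra.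
  rewrite /delta -Rinv_1; apply: Rinv_lt_contravar; first lra.
  by rewrite -(tech_pow_Rmult 2 57); have := p2 57%N; lra.
have t0 := minor_t0.
set M := Rmax 1 t.
have M1 : 1 <= M by apply: Rmax_l.
have ML : M <= exp (10 * L) by apply: Rmax_lub => //; have := exp_ge1p (10 * L); lra.
have Qp := INR_gt0 Q0.
have QM : 0 < INR Q * M by nra.
set y := delta * INR N / (INR Q * M).
have y1 : 1 <= y.
  apply: le_divr => //; rewrite Rmult_1_l.
  apply: (@Rle_trans _ (exp (28 * L) * exp (10 * L))); first by apply: Rmult_le_compat; lra.
  apply: (@Rle_trans _ (delta * (Nr / 2))); last by apply: Rmult_le_compat_l; lra.
  rewrite -exp_plus /Nr; have -> : 40 * L = (28 * L + 10 * L) + 2 * L by ring.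
  rewrite [in X in _ <= X]exp_plus; set X := exp (28 * L + 10 * L).
  have X0 : 0 < X by exact: exp_pos.
  have : 2 ^ 59 <= exp (2 * L) by apply: pow2_le_exp; rewrite INR_IZR_INZ /=; lra.
  rewrite -(tech_pow_Rmult 2 58) => h.
  have -> : delta * (X * exp (2 * L) / 2) = X * (delta * exp (2 * L) / 2) by field.
  rewrite -{1}[X]Rmult_1_r; apply: Rmult_le_compat_l; first lra.
  have : delta * (2 * 2 ^ 58) <= delta * exp (2 * L) by apply: Rmult_le_compat_l; lra.
  have -> : delta * (2 * 2 ^ 58) = 2 by rewrite /delta; field; lra.
  lra.
have [fh1 fh2] := @nfloor_bounds y ltac:(lra).
set h := nfloor y in fh1 fh2.
have h1 : 1 <= INR h.
  have := @leq_nfloor 1 y ltac:(lra); rewrite INR1 -/h => H; have := leq_INR (H y1); rewrite INR1; lra.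
set g := (Q * h)%N.
have yQM : y * (INR Q * M) = delta * INR N by rewrite /y; field; lra.
have gM : INR g * M = INR h * (INR Q * M) by rewrite /g INR_muln; ring.
have g1 : INR g * M <= delta * INR N by rewrite gM -yQM; apply: Rmult_le_compat_r; lra.
have g2 : delta * INR N <= 2 * (INR g * M).
  rewrite gM -yQM; have : y <= 2 * INR h by lra.
  by move=> hy; have := Rmult_le_compat_r (INR Q * M) _ _ (Rlt_le _ _ QM) hy; lra.
have Npos := INR_gt0 N0.
have gN : (g <= N)%N.
  apply: INR_leq; have := pos_INR g => gp; nra.
have hB b : b \in B -> (b %| g)%N by move=> /QB hb; rewrite /g; apply: dvdn_mulr.
have key := @phase_lower B t delta N g t0 dl gN N0 hB (conj g1 g2).
have hs : INR N * / 2 ^ 56 <= scnt B N.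
  have nfN : nfloor (INR N) = N.
    have [q1 q2] := @nfloor_bounds (INR N) ltac:(lra).
    have l1 := INR_leq q1.
    have l2 : (N <= nfloor (INR N))%N by apply: leq_nfloor; lra.
    by lia.
  have := @sieve_bound B (INR N) (pcoprime_primes uB pB) ltac:(lra).
  rewrite nfN => /Rabs_le_between [hsv _].
  have s55 : (size B <= 55)%N by lia.
  have pr1 : / 2 ^ 55 <= \rprod_(d <- B) (1 - / INR d).
    apply: (@Rle_trans _ ((/ 2) ^ size B)).
      rewrite -pow_inv; have -> : (55 = (55 - size B) + size B)%N by lia.
      rewrite pow_add; have : (/ 2) ^ (55 - size B) <= 1 by rewrite -[X in _ <= X](pow1 (55 - size B)); apply: pow_incr; lra.
      by have := pow_lt (/ 2) (size B) ltac:(lra); nra.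
    apply: rprod_ge_pow; first lra.
    move=> p hp; have pp : prime p by move/allP: pB; apply.
    have := INR_prime_ge2 pp => pp2.
    have : / INR p <= / 2 by apply: Rinv_le_contravar; lra.
    lra.
  have pr2 : \rprod_(d <- B) (1 + / pow34 (INR d)) <= 2 ^ 55.
    apply: (@Rle_trans _ (2 ^ size B)); last by apply: Rle_pow; [lra | lia].
    apply: rprod_le_pow => p hp; have pp : prime p by move/allP: pB; apply.
    have := INR_prime_ge2 pp => pp2; have := @pow34_ge1 (INR p) ltac:(lra) => p34.
    have : 0 < / pow34 (INR p) <= 1.
      by split; [apply: Rinv_0_lt_compat; lra | rewrite -Rinv_1; apply: Rinv_le_contravar; lra].
    lra.
  (* The main term of the sieve is at least [N / 2^55]; half of it may be spent on the error, which
     requires [N^(1/4) >= 2^111]. *)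
  have p34N : pow34 (INR N) * 2 ^ 55 <= INR N * / 2 ^ 56.
    set s := sqrt (INR N); set w := sqrt s.
    have ss : s * s = INR N by apply: sqrt_sqrt; lra.
    have s0 : 0 < s by apply: sqrt_lt_R0.
    have ww : w * w = s by apply: sqrt_sqrt; lra.
    have w0 : 0 < w by apply: sqrt_lt_R0.
    have hw : 2 ^ 111 <= w.
      apply: Rnot_lt_le => hlt.
      have q1 : w * w < 2 ^ 111 * 2 ^ 111 by apply: Rmult_le_0_lt_compat; lra.
      have q2 : s * s < (2 ^ 111 * 2 ^ 111) * (2 ^ 111 * 2 ^ 111) by apply: Rmult_le_0_lt_compat; lra.
      have e444 : (2 ^ 111 * 2 ^ 111) * (2 ^ 111 * 2 ^ 111) = 2 ^ 444 by rewrite -!pow_add.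
      have : 2 * 2 ^ 444 <= 2 ^ 800 by rewrite tech_pow_Rmult; apply: Rle_pow; [lra | lia].
      rewrite e444 ss in q2; lra.
    rewrite /pow34 -/s -/w -ss.
    have -> : s * w * 2 ^ 55 = s * (w * 2 ^ 55) by ring.
    have -> : s * s * / 2 ^ 56 = s * (w * (w * / 2 ^ 56)).
      by rewrite -[w * (w * _)]Rmult_assoc ww Rmult_assoc.
    apply: Rmult_le_compat_l; first lra.
    apply: Rmult_le_compat_l; first lra.
    have := p2 56%N => p56; apply: (Rmult_le_reg_r (2 ^ 56)); first lra.
    have -> : w * / 2 ^ 56 * 2 ^ 56 = w by field; lra.
    by rewrite -pow_add.
  have a1 : INR N * / 2 ^ 55 <= INR N * \rprod_(d <- B) (1 - / INR d) by apply: Rmult_le_compat_l; lra.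
  have a2 : pow34 (INR N) * \rprod_(d <- B) (1 + / pow34 (INR d)) <= pow34 (INR N) * 2 ^ 55.
    by apply: Rmult_le_compat_l => //; exact: pow34_ge0.
  have e55 : / 2 ^ 55 = 2 * / 2 ^ 56.
    by rewrite -(tech_pow_Rmult 2 55); field; have := p2 55%N; lra.
  rewrite e55 in a1; lra.
have mn : / (2 * L) <= Rmin 1 t.
  apply: Rmin_glb => //; rewrite -Rinv_1; apply: Rinv_le_contravar; lra.
set S := \rsum_(1 <= m < (2 * N).+1) _ in key.
have lowS : INR N * (2 * cc / L) <= S.
  have e1 : INR N * / 2 ^ 57 <= scnt B N - delta * INR N.
    have z1 : delta = / 2 ^ 56 * / 4 by rewrite /delta -Rinv_mult (_ : 58 = 56 + 2)%N // pow_add; congr (/ (_ * _)); ring.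
    have z2 : / 2 ^ 57 = / 2 ^ 56 * / 2 by rewrite -Rinv_mult (_ : 57 = 56 + 1)%N // pow_add; congr (/ (_ * _)); ring.
    have i56 : 0 < / 2 ^ 56 by apply: Rinv_0_lt_compat; have := p2 56%N; lra.
    rewrite z1 z2; nra.
  have e2 : INR N * / 2 ^ 57 * (delta / 16 * / (2 * L)) <= (scnt B N - delta * INR N) * (delta / 16 * Rmin 1 t).
    have i57 : 0 < / 2 ^ 57 by apply: Rinv_0_lt_compat; have := p2 57%N; lra.
    have iL : 0 < / (2 * L) by apply: Rinv_0_lt_compat; lra.
    apply: Rmult_le_compat => //; [nra | apply: Rmult_le_pos; lra | apply: Rmult_le_compat_l; lra].
  have e3 : INR N * / 2 ^ 57 * (delta / 16 * / (2 * L)) = 2 * (INR N * (2 * cc / L)).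
    (* The exponent 122 is [57 + 58 + 7]: the proportion of usable [n], [delta], and the numerical
       factors of [phase_lower]. *)
    have -> : cc = / 2 ^ 57 * (delta * / 2 ^ 7) by rewrite /cc /delta -!Rinv_mult -!pow_add.
    by field; have := p2 57%N; lra.
  lra.
have upS := dph_sum_upper t (2 * N) pB; rewrite -/S in upS.
set SP := \rsum_(0 <= p < (2 * N).+1) _ in upS.
have cc0 : 0 < cc by apply: Rinv_0_lt_compat; have := p2 122%N; lra.
have lowP : cc / L <= SP.
  rewrite INR_muln INR2 in upS.
  apply: (Rmult_le_reg_l (2 * INR N)); first lra.
  have -> : 2 * INR N * (cc / L) = INR N * (2 * cc / L) by field; lra.
  lra.
have L30 : 0 < / L ^ 3 by apply: Rinv_0_lt_compat; apply: pow_lt; lra.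
pose big p := prime p && (z < p)%N && is_left (Rle_dec (/ L ^ 3) (dph t p)).
set S1 := \rsum_(0 <= p < (2 * N).+1) (if big p then / (INR p - 1) else 0).
have lN2 : ln (INR (2 * N)) <= 41 * L.
  rewrite INR_muln INR2 ln_mult; [|lra|lra].
  have : ln (INR N) <= 40 * L by rewrite -(ln_exp (40 * L)); apply: ln_le fN1.
  have := ln2_bounds; lra.
have split : SP <= S1 + 4 * / L ^ 3 * mertens_sum (2 * N).
  rewrite /SP /S1 /mertens_sum rsumM [X in _ <= _ + X]big_mkcond -big_split /=; apply: rsum_nat_le => p _.
  rewrite /big; case: (boolP (prime p)) => pp /=; last by lra.
  have pp2 := INR_prime_ge2 pp; have lp := ln_prime_gt0 pp.
  have lp2 : 1 / 2 < ln (INR p).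
    by have := @ln_le 2 (INR p) ltac:(lra) pp2; have := ln2_bounds; lra.
  have tp : 0 <= 4 * / L ^ 3 * (ln (INR p) / INR p).
    by apply: Rmult_le_pos; [lra | apply: Rdiv_le_0_compat; lra].
  have ip : 0 < / (INR p - 1) by apply: Rinv_0_lt_compat; lra.
  have d0 := dph_ge0 t p; have d1 := dph_le1 t p.
  case: (boolP (p \in B)) => pBn /=.
    by case: ifP => _; lra.
  case: (Rle_dec (/ L ^ 3) (dph t p)) => hd.
    have -> : (z < p)%N.
      rewrite ltnNge; apply/negP => pz; move/negP: pBn; apply.
      rewrite mem_filter mem_iota pp /=; apply/andP; split; last by lia.
      by case: Rle_dec.
    rewrite /=; have : dph t p / (INR p - 1) <= / (INR p - 1) by rewrite /Rdiv; nra.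
    lra.
  rewrite andbF.
  have : dph t p / (INR p - 1) <= 4 * / L ^ 3 * (ln (INR p) / INR p).
    apply: divr_le; first lra.
    have -> : 4 * / L ^ 3 * (ln (INR p) / INR p) * (INR p - 1) = / L ^ 3 * (4 * ln (INR p) * ((INR p - 1) / INR p)) by field; lra.
    have hh : 1 / 2 <= (INR p - 1) / INR p by apply: le_divr; lra.
    have : 1 <= 4 * ln (INR p) * ((INR p - 1) / INR p) by nra.
    nra.
  lra.
have hm := @mertens_upper (2 * N) ltac:(lia).
have lowS1 : cc / (2 * L) <= S1.
  have e1 : 4 * / L ^ 3 * mertens_sum (2 * N) <= 4 * / L ^ 3 * (42 * L) by apply: Rmult_le_compat_l; lra.
  have e2 : 4 * / L ^ 3 * (42 * L) <= cc / (2 * L).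
    have -> : 4 * / L ^ 3 * (42 * L) = 168 / L / L by field; lra.
    have -> : cc / (2 * L) = cc / 2 / L by field; lra.
    apply: Rmult_le_compat_r; first by left; apply: Rinv_0_lt_compat; lra.
    apply: divr_le; first lra.
    have : cc * (336 * 2 ^ 122) <= cc * L by apply: Rmult_le_compat_l; lra.
    have -> : cc * (336 * 2 ^ 122) = 336 by rewrite /cc; field; have := p2 122%N; lra.
    lra.
  have -> : cc / (2 * L) = cc / L - cc / (2 * L) by field; lra.
  lra.
have -> : - (14 * L) = - (28 * L) / 2 by field.
apply: (charf_Cmod_le a0); exists (2 * N).+1 => k hk.
apply: (@Rle_trans _ (\rsum_(0 <= n < (2 * N).+1) eg a t n)); last first.
  by apply: rsum_sub_range => // i; have := eg_bounds a0 t i; lra.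
apply: (@Rle_trans _ (exp (L / 2) / 8 * S1)); last first.
  rewrite /S1 rsumM; apply: rsum_nat_le => n /andP [_ hn]; rewrite /big.
  case: (boolP (prime n)) => pn /=; last by rewrite Rmult_0_r; have := eg_bounds a0 t n; lra.
  case: (boolP (z < n)%N) => zn /=; last by rewrite Rmult_0_r; have := eg_bounds a0 t n; lra.
  case: Rle_dec => hd /=; last by rewrite Rmult_0_r; have := eg_bounds a0 t n; lra.
  apply: (@bad_large n (INR (2 * N))) => //.
    by have := leq_INR zn; rewrite S_INR; lra.
  by apply: leq_INR; lia.
have e8 : 0 < exp (L / 2) / 8 by lra.
apply: Rle_trans (Rmult_le_compat_l _ _ _ (Rlt_le _ _ e8) lowS1).
(* The required gain [28 L] times [16 L] is the [448 L^2] of the hypothesis on [exp (L / 2)]. *)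
have -> : exp (L / 2) / 8 * (cc / (2 * L)) = cc * exp (L / 2) / (16 * L) by field; lra.
apply: le_divr; first lra.
have : cc * (448 * 2 ^ 122 * L ^ 2) <= cc * exp (L / 2) by apply: Rmult_le_compat_l; lra.
have -> : cc * (448 * 2 ^ 122 * L ^ 2) = 448 * L ^ 2 by rewrite /cc; field; have := p2 122%N; lra.
rewrite /=; lra.
Qed.

Lemma minor_arc_aux : Cmod (charf a t) <= exp (- (14 * L)).
Proof.
have [h1 h2] := @nfloor_bounds (exp (L / 2)) ltac:(have := exp_pos (L / 2); lra).
case: (ltnP (size (bad_primes (nfloor (exp (L / 2))))) 56) => h.
  exact: minor_few h.
exact: minor_many h.
Qed.

End Minor.

Lemma minor_arc : exists L0, 1000 <= L0 /\ forall a t, 0 < a -> L0 <= - ln a ->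
  / (2 * - ln a) <= t -> t <= exp (10 * - ln a) ->
  Cmod (charf a t) <= exp (- (14 * - ln a)).
Proof.
have [L1 [L10 h1]] := @exp_dominates 200 (1 / 4) 4 ltac:(lra).
have [L2 [L20 h2]] := @exp_dominates (448 * 2 ^ 122) (1 / 2) 2 ltac:(lra).
exists (Rmax 1000 (Rmax (336 * 2 ^ 122) (Rmax L1 L2))); split; first exact: Rmax_l.
move=> a t a0 hL t1 t2; set L := - ln a in hL t1 t2 *.
have i1 := Rmax_l 1000 (Rmax (336 * 2 ^ 122) (Rmax L1 L2)).
have i2 := Rmax_r 1000 (Rmax (336 * 2 ^ 122) (Rmax L1 L2)).
have i3 := Rmax_l (336 * 2 ^ 122) (Rmax L1 L2).
have i4 := Rmax_r (336 * 2 ^ 122) (Rmax L1 L2).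
have i5 := Rmax_l L1 L2; have i6 := Rmax_r L1 L2.
apply: minor_arc_aux => //; rewrite -/L.
- by lra.
- have := h1 L ltac:(lra); have -> : 1 / 4 * L = L / 4 by field.
  by [].
- by apply: Rle_trans i3 _; lra.
- have := h2 L ltac:(lra); have -> : 1 / 2 * L = L / 2 by field.
  by [].
Qed.

(** * Bounds on the whole frequency range *)

Lemma pow_le_exp (n : nat) (y c : R) : (0 < n)%N -> 0 < c -> c <= 1 -> 0 <= y ->
  (1 + y) ^ n <= (INR n / c) ^ n * exp (c * y).
Proof.
move=> n0 c0 c1 y0; have hn := INR_ge1 n0.
have -> : exp (c * y) = exp (c * y / INR n) ^ n by rewrite exp_nat_mul; congr exp; field; lra.
rewrite -Rpow_mult_distr; apply: pow_incr; split; first lra.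
have h := exp_ge1p (c * y / INR n).
have hc : 1 <= INR n / c by apply: le_divr; lra.
apply: (@Rle_trans _ (INR n / c * (1 + c * y / INR n))); last by apply: Rmult_le_compat_l; lra.
have -> : INR n / c * (1 + c * y / INR n) = INR n / c + y by field; lra.
lra.
Qed.

(** The constant [(n / c)^n] of [pow_le_exp] for [n = 2] and [c = 1 / 256], the decay rate in
    [central_bounds]; [K3] is the case [n = 3]. *)
Definition K2 := 512 ^ 2.
Definition K3 := 768 ^ 3.

Lemma K2_bound y : 0 <= y -> (1 + y) ^ 2 * exp (- (y / 256)) <= K2.
Proof.
move=> y0; have h := @pow_le_exp 2 y (/ 256) isT ltac:(lra) ltac:(lra) y0.
have e : exp (/ 256 * y) * exp (- (y / 256)) = 1 by rewrite -exp_plus -exp_0; congr exp; field.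
have ep := exp_pos (- (y / 256)).
apply: Rle_trans (Rmult_le_compat_r _ _ _ (Rlt_le _ _ ep) h) _.
rewrite Rmult_assoc e Rmult_1_r INR2 /K2; right; field.
Qed.

Lemma K3_bound y : 0 <= y -> (1 + y) ^ 3 * exp (- (y / 256)) <= K3.
Proof.
move=> y0; have h := @pow_le_exp 3 y (/ 256) isT ltac:(lra) ltac:(lra) y0.
have e : exp (/ 256 * y) * exp (- (y / 256)) = 1 by rewrite -exp_plus -exp_0; congr exp; field.
have ep := exp_pos (- (y / 256)).
apply: Rle_trans (Rmult_le_compat_r _ _ _ (Rlt_le _ _ ep) h) _.
rewrite Rmult_assoc e Rmult_1_r (_ : INR 3 = 3) /K3; last by rewrite INR_IZR_INZ.
by right; field.
Qed.

Section CharBounds.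
Variable a : R.
Hypothesis a0 : 0 < a.
Let L := - ln a.
Hypothesis hL : 1000 <= L.
Let kap := / (a ^ 3 * L).

Lemma kap_gt0 : 0 < kap.
Proof. by apply: Rinv_0_lt_compat; apply: Rmult_lt_0_compat; [exact: pow_lt | lra]. Qed.

(** For [t <= a] the gain of [eg_sum_lower] is at least [kap t^2 / 128], and [charf_Cmod_le] uses
    half of it. The two lower bounds for the real part come from the nonnegativity of the product in
    [re_prod] and from its expansion near 0. *)
Lemma central_bounds t : 0 <= t <= a / 10 ->
  Cmod (charf a t) <= exp (- (kap * t ^ 2 / 256)) /\
  Rabs (snd (charf a t)) <= 138000 * (kap / a * t ^ 3) * exp (- (kap * t ^ 2 / 256)) /\
  - (138000 * (kap / a * t ^ 3) * exp (- (kap * t ^ 2 / 256))) <= fst (charf a t) /\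
  1 - 69000 * (kap * t ^ 2) - 138000 * (kap / a * t ^ 3) * exp (- (kap * t ^ 2 / 256)) <= fst (charf a t).
Proof.
move=> [t0 t1].
have aL := aL_le1 a0 hL; rewrite -/L in aL.
have a2 := pow_lt a 2 a0; have a3 := pow_lt a 3 a0; have t20 := pow_le t 2 t0; have t30 := pow_le t 3 t0.
have [K hK] := eg_sum_lower a0 hL t0 ltac:(rewrite -/L; nra); rewrite -/L in hK.
set g := t ^ 2 / (64 * a * (a ^ 2 + t ^ 2) * L) in hK.
have hg : kap * t ^ 2 / 128 <= g.
  have -> : kap * t ^ 2 / 128 = t ^ 2 / (128 * a ^ 3 * L) by rewrite /kap; field; lra.
  apply: Rmult_le_compat_l => //; apply: Rinv_le_contravar.
    by apply: Rmult_lt_0_compat; [apply: Rmult_lt_0_compat|]; lra.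
  have : t ^ 2 <= a ^ 2 by apply: pow_incr; lra.
  have -> : 128 * a ^ 3 * L = 64 * a * (a ^ 2 + a ^ 2) * L by ring.
  move=> h; apply: Rmult_le_compat_r; first lra.
  by apply: Rmult_le_compat_l; lra.
have he : exp (- g / 2) <= exp (- (kap * t ^ 2 / 256)) by apply: exp_le; lra.
split.
  by apply: Rle_trans he; apply: (charf_Cmod_le a0); exists K.
have eI : 69000 * t ^ 3 / (a ^ 4 * L) = 69000 * (kap / a * t ^ 3) by rewrite /kap; field; lra.
have hI k : \rsum_(0 <= n < k) Rabs (snd (aph a t n)) <= 69000 * (kap / a * t ^ 3).
  by rewrite -eI; exact: im_sum.
have kp := kap_gt0.
have I0 : 0 <= kap / a * t ^ 3 by apply: Rmult_le_pos => //; apply: Rdiv_le_0_compat; lra.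
have e12 : exp (1 / 2) <= 2 by have := @exp_sub1_le2 (1 / 2) ltac:(lra); lra.
have hB : exp (1 / 2) * (69000 * (kap / a * t ^ 3)) * exp (- g / 2) <=
   138000 * (kap / a * t ^ 3) * exp (- (kap * t ^ 2 / 256)).
  have ep1 := exp_pos (1 / 2); have ep2 := exp_pos (- g / 2).
  apply: Rmult_le_compat; [nra | lra | nra | lra].
have [c1 c2] := @charf_central a a0 t g _ 0 (ex_intro _ K hK) hI (fun k => proj1 (re_prod a0 hL k (conj t0 t1))).
have eR : 69000 * t ^ 2 / (a ^ 3 * L) = 69000 * (kap * t ^ 2) by rewrite /kap; field; lra.
have [_ c3] := @charf_central a a0 t g _ (1 - 69000 * (kap * t ^ 2)) (ex_intro _ K hK) hI
  (fun k => eq_ind _ (fun z => 1 - z <= _) (proj2 (re_prod a0 hL k (conj t0 t1))) _ eR).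
split; first lra.
split; lra.
Qed.

End CharBounds.

(** Between [a / 10] and [1 / (2 L)] the gain of [eg_sum_lower] is of order [1 / (a L)], far more
    than [28 L]; above, [minor_arc] applies. *)
Lemma outer_bound : exists L0, 1000 <= L0 /\ forall a t, 0 < a -> L0 <= - ln a ->
  a / 10 <= t <= exp (10 * - ln a) -> Cmod (charf a t) <= exp (- (14 * - ln a)).
Proof.
have [L1 [h1000 h1]] := minor_arc.
have [L2 [L20 h2]] := @exp_dominates (14 * 12928) 1 2 ltac:(lra).
exists (Rmax L1 L2); have i1 := Rmax_l L1 L2; have i2 := Rmax_r L1 L2.
split; first lra.
move=> a t a0 hL [ht1 ht2].
case: (Rle_lt_dec (/ (2 * - ln a)) t) => ht; first by apply: h1 => //; lra.
set L := - ln a in hL ht2 ht *.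
have hL1 : 1000 <= L by lra.
have t0 : 0 < t by lra.
have ht' : 2 * t * L <= 1.
  have : t * (2 * L) <= / (2 * L) * (2 * L) by apply: Rmult_le_compat_r; lra.
  rewrite Rinv_l; lra.
have [K hK] := eg_sum_lower a0 hL1 (Rlt_le _ _ t0) ht'; rewrite -/L in hK.
apply: (@Rle_trans _ (exp (- (28 * L) / 2))); last by apply: exp_le; lra.
apply: (charf_Cmod_le a0); exists K => k /hK h; apply: Rle_trans h.
have t2 := pow_lt t 2 t0; have a2 := pow_lt a 2 a0.
have ha2 : a ^ 2 <= 100 * t ^ 2.
  have -> : 100 * t ^ 2 = (10 * t) ^ 2 by ring.
  by apply: pow_incr; lra.
apply: le_divr.
  by apply: Rmult_lt_0_compat; [apply: Rmult_lt_0_compat|]; lra.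
have eL : a * exp L = 1 by rewrite -(inv_a_expL a0) Rinv_r; lra.
have hE := h2 L ltac:(lra); rewrite Rmult_1_l in hE.
have k1 : a * (14 * 12928 * L ^ 2) <= 1 by rewrite -eL; apply: Rmult_le_compat_l; lra.
have -> : 28 * L * (64 * a * (a ^ 2 + t ^ 2) * L) = (28 * 64 * (a * L ^ 2)) * (a ^ 2 + t ^ 2) by ring.
apply: (@Rle_trans _ ((28 * 64 * (a * L ^ 2)) * (101 * t ^ 2))).
  apply: Rmult_le_compat_l; last lra.
  by have := pow_lt L 2 ltac:(lra); nra.
have -> : 28 * 64 * (a * L ^ 2) * (101 * t ^ 2) = (a * (14 * 12928 * L ^ 2)) * t ^ 2 by ring.
nra.
Qed.

(** * Integration of series *)

Lemma ex_RInt_cont (f : R -> R) a b : (forall x, continuous f x) -> ex_RInt f a b.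
Proof. by move=> h; apply: ex_RInt_continuous => x _. Qed.

Lemma lip_continuous (f : R -> R) (K : R) : (forall x y, Rabs (f x - f y) <= K * Rabs (x - y)) ->
  forall x, continuous f x.
Proof.
move=> h x; apply/filterlim_locally => eps.
have K0 : 0 <= Rabs K by exact: Rabs_pos.
have hd : 0 < eps / (Rabs K + 1) by apply: Rdiv_lt_0_compat; [exact: cond_pos | lra].
exists (mkposreal _ hd) => y; rewrite /ball /= /AbsRing_ball /= /abs /minus /plus /opp /= => hy.
rewrite -/(Rminus _ _) in hy *.
apply: Rle_lt_trans (h y x) _.
apply: (@Rle_lt_trans _ (Rabs K * Rabs (y - x))).
  by apply: Rmult_le_compat_r; [exact: Rabs_pos | exact: Rle_abs].
apply: (@Rle_lt_trans _ (Rabs K * (eps / (Rabs K + 1)))); first by apply: Rmult_le_compat_l; lra.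
have -> : Rabs K * (eps / (Rabs K + 1)) = eps - eps / (Rabs K + 1) by field; lra.
lra.
Qed.

(** A summable weight against uniformly bounded functions converges uniformly. *)
Lemma RInt_series_swap (P : nat -> R) (g : nat -> R -> R) (B a b : R) :
  (forall m, 0 <= P m) -> ex_series P -> 0 <= B ->
  (forall m, ex_RInt (g m) a b) -> (forall m x, Rabs (g m x) <= B) ->
  is_RInt (fun x => Series (fun m => P m * g m x)) a b (Series (fun m => P m * RInt (g m) a b)).
Proof.
move=> P0 hP B0 hg hB.
have sPB : ex_series (fun m => P m * B).
  by apply: (ex_series_ext (fun m => B * P m)) => [m|]; [rewrite Rmult_comm | exact: ex_series_scal_l].
have le x m : Rabs (P m * g m x) <= P m * B.
  by rewrite Rabs_mult (Rabs_pos_eq (P m)) //; apply: Rmult_le_compat_l.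
pose f N x := \rsum_(0 <= m < N) (P m * g m x).
have hf N : is_RInt (f N) a b (\rsum_(0 <= m < N) (P m * RInt (g m) a b)).
  elim: N => [|N IH].
    apply: (is_RInt_ext (fun _ => 0)); first by move=> x _; rewrite /f big_geq.
    rewrite big_geq //; have := is_RInt_const a b 0; by rewrite /scal /= /mult /= Rmult_0_r.
  rewrite big_nat_recr //=.
  apply: (is_RInt_ext (fun x => plus (f N x) (P N * g N x))).
    by move=> x _; rewrite /f big_nat_recr.
  apply: is_RInt_plus => //.
  exact: (is_RInt_scal (g N) a b (P N) _ (RInt_correct _ _ _ (hg N))).
have hu : filterlim f eventually (locally (fun x => Series (fun m => P m * g m x) : R_CompleteNormedModule)).
  apply/filterlim_locally => eps.
  have e2 : 0 < eps / 2 by have := cond_pos eps; lra.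
  have [N hN] := series_tail_small sPB e2.
  exists N => n hn x.
  have [sx _] := series_le (le x) sPB.
  have hn' : (N <= n)%N by lia.
  have key : Rabs (Series (fun m => P m * g m x) - f n x) <= eps / 2.
    apply: Rle_trans (Rlt_le _ _ (hN n hn')).
    have fin (u : nat -> R) : ex_series u -> is_series (fun m => if (m < n)%N then 0 else u m) (Series u - \rsum_(0 <= m < n) u m).
      move=> su; apply/is_series_rsum.
      apply: (is_lim_seq_ext_loc (fun k => \rsum_(0 <= m < k) u m - \rsum_(0 <= m < n) u m)).
        exists n => k hk; rewrite (@big_cat_nat _ _ _ n 0 k) //=; last by lia.
        rewrite [in RHS](@big_cat_nat _ _ _ n 0 k) //=; last by lia.
        rewrite [X in _ = X + _]big1_seq; last first.
          by move=> i; rewrite mem_index_iota => /andP [_ /andP [_ ->]].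
        have -> : \rsum_(n <= i < k) (if (i < n)%N then 0 else u i) = \rsum_(n <= i < k) u i.
          apply: eq_big_seq => i; rewrite mem_index_iota => /andP [h _].
          by rewrite ltnNge h.
        lra.
      apply: is_lim_seq_minus'; [exact: Series_rsum | exact: is_lim_seq_const].
    rewrite /f -(is_series_unique _ _ (fin _ sx)) -(is_series_unique _ _ (fin _ sPB)).
    apply: Rle_trans (Rle_abs _).
    apply: (proj2 (series_le _ (ex_intro _ _ (fin _ sPB)))) => m.
    by case: ifP => _; [rewrite Rabs_R0; lra | exact: le].
  rewrite /ball /= /AbsRing_ball /= /abs /minus /plus /opp /= -/(Rminus _ _) Rabs_minus_sym.
  by apply: Rle_lt_trans key _; lra.
have [If [l1 l2]] := filterlim_RInt f a b eventually _ _ _ hf hu.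
have -> // : Series (fun m => P m * RInt (g m) a b) = If.
apply: is_series_unique; apply/is_series_rsum; exact: l1.
Qed.

(** * Fejer smoothing *)

Definition tent (T t : R) := Rmax 0 (1 - Rabs t / T).

Lemma tent_bounds T t : 0 < T -> 0 <= tent T t <= 1.
Proof.
move=> T0; have : 0 <= Rabs t / T by apply: Rdiv_le_0_compat; [exact: Rabs_pos | lra].
by rewrite /tent => h; split; [exact: Rmax_l | apply: Rmax_lub; lra].
Qed.

Lemma tent_eq T t : 0 < T -> 0 <= t <= T -> tent T t = 1 - t / T.
Proof.
move=> T0 h; rewrite /tent Rabs_pos_eq; last lra.
have : t / T <= 1 by apply: divr_le; lra.
by move=> h1; rewrite Rmax_right; lra.
Qed.

(** The Fejer kernel [2 (1 - cos (T y)) / (T y^2)], of total mass [2 PI], given by its compactly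
    supported Fourier transform. *)
Definition W (T y : R) := 2 * RInt (fun t => tent T t * cos (t * y)) 0 T.

Lemma ex_RInt_tent_cos T y : 0 < T -> ex_RInt (fun t => tent T t * cos (t * y)) 0 T.
Proof.
move=> T0; apply: (ex_RInt_ext (fun t => (1 - t / T) * cos (t * y))).
  by move=> t; rewrite Rmin_left ?Rmax_right; [|lra|lra] => h; rewrite tent_eq //; lra.
apply: ex_RInt_cont => x; apply: (@ex_derive_continuous _ _ (fun t => (1 - t / T) * cos (t * y))).
by auto_derive; lra.
Qed.

Lemma W_closed T y : 0 < T -> y <> 0 -> W T y = 2 * ((1 - cos (T * y)) / (T * (y * y))).
Proof.
move=> T0 y0; rewrite /W; congr (2 * _); apply: is_RInt_unique.
apply: (is_RInt_ext (fun t => (1 - t / T) * cos (t * y))).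
  by move=> t; rewrite Rmin_left ?Rmax_right; [|lra|lra] => h; rewrite tent_eq //; lra.
pose F t := (1 - t / T) * sin (t * y) / y - cos (t * y) / (T * (y * y)).
have -> : (1 - cos (T * y)) / (T * (y * y)) = minus (F T) (F 0).
  by rewrite /F /minus /plus /opp /= Rmult_0_l sin_0 cos_0; field; lra.
apply: is_RInt_derive => t _.
  by rewrite /F; auto_derive; [lra | field; lra].
apply: (@ex_derive_continuous _ _ (fun t => (1 - t / T) * cos (t * y))).
by auto_derive; lra.
Qed.

Lemma W_0 T : 0 < T -> W T 0 = T.
Proof.
move=> T0; rewrite /W.
have -> : RInt (fun t => tent T t * cos (t * 0)) 0 T = T / 2; last by field.
apply: is_RInt_unique.
apply: (is_RInt_ext (fun t => 1 - t / T)).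
  move=> t; rewrite Rmin_left ?Rmax_right; [|lra|lra] => h.
  by rewrite tent_eq ?Rmult_0_r ?cos_0 //; lra.
pose F t := t - t * t / (2 * T).
have -> : T / 2 = minus (F T) (F 0) by rewrite /F /minus /plus /opp /=; field; lra.
apply: is_RInt_derive => t _.
  by rewrite /F; auto_derive => //; field; lra.
by apply: (@ex_derive_continuous _ _ (fun t => 1 - t / T)); auto_derive; lra.
Qed.

Lemma W_bounds T y : 0 < T -> 0 <= W T y <= 5 * (T / (1 + (T * y) ^ 2)).
Proof.
move=> T0; case: (Req_dec y 0) => y0.
  rewrite y0 W_0 // Rmult_0_r; have -> : 1 + 0 ^ 2 = 1 by ring.
  by rewrite /Rdiv Rinv_1; lra.
rewrite W_closed //; set z := T * y.
have z0 : z <> 0 by apply: Rmult_integral_contrapositive_currified; lra.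
have zz : 0 < z ^ 2 by rewrite -Rsqr_pow2; exact: Rsqr_pos_lt.
have [c1 c2] := one_sub_cos_le z; have cb := COS_bound z.
have -> : 2 * ((1 - cos z) / (T * (y * y))) = T * (2 * (1 - cos z) / z ^ 2) by rewrite /z; field; lra.
have -> : 5 * (T / (1 + z ^ 2)) = T * (5 / (1 + z ^ 2)) by field; lra.
split; first by apply: Rmult_le_pos; [lra | apply: Rdiv_le_0_compat; lra].
apply: Rmult_le_compat_l; first lra.
apply: divr_le => //.
have -> : 5 / (1 + z ^ 2) * z ^ 2 = 5 * z ^ 2 / (1 + z ^ 2) by field; lra.
apply: le_divr; first lra.
have e : z * z = z ^ 2 by ring.
(* Up to [z^2 = 4] the bound [1 - cos z <= z^2 / 2] is used, beyond it [1 - cos z <= 2]; both give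
   exactly 5 at [z^2 = 4]. *)
rewrite e in c2; case: (Rle_lt_dec (z ^ 2) 4) => h4; nra.
Qed.

Lemma W_lip T x y : 0 < T -> Rabs (W T x - W T y) <= 2 * T ^ 2 * Rabs (x - y).
Proof.
move=> T0; rewrite /W -Rmult_minus_distr_l.
have hm : RInt (fun t => tent T t * cos (t * x)) 0 T - RInt (fun t => tent T t * cos (t * y)) 0 T =
  RInt (fun t => minus (tent T t * cos (t * x)) (tent T t * cos (t * y))) 0 T.
  by rewrite RInt_minus //; exact: ex_RInt_tent_cos.
rewrite hm Rabs_mult (Rabs_pos_eq 2); last lra.
have -> : 2 * T ^ 2 * Rabs (x - y) = 2 * ((T - 0) * (T * Rabs (x - y))) by ring.
apply: Rmult_le_compat_l; first lra.
apply: abs_RInt_le_const; first lra.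
  by apply: ex_RInt_minus; exact: ex_RInt_tent_cos.
move=> t ht; rewrite /minus /plus /opp /= -/(Rminus _ _) -Rmult_minus_distr_l Rabs_mult.
have [h1 h2] := tent_bounds t T0; rewrite (Rabs_pos_eq (tent T t)) //.
have := Rabs_cos_sub (t * x) (t * y).
have -> : t * x - t * y = t * (x - y) by ring.
rewrite Rabs_mult (Rabs_pos_eq t); last lra.
have := Rabs_pos (cos (t * x) - cos (t * y)); have := Rabs_pos (x - y); nra.
Qed.

Lemma W_continuous T y : 0 < T -> continuous (W T) y.
Proof. by move=> T0; apply: (@lip_continuous _ (2 * T ^ 2)) => u w; exact: W_lip. Qed.

Lemma is_RInt_cauchy k x a b : 0 < k ->
  is_RInt (fun u => k / (1 + (k * (x - u)) ^ 2)) a b (atan (k * (b - x)) - atan (k * (a - x))).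
Proof.
move=> k0; have -> : atan (k * (b - x)) - atan (k * (a - x)) =
  minus (atan (k * (b - x))) (atan (k * (a - x))) by [].
apply: (is_RInt_derive (fun u => atan (k * (u - x)))) => u _.
  auto_derive => //; rewrite /Rsqr; field.
  have h := Rle_0_sqr (k * (x - u)); rewrite /Rsqr in h; nra.
apply: (@ex_derive_continuous _ _ (fun u => k / (1 + (k * (x - u)) ^ 2))).
auto_derive.
have := pow2_ge_0 (k * (x - u)); rewrite /Rminus /= => h; nra.
Qed.

Lemma RInt_cauchy_le k x a b : 0 < k -> a <= b -> RInt (fun u => k / (1 + (k * (x - u)) ^ 2)) a b <= 4.
Proof.
move=> k0 ab; rewrite (is_RInt_unique _ _ _ _ (@is_RInt_cauchy k x a b k0)).
have := atan_bound (k * (b - x)); have := atan_bound (k * (a - x)); have := PI_4; lra.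
Qed.

Lemma ex_RInt_cauchy k x a b : 0 < k -> ex_RInt (fun u => k / (1 + (k * (x - u)) ^ 2)) a b.
Proof. by move=> k0; eexists; exact: is_RInt_cauchy. Qed.

Lemma ex_RInt_Wshift T x a b : 0 < T -> ex_RInt (fun u => W T (x - u)) a b.
Proof.
move=> T0; apply: ex_RInt_cont; apply: (@lip_continuous _ (2 * T ^ 2)) => u w.
apply: Rle_trans (@W_lip _ _ _ T0) _; have -> : x - u - (x - w) = - (u - w) by ring.
by rewrite Rabs_Ropp; lra.
Qed.

Lemma RInt_Wshift_bounds T x a b : 0 < T -> a <= b -> 0 <= RInt (fun u => W T (x - u)) a b <= 20.
Proof.
move=> T0 ab; split.
  by apply: RInt_ge_0 => // [|u _]; [exact: ex_RInt_Wshift | have := @W_bounds T (x - u) T0; lra].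
apply: (@Rle_trans _ (RInt (fun u => scal 5 (T / (1 + (T * (x - u)) ^ 2))) a b)).
  apply: RInt_le => //; first exact: ex_RInt_Wshift.
    by apply: ex_RInt_scal; exact: ex_RInt_cauchy.
  by move=> u _; have := @W_bounds T (x - u) T0; rewrite /scal /= /mult /=; lra.
rewrite RInt_scal; last exact: ex_RInt_cauchy.
have := @RInt_cauchy_le T x a b T0 ab; set I := RInt _ _ _.
by rewrite /scal /= /mult /=; lra.
Qed.

Section Conv.
Variables (f : R -> R) (Lam a T U : R).
Hypothesis f01 : forall u, 0 <= f u <= 1.
Hypothesis Lam0 : 0 <= Lam.
Hypothesis flip : forall x y, Rabs (f x - f y) <= Lam * Rabs (x - y).
Hypothesis a0 : 0 < a.
Hypothesis fdec : forall u, f u <= exp (- (a * Rabs u)).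
Hypothesis T1 : 1 <= T.
Hypothesis U0 : 0 < U.

Let T0 : 0 < T.
Proof. lra. Qed.

(* The mass of the truncated kernel; it multiplies both expectations, so its value is irrelevant. *)
Definition Zf := RInt (fun u => W T (0 - u)) (- U) U.

Lemma f_continuous x : continuous f x.
Proof. exact: lip_continuous flip x. Qed.

Lemma ex_RInt_fW x b c : ex_RInt (fun u => f u * W T (x - u)) b c.
Proof.
apply: ex_RInt_cont => u; apply: (continuous_mult f (fun u => W T (x - u))); first exact: f_continuous.
apply: (continuous_comp (fun u => x - u) (W T)); last exact: W_continuous.
by apply: (@ex_derive_continuous _ _ (fun u => x - u)); auto_derive.
Qed.

(** An approximate identity, split at distance [1 / sqrt T] from [x]. Closer, the Lipschitz bound
    gives [Lam / sqrt T]. Farther, the kernel is at most [10 / sqrt T] times a Cauchy kernel of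
    width [1 / sqrt T], so both parts integrate by [RInt_cauchy_le]. *)
Lemma conv_local x :
  Rabs (RInt (fun u => f u * W T (x - u)) (- U) U - f x * RInt (fun u => W T (x - u)) (- U) U)
  <= (20 * Lam + 40) / sqrt T.
Proof.
have s0 : 0 < sqrt T by apply: sqrt_lt_R0.
have ss : sqrt T * sqrt T = T by apply: sqrt_sqrt; lra.
have -> : RInt (fun u => f u * W T (x - u)) (- U) U - f x * RInt (fun u => W T (x - u)) (- U) U =
  RInt (fun u => minus (f u * W T (x - u)) (scal (f x) (W T (x - u)))) (- U) U.
  rewrite RInt_minus; [|exact: ex_RInt_fW | by apply: ex_RInt_scal; exact: ex_RInt_Wshift].
  by rewrite (RInt_scal (fun u => W T (x - u)) (- U) U (f x)); [|exact: ex_RInt_Wshift].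
pose Gm u := plus (scal (5 * Lam / sqrt T) (T / (1 + (T * (x - u)) ^ 2)))
   (scal (10 / sqrt T) (sqrt T / (1 + (sqrt T * (x - u)) ^ 2))).
apply: (@Rle_trans _ (RInt Gm (- U) U)).
  apply: (norm_RInt_le (fun u => minus (f u * W T (x - u)) (scal (f x) (W T (x - u)))) Gm (- U) U); first lra.
  - move=> u _; rewrite /Gm /norm /= /abs /minus /plus /opp /scal /= /mult /= -/(Rminus _ _).
    have -> : f u * W T (x - u) - f x * W T (x - u) = (f u - f x) * W T (x - u) by ring.
    have [w0 w1] := @W_bounds T (x - u) T0.
    rewrite Rabs_mult (Rabs_pos_eq (W T _)) //.
    have h1 : Rabs (f u - f x) <= Lam * Rabs (x - u).
      by have := flip u x; rewrite (Rabs_minus_sym u x).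
    have h2 : Rabs (f u - f x) <= 1.
      by apply: Rabs_le; have := f01 u; have := f01 x; lra.
    set y := x - u in w0 w1 h1 *.
    have yy : (T * y) ^ 2 = T * T * y ^ 2 by ring.
    have y2 := pow2_ge_0 y; have ya : Rabs y ^ 2 = y ^ 2 by exact: pow2_abs.
    have q1 : 0 < T / (1 + (T * y) ^ 2) by apply: Rdiv_lt_0_compat => //; rewrite yy; nra.
    have yy2 : (sqrt T * y) ^ 2 = T * y ^ 2 by rewrite -{2}ss; ring.
    have q2 : 0 < sqrt T / (1 + (sqrt T * y) ^ 2) by apply: Rdiv_lt_0_compat => //; rewrite yy2; nra.
    have q3 : 0 <= 10 / sqrt T by apply: Rdiv_le_0_compat; lra.
    have q4 : 0 <= 5 * Lam / sqrt T by apply: Rdiv_le_0_compat; lra.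
    case: (Rle_lt_dec (Rabs y) (/ sqrt T)) => hy.
      apply: (@Rle_trans _ (Lam * / sqrt T * (5 * (T / (1 + (T * y) ^ 2))))).
        apply: Rmult_le_compat => //; first exact: Rabs_pos.
        by apply: Rle_trans h1 _; apply: Rmult_le_compat_l.
      have -> : Lam * / sqrt T * (5 * (T / (1 + (T * y) ^ 2))) = 5 * Lam / sqrt T * (T / (1 + (T * y) ^ 2)).
        by rewrite /Rdiv; ring.
      have : 0 <= 10 / sqrt T * (sqrt T / (1 + (sqrt T * y) ^ 2)) by apply: Rmult_le_pos; lra.
      lra.
    have h3 : 1 <= T * y ^ 2.
      have : / sqrt T * sqrt T <= Rabs y * sqrt T by apply: Rmult_le_compat_r; lra.
      rewrite Rinv_l; last lra.
      move=> h4; have := Rabs_pos y => ypos; rewrite -ya -ss.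
      have -> : sqrt T * sqrt T * Rabs y ^ 2 = (Rabs y * sqrt T) * (Rabs y * sqrt T) by ring.
      nra.
    apply: (@Rle_trans _ (1 * (5 * (T / (1 + (T * y) ^ 2))))).
      by apply: Rmult_le_compat => //; exact: Rabs_pos.
    have h5 : 5 * (T / (1 + (T * y) ^ 2)) <= 10 / sqrt T * (sqrt T / (1 + (sqrt T * y) ^ 2)).
      have -> : 10 / sqrt T * (sqrt T / (1 + (sqrt T * y) ^ 2)) = 10 / (1 + (sqrt T * y) ^ 2).
        by field; split; [rewrite yy2; nra | lra].
      rewrite yy yy2.
      have -> : 5 * (T / (1 + T * T * y ^ 2)) = 5 * T / (1 + T * T * y ^ 2) by field; nra.
      apply: divr_le; first by nra.
      have -> : 10 / (1 + T * y ^ 2) * (1 + T * T * y ^ 2) = 10 * (1 + T * T * y ^ 2) / (1 + T * y ^ 2) by field; nra.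
      apply: le_divr; first by nra.
      nra.
    have : 0 <= 5 * Lam / sqrt T * (T / (1 + (T * y) ^ 2)) by apply: Rmult_le_pos; lra.
    lra.
  - apply: RInt_correct; apply: ex_RInt_minus; first exact: ex_RInt_fW.
    by apply: ex_RInt_scal; exact: ex_RInt_Wshift.
  - apply: RInt_correct; apply: ex_RInt_plus; apply: ex_RInt_scal; exact: ex_RInt_cauchy.
rewrite /Gm RInt_plus; [|by apply: ex_RInt_scal; exact: ex_RInt_cauchy|by apply: ex_RInt_scal; exact: ex_RInt_cauchy].
rewrite (RInt_scal (fun u => T / (1 + (T * (x - u)) ^ 2))); last exact: ex_RInt_cauchy.
rewrite (RInt_scal (fun u => sqrt T / (1 + (sqrt T * (x - u)) ^ 2))); last exact: ex_RInt_cauchy.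
have c1 := @RInt_cauchy_le T x (- U) U T0 ltac:(lra).
have c2 := @RInt_cauchy_le (sqrt T) x (- U) U s0 ltac:(lra).
move: c1 c2; set I1 := RInt _ _ _; set I2 := RInt _ _ _ => c1 c2.
rewrite /plus /scal /= /mult /=.
have -> : (20 * Lam + 40) / sqrt T = 5 * Lam / sqrt T * 4 + 10 / sqrt T * 4 by field; lra.
apply: Rplus_le_compat; apply: Rmult_le_compat_l => //; apply: Rdiv_le_0_compat; lra.
Qed.

(** If [x] is within [U / 2] of 0, shifting the window changes the mass by two intervals of length
    at most [U / 2] on which the kernel is [O (1 / (T U^2))]. Otherwise [f x] itself is tiny. *)
Lemma conv_mass x : f x * Rabs (RInt (fun u => W T (x - u)) (- U) U - Zf) <=
  20 / (T * U) + 20 * exp (- (a * U / 2)).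
Proof.
have [b1 b2] := @RInt_Wshift_bounds T x (- U) U T0 ltac:(lra).
have [z1 z2] := @RInt_Wshift_bounds T 0 (- U) U T0 ltac:(lra).
have TU : 0 < T * U by nra.
have p1 : 0 < 20 / (T * U) by apply: Rdiv_lt_0_compat; lra.
have ep := exp_pos (- (a * U / 2)).
case: (Rle_lt_dec (Rabs x) (U / 2)) => hx; last first.
  have h1 : f x <= exp (- (a * U / 2)) by apply: Rle_trans (fdec x) _; apply: exp_le; nra.
  have h2 : Rabs (RInt (fun u => W T (x - u)) (- U) U - Zf) <= 20 by apply: Rabs_le; rewrite /Zf; lra.
  apply: (@Rle_trans _ (exp (- (a * U / 2)) * 20)); last lra.
  by apply: Rmult_le_compat => //; [case: (f01 x) | exact: Rabs_pos].
pose g y := W T (0 - y).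
have exg b c : ex_RInt g b c by exact: ex_RInt_Wshift.
have e1 : RInt (fun u => W T (x - u)) (- U) U = RInt g (- U + - x) (U + - x).
  have h := @RInt_comp_lin _ g 1 (- x) (- U) U (exg _ _).
  rewrite !Rmult_1_l in h; rewrite -h; apply: RInt_ext => u _.
  by rewrite /scal /= /mult /= Rmult_1_l /g; congr (W T _); ring.
have e2 : RInt g (- U + - x) (U + - x) - Zf = RInt g (- U + - x) (- U) - RInt g (U + - x) U.
  have c1 : RInt g (- U + - x) (- U) + RInt g (- U) U = RInt g (- U + - x) U.
    exact: RInt_Chasles.
  have c2 : RInt g (- U + - x) (U + - x) + RInt g (U + - x) U = RInt g (- U + - x) U.
    exact: RInt_Chasles.
  have -> : Zf = RInt g (- U) U by [].
  lra.
have gb y : U / 2 <= Rabs y -> Rabs (g y) <= 20 / (T * (U * U)).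
  move=> hy; rewrite /g; have [w0 w1] := @W_bounds T (0 - y) T0.
  rewrite Rabs_pos_eq //; apply: Rle_trans w1 _.
  have -> : (T * (0 - y)) ^ 2 = T * T * Rabs y ^ 2 by rewrite pow2_abs; ring.
  have h : U * U / 4 <= Rabs y ^ 2.
    have -> : U * U / 4 = (U / 2) ^ 2 by field.
    by apply: pow_incr; lra.
  have -> : 5 * (T / (1 + T * T * Rabs y ^ 2)) = 5 * T / (1 + T * T * Rabs y ^ 2).
    by field; have : 0 <= Rabs y ^ 2 by [apply: pow2_ge_0]; nra.
  have TT : 0 < T * T by nra.
  have UU : 0 < U * U by nra.
  apply: divr_le; first by nra.
  have -> : 20 / (T * (U * U)) * (1 + T * T * Rabs y ^ 2) = 20 * (1 + T * T * Rabs y ^ 2) / (T * (U * U)) by field; lra.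
  apply: le_divr; first by nra.
  nra.
have int1 b c : Rabs (c - b) <= U / 2 -> (forall y, Rmin b c <= y <= Rmax b c -> U / 2 <= Rabs y) ->
   Rabs (RInt g b c) <= 10 / (T * U).
  move=> hbc hb.
  have := @norm_RInt_le_const_abs _ g b c (RInt g b c) (20 / (T * (U * U))) (fun y hy => gb y (hb y hy)) (RInt_correct _ _ _ (exg b c)).
  rewrite /norm /= /abs /= => h; apply: Rle_trans h _.
  have -> : 10 / (T * U) = U / 2 * (20 / (T * (U * U))) by field; lra.
  apply: Rmult_le_compat_r => //; apply: Rdiv_le_0_compat; [lra | nra].
have [x1 x2] := proj1 (Rabs_le_between _ _) hx.
have j1 : Rabs (RInt g (- U + - x) (- U)) <= 10 / (T * U).
  apply: int1.
    by have -> : - U - (- U + - x) = x by ring.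
  move=> y [_ hy]; have : Rmax (- U + - x) (- U) <= - (U / 2) by apply: Rmax_lub; lra.
  by move=> h; rewrite Rabs_left; lra.
have j2 : Rabs (RInt g (U + - x) U) <= 10 / (T * U).
  apply: int1.
    by have -> : U - (U + - x) = x by ring.
  move=> y [hy _]; have : U / 2 <= Rmin (U + - x) U by apply: Rmin_glb; lra.
  by move=> h; rewrite Rabs_pos_eq; lra.
rewrite e1 e2.
have : Rabs (RInt g (- U + - x) (- U) - RInt g (U + - x) U) <= 20 / (T * U).
  apply: Rle_trans (Rabs_triang _ _) _; rewrite Rabs_Ropp.
  have -> : 20 / (T * U) = 10 / (T * U) + 10 / (T * U) by field; lra.
  lra.
have := f01 x; have := Rabs_pos (RInt g (- U + - x) (- U) - RInt g (U + - x) U); nra.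
Qed.

Definition conv_err := (20 * Lam + 40) / sqrt T + (20 / (T * U) + 20 * exp (- (a * U / 2))).

Lemma conv_approx x : Rabs (RInt (fun u => f u * W T (x - u)) (- U) U - Zf * f x) <= conv_err.
Proof.
have h1 := conv_local x; have h2 := conv_mass x.
set A := RInt (fun u => f u * W T (x - u)) (- U) U in h1 *.
set B := RInt (fun u => W T (x - u)) (- U) U in h1 h2.
have -> : A - Zf * f x = (A - f x * B) + f x * (B - Zf) by ring.
apply: Rle_trans (Rabs_triang _ _) _; rewrite [in X in _ + X]Rabs_mult (Rabs_pos_eq (f x)); last by case: (f01 x).
rewrite /conv_err; lra.
Qed.

(* The density of [X] smoothed by [W T]. *)
Definition Msm (u : R) := Series (fun m => Pm a m * W T (Xm a m - u)).

Definition expect (h : R -> R) := Series (fun m => Pm a m * h (Xm a m)).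

Lemma W_abs_le y : Rabs (W T y) <= 5 * T.
Proof.
have [w0 w1] := @W_bounds T y T0; rewrite Rabs_pos_eq //.
apply: Rle_trans w1 _; apply: Rmult_le_compat_l; first lra.
have h := pow2_ge_0 (T * y); apply: divr_le; first lra.
nra.
Qed.

Lemma ex_series_Pm_bounded (h : nat -> R) B : (forall m, Rabs (h m) <= B) ->
  ex_series (fun m => Pm a m * h m) /\ Rabs (Series (fun m => Pm a m * h m)) <= B.
Proof.
move=> hB.
have sB : is_series (fun m => B * Pm a m) B.
  by rewrite -{2}[B]Rmult_1_r; exact: is_series_scal_l (Pm_series a0).
have le m : Rabs (Pm a m * h m) <= B * Pm a m.
  have p0 := Pm_ge0 a0 m; rewrite Rabs_mult (Rabs_pos_eq (Pm a m)) // Rmult_comm.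
  by apply: Rmult_le_compat_r.
have [s1 s2] := series_le le (ex_intro _ _ sB); split=> //.
by rewrite -(is_series_unique _ _ sB).
Qed.

(** Averaging [conv_approx] over the law: the test function sees the smoothed density, up to the
    factor [Zf]. *)
Lemma conv_expect : is_RInt (fun u => f u * Msm u) (- U) U
    (Series (fun m => Pm a m * RInt (fun u => f u * W T (Xm a m - u)) (- U) U)) /\
  Rabs (RInt (fun u => f u * Msm u) (- U) U - Zf * expect f) <= conv_err.
Proof.
have sw := @RInt_series_swap (Pm a) (fun m u => f u * W T (Xm a m - u)) (5 * T) (- U) U
  (Pm_ge0 a0) (ex_series_Pm a0) ltac:(lra) (fun m => ex_RInt_fW (Xm a m) (- U) U).
have hb m u : Rabs (f u * W T (Xm a m - u)) <= 5 * T.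
  rewrite Rabs_mult (Rabs_pos_eq (f u)); last by case: (f01 u).
  by have := f01 u; have := W_abs_le (Xm a m - u); have := Rabs_pos (W T (Xm a m - u)); nra.
have {sw hb} sw := sw hb.
have is1 : is_RInt (fun u => f u * Msm u) (- U) U
    (Series (fun m => Pm a m * RInt (fun u => f u * W T (Xm a m - u)) (- U) U)).
  apply: is_RInt_ext sw => u _; rewrite /Msm -Series_scal_l.
  by apply: Series_ext => m; ring.
split=> //; rewrite (is_RInt_unique _ _ _ _ is1).
have bnd m : Rabs (RInt (fun u => f u * W T (Xm a m - u)) (- U) U - Zf * f (Xm a m)) <= conv_err.
  exact: conv_approx.
have [s1 s2] := ex_series_Pm_bounded bnd.
have Z20 : 0 <= Zf <= 20 by apply: RInt_Wshift_bounds; lra.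
have [s3 _] := @ex_series_Pm_bounded (fun m => Zf * f (Xm a m)) 20 ltac:(move=> m; rewrite Rabs_pos_eq; have := f01 (Xm a m); nra).
have -> : Zf * expect f = Series (fun m => Pm a m * (Zf * f (Xm a m))).
  by rewrite /expect -Series_scal_l; apply: Series_ext => m; ring.
have s4 : ex_series (fun m => Pm a m * RInt (fun u => f u * W T (Xm a m - u)) (- U) U).
  apply: (ex_series_ext (fun m => Pm a m * (RInt (fun u => f u * W T (Xm a m - u)) (- U) U - Zf * f (Xm a m)) + Pm a m * (Zf * f (Xm a m)))).
    by move=> m; rewrite /plus /=; ring.
  exact: ex_series_plus s1 s3.
rewrite -Series_minus //; apply: Rle_trans s2; right; congr Rabs.
by apply: Series_ext => m; ring.
Qed.

(** Fourier inversion for the smoothed density; the half comes from integrating over [t >= 0]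
    only. *)
Lemma Msm_fourier u : is_RInt (fun t => tent T t * (fst (charf a t) * cos (t * u) + snd (charf a t) * sin (t * u)))
  0 T (Msm u / 2).
Proof.
have sw := @RInt_series_swap (Pm a) (fun m t => tent T t * cos (t * (Xm a m - u))) 1 0 T
  (Pm_ge0 a0) (ex_series_Pm a0) ltac:(lra) (fun m => @ex_RInt_tent_cos T (Xm a m - u) T0).
have hb m t : Rabs (tent T t * cos (t * (Xm a m - u))) <= 1.
  have [h1 h2] := tent_bounds t T0.
  rewrite Rabs_mult (Rabs_pos_eq (tent T t)) //.
  have : Rabs (cos (t * (Xm a m - u))) <= 1 by apply: Rabs_le; exact: COS_bound.
  have := Rabs_pos (cos (t * (Xm a m - u))); nra.
have {sw hb} sw := sw hb.
have -> : Msm u / 2 = Series (fun m => Pm a m * RInt (fun t => tent T t * cos (t * (Xm a m - u))) 0 T).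
  rewrite /Msm /Rdiv -Series_scal_r; apply: Series_ext => m; rewrite /W; field.
apply: is_RInt_ext sw => t _.
have [sc _] := @ex_series_Pm_bounded (fun m => cos (t * Xm a m)) 1 ltac:(move=> m; apply: Rabs_le; exact: COS_bound).
have [ss _] := @ex_series_Pm_bounded (fun m => sin (t * Xm a m)) 1 ltac:(move=> m; apply: Rabs_le; exact: SIN_bound).
have e1 : fst (charf a t) = Series (fun m => Pm a m * cos (t * Xm a m)).
  by rewrite /charf /CSeries /=; apply: Series_ext => m /=; ring.
have e2 : snd (charf a t) = Series (fun m => Pm a m * sin (t * Xm a m)).
  by rewrite /charf /CSeries /=; apply: Series_ext => m /=; ring.
rewrite e1 e2.
have -> : tent T t * (Series (fun m => Pm a m * cos (t * Xm a m)) * cos (t * u) + Series (fun m => Pm a m * sin (t * Xm a m)) * sin (t * u))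
  = Series (fun m => Pm a m * cos (t * Xm a m)) * (tent T t * cos (t * u)) + Series (fun m => Pm a m * sin (t * Xm a m)) * (tent T t * sin (t * u)) by ring.
rewrite -!Series_scal_r -Series_plus; [|exact: ex_series_scal_r|exact: ex_series_scal_r].
apply: Series_ext => m; rewrite Rmult_minus_distr_l cos_minus; ring.
Qed.

End Conv.

(** * The smoothed density near 0 *)

Section Density.
Variable a : R.
Hypothesis a0 : 0 < a.
Let L := - ln a.
Hypothesis hL : 1000 <= L.
Hypothesis hout : forall t, a / 10 <= t <= exp (10 * L) -> Cmod (charf a t) <= exp (- (14 * L)).
Let kap := / (a ^ 3 * L).
Let tau := sqrt (a ^ 3 * L).
Let T := exp (10 * L).

Lemma tau_facts : 0 < tau /\ tau * tau = a ^ 3 * L /\ kap * (tau * tau) = 1 /\ sqrt kap = / tau /\ a ^ 2 <= tau.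
Proof.
have a3 : 0 < a ^ 3 * L by apply: Rmult_lt_0_compat; [exact: pow_lt | lra].
have tp : 0 < tau by apply: sqrt_lt_R0.
have tt : tau * tau = a ^ 3 * L by apply: sqrt_sqrt; lra.
split=> //; split=> //; split; first by rewrite tt /kap Rinv_l; lra.
split; first by rewrite /kap sqrt_inv.
apply: Rnot_lt_le => h.
have : tau * tau < a ^ 2 * a ^ 2 by apply: Rmult_le_0_lt_compat; lra.
rewrite tt; have aL := aL_le1 a0 hL; rewrite -/L in aL.
have -> : a ^ 2 * a ^ 2 = a ^ 3 * a by ring.
have := pow_lt a 3 a0 => h3 h4.
have : a ^ 3 * a <= a ^ 3 * L by apply: Rmult_le_compat_l; nra.
lra.
Qed.

Lemma T_facts : 1 <= T /\ exp (- (14 * L)) * T = a ^ 4 /\ a / 10 <= T.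
Proof.
have aL := aL_le1 a0 hL; rewrite -/L in aL.
have h1 : 1 <= T by have := exp_ge1p (10 * L); rewrite -/T; lra.
split=> //; split; last by nra.
rewrite /T -exp_plus (a_expL a0) -/L exp_nat_mul; congr exp.
by rewrite (_ : INR 4 = 4); [ring | rewrite INR_IZR_INZ].
Qed.

(** A Gaussian moment is dominated by a Cauchy profile at the scale [tau = kap^(-1/2)], so that the
    same arctangent bound integrates it. *)
Lemma y2_dom t : 0 <= t -> t ^ 2 * exp (- (kap * t ^ 2 / 256)) <= K2 * (a ^ 3 * L) / (1 + kap * t ^ 2).
Proof.
move=> t0; have kp := kap_gt0 a0 hL; rewrite -/L -/kap in kp.
have a3 : 0 < a ^ 3 * L by apply: Rmult_lt_0_compat; [exact: pow_lt | lra].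
set y := kap * t ^ 2; have y0 : 0 <= y by apply: Rmult_le_pos; [lra | exact: pow2_ge_0].
have e : t ^ 2 = y * (a ^ 3 * L) by rewrite /y /kap; field; lra.
have h := K2_bound y0; have ep := exp_pos (- (y / 256)).
apply: le_divr; first lra; rewrite e.
have -> : y * (a ^ 3 * L) * exp (- (y / 256)) * (1 + y) = (y * (1 + y) * exp (- (y / 256))) * (a ^ 3 * L) by ring.
apply: Rmult_le_compat_r; first lra.
apply: Rle_trans h; apply: Rmult_le_compat_r; first lra.
by nra.
Qed.

Lemma y4_dom t : 0 <= t -> kap * t ^ 4 * exp (- (kap * t ^ 2 / 256)) <= K3 * (a ^ 3 * L) / (1 + kap * t ^ 2).
Proof.
move=> t0; have kp := kap_gt0 a0 hL; rewrite -/L -/kap in kp.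
have a3 : 0 < a ^ 3 * L by apply: Rmult_lt_0_compat; [exact: pow_lt | lra].
set y := kap * t ^ 2; have y0 : 0 <= y by apply: Rmult_le_pos; [lra | exact: pow2_ge_0].
have e : kap * t ^ 4 = y ^ 2 * (a ^ 3 * L) by rewrite /y /kap; field; lra.
have h := K3_bound y0; have ep := exp_pos (- (y / 256)).
apply: le_divr; first lra; rewrite e.
have -> : y ^ 2 * (a ^ 3 * L) * exp (- (y / 256)) * (1 + y) = (y ^ 2 * (1 + y) * exp (- (y / 256))) * (a ^ 3 * L) by ring.
apply: Rmult_le_compat_r; first lra.
apply: Rle_trans h; apply: Rmult_le_compat_r; first lra.
have := pow2_ge_0 y; nra.
Qed.

Lemma y3_dom t : 0 <= t -> kap * t ^ 3 * exp (- (kap * t ^ 2 / 256)) <= K3 * tau / (1 + kap * t ^ 2).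
Proof.
move=> t0; have kp := kap_gt0 a0 hL; rewrite -/L -/kap in kp.
have [tp [tt [kt _]]] := tau_facts.
set y := kap * t ^ 2; have y0 : 0 <= y by apply: Rmult_le_pos; [lra | exact: pow2_ge_0].
have h := K3_bound y0; have ep := exp_pos (- (y / 256)).
set s := t / tau.
have s0 : 0 <= s by apply: Rdiv_le_0_compat.
have es : t = s * tau by rewrite /s; field; lra.
have ys : y = s ^ 2.
  have -> : y = kap * (tau * tau) * s ^ 2 by rewrite /y es; ring.
  by rewrite kt Rmult_1_l.
have e : kap * t ^ 3 = s ^ 3 * tau.
  have -> : kap * t ^ 3 = kap * (tau * tau) * (s ^ 3 * tau) by rewrite es; ring.
  by rewrite kt Rmult_1_l.
apply: le_divr; first lra; rewrite e.
have -> : s ^ 3 * tau * exp (- (y / 256)) * (1 + y) = (s ^ 3 * (1 + y) * exp (- (y / 256))) * tau by ring.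
apply: Rmult_le_compat_r; first lra.
apply: Rle_trans h; apply: Rmult_le_compat_r; first lra.
have : s ^ 3 <= (1 + y) ^ 2.
  rewrite ys; have -> : s ^ 3 = s * s ^ 2 by ring.
  have : s <= 1 + s ^ 2 by nra.
  have := pow2_ge_0 s; nra.
have -> : (1 + y) ^ 3 = (1 + y) ^ 2 * (1 + y) by ring.
by move=> h3; apply: Rmult_le_compat_r; lra.
Qed.

Definition C1 := 8 * (K2 + 138000 * K3) + 1.

(** In the inversion formula the real part meets [1 - cos (t u) = O (t^2 u^2)], and the cubic
    imaginary part meets [sin (t u) = O (t u)]. After integration at scale [tau] both are
    [tau^3 / a^2 = tau a L] for [u] of order [1 / a]. *)
Lemma Msm_diff u : Rabs (Msm a T u - Msm a T 0) <= C1 * (tau * (a * L)) * (1 + (a * u) ^ 2).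
Proof.
have [tp [tt [kt [sk a2t]]]] := tau_facts; have [T1 [eT aT]] := T_facts.
have T0 : 0 < T by lra.
have kp := kap_gt0 a0 hL; rewrite -/L -/kap in kp.
have aL := aL_le1 a0 hL; rewrite -/L in aL.
have a3 : 0 < a ^ 3 * L by apply: Rmult_lt_0_compat; [exact: pow_lt | lra].
have i1 := @Msm_fourier a T a0 T1 u; have i2 := @Msm_fourier a T a0 T1 0.
have hi := is_RInt_minus _ _ _ _ _ _ i1 i2.
pose A := u ^ 2 / 2 * (K2 * (a ^ 3 * L)) + 138000 / a * Rabs u * (K3 * (a ^ 3 * L)).
(* The integrable majorant: a Cauchy profile for the central range, and a constant, 2 for the cosine
   plus 1 for the sine, for the outer one, worth [3 a^4] over [[0, T]]. *)
pose Gm t := plus (scal (A * tau) (/ tau / (1 + (/ tau * (0 - t)) ^ 2))) (3 * exp (- (14 * L))).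
have k20 : 0 < K2 by rewrite /K2; lra.
have k30 : 0 < K3 by rewrite /K3; lra.
have u0 := Rabs_pos u; have u2 := pow2_ge_0 u.
have A0 : 0 <= A.
  apply: Rplus_le_le_0_compat; first by apply: Rmult_le_pos; [lra | apply: Rmult_le_pos; lra].
  apply: Rmult_le_pos; last by apply: Rmult_le_pos; lra.
  by apply: Rmult_le_pos => //; apply: Rdiv_le_0_compat; lra.
have e14 := exp_pos (- (14 * L)).
have it : 0 < / tau by apply: Rinv_0_lt_compat.
have ic := @ex_RInt_cauchy (/ tau) 0 0 T it.
have exG : ex_RInt Gm 0 T.
  apply: ex_RInt_plus; [exact: ex_RInt_scal | exact: ex_RInt_const].
have hn := norm_RInt_le _ Gm 0 T _ _ (Rlt_le _ _ T0) _ hi (RInt_correct _ _ _ exG).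
have hle : Rabs (Msm a T u / 2 - Msm a T 0 / 2) <= RInt Gm 0 T.
  apply: hn => t [t0 tT].
  rewrite /norm /= /abs /= /minus /plus /opp /= Rmult_0_r cos_0 sin_0.
  have [w0 w1] := tent_bounds t T0.
  set R1 := fst (charf a t); set I1 := snd (charf a t).
  have -> : tent T t * (R1 * cos (t * u) + I1 * sin (t * u)) + - (tent T t * (R1 * 1 + I1 * 0)) =
    tent T t * (R1 * (cos (t * u) - 1) + I1 * sin (t * u)) by ring.
  rewrite Rabs_mult (Rabs_pos_eq (tent T t)) //.
  set V := R1 * (cos (t * u) - 1) + I1 * sin (t * u).
  suff hV : Rabs V <= A / (1 + kap * t ^ 2) + 3 * exp (- (14 * L)).
    have -> : Gm t = A / (1 + kap * t ^ 2) + 3 * exp (- (14 * L)).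
      rewrite /Gm /plus /scal /= /mult /=; congr (_ + _).
      have -> : kap = / tau * / tau by rewrite /kap -tt Rinv_mult.
      by field; split; [lra | have := pow2_ge_0 t; have := pow2_ge_0 tau; have : 0 < tau * tau by [nra]; nra].
    have := Rabs_pos V; nra.
  have [m1 m2] : Rabs R1 <= Cmod (charf a t) /\ Rabs I1 <= Cmod (charf a t).
    by split; [exact: Rabs_fst_Cmod | exact: Rabs_snd_Cmod].
  have y0 : 0 <= kap * t ^ 2 by apply: Rmult_le_pos; [lra | exact: pow2_ge_0].
  have cos1 : Rabs (cos (t * u) - 1) <= 2 by apply: Rabs_le; have := COS_bound (t * u); lra.
  have sin1 : Rabs (sin (t * u)) <= 1 by apply: Rabs_le; exact: SIN_bound.
  have tri : Rabs V <= Rabs R1 * Rabs (cos (t * u) - 1) + Rabs I1 * Rabs (sin (t * u)).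
    by apply: Rle_trans (Rabs_triang _ _) _; rewrite !Rabs_mult; lra.
  have Aq : 0 <= A / (1 + kap * t ^ 2) by apply: Rdiv_le_0_compat; lra.
  case: (Rle_lt_dec t (a / 10)) => ht; last first.
    have hc := hout (conj (Rlt_le _ _ ht) tT).
    apply: Rle_trans tri _.
    have b1 : Rabs R1 * Rabs (cos (t * u) - 1) <= exp (- (14 * L)) * 2.
      by apply: Rmult_le_compat; [exact: Rabs_pos | exact: Rabs_pos | lra | lra].
    have b2 : Rabs I1 * Rabs (sin (t * u)) <= exp (- (14 * L)) * 1.
      by apply: Rmult_le_compat; [exact: Rabs_pos | exact: Rabs_pos | lra | lra].
    lra.
  have [c1 [c2 _]] := central_bounds a0 hL (conj t0 ht); rewrite -/L -/kap in c1 c2.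
  have cosu : Rabs (cos (t * u) - 1) <= t ^ 2 * (u ^ 2 / 2).
    have [z1 z2] := one_sub_cos_le (t * u); rewrite Rabs_left1; last lra.
    by have -> : t ^ 2 * (u ^ 2 / 2) = t * u * (t * u) / 2 by [field]; lra.
  have sinu : Rabs (sin (t * u)) <= t * Rabs u.
    by apply: Rle_trans (Rabs_sin_le _) _; rewrite Rabs_mult (Rabs_pos_eq t); lra.
  apply: Rle_trans tri _.
  set E := exp (- (kap * t ^ 2 / 256)) in c1 c2.
  have b1 : Rabs R1 * Rabs (cos (t * u) - 1) <= u ^ 2 / 2 * (K2 * (a ^ 3 * L) / (1 + kap * t ^ 2)).
    apply: (@Rle_trans _ (E * (t ^ 2 * (u ^ 2 / 2)))).
      by apply: Rmult_le_compat => //; [exact: Rabs_pos | exact: Rabs_pos | lra].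
    have -> : E * (t ^ 2 * (u ^ 2 / 2)) = u ^ 2 / 2 * (t ^ 2 * E) by ring.
    by apply: Rmult_le_compat_l; [lra | exact: y2_dom].
  have b2 : Rabs I1 * Rabs (sin (t * u)) <= 138000 / a * Rabs u * (K3 * (a ^ 3 * L) / (1 + kap * t ^ 2)).
    apply: (@Rle_trans _ (138000 * (kap / a * t ^ 3) * E * (t * Rabs u))).
      by apply: Rmult_le_compat => //; exact: Rabs_pos.
    have -> : 138000 * (kap / a * t ^ 3) * E * (t * Rabs u) = 138000 / a * Rabs u * (kap * t ^ 4 * E) by field; lra.
    apply: Rmult_le_compat_l; last exact: y4_dom.
    by apply: Rmult_le_pos => //; apply: Rdiv_le_0_compat; lra.
  have -> : A / (1 + kap * t ^ 2) = u ^ 2 / 2 * (K2 * (a ^ 3 * L) / (1 + kap * t ^ 2)) +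
    138000 / a * Rabs u * (K3 * (a ^ 3 * L) / (1 + kap * t ^ 2)) by rewrite /A; field; lra.
  lra.
have hG : RInt Gm 0 T <= 4 * (A * tau) + 3 * a ^ 4.
  rewrite RInt_plus; [|exact: ex_RInt_scal | exact: ex_RInt_const].
  rewrite (RInt_scal (fun t => / tau / (1 + (/ tau * (0 - t)) ^ 2))) // RInt_const.
  have := @RInt_cauchy_le (/ tau) 0 0 T it ltac:(lra); set I1 := RInt _ _ _ => hI.
  rewrite /plus /scal /= /mult /=.
  have : A * tau * I1 <= A * tau * 4 by apply: Rmult_le_compat_l; [apply: Rmult_le_pos; lra | lra].
  have -> : (T - 0) * (3 * exp (- (14 * L))) = 3 * (exp (- (14 * L)) * T) by ring.
  rewrite eT; lra.
have -> : Msm a T u - Msm a T 0 = 2 * (Msm a T u / 2 - Msm a T 0 / 2) by field.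
rewrite Rabs_mult (Rabs_pos_eq 2); last lra.
have eA : A = a * L * (K2 / 2 * (a * u) ^ 2 + 138000 * K3 * (a * Rabs u)) by rewrite /A; field; lra.
set z := a * Rabs u.
have z0 : 0 <= z by apply: Rmult_le_pos; lra.
have zz : (a * u) ^ 2 = z ^ 2 by rewrite /z Rpow_mult_distr Rpow_mult_distr pow2_abs.
have hA : A <= a * L * ((K2 + 138000 * K3) * (1 + z ^ 2)).
  rewrite eA zz -/z; apply: Rmult_le_compat_l; first by nra.
  have : z <= 1 + z ^ 2 by nra.
  have := pow2_ge_0 z; nra.
have ha4 : 6 * a ^ 4 <= tau * (a * L).
  apply: (@Rle_trans _ (a ^ 2 * (a * L))); last by apply: Rmult_le_compat_r => //; nra.
  have -> : 6 * a ^ 4 = a ^ 2 * (a * (6 * a)) by ring.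
  apply: Rmult_le_compat_l; first exact: pow2_ge_0.
  by apply: Rmult_le_compat_l; nra.
have hA2 : A * tau <= a * L * ((K2 + 138000 * K3) * (1 + z ^ 2)) * tau by apply: Rmult_le_compat_r; lra.
have z2 := pow2_ge_0 z.
have : tau * (a * L) <= tau * (a * L) * (1 + z ^ 2) by have : 0 <= tau * (a * L) by [apply: Rmult_le_pos; nra]; nra.
rewrite zz /C1; nra.
Qed.

Hypothesis hsmall : 552000 * K3 * sqrt (a * L) <= / 20000.

(** On [[0, tau / 600]] the real part of the characteristic function is at least 1/2. Elsewhere it
    may be negative, but only by the cubic error, which integrates to [O (tau sqrt (a L))], and by
    [a^14] in the outer range. *)
Lemma Msm_low : tau / 2000 <= Msm a T 0.
Proof.
have [tp [tt [kt [sk a2t]]]] := tau_facts; have [T1 [eT aT]] := T_facts.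
have T0 : 0 < T by lra.
have kp := kap_gt0 a0 hL; rewrite -/L -/kap in kp.
have aL := aL_le1 a0 hL; rewrite -/L in aL.
have k30 : 0 < K3 by rewrite /K3; lra.
have aLp : 0 < a * L by nra.
have sq : sqrt (a * L) * sqrt (a * L) = a * L by apply: sqrt_sqrt; lra.
have sq0 : 0 < sqrt (a * L) by apply: sqrt_lt_R0.
have taua : tau = a * sqrt (a * L).
  rewrite /tau; have -> : a ^ 3 * L = a ^ 2 * (a * L) by ring.
  by rewrite sqrt_mult ?sqrt_pow2 //; [lra | exact: pow2_ge_0 | lra].
have sq1 : sqrt (a * L) <= 1 / 10.
  by apply: Rnot_lt_le => h; nra.
set t1 := tau / 600.
have t10 : 0 < t1 by rewrite /t1; lra.
have t1a : t1 <= a / 10 by rewrite /t1 taua; nra.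
have i1 := @Msm_fourier a T a0 T1 0.
pose D t := tent T t * (fst (charf a t) * cos (t * 0) + snd (charf a t) * sin (t * 0)).
have eD t : D t = tent T t * fst (charf a t) by rewrite /D Rmult_0_r cos_0 sin_0; ring.
have exD : ex_RInt D 0 T by eexists; exact: i1.
have t1T : t1 <= T by lra.
have ex1 : ex_RInt D 0 t1 by apply: (ex_RInt_Chasles_1 _ _ _ T) => //; lra.
have ex2 : ex_RInt D t1 T by apply: (ex_RInt_Chasles_2 _ 0) => //; lra.
have ch : RInt D 0 t1 + RInt D t1 T = Msm a T 0 / 2.
  rewrite -(is_RInt_unique _ _ _ _ i1); exact: RInt_Chasles.
have h1 : t1 / 4 <= RInt D 0 t1.
  have -> : t1 / 4 = RInt (fun _ => 1 / 4) 0 t1.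
    by rewrite RInt_const /scal /= /mult /=; field.
  apply: RInt_le => //; [lra | exact: ex_RInt_const |].
  move=> t [t0 tt1]; rewrite eD tent_eq //; last lra.
  have [_ [_ [_ c]]] := central_bounds a0 hL (conj (Rlt_le _ _ t0) (Rle_trans _ _ _ (Rlt_le _ _ tt1) t1a)).
  rewrite -/L -/kap in c.
  have kt2 : kap * t ^ 2 <= / 360000.
    have : t ^ 2 <= t1 ^ 2 by apply: pow_incr; lra.
    have -> : / 360000 = kap * t1 ^ 2.
      have -> : kap * t1 ^ 2 = kap * (tau * tau) * / 360000 by rewrite /t1; field.
      by rewrite kt Rmult_1_l.
    by move=> h; apply: Rmult_le_compat_l; lra.
  have kt3 : kap / a * t ^ 3 <= / 360000 * (1 / 6000).
    have -> : kap / a * t ^ 3 = kap * t ^ 2 * (t / a) by field; lra.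
    have : t / a <= 1 / 6000.
      by apply: divr_le => //; rewrite /t1 taua in tt1; nra.
    have : 0 <= kap * t ^ 2 by apply: Rmult_le_pos; [lra | exact: pow2_ge_0].
    have : 0 <= t / a by apply: Rdiv_le_0_compat; lra.
    nra.
  have e1 : exp (- (kap * t ^ 2 / 256)) <= 1.
    by apply: exp_le1; have : 0 <= kap * t ^ 2; [apply: Rmult_le_pos; [lra | exact: pow2_ge_0] | lra].
  have kt30 : 0 <= kap / a * t ^ 3.
    by apply: Rmult_le_pos; [apply: Rdiv_le_0_compat; lra | apply: pow_le; lra].
  have ep := exp_pos (- (kap * t ^ 2 / 256)).
  have re : 1 / 2 <= fst (charf a t).
    apply: Rle_trans c; set X1 := kap * t ^ 2 in kt2 e1 ep *; set X2 := kap / a * t ^ 3 in kt3 kt30 *.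
    have : 138000 * X2 * exp (- (X1 / 256)) <= 138000 * X2 * 1 by apply: Rmult_le_compat_l; lra.
    lra.
  have : t / T <= 1 / 2 by apply: divr_le => //; nra.
  have : 0 <= t / T by apply: Rdiv_le_0_compat; lra.
  nra.
have e14 := exp_pos (- (14 * L)).
pose B := 138000 / a * (K3 * tau).
pose Gm t := plus (scal (- (B * tau)) (/ tau / (1 + (/ tau * (0 - t)) ^ 2))) (- exp (- (14 * L))).
have it : 0 < / tau by apply: Rinv_0_lt_compat.
have ic := @ex_RInt_cauchy (/ tau) 0 t1 T it.
have B0 : 0 < B.
  by apply: Rmult_lt_0_compat; [apply: Rdiv_lt_0_compat; lra | apply: Rmult_lt_0_compat; lra].
have exG : ex_RInt Gm t1 T.
  by apply: ex_RInt_plus; [exact: ex_RInt_scal | exact: ex_RInt_const].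
have h2 : RInt Gm t1 T <= RInt D t1 T.
  apply: RInt_le => // t [tt1 tT]; rewrite eD.
  have t0 : 0 <= t by lra.
  have [w0 w1] := tent_bounds t T0.
  have -> : Gm t = - (B / (1 + kap * t ^ 2)) - exp (- (14 * L)).
    rewrite /Gm /plus /scal /= /mult /=.
    have -> : kap = / tau * / tau by rewrite /kap -tt Rinv_mult.
    by field; split; [lra | have := pow2_ge_0 t; have : 0 < tau * tau by [nra]; nra].
  have y0 : 0 <= kap * t ^ 2 by apply: Rmult_le_pos; [lra | exact: pow2_ge_0].
  have Bq : 0 <= B / (1 + kap * t ^ 2) by apply: Rdiv_le_0_compat; lra.
  suff : - (B / (1 + kap * t ^ 2)) - exp (- (14 * L)) <= fst (charf a t).
    by case: (Rle_lt_dec 0 (fst (charf a t))) => ? ?; nra.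
  case: (Rle_lt_dec t (a / 10)) => ht; last first.
    have hc := hout (conj (Rlt_le _ _ ht) (Rlt_le _ _ tT)).
    have := Rle_trans _ _ _ (Rabs_fst_Cmod _) hc; move/Rabs_le_between; lra.
  have [_ [_ [c _]]] := central_bounds a0 hL (conj t0 ht); rewrite -/L -/kap in c.
  have := y3_dom t0; set E := exp _ in c *; move=> h3.
  have : 138000 * (kap / a * t ^ 3) * E <= B / (1 + kap * t ^ 2).
    have -> : 138000 * (kap / a * t ^ 3) * E = 138000 / a * (kap * t ^ 3 * E) by field; lra.
    have -> : B / (1 + kap * t ^ 2) = 138000 / a * (K3 * tau / (1 + kap * t ^ 2)) by rewrite /B; field; lra.
    by apply: Rmult_le_compat_l => //; apply: Rdiv_le_0_compat; lra.
  lra.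
have hG : - (4 * (B * tau)) - a ^ 4 <= RInt Gm t1 T.
  rewrite RInt_plus; [|exact: ex_RInt_scal | exact: ex_RInt_const].
  rewrite (RInt_scal (fun t => / tau / (1 + (/ tau * (0 - t)) ^ 2))) // RInt_const.
  have := @RInt_cauchy_le (/ tau) 0 t1 T it ltac:(lra); set I1 := RInt _ _ _ => hI.
  rewrite /plus /scal /= /mult /=.
  have Bt : 0 <= B * tau by apply: Rmult_le_pos; lra.
  have : (B * tau) * I1 <= (B * tau) * 4 by apply: Rmult_le_compat_l.
  have : exp (- (14 * L)) * (T - t1) <= a ^ 4 by rewrite -eT; apply: Rmult_le_compat_l; lra.
  nra.
have eB : 4 * (B * tau) <= tau / 20000.
  have -> : 4 * (B * tau) = 552000 * K3 * (tau / a) * tau by rewrite /B; field; lra.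
  have -> : tau / a = sqrt (a * L) by rewrite taua; field; lra.
  have := Rmult_le_compat_r tau _ _ (Rlt_le _ _ tp) hsmall; lra.
have ha4 : a ^ 4 <= tau / 20000.
  have -> : a ^ 4 = a ^ 2 * a ^ 2 by ring.
  have aa : a <= 1 / 100000 by nra.
  have : a ^ 2 <= / 20000 by nra.
  have := pow2_ge_0 a; nra.
have et : t1 = tau / 600 by [].
lra.
Qed.

End Density.

(** Both test functions have this two-sided exponential form: [f] is the case [A = a], [b = 1 - a],
    and [r] the case [A = beta + a], [b = 1 - a]. *)
Definition ftest (A b u : R) := exp (- (A * Rmax (- u) 0 + b * Rmax u 0)).

Lemma ftest_arg A b u : 0 < A -> 0 < b -> 0 <= A * Rmax (- u) 0 + b * Rmax u 0.
Proof.
move=> A0 b0; have h1 := Rmax_r (- u) 0; have h2 := Rmax_r u 0; nra.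
Qed.

Lemma ftest_bounds A b u : 0 < A -> 0 < b -> 0 <= ftest A b u <= 1.
Proof.
move=> A0 b0; split; first by left; exact: exp_pos.
by apply: exp_le1; have := ftest_arg u A0 b0; lra.
Qed.

Lemma exp_neg_lip x y : 0 <= x -> 0 <= y -> Rabs (exp (- x) - exp (- y)) <= Rabs (x - y).
Proof.
have H u w : 0 <= u -> u <= w -> 0 <= exp (- u) - exp (- w) <= w - u.
  move=> u0 uw; have -> : exp (- w) = exp (- u) * exp (- (w - u)) by rewrite -exp_plus; congr exp; ring.
  have e1 := exp_pos (- u); have e2 : exp (- u) <= 1 by apply: exp_le1; lra.
  have e3 := exp_ge1p (- (w - u)); have e4 : exp (- (w - u)) <= 1 by apply: exp_le1; lra.
  nra.
move=> x0 y0; case: (Rle_lt_dec x y) => h.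
  by have := H x y x0 h => h1; rewrite Rabs_pos_eq; [rewrite Rabs_left1; lra | lra].
have := H y x y0 (Rlt_le _ _ h) => h1.
by rewrite Rabs_left1; [rewrite Rabs_pos_eq; lra | lra].
Qed.

Lemma ftest_lip A b x y : 0 < A -> 0 < b ->
  Rabs (ftest A b x - ftest A b y) <= (A + b) * Rabs (x - y).
Proof.
move=> A0 b0; apply: Rle_trans (exp_neg_lip (ftest_arg x A0 b0) (ftest_arg y A0 b0)) _.
have H u w : Rabs (Rmax u 0 - Rmax w 0) <= Rabs (u - w).
  apply: Rabs_le; have := Rle_abs (u - w); have := Rle_abs (- (u - w)); rewrite Rabs_Ropp.
  by rewrite /Rmax; case: Rle_dec; case: Rle_dec; lra.
have -> : A * Rmax (- x) 0 + b * Rmax x 0 - (A * Rmax (- y) 0 + b * Rmax y 0) =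
  A * (Rmax (- x) 0 - Rmax (- y) 0) + b * (Rmax x 0 - Rmax y 0) by ring.
apply: Rle_trans (Rabs_triang _ _) _; rewrite !Rabs_mult (Rabs_pos_eq A) ?(Rabs_pos_eq b); [|lra|lra].
have h1 := H (- x) (- y); have h2 := H x y.
have e : Rabs (- x - - y) = Rabs (x - y) by rewrite -Rabs_Ropp; congr Rabs; ring.
rewrite e in h1; nra.
Qed.

Lemma Rmax_abs u : Rmax (- u) 0 + Rmax u 0 = Rabs u.
Proof. by rewrite /Rmax /Rabs; case: Rle_dec; case: Rle_dec; case: Rcase_abs; lra. Qed.

Lemma ftest_dec a A b u : 0 < a -> a <= A -> a <= b -> ftest A b u <= exp (- (a * Rabs u)).
Proof.
move=> a0 hA hb; apply: exp_le; rewrite -Rmax_abs.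
have h1 := Rmax_r (- u) 0; have h2 := Rmax_r u 0; nra.
Qed.

(** Halving both decay rates pays for the factor [1 + (a u)^2] from [Msm_diff]. *)
Lemma ftest_weight a A b u : 0 < a -> a <= A -> a <= b ->
  ftest A b u * (1 + (a * u) ^ 2) <= 16 * ftest (A / 2) (b / 2) u.
Proof.
move=> a0 hA hb.
have -> : ftest A b u = ftest (A / 2) (b / 2) u * ftest (A / 2) (b / 2) u.
  by rewrite /ftest -exp_plus; congr exp; field.
have h := @ftest_dec (a / 2) (A / 2) (b / 2) u ltac:(lra) ltac:(lra) ltac:(lra).
have f0 : 0 < ftest (A / 2) (b / 2) u by exact: exp_pos.
have y0 : 0 <= a * Rabs u by apply: Rmult_le_pos; [lra | exact: Rabs_pos].
have hs := sq_le_exp y0.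
have e : exp (- (a / 2 * Rabs u)) * exp (a * Rabs u / 2) = 1.
  by rewrite -exp_plus -exp_0; congr exp; field.
have -> : (a * u) ^ 2 = (a * Rabs u) ^ 2 by rewrite !Rpow_mult_distr pow2_abs.
set y := a * Rabs u in y0 hs e *.
have hy : 1 + y ^ 2 <= 16 * exp (y / 2) by nra.
have : ftest (A / 2) (b / 2) u * (1 + y ^ 2) <= exp (- (a / 2 * Rabs u)) * (16 * exp (y / 2)).
  by apply: Rmult_le_compat; [lra | have := pow2_ge_0 y; lra | exact: h | exact: hy].
have -> : exp (- (a / 2 * Rabs u)) * (16 * exp (y / 2)) = 16 by rewrite -[16 * _]Rmult_comm -Rmult_assoc e; ring.
nra.
Qed.

Lemma ftest_continuous A b u : 0 < A -> 0 < b -> continuous (ftest A b) u.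
Proof. by move=> A0 b0; apply: (@lip_continuous _ (A + b)) => x y; exact: ftest_lip. Qed.

Lemma ftest_RInt A b U : 0 < A -> 0 < b -> 0 < U ->
  RInt (ftest A b) (- U) U = (1 - exp (- (A * U))) / A + (1 - exp (- (b * U))) / b.
Proof.
move=> A0 b0 U0.
have ex c d : ex_RInt (ftest A b) c d by apply: ex_RInt_cont => u; exact: ftest_continuous.
have <- : RInt (ftest A b) (- U) 0 + RInt (ftest A b) 0 U = RInt (ftest A b) (- U) U by exact: RInt_Chasles.
congr (_ + _); apply: is_RInt_unique.
  apply: (is_RInt_ext (fun u => exp (A * u))).
    move=> u; rewrite Rmin_left ?Rmax_right; [|lra|lra] => h.
    by rewrite /ftest Rmax_left ?Rmax_right; [congr exp; ring|lra|lra].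
  have -> : (1 - exp (- (A * U))) / A = minus (exp (A * 0) / A) (exp (A * - U) / A).
    rewrite /minus /plus /opp /= Rmult_0_r exp_0; have -> : A * - U = - (A * U) by ring.
    by field; lra.
  apply: (is_RInt_derive (fun u => exp (A * u) / A)) => u _.
    by auto_derive => //; field; lra.
  by apply: (@ex_derive_continuous _ _ (fun u => exp (A * u))); auto_derive.
apply: (is_RInt_ext (fun u => exp (- (b * u)))).
  move=> u; rewrite Rmin_left ?Rmax_right; [|lra|lra] => h.
  by rewrite /ftest Rmax_right ?Rmax_left; [congr exp; ring|lra|lra].
have -> : (1 - exp (- (b * U))) / b = minus (- exp (- (b * U)) / b) (- exp (- (b * 0)) / b).
  by rewrite /minus /plus /opp /= Rmult_0_r Ropp_0 exp_0; field; lra.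
apply: (is_RInt_derive (fun u => - exp (- (b * u)) / b)) => u _.
  by auto_derive => //; field; lra.
by apply: (@ex_derive_continuous _ _ (fun u => exp (- (b * u)))); auto_derive.
Qed.

(** The three summands account for smoothing, for the variation of the density, and for cutting the
    integral of the test function at [U]. *)
Definition CE (Lam : R) := 2000 * (20 * Lam + 80) + 64000 * C1 + 1.

(** * Expectations of the two test functions *)

Section ExpectAsymp.
Variable a : R.
Hypothesis a0 : 0 < a.
Let L := - ln a.
Hypothesis hL : 1000 <= L.
Hypothesis hout : forall t, a / 10 <= t <= exp (10 * L) -> Cmod (charf a t) <= exp (- (14 * L)).
Hypothesis hsmall : 552000 * K3 * sqrt (a * L) <= / 20000.
Let T := exp (10 * L).
Let U := exp (2 * L).
Let M0 := Msm a T 0.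

Lemma M0_ge : a ^ 2 / 2000 <= M0.
Proof.
have := Msm_low a0 hL hout hsmall; have [tp [_ [_ [_ a2t]]]] := tau_facts a0 hL.
rewrite -/M0 -/L -/T in a2t *; lra.
Qed.

(** The integral of [ftest A b] is [1 / A + 1 / b], and at the scales it sees the smoothed density
    is [M0] up to a relative [O (a L)]. *)
Lemma expect_asymp A b Lam : a <= A -> 1 / 2 <= b <= 1 -> A + b <= Lam ->
  Rabs (Zf T U * expect a (ftest A b) - M0 * (/ A + / b)) <= CE Lam * (a * L) * (M0 * (/ A + / b)).
Proof.
move=> hA hb hLam.
have aL := aL_le1 a0 hL; rewrite -/L in aL.
have A0 : 0 < A by lra.
have b0 : 0 < b by lra.
have ab : a <= b by nra.
have [T1 _] := T_facts a0 hL; rewrite -/L -/T in T1.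
have U0 : 0 < U by exact: exp_pos.
have Lam0 : 0 <= A + b by lra.
set f := ftest A b.
have f01 u : 0 <= f u <= 1 by exact: ftest_bounds.
have flip x y : Rabs (f x - f y) <= (A + b) * Rabs (x - y) by exact: ftest_lip.
have fdec u : f u <= exp (- (a * Rabs u)) by exact: ftest_dec.
have [i1 h1] := conv_expect f01 Lam0 flip a0 fdec T1 U0.
have Ml := Msm_low a0 hL hout hsmall; rewrite -/L -/T -/M0 in Ml.
have [tp [tt [_ [_ a2t]]]] := tau_facts a0 hL; rewrite -/L in tp tt a2t Ml.
set tau := sqrt (a ^ 3 * L) in tp tt a2t Ml.
have Mdiff u : Rabs (Msm a T u - M0) <= C1 * (tau * (a * L)) * (1 + (a * u) ^ 2) by exact: Msm_diff.
have k20 : 0 < K2 by rewrite /K2; lra.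
have k30 : 0 < K3 by rewrite /K3; lra.
have C10 : 0 < C1 by rewrite /C1; lra.
have aLp : 0 < a * L by nra.
have M00 : 0 < M0 by lra.
set I := / A + / b.
have iA : 0 < / A by apply: Rinv_0_lt_compat.
have ib : 1 <= / b by rewrite -{1}Rinv_1; apply: Rinv_le_contravar; lra.
have I1 : 1 <= I by rewrite /I; lra.
have exf c d : ex_RInt f c d by apply: ex_RInt_cont => u; exact: ftest_continuous.
have exfM : ex_RInt (fun u => f u * Msm a T u) (- U) U by eexists; exact: i1.
have ex2 c d : ex_RInt (ftest (A / 2) (b / 2)) c d.
  by apply: ex_RInt_cont => u; apply: ftest_continuous; lra.
set S1 := RInt (fun u => f u * Msm a T u) (- U) U in h1.
have h2 : Rabs (S1 - M0 * RInt f (- U) U) <= C1 * (tau * (a * L)) * 16 * (2 * I).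
  have -> : S1 - M0 * RInt f (- U) U = RInt (fun u => minus (f u * Msm a T u) (scal M0 (f u))) (- U) U.
    rewrite RInt_minus //; last exact: ex_RInt_scal.
    by rewrite (RInt_scal f).
  have ct : 0 <= C1 * (tau * (a * L)) by apply: Rmult_le_pos; [lra | apply: Rmult_le_pos; lra].
  apply: (@Rle_trans _ (RInt (fun u => scal (C1 * (tau * (a * L)) * 16) (ftest (A / 2) (b / 2) u)) (- U) U)).
    apply: (norm_RInt_le (fun u => minus (f u * Msm a T u) (scal M0 (f u)))
       (fun u => scal (C1 * (tau * (a * L)) * 16) (ftest (A / 2) (b / 2) u)) (- U) U); first lra.
    - move=> u _; rewrite /norm /= /abs /minus /plus /opp /scal /= /mult /=.
      have -> : f u * Msm a T u + - (M0 * f u) = f u * (Msm a T u - M0) by ring.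
      have [f0 f1] := f01 u; rewrite Rabs_mult (Rabs_pos_eq (f u)) //.
      apply: (@Rle_trans _ (f u * (C1 * (tau * (a * L)) * (1 + (a * u) ^ 2)))); first by apply: Rmult_le_compat_l.
      have := @ftest_weight a A b u a0 hA ab; rewrite -/f => h.
      have := Rmult_le_compat_l _ _ _ ct h; lra.
    - by apply: RInt_correct; apply: ex_RInt_minus => //; exact: ex_RInt_scal.
    - by apply: RInt_correct; exact: ex_RInt_scal.
  rewrite (RInt_scal (ftest (A / 2) (b / 2))) //.
  rewrite /scal /= /mult /=; apply: Rmult_le_compat_l; first lra.
  rewrite ftest_RInt; [|lra|lra|lra].
  have e1 := exp_pos (- (A / 2 * U)); have e2 := exp_pos (- (b / 2 * U)).
  have -> : 2 * I = 1 / (A / 2) + 1 / (b / 2) by rewrite /I; field; lra.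
  by apply: Rplus_le_compat; apply: Rmult_le_compat_r; [left; apply: Rinv_0_lt_compat; lra | lra | left; apply: Rinv_0_lt_compat; lra | lra].
have eLa : a * exp L = 1 by rewrite -(inv_a_expL a0) Rinv_r; lra.
(* [U = a^-2], so the tails of the test functions beyond [U] are exponentially small in [1 / a]. *)
have aU : a * U = exp L.
  rewrite /U; have -> : 2 * L = L + L by ring.
  by rewrite exp_plus -Rmult_assoc eLa; ring.
have eL10 : 10 * L <= exp L.
  by have := @exp_ge_pow6 L ltac:(lra); have -> : (L / 6) ^ 6 = L * (L ^ 5 / 46656) by [field];
     have : 1000 ^ 5 <= L ^ 5 by [apply: pow_incr; lra]; nra.
have a5 : exp (- (5 * L)) = a ^ 5.
  by rewrite (a_expL a0) -/L exp_nat_mul; congr exp; rewrite (_ : INR 5 = 5) ?INR_IZR_INZ //; ring.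
have a5a : a ^ 5 <= a ^ 2 * (a * L).
  have -> : a ^ 5 = a ^ 2 * (a * (a * a)) by ring.
  apply: Rmult_le_compat_l; first exact: pow2_ge_0.
  by apply: Rmult_le_compat_l; nra.
have eU c : a <= c -> exp (- (c * U)) <= a * L.
  move=> hc; apply: (@Rle_trans _ (exp (- L))).
    by apply: exp_le; have : a * U <= c * U; [apply: Rmult_le_compat_r; lra | lra].
  by rewrite -(a_expL a0); nra.
have h3 : Rabs (RInt f (- U) U - I) <= a * L * I.
  rewrite /f ftest_RInt // /I.
  have -> : (1 - exp (- (A * U))) / A + (1 - exp (- (b * U))) / b - (/ A + / b) =
    - (exp (- (A * U)) * / A + exp (- (b * U)) * / b) by field; lra.
  have e1 := exp_pos (- (A * U)); have e2 := exp_pos (- (b * U)).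
  rewrite Rabs_Ropp Rabs_pos_eq; last by apply: Rplus_le_le_0_compat; apply: Rmult_le_pos; lra.
  have := Rmult_le_compat_r (/ A) _ _ ltac:(lra) (eU A hA).
  have := Rmult_le_compat_r (/ b) _ _ ltac:(lra) (eU b ab); lra.
have sT : sqrt T = exp (5 * L).
  have -> : T = exp (5 * L) * exp (5 * L) by rewrite /T -exp_plus; congr exp; ring.
  by rewrite sqrt_square //; left; exact: exp_pos.
have herr : conv_err (A + b) a T U <= (20 * Lam + 80) * a ^ 5.
  rewrite /conv_err sT.
  have p5 := pow_lt a 5 a0.
  have g1 : (20 * (A + b) + 40) / exp (5 * L) <= (20 * Lam + 40) * a ^ 5.
    by rewrite /Rdiv -exp_Ropp a5; apply: Rmult_le_compat_r; lra.
  have g2 : 20 / (T * U) <= 20 * a ^ 5.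
    rewrite /T /U -exp_plus /Rdiv -exp_Ropp -a5; apply: Rmult_le_compat_l; first lra.
    by apply: exp_le; lra.
  have g3 : 20 * exp (- (a * U / 2)) <= 20 * a ^ 5.
    by rewrite aU -a5; apply: Rmult_le_compat_l; [lra | apply: exp_le; lra].
  lra.
have a2M : a ^ 2 <= 2000 * M0 by lra.
have g5 : (20 * Lam + 80) * a ^ 5 <= 2000 * (20 * Lam + 80) * (a * L) * (M0 * I).
  have -> : 2000 * (20 * Lam + 80) * (a * L) * (M0 * I) = (20 * Lam + 80) * ((2000 * M0) * (a * L) * I) by ring.
  apply: Rmult_le_compat_l; first lra.
  apply: Rle_trans a5a _.
  have : a ^ 2 * (a * L) <= 2000 * M0 * (a * L) by apply: Rmult_le_compat_r; lra.
  have : 0 <= 2000 * M0 * (a * L) by apply: Rmult_le_pos; lra.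
  nra.
have g6 : C1 * (tau * (a * L)) * 16 * (2 * I) <= 64000 * C1 * (a * L) * (M0 * I).
  have -> : C1 * (tau * (a * L)) * 16 * (2 * I) = (32 * C1 * (a * L) * I) * tau by ring.
  have -> : 64000 * C1 * (a * L) * (M0 * I) = (32 * C1 * (a * L) * I) * (2000 * M0) by ring.
  apply: Rmult_le_compat_l; last lra.
  by apply: Rmult_le_pos; [apply: Rmult_le_pos; lra | lra].
set RI := RInt f (- U) U in h2 h3.
have h3' : Rabs (M0 * (RI - I)) <= M0 * (a * L * I).
  by rewrite Rabs_mult (Rabs_pos_eq M0); [apply: Rmult_le_compat_l; lra | lra].
have -> : Zf T U * expect a f - M0 * I = - (S1 - Zf T U * expect a f) + ((S1 - M0 * RI) + M0 * (RI - I)) by ring.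
apply: Rle_trans (Rabs_triang _ _) _; rewrite Rabs_Ropp.
have := Rabs_triang (S1 - M0 * RI) (M0 * (RI - I)).
rewrite /CE; lra.
Qed.

End ExpectAsymp.

(** The unknown factors [Zf] and [M0] cancel in the quotient of two instances of [expect_asymp]. The
    crude lower bound is kept to dominate the sieve error later. *)
Lemma expect_ratio (beta : R) : 0 < beta -> exists C L0, 0 < C /\ 1000 <= L0 /\
  forall a, 0 < a -> L0 <= - ln a ->
  a / 80000 <= expect a (ftest a (1 - a)) /\
  Rabs (expect a (ftest (beta + a) (1 - a)) - expect a (ftest a (1 - a)) * (a * ((1 + beta) / beta)))
   <= C * (a * - ln a) * (expect a (ftest a (1 - a)) * (a * ((1 + beta) / beta))).
Proof.
move=> b0; have [L1 [h1000 hout]] := outer_bound.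
have k20 : 0 < K2 by rewrite /K2; lra.
have k30 : 0 < K3 by rewrite /K3; lra.
have C10 : 0 < C1 by rewrite /C1; lra.
set Lam := 1 + beta.
have CE0 : 0 < CE Lam by rewrite /CE /Lam; lra.
have ib : 0 < / beta by apply: Rinv_0_lt_compat.
exists (4 * CE Lam + / beta), (L1 + 20000 * (552000 * K3) + 2 * CE Lam).
split; first lra.
split; first lra.
move=> a a0 hL; set L := - ln a in hL *.
have hL1 : 1000 <= L by lra.
have ho : forall t, a / 10 <= t <= exp (10 * L) -> Cmod (charf a t) <= exp (- (14 * L)).
  by move=> t ht; apply: hout => //; rewrite -/L; lra.
have aL3 := @aL3_le a a0 ltac:(rewrite -/L; lra); rewrite -/L in aL3.
have aL := aL_le1 a0 hL1; rewrite -/L in aL.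
have aLp : 0 < a * L by nra.
have iL : 0 < / L by apply: Rinv_0_lt_compat; lra.
have aLi : a * L <= / L * / L.
  have -> : a * L = (a * L ^ 3) * (/ L * / L) by field; lra.
  have : 0 < / L * / L by nra.
  nra.
have iL1 : / L <= 1 by rewrite -Rinv_1; apply: Rinv_le_contravar; lra.
have LL : L * / L = 1 by rewrite Rinv_r; lra.
have hs : 552000 * K3 * sqrt (a * L) <= / 20000.
  have : sqrt (a * L) <= / L by rewrite -(sqrt_square (/ L)); [apply: sqrt_le_1_alt | lra].
  move=> h; apply: (@Rle_trans _ (552000 * K3 * / L)); first by apply: Rmult_le_compat_l; lra.
  have : (20000 * (552000 * K3)) * / L <= L * / L by apply: Rmult_le_compat_r; lra.
  lra.
have eps2 : CE Lam * (a * L) <= 1 / 2.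
  have : 2 * CE Lam * / L <= L * / L by apply: Rmult_le_compat_r; lra.
  have : CE Lam * (a * L) <= CE Lam * / L by apply: Rmult_le_compat_l; nra.
  lra.
set T := exp (10 * L); set U := exp (2 * L).
have a12 : a <= 1 / 2 by nra.
have hA := @expect_asymp a a0 hL1 ho hs a (1 - a) Lam ltac:(lra) ltac:(lra) ltac:(rewrite /Lam; lra).
have hB := @expect_asymp a a0 hL1 ho hs (beta + a) (1 - a) Lam ltac:(lra) ltac:(lra) ltac:(rewrite /Lam; lra).
have M0g := M0_ge a0 hL1 ho hs.
rewrite -/L -/T -/U in hA hB M0g.
set Ef := expect a (ftest a (1 - a)) in hA *; set Er := expect a (ftest (beta + a) (1 - a)) in hB *.
set Z := Zf T U in hA hB; set M0 := Msm a T 0 in hA hB M0g.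
set I1 := / a + / (1 - a) in hA; set I2 := / (beta + a) + / (1 - a) in hB.
set eps := CE Lam * (a * L) in eps2 hA hB.
have eps0 : 0 < eps by rewrite /eps; nra.
have ia : 0 < / a by apply: Rinv_0_lt_compat.
have i1a : 0 < / (1 - a) by apply: Rinv_0_lt_compat; lra.
have M00 : 0 < M0 by have := pow_lt a 2 a0; lra.
have T0 : 0 < T by exact: exp_pos.
have Zb : 0 <= Z <= 20 by apply: RInt_Wshift_bounds => //; have := exp_pos (2 * L); rewrite -/U; lra.
have Ef0 : 0 <= Ef.
  apply: Series_ge0.
    move=> m; apply: Rmult_le_pos; first exact: Pm_ge0.
    by have := @ftest_bounds a (1 - a) (Xm a m) a0 ltac:(lra); lra.
  apply: (proj1 (@ex_series_Pm_bounded a a0 (fun m => ftest a (1 - a) (Xm a m)) 1 _)) => m.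
  by have := @ftest_bounds a (1 - a) (Xm a m) a0 ltac:(lra) => h; rewrite Rabs_pos_eq; lra.
have [a1 a2] := proj1 (Rabs_le_between _ _) hA.
have MI : 0 < M0 * I1 by apply: Rmult_lt_0_compat => //; rewrite /I1; lra.
have ZE : M0 * I1 <= 2 * (Z * Ef) by nra.
have lowE : a / 80000 <= Ef.
  have : a / 2000 <= M0 * I1.
    have -> : a / 2000 = a ^ 2 / 2000 * / a by field; lra.
    by apply: Rmult_le_compat; [have := pow2_ge_0 a; lra | lra | lra | rewrite /I1; lra].
  nra.
split=> //.
set R := a * ((1 + beta) / beta).
set rr := a * (1 + beta) / (beta + a).
have R0 : 0 < R by apply: Rmult_lt_0_compat => //; apply: Rdiv_lt_0_compat; lra.
have rr0 : 0 < rr by apply: Rdiv_lt_0_compat; nra.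
(* The exact ratio of the integrals is [rr]; it differs from [R] by the relative error
   [a / (beta + a)]. *)
have eI : I2 = rr * I1 by rewrite /I2 /rr /I1; field; lra.
have eR : R - rr = R * (a / (beta + a)) by rewrite /R /rr; field; lra.
have rR : 0 <= R - rr <= R * (a * / beta).
  rewrite eR; split; first by apply: Rmult_le_pos; [lra | apply: Rdiv_le_0_compat; lra].
  by apply: Rmult_le_compat_l; [lra | apply: Rmult_le_compat_l; [lra | apply: Rinv_le_contravar; lra]].
have [c1 c2] := proj1 (Rabs_le_between _ _) hB.
have Zp : 0 < Z by apply: Rnot_le_lt => h; nra.
have d1 : Rabs (Er - rr * Ef) <= 4 * eps * rr * Ef.
  apply: (Rmult_le_reg_l Z) => //.
  rewrite -{1}(Rabs_pos_eq Z); last lra.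
  rewrite -Rabs_mult.
  have -> : Z * (Er - rr * Ef) = (Z * Er - M0 * I2) + - rr * (Z * Ef - M0 * I1) by rewrite eI; ring.
  apply: Rle_trans (Rabs_triang _ _) _; rewrite [in X in _ + X]Rabs_mult Rabs_Ropp (Rabs_pos_eq rr); last lra.
  have : rr * Rabs (Z * Ef - M0 * I1) <= rr * (eps * (M0 * I1)) by apply: Rmult_le_compat_l; lra.
  have -> : Z * (4 * eps * rr * Ef) = 2 * eps * rr * (2 * (Z * Ef)) by ring.
  have : 2 * eps * rr * (M0 * I1) <= 2 * eps * rr * (2 * (Z * Ef)) by apply: Rmult_le_compat_l => //; nra.
  rewrite eI in hB; rewrite eI; lra.
have -> : Er - Ef * R = (Er - rr * Ef) + - ((R - rr) * Ef) by ring.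
apply: Rle_trans (Rabs_triang _ _) _; rewrite Rabs_Ropp (Rabs_pos_eq ((R - rr) * Ef)); last by apply: Rmult_le_pos; lra.
have d2 : (R - rr) * Ef <= R * (a * / beta) * Ef by apply: Rmult_le_compat_r; lra.
have d3 : 4 * eps * rr * Ef <= 4 * eps * R * Ef.
  by apply: Rmult_le_compat_r => //; apply: Rmult_le_compat_l; lra.
have d4 : R * (a * / beta) * Ef <= / beta * (a * L) * (Ef * R).
  have -> : R * (a * / beta) * Ef = / beta * a * (Ef * R) by ring.
  have ER : 0 <= Ef * R by apply: Rmult_le_pos; lra.
  apply: Rmult_le_compat_r => //; apply: Rmult_le_compat_l; nra.
have -> : (4 * CE Lam + / beta) * (a * L) * (Ef * R) = 4 * eps * R * Ef + / beta * (a * L) * (Ef * R) by rewrite /eps; ring.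
lra.
Qed.

(** * Rankin's bound for the sieve error *)

(** The local weight of [16^(a/8)] per prime divisor and [rad j^(-(1 - a/8))], as produced by
    [Qc_interp] with [eps = a / 8]. *)
Definition rb (a : R) (n : nat) : R := Rpower (16 * INR n) (a / 8) / INR n.

Definition rv (a : R) (n : nat) : R :=
  if prime n then qp a n * ((INR n + 1) * rb a n - 1) else 0.

(** The new Euler factor is the factor of [Hs] times [1 + rv a n], since
    [e / (1 - e) = (p + 1) q / (1 - q)]. So only the sum of [rv] must be controlled. *)
Lemma rankin_efac a n : 0 < a -> prime n ->
  0 <= efac (rb a) (rho a) n <= hfac a n * exp (rv a n).
Proof.
move=> a0 pn; have [q0 q1] := qp_bounds a0 pn; have h2 := INR_prime_ge2 pn.
have [r0 r1] := rho_bounds a0 pn.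
have b0 : 0 < rb a n by apply: Rdiv_lt_0_compat; [exact: exp_pos | lra].
have e := efac_hb a0 pn.
rewrite /efac /hfac /rv pn.
set t := rho a n / (1 - rho a n) in e *.
have t0 : 0 < t by apply: Rdiv_lt_0_compat; lra.
split; first by have := Rmult_lt_0_compat _ _ b0 t0; lra.
have et : t = (INR n + 1) * (qp a n / (1 - qp a n)).
  have -> : t = (INR n + 1) * (1 + hb n * t - 1) by rewrite /hb; field; lra.
  by rewrite e; field; lra.
have -> : 1 + rb a n * t = / (1 - qp a n) * (1 + qp a n * ((INR n + 1) * rb a n - 1)).
  by rewrite et; field; lra.
apply: Rmult_le_compat_l; first by left; apply: Rinv_0_lt_compat; lra.
exact: exp_ge1p.
Qed.

Lemma rprod_hfac_le a N : 0 < a -> \rprod_(0 <= n < N) hfac a n <= Hs a.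
Proof.
move=> a0; apply: is_lim_seq_ge_const (euler_Hs a0).
exists N => n hn; rewrite (@big_cat_nat _ _ _ N 0 n) //=.
have h1 s : 1 <= \rprod_(i <- s) hfac a i.
  elim: s => [|i s IH]; first by rewrite big_nil; lra.
  by rewrite big_cons; have := hfac_ge1 a0 i; nra.
have := h1 (index_iota 0 N); have := h1 (index_iota N n); nra.
Qed.

Lemma harmonic_le w : \rsum_(1 <= n < w.+1) / INR n <= 1 + ln (INR w).
Proof.
case: w => [|w]; first by rewrite big_geq //; have := lnINR_ge0 0; lra.
elim: w => [|w IH]; first by rewrite big_nat1 INR1 ln_1 Rinv_1; lra.
rewrite big_nat_recr //=.
have w0 : 0 < INR w.+1 by exact: INR_gt0.
have w1 : 0 < INR w.+2 by exact: INR_gt0.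
have := @ln_ge_1sub (INR w.+2 / INR w.+1) ltac:(apply: Rdiv_lt_0_compat; lra).
rewrite ln_div //.
have -> : 1 - / (INR w.+2 / INR w.+1) = / INR w.+2.
  by rewrite (S_INR w.+1) in w1 *; field; lra.
lra.
Qed.

Section RankinSmall.
Variable a : R.
Hypothesis a0 : 0 < a.
Hypothesis La : 100 <= - ln a.
Let L := - ln a.

Lemma rankin_a_small : a * L ^ 2 <= / 100 /\ a <= / 100.
Proof.
have h := aL3_le a0 La; rewrite -/L in h.
have hL : 100 <= L by exact: La.
have a2 : 0 <= a * L ^ 2 by apply: Rmult_le_pos; [lra | apply: pow_le; lra].
have e : a * L ^ 3 = a * L ^ 2 * L by rewrite /pow; ring.
have h1 : a * L ^ 2 <= / 100 by nra.
split=> //; have : 1 <= L ^ 2 by rewrite /pow; nra.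
nra.
Qed.

(** While [a ln p] is small, [(p + 1) rb - 1] is about [a ln p + 1 / p], and the first part is
    compensated by [qp <= 1 / (a p ln p)]. For larger primes the decay of [qp] absorbs [p^(a/8)]. *)
Lemma rv_le n : prime n ->
  rv a n <= (if Rle_dec (ln (INR n)) (L ^ 2) then 4 / INR n else 4 / a * plog n).
Proof.
move=> pn; have h2 := INR_prime_ge2 pn; have lp := ln_prime_gt0 pn.
have [q0 q1] := qp_bounds a0 pn; have [aL2 as1] := rankin_a_small.
have l2 : ln 2 <= ln (INR n) by apply: ln_le; lra.
have [l2a l2b] := ln2_bounds.
have l16 : ln (16 * INR n) = 4 * ln 2 + ln (INR n).
  rewrite ln_mult; [|lra|lra].
  have -> : 16 = 2 ^ 4 by rewrite /pow; lra.
  by rewrite ln_pow; [rewrite [INR 4]INR_IZR_INZ /=; lra | lra].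
have eb : (INR n + 1) * rb a n = (1 + / INR n) * exp (a / 8 * (4 * ln 2 + ln (INR n))).
  by rewrite /rb /Rpower l16; field; lra.
rewrite /rv pn eb /plog pn; set z := a / 8 * (4 * ln 2 + ln (INR n)).
have z0 : 0 <= z by rewrite /z; nra.
have in0 : 0 < / INR n by apply: Rinv_0_lt_compat; lra.
have in1 : / INR n <= 1 by rewrite -Rinv_1; apply: Rinv_le_contravar; lra.
have ez := exp_pos z.
have d0 : 0 < a * (INR n * ln (INR n)) by apply: Rmult_lt_0_compat => //; nra.
case: Rle_dec => hn /=.
  have z1 : z <= 5 * a / 8 * ln (INR n) by rewrite /z; nra.
  have z2 : z <= 1 / 2.
    apply: Rle_trans z1 _; have : a * ln (INR n) <= a * L ^ 2 by apply: Rmult_le_compat_l; lra.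
    lra.
  have h3 := exp_sub1_le2 (conj z0 z2).
  have hq := qp_le_simple a0 pn.
  have h4 : qp a n * (exp z - 1) <= 5 / 4 * / INR n.
    apply: (@Rle_trans _ (/ (a * (INR n * ln (INR n))) * (5 * a / 4 * ln (INR n)))).
      by apply: Rmult_le_compat; [lra | have := exp_ge1p z; lra | exact: hq | lra].
    by right; field; repeat split; lra.
  have h5 : qp a n * exp z <= 2 by nra.
  have h6 : qp a n * exp z * / INR n <= 2 * / INR n by apply: Rmult_le_compat_r; lra.
  have -> : qp a n * ((1 + / INR n) * exp z - 1) = qp a n * (exp z - 1) + qp a n * exp z * / INR n by ring.
  rewrite /Rdiv; lra.
have hq := qp_le a0 pn.
have h3 : qp a n * exp z <= 2 * / (a * (INR n * ln (INR n))).
  apply: (@Rle_trans _ (/ (a * (INR n * ln (INR n))) * (exp (- (a * ln (INR n) / 2)) * exp z))).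
    by rewrite -Rmult_assoc; apply: Rmult_le_compat_r; lra.
  rewrite Rmult_comm; apply: Rmult_le_compat_r; first by left; apply: Rinv_0_lt_compat.
  rewrite -exp_plus.
  apply: (@Rle_trans _ (exp (1 / 2))).
    by apply: exp_le; rewrite /z; nra.
  have := @exp_sub1_le2 (1 / 2) ltac:(lra); lra.
have -> : 4 / a * / (INR n * ln (INR n)) = 2 * (2 * / (a * (INR n * ln (INR n)))).
  by field; repeat split; lra.
have h7 : qp a n * exp z * (1 + / INR n) <= qp a n * exp z * 2.
  by apply: Rmult_le_compat_l; nra.
have -> : qp a n * ((1 + / INR n) * exp z - 1) = qp a n * exp z * (1 + / INR n) - qp a n by ring.
lra.
Qed.

(** Cut at [exp (L^2)]: below, a harmonic sum over all integers; above, [1 / (p ln p)] sums to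
    [O (1 / L^2)]. Both parts are of smaller order than [1 / (a L)], the size of the gain in
    Rankin's trick. *)
Lemma rv_sum_le N : \rsum_(0 <= n < N) rv a n <= 4 * (1 + L ^ 2) + 200 / (a * L ^ 2).
Proof.
have hL : 100 <= L by exact: La.
have L2 : 10000 <= L ^ 2 by rewrite /pow; nra.
have eY : 2 <= exp (L ^ 2) by have := exp_ge1p (L ^ 2); lra.
have [[w1 w2] w3] := exp_nfloor_ln eY; rewrite ln_exp in w1 w2.
set w := nfloor (exp (L ^ 2)) in w1 w2 w3.
have Y0 : 0 <= exp (L ^ 2) by lra.
have [_ wf] := nfloor_bounds Y0; rewrite -/w in wf.
pose E n := if (n <= w)%N then (if (0 < n)%N then 4 * / INR n else 0) else 4 / a * plog n.
have ia : 0 < 4 / a by apply: Rdiv_lt_0_compat; lra.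
have E0 n : 0 <= E n.
  rewrite /E; case: ifP => _; last by have := plog_ge0 n; nra.
  case: ifP => n0; last lra.
  by have := Rinv_0_lt_compat _ (INR_gt0 n0); lra.
apply: (@Rle_trans _ (\rsum_(0 <= n < N) E n)).
  apply: rsum_nat_le => n _; case pn: (prime n); last by rewrite /rv pn.
  apply: Rle_trans (rv_le pn) _; have h2 := INR_prime_ge2 pn; have n0 := prime_gt0 pn.
  rewrite /E n0; case: Rle_dec => hn /=; case: leqP => hw.
  - by rewrite /Rdiv; lra.
  - have : ln (exp (L ^ 2)) < ln (INR n).
      apply: ln_increasing; first by lra.
      by have := leq_INR hw; rewrite S_INR; lra.
    by rewrite ln_exp; lra.
  - by have := ln_le (INR_gt0 n0) (leq_INR hw); lra.
  - by lra.
apply: (@Rle_trans _ (\rsum_(0 <= n < maxn N w.+1) E n)).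
  by apply: rsum_sub_range => //; rewrite leq_maxl.
rewrite (@big_cat_nat _ _ _ w.+1) //=; last by rewrite leq_maxr.
apply: Rplus_le_compat.
  rewrite big_ltn // [E 0%N]/E /= Rplus_0_l.
  apply: (@Rle_trans _ (4 * \rsum_(1 <= n < w.+1) / INR n)); last by have := harmonic_le w; lra.
  rewrite rsumM; apply: rsum_nat_le => n /andP [n0 nw]; rewrite /E n0 -ltnS nw; lra.
apply: (@Rle_trans _ (4 / a * \rsum_(w.+1 <= n < maxn N w.+1) plog n)).
  rewrite rsumM; apply: rsum_nat_le => n /andP [n0 nw]; rewrite /E leqNgt n0 /=; lra.
rewrite rsum_plog; apply: Rle_trans (Rmult_le_compat_l _ _ _ (Rlt_le _ _ ia) (prime_sum_inv_log_le _ w3)) _.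
have lw : 82 / 100 * L ^ 2 <= ln (INR w) by lra.
apply: (@Rle_trans _ (4 / a * (41 / (82 / 100 * L ^ 2)))).
  apply: Rmult_le_compat_l; first lra.
  by apply: Rmult_le_compat_l; [lra | apply: Rinv_le_contravar; lra].
by right; field; lra.
Qed.

Lemma rankin_euler N :
  \rsum_(1 <= j < N) (pweight (rb a) j * Rpower (INR j) (- a)) <=
  Hs a * exp (4 * (1 + L ^ 2) + 200 / (a * L ^ 2)).
Proof.
have H1 := Hs_ge1 a0.
have rb0 p : 0 <= rb a p.
  case: p => [|p]; first by rewrite /rb INR0 /Rdiv Rinv_0; lra.
  by apply: Rdiv_le_0_compat; [left; exact: exp_pos | exact: INR_gt0].
have h := @euler_upper (rb a) (rho a) rb0 _ _ _ _ N.
apply: Rle_trans (h _ _ _ _) _.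
- by move=> m; left; exact: exp_pos.
- by rewrite /rho INR1 Rpower_1l.
- by move=> p m pp m0; rewrite /rho Rpower_INR_mul // prime_gt0.
- by move=> p pp; have := rho_bounds a0 pp; lra.
apply: (@Rle_trans _ (\rprod_(0 <= n < N) (hfac a n * exp (rv a n)))).
  apply: rprod_le => n _; case pn: (prime n); first exact: rankin_efac.
  by rewrite /efac /hfac /rv pn exp_0; lra.
rewrite rprod_mul rprod_exp; apply: Rmult_le_compat.
- by apply: rprod_ge0 => n _; have := hfac_ge1 a0 n; lra.
- by left; exact: exp_pos.
- exact: rprod_hfac_le.
- by apply: exp_le; exact: rv_sum_le.
Qed.

(** With [u = ln j - v], [ln Yj] is at most [beta v - u] and [beta v + beta u]; whichever sign [u]
    has, one of them gives [Yj^(1 - a/8) <= exp (beta v (1 - a/8) - a u)]. *)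
Lemma Yj_term_le (beta : R) (j : nat) : 0 < beta -> (0 < j)%N ->
  Rpower (Yj beta (exp ((1 + beta) * G a)) j / INR (rad j)) (1 - a / 8) *
    \rprod_(p <- primes j) Rpower 16 (a / 8) <=
  exp (beta * G a * (1 - a / 8)) * exp (a * G a) * (pweight (rb a) j * Rpower (INR j) (- a)).
Proof.
move=> b0 j0; have [_ as1] := rankin_a_small.
have rj := INR_gt0 j0; have r0 := INR_gt0 (rad_gt0 j).
have e1 : exp ((1 + beta) * G a) / INR j = exp (beta * G a - Xm a j).
  rewrite -{1}(exp_ln (INR j)) // /Rdiv -exp_Ropp -exp_plus /Xm; congr exp; ring.
have e2 : Rpower (INR j) beta = exp (beta * G a + beta * Xm a j).
  by rewrite /Rpower /Xm; congr exp; ring.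
have y0 : 0 < Yj beta (exp ((1 + beta) * G a)) j.
  by rewrite /Yj e1 e2; apply: Rmin_glb_lt; exact: exp_pos.
have -> : Rpower (Yj beta (exp ((1 + beta) * G a)) j / INR (rad j)) (1 - a / 8) =
  Rpower (Yj beta (exp ((1 + beta) * G a)) j) (1 - a / 8) * Rpower (/ INR (rad j)) (1 - a / 8).
  by rewrite -Rpower_mult_distr //; exact: Rinv_0_lt_compat.
have -> : pweight (rb a) j = Rpower (/ INR (rad j)) (1 - a / 8) * \rprod_(p <- primes j) Rpower 16 (a / 8).
  have -> : Rpower (/ INR (rad j)) (1 - a / 8) = \rprod_(p <- primes j) Rpower (/ INR p) (1 - a / 8).
    rewrite /rad INR_prod.
    have : all (fun p => 0 < p)%N (primes j) by apply/allP => p; rewrite mem_primes => /andP [/prime_gt0].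
    elim: (primes j) => [|p s IH] /=; first by rewrite !big_nil Rinv_1 Rpower_1l.
    move=> /andP [p0 hs]; rewrite !big_cons -IH // Rinv_mult Rpower_mult_distr //.
      by apply: Rinv_0_lt_compat; exact: INR_gt0.
    by apply: Rinv_0_lt_compat; apply: rprod_gt0 => i hi; apply: INR_gt0; move/allP: hs; apply.
  rewrite -rprod_mul /pweight; apply: eq_big_seq => p; rewrite mem_primes => /andP [pp _].
  have h2 := INR_prime_ge2 pp.
  rewrite /rb /Rpower ln_Rinv; last lra.
  rewrite ln_mult; [|lra|lra].
  rewrite -{2}(exp_ln (INR p)); last lra.
  by rewrite /Rdiv -exp_Ropp -!exp_plus; congr exp; field.
have hp : 0 < Rpower (/ INR (rad j)) (1 - a / 8) * \rprod_(p <- primes j) Rpower 16 (a / 8).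
  by apply: Rmult_lt_0_compat; [exact: exp_pos | apply: rprod_gt0 => p _; exact: exp_pos].
move: hp; rewrite Rmult_assoc; set D := _ * \rprod_(_ <- _) _ => hp.
have -> : exp (beta * G a * (1 - a / 8)) * exp (a * G a) * (D * Rpower (INR j) (- a)) =
  exp (beta * G a * (1 - a / 8)) * (exp (a * G a) * Rpower (INR j) (- a)) * D by ring.
apply: Rmult_le_compat_r; first lra.
have -> : exp (a * G a) * Rpower (INR j) (- a) = exp (- (a * Xm a j)).
  by rewrite /Rpower -exp_plus /Xm; congr exp; ring.
rewrite -exp_plus [Rpower (Yj _ _ _) _]/Rpower; apply: exp_le.
set u := Xm a j in e1 e2 *.
have y1 : ln (Yj beta (exp ((1 + beta) * G a)) j) <= beta * G a - u.
  by rewrite -(ln_exp (beta * G a - u)) -e1; apply: ln_le => //; exact: Rmin_l.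
have y2 : ln (Yj beta (exp ((1 + beta) * G a)) j) <= beta * G a + beta * u.
  by rewrite -(ln_exp (beta * G a + beta * u)) -e2; apply: ln_le => //; exact: Rmin_r.
move: (ln (Yj _ _ _)) y1 y2 => y y1 y2.
case: (Rle_lt_dec 0 u) => hu.
  have h1 : (1 - a / 8) * y <= (1 - a / 8) * (beta * G a - u) by apply: Rmult_le_compat_l; lra.
  have h2 : a * u <= (1 - a / 8) * u by apply: Rmult_le_compat_r; lra.
  lra.
have h1 : (1 - a / 8) * y <= (1 - a / 8) * (beta * G a + beta * u) by apply: Rmult_le_compat_l; lra.
have bu : beta * u <= 0 by nra.
have h2 : (1 - a / 8) * (beta * u) <= 0.
  have := Rmult_le_compat_l (1 - a / 8) _ _ ltac:(lra) bu; lra.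
have h3 : a * u <= 0 by nra.
lra.
Qed.

End RankinSmall.

(** The lowered exponent [1 - a/8] gains [exp (- beta a v / 8)] with [a v >= 1 / (2 a L)], which
    beats the loss of [rankin_euler] and leaves [a^5]. *)
Lemma rankin (beta : R) : 0 < beta -> exists L0, 1000 <= L0 /\
  forall a, 0 < a -> L0 <= - ln a -> forall N,
  \rsum_(1 <= j < N) (9 * (Rpower (Yj beta (exp ((1 + beta) * G a)) j / INR (rad j)) (1 - a / 8) *
    \rprod_(p <- primes j) Rpower 16 (a / 8))) <=
  9 * (exp (beta * G a) * exp (a * G a) * Hs a * a ^ 5).
Proof.
move=> b0.
have [L1 [L1p hL1]] := @exp_dominates (32 / beta * 13) 1 3 ltac:(lra).
exists (Rmax (Rmax 3000 L1) (12800 / beta)); split.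
  by apply: Rle_trans (Rmax_l _ _); apply: Rle_trans (Rmax_l _ _); lra.
move=> a a0 hL N; set L := - ln a in hL.
have hLa : 3000 <= L by apply: Rle_trans hL; apply: Rle_trans (Rmax_l _ _); exact: Rmax_l.
have hLb : L1 <= L by apply: Rle_trans hL; apply: Rle_trans (Rmax_l _ _); exact: Rmax_r.
have hLc : 12800 / beta <= L by apply: Rle_trans hL; exact: Rmax_r.
have La : 100 <= - ln a by rewrite -/L; lra.
have H1 := Hs_ge1 a0.
rewrite -rsumM; apply: Rmult_le_compat_l; first lra.
apply: (@Rle_trans _ (exp (beta * G a * (1 - a / 8)) * exp (a * G a) *
   (Hs a * exp (4 * (1 + L ^ 2) + 200 / (a * L ^ 2))))).
  apply: (@Rle_trans _ (\rsum_(1 <= j < N) (exp (beta * G a * (1 - a / 8)) * exp (a * G a) *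
     (pweight (rb a) j * Rpower (INR j) (- a))))).
    by apply: rsum_nat_le => j /andP [j0 _]; exact: Yj_term_le.
  rewrite -rsumM; apply: Rmult_le_compat_l; last exact: rankin_euler.
  by left; apply: Rmult_lt_0_compat; exact: exp_pos.
have -> : exp (beta * G a * (1 - a / 8)) * exp (a * G a) *
   (Hs a * exp (4 * (1 + L ^ 2) + 200 / (a * L ^ 2))) =
  exp (beta * G a) * exp (a * G a) * Hs a * exp (4 * (1 + L ^ 2) + 200 / (a * L ^ 2) - beta * a * G a / 8).
  rewrite /Rminus (exp_plus (4 * (1 + L ^ 2) + 200 / (a * L ^ 2))).
  have -> : beta * G a * (1 + - (a / 8)) = beta * G a + - (beta * a * G a / 8) by field.
  by rewrite exp_plus; ring.
apply: Rmult_le_compat_l.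
  by apply: Rmult_le_pos; [left; apply: Rmult_lt_0_compat; exact: exp_pos | lra].
have -> : a ^ 5 = exp (- (5 * L)).
  rewrite {1}(a_expL a0) -/L exp_nat_mul [INR 5]INR_IZR_INZ /=; congr exp; ring.
apply: exp_le.
have GL : / (2 * (a * a * L)) <= G a.
  apply: Rle_trans (G_lower a0 La); rewrite -/L.
  have s54 : 54 <= sqrt L.
    rewrite -(sqrt_square 54); last lra.
    by apply: sqrt_le_1_alt; lra.
  have : 27 / sqrt L <= 1 / 2 by apply: divr_le; lra.
  move=> h; rewrite Rinv_mult /Rdiv; apply: Rmult_le_compat_r; last lra.
  by left; apply: Rinv_0_lt_compat; nra.
have aL0 : 0 < a * L by nra.
have iaL : 0 < / (a * L) by apply: Rinv_0_lt_compat.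
have g1 : beta / 16 * / (a * L) <= beta * a * G a / 8.
  have -> : beta / 16 * / (a * L) = beta * a / 8 * / (2 * (a * a * L)) by field; lra.
  have -> : beta * a * G a / 8 = beta * a / 8 * G a by field.
  by apply: Rmult_le_compat_l => //; nra.
have g2 : 200 / (a * L ^ 2) <= beta / 64 * / (a * L).
  have -> : 200 / (a * L ^ 2) = 200 / L * / (a * L) by field; lra.
  apply: Rmult_le_compat_r; first lra.
  apply: divr_le; first lra.
  have -> : 200 = beta / 64 * (12800 / beta) by field; lra.
  by apply: Rmult_le_compat_l => //; lra.
have g3 : 13 * L ^ 2 <= beta / 32 * / (a * L).
  have := hL1 L hLb; rewrite Rmult_1_l -(inv_a_expL a0) => h.
  have -> : beta / 32 * / (a * L) = / a * (beta / 32 * / L) by field; lra.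
  have -> : 13 * L ^ 2 = 32 / beta * 13 * L ^ 3 * (beta / 32 * / L) by field; lra.
  apply: Rmult_le_compat_r => //.
  by apply: Rmult_le_pos; [lra | left; apply: Rinv_0_lt_compat; lra].
have L2 : 1 <= L ^ 2 by rewrite /pow; nra.
have L3 : L <= L ^ 2 by rewrite /pow; nra.
lra.
Qed.

(** * The asymptotic formula *)

Lemma ftest_tilt a b u : 0 <= b ->
  ftest (b + a) (1 - a) u * exp (- (a * u)) = Rmin (exp (b * u)) (exp (- u)).
Proof.
move=> b0; rewrite /ftest -exp_plus; case: (Rle_lt_dec 0 u) => hu.
  rewrite Rmax_right; last lra.
  rewrite Rmax_left // Rmin_right; last by apply: exp_le; nra.
  by congr exp; ring.
rewrite Rmax_left; last lra.
rewrite Rmax_right; last lra.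
by rewrite Rmin_left; [congr exp; ring | apply: exp_le; nra].
Qed.

(** Undoing the tilt by [m^(-a)]: the case [b = 0] is [F], the case [b = beta] is the main term of
    [S_theta]. The shift of the index drops the zero term at [m = 0]. *)
Lemma series_expect a b : 0 < a -> a < 1 -> 0 <= b ->
  is_series (fun n => / INR (psi n.+1) * Rmin (exp (b * Xm a n.+1)) (exp (- Xm a n.+1)))
    (exp (a * G a) * Hs a * expect a (ftest (b + a) (1 - a))).
Proof.
move=> a0 a1 b0; have H1 := Hs_ge1 a0.
have [s _] := @ex_series_Pm_bounded a a0 (fun m => ftest (b + a) (1 - a) (Xm a m)) 1
  (fun m => ltac:(have := @ftest_bounds (b + a) (1 - a) (Xm a m) ltac:(lra) ltac:(lra) => h; rewrite Rabs_pos_eq; lra)).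
have h := Series_correct _ s; rewrite -/(expect a (ftest (b + a) (1 - a))) in h.
have h1 : is_series (fun n => Pm a n.+1 * ftest (b + a) (1 - a) (Xm a n.+1)) (expect a (ftest (b + a) (1 - a))).
  apply: (@is_series_incr_1 _ _ (fun m => Pm a m * ftest (b + a) (1 - a) (Xm a m))).
  have -> // : plus (expect a (ftest (b + a) (1 - a))) (Pm a 0 * ftest (b + a) (1 - a) (Xm a 0)) =
     expect a (ftest (b + a) (1 - a)).
  by rewrite /plus /= /Pm /hterm /= /Rdiv; ring.
have h2 := @is_series_scal _ _ (exp (a * G a) * Hs a) _ _ h1.
apply: is_series_ext h2 => n; rewrite -(ftest_tilt a _ b0).
rewrite /scal /= /mult /= -pweight_psi /Pm /hterm /=.
have -> : exp (- (a * Xm a n.+1)) = exp (a * G a) * Rpower (INR n.+1) (- a).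
  by rewrite /Rpower -exp_plus /Xm; congr exp; ring.
by field; lra.
Qed.

Lemma F_expect a : 0 < a -> a < 1 ->
  F (G a) = 6 / PI ^ 2 * (exp (a * G a) * Hs a * expect a (ftest a (1 - a))).
Proof.
move=> a0 a1; have := @series_expect a 0 a0 a1 (Rle_refl _); rewrite Rplus_0_l => h.
rewrite /F -(is_series_unique _ _ h); congr (_ * _); apply: Series_ext => n.
rewrite Rmult_0_l exp_0; congr (_ * Rmin _ _).
have n0 : 0 < INR n.+1 by exact: INR_gt0.
by rewrite -{1}(exp_ln (INR n.+1)) // /Rdiv -exp_Ropp -exp_plus /Xm; congr exp; ring.
Qed.

(** The term [m = 1]; convergence follows from [min (1, e^v / m) <= e^v / m] and [hsum_bound] at
    exponent 1. *)
Lemma F_ge v : 0 < v -> 6 / PI ^ 2 <= F v.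
Proof.
move=> v0; have [c0 _] := six_PI2.
have t0 n : 0 <= / INR (psi n.+1) * Rmin 1 (exp v / INR n.+1).
  have n0 : 0 < INR n.+1 by exact: INR_gt0.
  apply: Rmult_le_pos; last first.
    by apply: Rmin_glb; [lra | apply: Rdiv_le_0_compat => //; left; exact: exp_pos].
  left; apply: Rinv_0_lt_compat.
  by rewrite /psi INR_prod; apply: rprod_gt0 => p _; exact: INR_gt0.
suff : 1 <= Series (fun n : nat => / INR (psi n.+1) * Rmin 1 (exp v / INR n.+1)).
  by rewrite /F; nra.
have ex : ex_series (fun n : nat => / INR (psi n.+1) * Rmin 1 (exp v / INR n.+1)).
  apply: (@pos_series_bounded _ (exp v * exp 83) t0 _).1 => N.
  have := @hsum_bound 1 ltac:(lra) N.+1; rewrite Rinv_1 Rmult_1_l big_ltn //.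
  rewrite [hterm 1 0]/hterm /= Rplus_0_l big_add1 /= => h.
  have e := Rmult_le_compat_l _ _ _ (Rlt_le _ _ (exp_pos v)) h; apply: Rle_trans e.
  rewrite rsumM; apply: rsum_nat_le => n _; rewrite /hterm /= -pweight_psi.
  have n0 : 0 < INR n.+1 by exact: INR_gt0.
  have w0 : 0 <= pweight hb n.+1 by apply: pweight_ge0 => p; have := hb_gt0 p; lra.
  have -> : exp v * (pweight hb n.+1 * Rpower (INR n.+1) (- (1))) = pweight hb n.+1 * (exp v / INR n.+1).
    by rewrite Rpower_Ropp Rpower_1 // /Rdiv; ring.
  by apply: Rmult_le_compat_l => //; exact: Rmin_r.
have := rsum_le_Series 1 t0 ex; rewrite big_nat1.
have -> : psi 1 = 1%N by rewrite /psi big_nil.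
rewrite INR1 Rinv_1 Rmult_1_l /Rdiv Rinv_1 Rmult_1_r Rmin_left //.
by have := exp_ge1p v; lra.
Qed.

Lemma Qc_zero j Y : 0 <= Y < 1 -> Qc j (nfloor Y) = 0.
Proof.
move=> [h1 h2]; have [h3 _] := nfloor_bounds h1.
have -> : nfloor Y = 0%N.
  have : INR (nfloor Y) < INR 1 by rewrite INR1; lra.
  by move/INR_ltn; lia.
by rewrite /Qc big_geq.
Qed.

Lemma six_PI2_ge : 1 / 3 <= 6 / PI ^ 2.
Proof.
have pp := PI_RGT_0; have := PI_4 => h; apply: le_divr; first by apply: pow_lt.
rewrite /pow; nra.
Qed.

Section MainEst.
Variables theta : R.
Hypothesis t0 : 0 < theta.
Hypothesis t1 : theta < 1.
Let beta := theta / (1 - theta).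

Lemma beta_gt0 : 0 < beta.
Proof. by apply: Rdiv_lt_0_compat; lra. Qed.

(** Here [x = exp ((1 + beta) v)], as [1 + beta = 1 / (1 - theta)]. For [j > x] the count is 0 and
    [Qc_interp] still bounds the main term, so the sum over [j] can be extended to infinity at the
    cost of [B]. *)
Lemma S_theta_approx a : 0 < a -> a < 1 -> 0 < G a ->
  forall B, (forall N, \rsum_(1 <= j < N) (9 * (Rpower (Yj beta (exp ((1 + beta) * G a)) j / INR (rad j)) (1 - a / 8) *
    \rprod_(p <- primes j) Rpower 16 (a / 8))) <= B) ->
  Rabs (S_theta theta (exp ((1 + beta) * G a)) -
    6 / PI ^ 2 * (exp (beta * G a) * (exp (a * G a) * Hs a * expect a (ftest (beta + a) (1 - a))))) <= B.
Proof.
move=> a0 a1 G0 B hB; have b0 := beta_gt0.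
set x := exp ((1 + beta) * G a).
have x1 : 1 <= x by have := exp_ge1p ((1 + beta) * G a); rewrite -/x; nra.
have Y0 j : (0 < j)%N -> 0 < Yj beta x j.
  move=> j0; apply: Rmin_glb_lt; last exact: exp_pos.
  by apply: Rdiv_lt_0_compat; [lra | exact: INR_gt0].
have eS N : (nfloor x < N)%N -> S_theta theta x = \rsum_(1 <= j < N) Qc j (nfloor (Yj beta x j)).
  move=> hN; rewrite (S_theta_Qc t0 t1 x1) -/beta.
  rewrite [RHS](@big_cat_nat _ _ _ (nfloor x).+1) //= [X in _ = _ + X]big1_seq ?Rplus_0_r //.
  move=> j; rewrite mem_index_iota => /andP [_ /andP [hj _]].
  have j0 : (0 < j)%N by lia.
  apply: Qc_zero; split; first by have := Y0 j j0; lra.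
  apply: Rle_lt_trans (Rmin_l _ _) _; have rj := INR_gt0 j0.
  apply Rlt_div_l => //; have [_ h] := nfloor_bounds (Rlt_le _ _ (Rlt_le_trans _ _ _ Rlt_0_1 x1)).
  by have := leq_INR hj; rewrite S_INR; lra.
have eY j : (0 < j)%N -> Yj beta x j / INR (psi j) =
   exp (beta * G a) * (/ INR (psi j) * Rmin (exp (beta * Xm a j)) (exp (- Xm a j))).
  move=> j0; have rj := INR_gt0 j0.
  have -> : Yj beta x j = exp (beta * G a) * Rmin (exp (beta * Xm a j)) (exp (- Xm a j)).
    have e1 : x / INR j = exp (beta * G a) * exp (- Xm a j).
      rewrite -{1}(exp_ln (INR j)) // /x /Rdiv -exp_Ropp -!exp_plus /Xm; congr exp; ring.
    have e2 : Rpower (INR j) beta = exp (beta * G a) * exp (beta * Xm a j).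
      by rewrite /Rpower /Xm -exp_plus; congr exp; ring.
    rewrite /Yj e1 e2 Rmin_comm; have ep := exp_pos (beta * G a).
    rewrite /Rmin; case: Rle_dec => h1; case: Rle_dec => h2 //; exfalso; nra.
  by rewrite /Rdiv; ring.
set W := fun n => / INR (psi n.+1) * Rmin (exp (beta * Xm a n.+1)) (exp (- Xm a n.+1)).
have hN N : (nfloor x < N)%N ->
  Rabs (S_theta theta x - 6 / PI ^ 2 * (exp (beta * G a) * \rsum_(0 <= n < N) W n)) <= B.
  move=> hN; rewrite (eS N.+1 (ltnW hN)).
  have -> : 6 / PI ^ 2 * (exp (beta * G a) * \rsum_(0 <= n < N) W n) =
    \rsum_(1 <= j < N.+1) (6 / PI ^ 2 * (Yj beta x j / INR (psi j))).
    by rewrite big_add1 /= !rsumM; apply: eq_bigr => n _; rewrite eY.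
  rewrite rsum_sub; apply: Rle_trans (rsum_abs _ _ _) _; apply: Rle_trans (hB N.+1).
  apply: rsum_nat_le => j /andP [j0 _]; apply: Qc_interp => //; last lra.
  exact: Y0.
have hs := proj1 (is_series_rsum _ _) (@series_expect a beta a0 a1 (Rlt_le _ _ b0)).
have hl : is_lim_seq (fun N => S_theta theta x - 6 / PI ^ 2 * (exp (beta * G a) * \rsum_(0 <= n < N) W n))
  (S_theta theta x - 6 / PI ^ 2 * (exp (beta * G a) * (exp (a * G a) * Hs a * expect a (ftest (beta + a) (1 - a))))).
  apply: is_lim_seq_minus'; first exact: is_lim_seq_const.
  apply: is_lim_seq_mult'; first exact: is_lim_seq_const.
  by apply: is_lim_seq_mult' => //; exact: is_lim_seq_const.
apply: is_lim_seq_le_const (is_lim_seq_abs _ _ hl).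
by exists (nfloor x).+1 => N /hN.
Qed.

Lemma main_estimate : exists C L0, 0 < C /\ 1000 <= L0 /\ forall a, 0 < a -> L0 <= - ln a -> 0 < G a ->
  Rabs (S_theta theta (exp (G a / (1 - theta))) - exp (beta * G a) * F (G a) * (a / theta)) <=
  C * (a * - ln a) * (exp (beta * G a) * F (G a) * (a / theta)).
Proof.
have b0 := beta_gt0.
have [C [L1 [C0 [hL1 h1]]]] := expect_ratio b0.
have [L2 [hL2 h2]] := rankin b0.
(* The second summand covers the sieve error [9 a^5], through [E1 >= a / 80000] and
   [6 / PI^2 >= 1 / 3]. *)
exists (C + 3000000), (Rmax L1 L2); split; first lra.
split; first by apply: Rle_trans hL1 (Rmax_l _ _).
move=> a a0 hL G0.
have [h3 h4] := h1 a a0 (Rle_trans _ _ _ (Rmax_l _ _) hL).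
have h5 := h2 a a0 (Rle_trans _ _ _ (Rmax_r _ _) hL).
have L1000 : 1000 <= - ln a by apply: Rle_trans hL; apply: Rle_trans hL1 (Rmax_l _ _).
have a1 : a < 1.
  by rewrite (a_expL a0) -exp_0; apply: exp_increasing; lra.
have h6 := @S_theta_approx a a0 a1 G0 _ h5.
have H1 := Hs_ge1 a0; have c3 := six_PI2_ge.
rewrite (F_expect a0 a1).
have eb : (1 + beta) / beta = / theta by rewrite /beta; field; lra.
have eb' : G a / (1 - theta) = (1 + beta) * G a by rewrite /beta; field; lra.
rewrite eb -/(Rdiv a theta) in h4; rewrite eb'.
set L := - ln a in L1000 h4 *.
set E1 := expect a (ftest a (1 - a)) in h3 h4 *; set E2 := expect _ _ in h4 h6.
move: h6; set S := S_theta _ _; set c := 6 / PI ^ 2 in c3 *; set K := exp (a * G a) * Hs a; set eB := exp (beta * G a) => h6.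
have K0 : 0 < K by apply: Rmult_lt_0_compat; [exact: exp_pos | lra].
have B0 : 0 < eB by exact: exp_pos.
have T0 : 0 < a / theta by apply: Rdiv_lt_0_compat.
have aT : a <= a / theta by apply: le_divr => //; nra.
have KB : 0 < eB * K by nra.
have h6' : Rabs (S - c * (eB * (K * E2))) <= 9 * (eB * K * a ^ 5).
  by apply: Rle_trans h6 _; right; rewrite /K /eB; ring.
have -> : S - eB * (c * (K * E1)) * (a / theta) =
  (S - c * (eB * (K * E2))) + c * (eB * K) * (E2 - E1 * (a / theta)) by ring.
apply: Rle_trans (Rabs_triang _ _) _; rewrite Rabs_mult (Rabs_pos_eq (c * (eB * K))); last by nra.
have h7 := Rmult_le_compat_l (c * (eB * K)) _ _ ltac:(nra) h4.
have h8 : 9 * a ^ 5 <= 3000000 * (a * L) * (c * (E1 * (a / theta))).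
  have a3 : 0 < a * a * a by apply: Rmult_lt_0_compat => //; nra.
  have a5 : a ^ 5 <= a * a * a.
    have -> : a ^ 5 = a * a * a * (a * a) by rewrite /pow; ring.
    have : a * a <= 1 by nra.
    nra.
  have m1 : a / 80000 * a <= E1 * (a / theta) by apply: Rmult_le_compat; lra.
  have m2 : 1 / 3 * (a / 80000 * a) <= c * (E1 * (a / theta)) by apply: Rmult_le_compat; nra.
  have m3 : 3000000 * a <= 3000000 * (a * L) by nra.
  have m4 : 3000000 * a * (1 / 3 * (a / 80000 * a)) <= 3000000 * (a * L) * (c * (E1 * (a / theta))).
    by apply: Rmult_le_compat; nra.
  nra.
have h9 := Rmult_le_compat_l (eB * K) _ _ (Rlt_le _ _ KB) h8.
have -> : (C + 3000000) * (a * L) * (eB * (c * (K * E1)) * (a / theta)) =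
  c * (eB * K) * (C * (a * L) * (E1 * (a / theta))) + eB * K * (3000000 * (a * L) * (c * (E1 * (a / theta)))) by ring.
lra.
Qed.

End MainEst.

(** * The size of [alpha] and the two claims *)

Lemma G_asymp a : 0 < a -> 3000 <= - ln a ->
  Rabs (a * a * G a * - ln a - 1) <= 690 / sqrt (- ln a) /\ - ln a <= ln (G a) /\ 0 < G a.
Proof.
move=> a0 hL; have La : 100 <= - ln a by lra.
have u := G_upper a0 La; have l := G_lower a0 La; have iL := inv_a_expL a0; move: u l.
set L := - ln a in hL La iL *.
set s := sqrt L; move=> u l.
have s54 : 54 <= s by rewrite -(sqrt_square 54); [apply: sqrt_le_1_alt|]; lra.
have ss : s * s = L by apply: sqrt_sqrt; lra.
have d0 : 0 < a * a * L by apply: Rmult_lt_0_compat; nra.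
have i0 : 0 < / s by apply: Rinv_0_lt_compat; lra.
have i1 : 27 / s <= 1 / 2 by apply: divr_le; lra.
have e : a * a * G a * L = G a * (a * a * L) by ring.
have u' : a * a * G a * L <= 1 + 690 / s.
  rewrite e; have := Rmult_le_compat_r _ _ _ (Rlt_le _ _ d0) u.
  by have -> : (1 + 690 / s) / (a * a * L) * (a * a * L) = 1 + 690 / s by field; nra.
have l' : 1 - 27 / s <= a * a * G a * L.
  rewrite e; have := Rmult_le_compat_r _ _ _ (Rlt_le _ _ d0) l.
  by have -> : (1 - 27 / s) / (a * a * L) * (a * a * L) = 1 - 27 / s by field; nra.
split; first by apply: Rabs_le; rewrite /Rdiv in u' l' *; lra.
have GL : exp L <= G a.
  rewrite -iL; apply: (Rmult_le_reg_r (a * a * L)) => //; rewrite -e.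
  have -> : / a * (a * a * L) = a * L by field; lra.
  apply: Rle_trans l'; have := aL3_le a0 La; rewrite -/L => h3.
  have -> : a * L = a * L ^ 3 * / (L * L) by rewrite /pow; field; lra.
  have iLL : 0 < / (L * L) by apply: Rinv_0_lt_compat; nra.
  have : / (L * L) <= 1 / 2.
    by rewrite -[1 / 2]Rinv_inv /Rdiv Rmult_1_l Rinv_inv; apply: Rinv_le_contravar; nra.
  nra.
have eL := exp_pos L; split; last lra.
by rewrite -{1}(ln_exp L); apply: ln_le.
Qed.

Lemma small_of_G a M : 0 < a -> 83 * exp (2 * M) <= G a -> M <= - ln a.
Proof.
move=> a0 h; have h2 := G_le a0.
have aa : 0 < a * a by nra.
have h3 : exp (2 * M) * (a * a) <= 1.
  have : 83 * exp (2 * M) * (a * a) <= 83.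
    apply: Rle_trans (Rmult_le_compat_r _ _ _ (Rlt_le _ _ aa) (Rle_trans _ _ _ h h2)) _.
    by right; field; lra.
  lra.
have e := exp_pos (2 * M).
have := @ln_le (exp (2 * M) * (a * a)) 1 ltac:(nra) h3.
rewrite ln_mult // ln_exp ln_1 ln_mult //; lra.
Qed.

Lemma alpha_spec theta x : theta < 1 -> 1 < x ->
  0 < alpha theta x /\ G (alpha theta x) = (1 - theta) * ln x.
Proof.
move=> t1 x1; apply: (epsilon_spec (inhabits 0) (fun a => 0 < a /\ G a = (1 - theta) * ln x)).
by apply: G_exists; have := ln_gt0 x1; nra.
Qed.

(** From [27 = 3^3] and [exp 1 <= 3]; the bound [x >= 27] thus keeps [ln (ln x)] away from 0. *)
Lemma lnln_ge x : 27 <= x -> 3 <= ln x /\ 1 <= ln (ln x).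
Proof.
have e3 := exp_le_3; have e0 := exp_pos 1.
have l3 : 1 <= ln 3 by rewrite -{1}(ln_exp 1); apply: ln_le.
move=> hx; have h : 3 <= ln x.
  have : ln (3 * (3 * 3)) <= ln x by apply: ln_le; lra.
  by rewrite ln_mult ?ln_mult; lra.
by split=> //; apply: Rle_trans l3 _; apply: ln_le; lra.
Qed.

Section Final.
Variables theta : R.
Hypothesis t0 : 0 < theta.
Hypothesis t1 : theta < 1.

Definition mainterm (x : R) : R := Rpower x theta * F ((1 - theta) * ln x) * (alpha theta x / theta).

Lemma mainterm_gt0 x : 1 < x -> 0 < mainterm x.
Proof.
move=> x1; have [a0 _] := @alpha_spec theta x t1 x1; have l0 := ln_gt0 x1.
have v0 : 0 < (1 - theta) * ln x by nra.
have := F_ge v0; have := six_PI2_ge => h1 h2.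
apply: Rmult_lt_0_compat; last exact: Rdiv_lt_0_compat.
by apply: Rmult_lt_0_compat; [exact: exp_pos | lra].
Qed.

Lemma main_estimate_x : exists C L0, 0 < C /\ 3000 <= L0 /\ forall x, 27 <= x -> L0 <= - ln (alpha theta x) ->
  Rabs (S_theta theta x - mainterm x) <= C * (alpha theta x * - ln (alpha theta x)) * mainterm x.
Proof.
have [C [L0 [C0 [hL0 h]]]] := main_estimate t0 t1.
exists C, (Rmax L0 3000); split=> //; split; first exact: Rmax_r.
move=> x x27 hL; have [a0 eG] := @alpha_spec theta x t1 ltac:(lra).
have [l3 _] := lnln_ge x27.
have := h _ a0 (Rle_trans _ _ _ (Rmax_l _ _) hL) ltac:(rewrite eG; nra).
rewrite eG.
have -> : (1 - theta) * ln x / (1 - theta) = ln x by field; lra.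
rewrite exp_ln; last lra.
have -> : theta / (1 - theta) * ((1 - theta) * ln x) = theta * ln x by field; lra.
by [].
Qed.

(** [(a L)^2 = (a^2 v L) L / v], where the bracket is at most 14 by [G_asymp] and
    [L <= ln v <= ln (ln x)]. *)
Lemma alpha_log_le x : 27 <= x -> 3000 <= - ln (alpha theta x) ->
  alpha theta x * - ln (alpha theta x) <= sqrt (14 / (1 - theta)) * sqrt (ln (ln x) / ln x).
Proof.
move=> x27 hL; have [a0 eG] := @alpha_spec theta x t1 ltac:(lra).
have [l3 ll1] := lnln_ge x27.
have [h1 [h2 _]] := G_asymp a0 hL; rewrite eG in h1 h2.
move: (alpha theta x) a0 hL h1 h2 {eG} => a a0; set L := - ln a => hL h1 h2.
have s54 : 54 <= sqrt L by rewrite -(sqrt_square 54); [apply: sqrt_le_1_alt|]; lra.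
have hs : 690 / sqrt L <= 13 by apply: divr_le; lra.
have h3 : a * a * ((1 - theta) * ln x) * L <= 14 by move/Rabs_le_between: h1; lra.
have h4 : L <= ln (ln x).
  apply: Rle_trans h2 _; apply: ln_le; first by nra.
  by nra.
have aL : 0 <= a * L by nra.
rewrite -sqrt_mult; last by apply: Rdiv_le_0_compat; lra.
  rewrite -(sqrt_square (a * L)) //; apply: sqrt_le_1_alt.
  have -> : 14 / (1 - theta) * (ln (ln x) / ln x) = (14 * ln (ln x)) / ((1 - theta) * ln x) by field; lra.
  apply: le_divr; first by nra.
  have -> : a * L * (a * L) * ((1 - theta) * ln x) = (a * a * ((1 - theta) * ln x) * L) * L by ring.
  by apply: Rmult_le_compat; [| lra | |] => //; repeat apply: Rmult_le_pos; lra.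
by apply: Rdiv_le_0_compat; lra.
Qed.

Lemma S_theta_bounds x : 0 <= x -> 0 <= S_theta theta x <= x.
Proof.
move=> x0; split; first exact: pos_INR.
have [h _] := nfloor_bounds x0; apply: Rle_trans h.
apply: leq_INR; rewrite /S_count -/(nfloor x).
apply: (@leq_trans (\sum_(1 <= m < (nfloor x).+1) 1)%N); last by rewrite sum_nat_const_nat subn1 muln1.
by apply: leq_sum => i _; case: Rle_dec.
Qed.

(** On a bounded range a large constant suffices, because [alpha], hence the main term, and the
    square root are bounded below there. *)
Lemma small_range V : 83 <= V -> exists C, 0 < C /\ forall x, 27 <= x -> (1 - theta) * ln x <= V ->
  Rabs (S_theta theta x - mainterm x) <= C * mainterm x * sqrt (ln (ln x) / ln x).
Proof.
move=> V83; set X0 := exp (V / (1 - theta)); set L2 := Rmax 3000 (ln V).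
set r0 := sqrt ((1 - theta) / V).
have X00 : 0 < X0 by exact: exp_pos.
have r00 : 0 < r0 by apply: sqrt_lt_R0; apply: Rdiv_lt_0_compat; lra.
have eL := exp_pos L2.
exists ((1 + 3 * X0 * exp L2) / r0); split.
  by apply: Rdiv_lt_0_compat => //; nra.
move=> x x27 hV; have [l3 ll1] := lnln_ge x27.
have [a0 eG] := @alpha_spec theta x t1 ltac:(lra).
have v0 : 0 < (1 - theta) * ln x by nra.
have m0 := @mainterm_gt0 x ltac:(lra).
have aL : exp (- L2) <= alpha theta x.
  rewrite {1}(a_expL a0); apply: exp_le.
  suff : - ln (alpha theta x) <= L2 by lra.
  case: (Rle_lt_dec (- ln (alpha theta x)) 3000) => hL; first by apply: Rle_trans hL (Rmax_l _ _).
  have [_ [h _]] := G_asymp a0 (Rlt_le _ _ hL); apply: Rle_trans h _; rewrite eG.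
  by apply: Rle_trans (Rmax_r _ _); apply: ln_le.
have mL : exp (- L2) / 3 <= mainterm x.
  have p1 : 1 <= Rpower x theta.
    rewrite /Rpower -exp_0; apply: exp_le; nra.
  have p2 : 1 / 3 <= F ((1 - theta) * ln x) by apply: Rle_trans six_PI2_ge (F_ge v0).
  have p3 : exp (- L2) <= alpha theta x / theta.
    apply: Rle_trans aL _; apply: le_divr => //; nra.
  have p4 : 1 / 3 <= Rpower x theta * F ((1 - theta) * ln x) by nra.
  have e0 := exp_pos (- L2).
  rewrite /mainterm; apply: (@Rle_trans _ (1 / 3 * exp (- L2))); first lra.
  by apply: Rmult_le_compat; lra.
have lx : ln x <= V / (1 - theta) by apply: le_divr; lra.
have xX : x <= X0 by rewrite -(exp_ln x); [apply: exp_le | lra].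
have [s0 s1] := @S_theta_bounds x ltac:(lra).
have hr : r0 <= sqrt (ln (ln x) / ln x).
  apply: sqrt_le_1_alt; apply: (@Rle_trans _ (1 / ln x)).
    apply: le_divr; first lra.
    have -> : (1 - theta) / V * ln x = ((1 - theta) * ln x) / V by field; lra.
    by apply: divr_le; lra.
  by apply: Rmult_le_compat_r => //; left; apply: Rinv_0_lt_compat; lra.
have sm : S_theta theta x <= 3 * X0 * exp L2 * mainterm x.
  apply: Rle_trans s1 _; apply: Rle_trans xX _.
  have e1 : exp L2 * exp (- L2) = 1 by rewrite -exp_plus Rplus_opp_r exp_0.
  apply: (@Rle_trans _ (3 * X0 * exp L2 * (exp (- L2) / 3))).
    have -> : 3 * X0 * exp L2 * (exp (- L2) / 3) = X0 * (exp L2 * exp (- L2)) by field.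
    by rewrite e1; lra.
  by apply: Rmult_le_compat_l => //; nra.
have h1 : Rabs (S_theta theta x - mainterm x) <= (1 + 3 * X0 * exp L2) * mainterm x.
  apply: Rabs_le; split; lra.
apply: Rle_trans h1 _.
have -> : (1 + 3 * X0 * exp L2) / r0 * mainterm x * sqrt (ln (ln x) / ln x) =
  (1 + 3 * X0 * exp L2) * mainterm x * (sqrt (ln (ln x) / ln x) / r0) by field; lra.
rewrite -{1}[_ * mainterm x]Rmult_1_r; apply: Rmult_le_compat_l.
  by apply: Rmult_le_pos; nra.
by apply: le_divr; lra.
Qed.

Lemma first_claim : exists C : R, 0 < C /\ forall x : R, 27 <= x ->
  Rabs (S_theta theta x - mainterm x) <= C * mainterm x * sqrt (ln (ln x) / ln x).
Proof.
have [C1 [L0 [C10 [hL0 h1]]]] := main_estimate_x.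
have e1 := exp_ge1p (2 * L0).
have [C2 [C20 h2]] := @small_range (83 * exp (2 * L0)) ltac:(lra).
have q0 := sqrt_pos (14 / (1 - theta)).
exists (C1 * sqrt (14 / (1 - theta)) + C2); split; first by nra.
move=> x x27; have [a0 eG] := @alpha_spec theta x t1 ltac:(lra).
have m0 := @mainterm_gt0 x ltac:(lra).
have r0 := sqrt_pos (ln (ln x) / ln x).
have mr : 0 <= mainterm x * sqrt (ln (ln x) / ln x) by nra.
case: (Rle_lt_dec ((1 - theta) * ln x) (83 * exp (2 * L0))) => hV.
  apply: Rle_trans (h2 x x27 hV) _.
  have : 0 <= C1 * sqrt (14 / (1 - theta)) * (mainterm x * sqrt (ln (ln x) / ln x)).
    by apply: Rmult_le_pos => //; nra.
  lra.
have hL : L0 <= - ln (alpha theta x) by apply: small_of_G => //; rewrite eG; lra.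
apply: Rle_trans (h1 x x27 hL) _.
have h3 := @alpha_log_le x x27 ltac:(lra).
have h4 := Rmult_le_compat_l (C1 * mainterm x) _ _ ltac:(nra) h3.
have : 0 <= C2 * (mainterm x * sqrt (ln (ln x) / ln x)) by nra.
lra.
Qed.

(** With [w = a^2 v L], close to 1 by [G_asymp], taking logarithms gives [2 L = ln v + ln L - ln w],
    so [l = ln (ln x) / (2 L)] is close to 1 as well. The squared quotient [r^2] equals [w l]. *)
Lemma alpha_asymp : exists K, 0 < K /\ forall x, 27 <= x -> 3000000 <= - ln (alpha theta x) ->
  Rabs (alpha theta x / (sqrt (2 / (1 - theta)) * / sqrt (ln x * ln (ln x))) - 1) <=
  K / sqrt (- ln (alpha theta x)).
Proof.
set b := Rabs (ln (1 - theta)).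
have b0 : 0 <= b by exact: Rabs_pos.
exists (690 + (b + 2) + 690 * (b + 2)); split; first lra.
move=> x x27 hL; have [a0 eG] := @alpha_spec theta x t1 ltac:(lra).
have [l3 ll1] := lnln_ge x27.
have [h1 _] := @G_asymp _ a0 ltac:(lra); rewrite eG in h1.
move: (alpha theta x) a0 hL h1 {eG} => a a0; have ea : ln a = - - ln a by lra.
move: ea; set L := - ln a => ea hL.
set v := (1 - theta) * ln x => h1.
have v0 : 0 < v by rewrite /v; nra.
have lL := @ln_le_2sqrt L ltac:(lra); have lL0 := @ln_ge0 L ltac:(lra).
set s := sqrt L in h1 lL *.
have ss : s * s = L by apply: sqrt_sqrt; lra.
(* Makes [690 / s <= 4 / 10], so that [w] stays away from 0 and [ln w] is bounded. *)
have s54 : 1725 <= s by rewrite -(sqrt_square 1725); [apply: sqrt_le_1_alt|]; lra.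
have i0 : 0 < / s by apply: Rinv_0_lt_compat; lra.
have i1 : / s <= 1 by rewrite -Rinv_1; apply: Rinv_le_contravar; lra.
have hs : 690 / s <= 4 / 10 by apply: divr_le; lra.
have h2 : 0 < a * a * v * L by repeat apply: Rmult_lt_0_compat => //; lra.
have A : ln (a * a * v * L) = - (2 * L) + ln v + ln L.
  have aa : 0 < a * a by nra.
  have aav : 0 < a * a * v by nra.
  rewrite (ln_mult _ L) //; last lra.
  rewrite (ln_mult _ v) // (ln_mult a a) // ea -/L; lra.
set w := a * a * v * L in h1 h2 A.
have w6 : 6 / 10 <= w by move/Rabs_le_between: h1; lra.
have lw1 : ln w <= 1.
  by apply: Rle_trans (ln_le_sub1 h2) _; move/Rabs_le_between: h1; lra.
have lw2 : - 1 <= ln w.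
  apply: Rle_trans (ln_ge_1sub h2).
  have : / w <= / (6 / 10) by apply: Rinv_le_contravar; lra.
  have -> : / (6 / 10) = 10 / 6 by field.
  lra.
have lv : ln v = ln (1 - theta) + ln (ln x) by rewrite /v ln_mult; lra.
have hb1 : - b <= ln (1 - theta) <= b by apply Rabs_le_between; rewrite -/b; lra.
set l := ln (ln x) / (2 * L).
have h3 : Rabs (l - 1) <= (b + 2) / s.
  have -> : l - 1 = (ln w - ln L - ln (1 - theta)) / (2 * L) by rewrite A lv /l; field; lra.
  rewrite /Rdiv Rabs_mult (Rabs_pos_eq (/ (2 * L))); last by left; apply: Rinv_0_lt_compat; lra.
  have -> : (b + 2) * / s = (2 * s * (b + 2)) * / (2 * L) by rewrite -ss; field; lra.
  apply: Rmult_le_compat_r; first by left; apply: Rinv_0_lt_compat; lra.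
  by apply: Rabs_le; nra.
have lx : 0 < ln x * ln (ln x) by apply: Rmult_lt_0_compat; lra.
have q1 : 0 < 2 / (1 - theta) by apply: Rdiv_lt_0_compat; lra.
have p1 := sqrt_lt_R0 _ lx; have p2 := sqrt_lt_R0 _ q1.
have p1' := sqrt_sqrt _ (Rlt_le _ _ lx); have p2' := sqrt_sqrt _ (Rlt_le _ _ q1).
set r := a / _.
have r0 : 0 < r.
  by apply: Rdiv_lt_0_compat => //; apply: Rmult_lt_0_compat => //; exact: Rinv_0_lt_compat.
have rr : r * r = w * l.
  have -> : r * r = a * a * (sqrt (ln x * ln (ln x)) * sqrt (ln x * ln (ln x))) /
     (sqrt (2 / (1 - theta)) * sqrt (2 / (1 - theta))) by rewrite /r; field; lra.
  by rewrite p1' p2' /w /l /v; field; lra.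
have h4 : Rabs (r - 1) <= Rabs (w * l - 1).
  rewrite -rr; have -> : r * r - 1 = (r - 1) * (r + 1) by ring.
  rewrite Rabs_mult (Rabs_pos_eq (r + 1)); last lra.
  by have := Rabs_pos (r - 1); nra.
apply: Rle_trans h4 _.
have -> : w * l - 1 = (w - 1) + (l - 1) + (w - 1) * (l - 1) by ring.
apply: Rle_trans (Rabs_triang _ _) _; rewrite Rabs_mult.
have h5 := Rabs_triang (w - 1) (l - 1).
have h6 : Rabs (w - 1) * Rabs (l - 1) <= 690 * ((b + 2) / s).
  apply: Rmult_le_compat; [exact: Rabs_pos | exact: Rabs_pos | | exact: h3].
  apply: Rle_trans h1 _; rewrite /Rdiv; nra.
have -> : (690 + (b + 2) + 690 * (b + 2)) / s = 690 / s + (b + 2) / s + 690 * ((b + 2) / s) by field; lra.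
lra.
Qed.

(** The quotient is [S_theta / mainterm] times the quotient of [alpha_asymp], each
    [1 + O (1 / sqrt L)]. *)
Lemma second_claim : is_lim (fun x : R =>
  S_theta theta x / (Rpower x theta * F ((1 - theta) * ln x) * / theta
    * sqrt (2 / (1 - theta)) * / sqrt (ln x * ln (ln x)))) p_infty 1.
Proof.
have [C [L0 [C0 [hL0 h1]]]] := main_estimate_x.
have [K [K0 h2]] := alpha_asymp.
apply/is_lim_spec => eps; have e0 := cond_pos eps.
(* Bounds the deviation of a product of two factors [1 + C / s] and [1 + K / s]; [M] forces
   [s > T / eps]. *)
set T := C + K + C * K; have T0 : 0 < T by rewrite /T; nra.
set M := Rmax (Rmax L0 3000000) ((T / eps + 1) * (T / eps + 1)).
exists (Rmax 27 (exp (83 * exp (2 * M) / (1 - theta)))) => x hx.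
have x27 : 27 <= x by have := Rmax_l 27 (exp (83 * exp (2 * M) / (1 - theta))); lra.
have xM : exp (83 * exp (2 * M) / (1 - theta)) < x.
  by have := Rmax_r 27 (exp (83 * exp (2 * M) / (1 - theta))); lra.
have [a0 eG] := @alpha_spec theta x t1 ltac:(lra).
have [l3 ll1] := lnln_ge x27.
have hLM : M <= - ln (alpha theta x).
  apply: small_of_G => //; rewrite eG.
  have := ln_increasing _ _ (exp_pos _) xM; rewrite ln_exp => h.
  have h' := Rmult_lt_compat_l (1 - theta) _ _ ltac:(lra) h.
  have e : (1 - theta) * (83 * exp (2 * M) / (1 - theta)) = 83 * exp (2 * M) by field; lra.
  lra.
have L1 : L0 <= - ln (alpha theta x).
  by apply: Rle_trans hLM; apply: Rle_trans (Rmax_l _ _); exact: Rmax_l.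
have L2 : 3000000 <= - ln (alpha theta x).
  by apply: Rle_trans hLM; apply: Rle_trans (Rmax_l _ _); exact: Rmax_r.
have L3 : (T / eps + 1) * (T / eps + 1) <= - ln (alpha theta x).
  by apply: Rle_trans hLM; exact: Rmax_r.
have m0 := @mainterm_gt0 x ltac:(lra).
have i1 := h1 x x27 L1; have i2 := h2 x x27 L2.
have aL3 := @aL3_le _ a0 ltac:(lra).
have v0 : 0 < (1 - theta) * ln x by nra.
have Fp : 0 < F ((1 - theta) * ln x) by have := F_ge v0; have := six_PI2_ge; lra.
have xp : 0 < Rpower x theta by exact: exp_pos.
have lx : 0 < ln x * ln (ln x) by apply: Rmult_lt_0_compat; lra.
have q1 : 0 < 2 / (1 - theta) by apply: Rdiv_lt_0_compat; lra.
have p1 := sqrt_lt_R0 _ lx; have p2 := sqrt_lt_R0 _ q1.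
set den := _ * / sqrt (ln x * ln (ln x)).
have -> : S_theta theta x / den =
  S_theta theta x / mainterm x * (alpha theta x / (sqrt (2 / (1 - theta)) * / sqrt (ln x * ln (ln x)))).
  by rewrite /den /mainterm; field; repeat split; lra.
set r := alpha theta x / (sqrt _ * _) in i2 *.
set L := - ln (alpha theta x) in L1 L2 L3 i1 i2 aL3.
set s := sqrt L in i2.
have ss : s * s = L by apply: sqrt_sqrt; lra.
have te : 0 < T / eps by apply: Rdiv_lt_0_compat.
have hs : T / eps + 1 <= s.
  by rewrite -(sqrt_square (T / eps + 1)); [apply: sqrt_le_1_alt; exact: L3 | lra].
have s1 : 1 <= s by lra.
have is0 : 0 < / s by apply: Rinv_0_lt_compat; lra.
have is1 : / s <= 1 by rewrite -Rinv_1; apply: Rinv_le_contravar; lra.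
have aL : alpha theta x * L <= / s.
  rewrite -[/ s]Rmult_1_l; apply: le_divr; first lra.
  apply: Rle_trans aL3; rewrite Rmult_assoc; apply: Rmult_le_compat_l; first lra.
  have -> : L ^ 3 = L * (L * L) by rewrite /pow; ring.
  by apply: Rmult_le_compat_l; nra.
have i3 : Rabs (S_theta theta x / mainterm x - 1) <= C * / s.
  have -> : S_theta theta x / mainterm x - 1 = (S_theta theta x - mainterm x) / mainterm x by field; lra.
  rewrite /Rdiv Rabs_mult (Rabs_pos_eq (/ mainterm x)); last by left; exact: Rinv_0_lt_compat.
  apply: divr_le => //; apply: Rle_trans i1 _; apply: Rmult_le_compat_r; first lra.
  by apply: Rmult_le_compat_l; lra.
move: i3; set q := S_theta theta x / mainterm x => i3.
have -> : q * r - 1 = (q - 1) + (r - 1) + (q - 1) * (r - 1) by ring.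
apply: Rle_lt_trans (Rabs_triang _ _) _; rewrite Rabs_mult.
have h5 := Rabs_triang (q - 1) (r - 1).
have h6 : Rabs (q - 1) * Rabs (r - 1) <= C * (K * / s).
  apply: Rmult_le_compat; [exact: Rabs_pos | exact: Rabs_pos | | exact: i2].
  by apply: Rle_trans i3 _; nra.
have h7 : T * / s < eps.
  apply Rlt_div_l; first lra.
  have -> : T = T / eps * eps by field; lra.
  by rewrite Rmult_comm; apply: Rmult_lt_compat_l; lra.
rewrite /T /Rdiv in h7 i2; lra.
Qed.

End Final.

Theorem theorem1 (theta : R) (H0 : 0 < theta) (H1 : theta < 1) :
  (exists C : R, 0 < C /\
     forall x : R, 27 <= x ->
       Rabs (S_theta theta x
             - Rpower x theta * F ((1 - theta) * ln x) * (alpha theta x / theta))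
       <= C * (Rpower x theta * F ((1 - theta) * ln x) * (alpha theta x / theta))
            * sqrt (ln (ln x) / ln x))
  /\
  is_lim (fun x : R =>
            S_theta theta x /
            (Rpower x theta * F ((1 - theta) * ln x) * / theta
             * sqrt (2 / (1 - theta)) * / sqrt (ln x * ln (ln x))))
         p_infty 1.
Proof.
split; last exact: second_claim.
exact: first_claim.
Qed.
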